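(* Let $d\ge1$. There exists a constant $C>0$ depending only on $d$ such that for all $2\le q\le\infty$ and $2\le\tilde q\le\infty$ with $1/q+1/\tilde q=1/2$, for every smooth, fast-decaying divergence-free velocity field $u$ on $[0,+\infty)\times\mathbf{R}^d$ and every smooth, fast-decaying solution $\theta$ of $$\partial_t\theta+\operatorname{div}(u\theta)=0,\qquad \operatorname{div}(u)=0\quad\text{on }[0,+\infty)\times\mathbf{R}^d,\qquad \theta(0,\cdot)=\theta_0,$$ the following hold. a) For all $t\ge0$, $$\left|\frac{d}{dt}\sqrt{\mathcal{W}\big(\theta(t,\cdot)\big)}\right|\le C\,\|\theta_0\|_{L^{\tilde q}}\,\|\nabla u(t,\cdot)\|_{L^q}.$$ b) If $\theta_0\in L^2\cap L^\infty$ and $u$ is bounded in $\dot W^{1,q}$ uniformly in time (that is, $\sup_{t\ge0}\|\nabla u(t,\cdot)\|_{L^q}<\infty$), then $\mathcal{W}(\theta(t,\cdot))$ grows at most quadratically: there is a constant $C'$ (depending on $\theta_0$ and $u$ but not on $t$) such that $\mathcal{W}(\theta(t,\cdot))\le C'(1+t)^2$ for all $t\ge0$.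
   Context: The Fourier transform is $\hat f(\xi)=\int_{\mathbf{R}^d}e^{-2i\pi\xi\cdot x}f(x)\,dx$. For $f$ in the Schwartz class $\mathcal{S}(\mathbf{R}^d)$, $$\mathcal{W}(f)=\int_{\mathbf{R}^d}(\log|\xi|)^2\,|\hat f(\xi)|^2\,d\xi.$$ ''Smooth, fast-decaying'' means: $\theta$ (real-valued) and $u$ (with values in $\mathbf{R}^d$) are smooth in $(t,x)$ and, together with all their derivatives, decay faster than any power of $|x|$ as $|x|\to\infty$, locally uniformly in $t$; in particular $\theta(t,\cdot)\in\mathcal{S}(\mathbf{R}^d)$ for all $t$. $\nabla u$ is the spatial gradient, and $\|\nabla u(t,\cdot)\|_{L^q}$ is the $L^q(\mathbf{R}^d)$ norm of $|\nabla u(t,\cdot)|$. *)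

(* Defs.v *)
From HB Require Import structures.
From mathcomp Require Import all_boot all_order all_algebra.
From mathcomp Require Import complex.
From mathcomp Require Import all_classical all_reals all_analysis.

Set Implicit Arguments.
Unset Strict Implicit.
Unset Printing Implicit Defensive.

Import Order.TTheory GRing.Theory Num.Theory.
Import numFieldNormedType.Exports.

Local Open Scope classical_set_scope.
Local Open Scope ring_scope.

(* The sigma-algebra generated by the coordinates (equivalently, the Borel
   sigma-algebra), as the library does for [n.-tuple T]. *)
Definition measure_rV_display : measure_display -> measure_display.
Proof. exact. Qed.

Section measurable_rV.
Context {R : realType} {n : nat}.

Let coord_rV : 'I_n -> 'rV[R]_n -> R := fun i x => x ord0 i.

Let rV_set0 : g_sigma_preimage coord_rV set0.
Proof. exact: sigma_algebra0. Qed.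

Let rV_setC A : g_sigma_preimage coord_rV A -> g_sigma_preimage coord_rV (~` A).
Proof. exact: sigma_algebraC. Qed.

Let rV_bigcup (F : _^nat) : (forall i, g_sigma_preimage coord_rV (F i)) ->
  g_sigma_preimage coord_rV (\bigcup_i (F i)).
Proof. exact: sigma_algebra_bigcup. Qed.

HB.instance Definition _ := @isMeasurable.Build
  (measure_rV_display default_measure_display)
  'rV[R]_n (g_sigma_preimage coord_rV) rV_set0 rV_setC rV_bigcup.

End measurable_rV.

Lemma measurable_coord_rV (R : realType) n (i : 'I_n) :
  measurable_fun [set: 'rV[R]_n] (fun x : 'rV[R]_n => x ord0 i).
Proof.
move=> _ Y mY; rewrite setTI; apply: sub_sigma_algebra => /=.
rewrite -bigcup_seq/=; exists i => /=; first by rewrite mem_index_enum.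
by exists Y => //; rewrite setTI.
Qed.

Lemma measurable_fun_rVP d (T : measurableType d) (R : realType) n
    (f : T -> 'rV[R]_n) :
  measurable_fun [set: T] f <->
  forall i, measurable_fun [set: T] (fun t => f t ord0 i).
Proof.
split=> [mf i|mf].
  by apply: (measurableT_comp (measurable_coord_rV i) mf).
rewrite /measurable_fun/= => _ A mA; rewrite setTI.
suff : g_sigma_preimage (fun (i : 'I_n) (x : 'rV[R]_n) => x ord0 i) `<=`
    [set B | measurable (f @^-1` B)] by move=> /(_ A mA).
apply: smallest_sub.
  split => /=; first by rewrite preimage_set0.
  - by move=> B mB; rewrite setTD preimage_setC; exact: measurableC.
  - by move=> F mF; rewrite preimage_bigcup; exact: bigcupT_measurable.
case: n => [|n] in f mf A mA *; first by rewrite big_ord0.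
rewrite -bigcup_mkord_ord; apply: bigcup_sub => i Ii B [C mC <-] /=.
by have /(_ measurableT _ mC) := mf (inord i); rewrite !setTI.
Qed.

Section lebesgue_rV_step.
Context {R : realType} {n : nat}.

Definition rV_cons (p : measurableTypeR R * 'rV[R]_n) : 'rV[R]_n.+1 :=
  row_mx (const_mx p.1 : 'rV[R]_1) p.2.

Lemma rV_cons0 p : rV_cons p ord0 ord0 = p.1.
Proof.
have -> : ord0 = lshift n (ord0 : 'I_1) :> 'I_n.+1 by apply/val_inj.
by rewrite /rV_cons (@row_mxEl _ 1 1 n) mxE.
Qed.

Lemma rV_consS p (i : 'I_n) : rV_cons p ord0 (lift ord0 i) = p.2 ord0 i.
Proof.
have -> : lift ord0 i = rshift 1 i :> 'I_n.+1 by apply/val_inj.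
by rewrite /rV_cons (@row_mxEr _ 1 1 n).
Qed.

Lemma measurable_rV_cons : measurable_fun [set: _] rV_cons.
Proof.
apply/measurable_fun_rVP => i; case: (unliftP ord0 i) => [j|] ->.
- rewrite (_ : (fun _ => _) = (fun x : 'rV[R]_n => x ord0 j) \o snd).
    by apply: measurableT_comp => //; exact: measurable_coord_rV.
  by apply/funext => p /=; rewrite rV_consS.
- rewrite (_ : (fun _ => _) = fst); first exact: measurable_fst.
  by apply/funext => p /=; rewrite rV_cons0.
Qed.

Variable mu : {sigma_finite_measure set 'rV[R]_n -> \bar R}.

Definition lebesgue_rVS : set 'rV[R]_n.+1 -> \bar R :=
  pushforward (lebesgue_measure \x mu)%E rV_cons.

Let lebesgue_rVS0 : lebesgue_rVS set0 = 0%E.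
Proof. by rewrite /lebesgue_rVS /pushforward preimage_set0 measure0. Qed.

Let lebesgue_rVS_ge0 A : (0 <= lebesgue_rVS A)%E.
Proof. by rewrite /lebesgue_rVS /pushforward measure_ge0. Qed.

Let lebesgue_rVS_sigma_additive : semi_sigma_additive lebesgue_rVS.
Proof.
move=> F mF tF mUF; rewrite /lebesgue_rVS /pushforward preimage_bigcup.
apply: measure_semi_sigma_additive.
- by move=> n0; rewrite -[X in measurable X]setTI; exact: measurable_rV_cons.
- apply/trivIsetP => /= i j _ _ ij; rewrite -preimage_setI.
  by move/trivIsetP : tF => /(_ _ _ _ _ ij) ->//; rewrite preimage_set0.
- rewrite -preimage_bigcup -[X in measurable X]setTI.
  exact: measurable_rV_cons.
Qed.

HB.instance Definition _ := isMeasure.Build _ _ _ lebesgue_rVS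
  lebesgue_rVS0 lebesgue_rVS_ge0 lebesgue_rVS_sigma_additive.

Let lebesgue_rVS_sigma_finite : sigma_finite setT lebesgue_rVS.
Proof.
have /sigma_finiteP[F [FT ndF Foo]] := sigma_finiteT (@lebesgue_measure R).
have /sigma_finiteP[G [GT ndG Goo]] := sigma_finiteT mu.
exists (fun k => (fun x : 'rV[R]_n.+1 => x ord0 ord0) @^-1` F k `&`
    (fun x : 'rV[R]_n.+1 => \row_i x ord0 (lift ord0 i)) @^-1` G k).
  apply/seteqP; split=> // x _.
  have [a _ Fa] : (\bigcup_i F i) (x ord0 ord0) by rewrite -FT.
  have [b _ Gb] : (\bigcup_i G i) (\row_i x ord0 (lift ord0 i)) by rewrite -GT.
  exists (maxn a b) => //; split.
  - by move/subsetPset : (ndF _ _ (leq_maxl a b)); exact.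
  - by move/subsetPset : (ndG _ _ (leq_maxr a b)); exact.
have mtl : measurable_fun [set: 'rV[R]_n.+1]
    (fun x : 'rV[R]_n.+1 => \row_i x ord0 (lift ord0 i)).
  apply/measurable_fun_rVP => i.
  rewrite (_ : (fun _ => _) = (fun x : 'rV[R]_n.+1 => x ord0 (lift ord0 i))).
    exact: measurable_coord_rV.
  by apply/funext => x /=; rewrite mxE.
move=> k; have [mF Fk] := Foo k; have [mG Gk] := Goo k; split.
  apply: measurableI.
    rewrite -[X in measurable X]setTI.
    exact: (measurable_coord_rV ord0 measurableT mF).
  by rewrite -[X in measurable X]setTI; exact: (mtl measurableT _ mG).
rewrite /lebesgue_rVS /pushforward (_ : _ @^-1` _ = F k `*` G k).
  by rewrite product_measure1E// lte_mul_pinfty// ge0_fin_numE.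
have tlE p : \row_i rV_cons p ord0 (lift ord0 i) = p.2.
  by apply/rowP => i; rewrite mxE rV_consS.
by apply/seteqP; split=> p /=; rewrite /setI/= rV_cons0 tlE.
Qed.

HB.instance Definition _ := Measure_isSigmaFinite.Build _ _ _ lebesgue_rVS
  lebesgue_rVS_sigma_finite.

End lebesgue_rV_step.

(* Lebesgue measure on R^n: the n-fold product of one-dimensional Lebesgue
   measures (a unit point mass for n = 0). *)
Fixpoint lebesgue_rV (R : realType) (n : nat) :
    {sigma_finite_measure set 'rV[R]_n -> \bar R} :=
  match n with
  | 0 => \d_(0 : 'rV[R]_0)
  | n'.+1 => lebesgue_rVS (lebesgue_rV R n')
  end.

Lemma lebesgue_rV_box (R : realType) (n : nat) (a b : 'I_n -> R) :
  (forall i, a i <= b i) ->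
  lebesgue_rV R n [set x | forall i, x ord0 i \in `[a i, b i]] =
  (\prod_(i < n) (b i - a i))%:E.
Proof.
elim: n a b => [|n IHn] a b ab.
  rewrite /= diracE big_ord0 mem_set//=.
  by case.
rewrite big_ord_recl EFinM -(IHn (a \o lift ord0) (b \o lift ord0)); last first.
  by move=> i; exact: ab.
rewrite /= /lebesgue_rVS /pushforward.
rewrite (_ : _ @^-1` _ = `[a ord0, b ord0]%classic `*`
    [set x : 'rV[R]_n | forall i, x ord0 i \in
      `[(a \o lift ord0) i, (b \o lift ord0) i]]); last first.
  apply/seteqP; split=> p /=.
    move=> h; split; first by have := h ord0; rewrite rV_cons0.
    by move=> i; have := h (lift ord0 i); rewrite rV_consS.
  move=> [h0 h] i; case: (unliftP ord0 i) => [j|] ->.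
    by rewrite rV_consS; exact: h.
  by rewrite rV_cons0.
rewrite product_measure1E//; first last.
  rewrite (_ : mkset _ = \bigcap_(i in [set: 'I_n])
      [set x : 'rV[R]_n | x ord0 i \in `[a (lift ord0 i), b (lift ord0 i)]]).
    apply: fin_bigcap_measurable => // i _.
    have := measurable_coord_rV i measurableT
      (measurable_itv `[a (lift ord0 i), b (lift ord0 i)]).
    by rewrite setTI.
  by apply/seteqP; split=> x /= h i; [move=> _|]; exact: h.
congr (_ * _)%E.
rewrite -[LHS]/(lebesgue_measure _) lebesgue_measure_itv/= lte_fin.
have := ab ord0; rewrite le_eqVlt => /predU1P[->|->//].
by rewrite ltxx subrr.
Qed.

Local Open Scope complex_scope.

Section euclidean.
Context {R : realType} {d : nat}.

Definition dotp (x y : 'rV[R]_d) : R := \sum_(i < d) x ord0 i * y ord0 i.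

(* The Euclidean norm; the library norm [`|x|] on matrices is the sup norm. *)
Definition enorm (x : 'rV[R]_d) : R := Num.sqrt (dotp x x).

Definition evec (i : 'I_d) : 'rV[R]_d := delta_mx ord0 i.

Definition divergence (v : 'rV[R]_d -> 'rV[R]_d) (x : 'rV[R]_d) : R :=
  \sum_(i < d) 'D_(evec i) (fun y => v y ord0 i) x.

(* The Euclidean (Frobenius) norm of the Jacobian matrix. *)
Definition grad_norm (v : 'rV[R]_d -> 'rV[R]_d) (x : 'rV[R]_d) : R :=
  Num.sqrt (\sum_(i < d) \sum_(j < d)
    ('D_(evec i) (fun y => v y ord0 j) x) ^+ 2).

Definition Lqnorm (q : \bar R) (f : 'rV[R]_d -> R) : \bar R :=
  Lnorm (lebesgue_rV R d) q (EFin \o f).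

End euclidean.

Section fourier.
Context {R : realType} {d : nat}.

Definition cexpi (t : R) : R[i] := cos t +i* sin t.

Definition cintegral (f : 'rV[R]_d -> R[i]) : R[i] :=
  (\int[lebesgue_rV R d]_x complex.Re (f x))
  +i* (\int[lebesgue_rV R d]_x complex.Im (f x)).

Definition fourier (f : 'rV[R]_d -> R[i]) (xi : 'rV[R]_d) : R[i] :=
  cintegral (fun x => cexpi (- (2 * pi * dotp xi x)) * f x).

(* [ln 0 = 0] in the library, but the point [xi = 0] is negligible when
   [0 < d]. *)
Definition Wfunc (f : 'rV[R]_d -> R[i]) : \bar R :=
  (\int[lebesgue_rV R d]_xi
    (ln (enorm xi) ^+ 2 * ComplexField.Normc.normc (fourier f xi) ^+ 2)%:E)%E.

End fourier.

Section time_derivative.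
Context {R : realType}.

(* Derivatives on the half-line [0, +oo[: two-sided at [t > 0], and one-sided
   at [t = 0]. Values of [g] at negative times are never used. *)
Definition time_quotient (g : R -> R) (t h : R) : R := h^-1 * (g (t + h) - g t).

Definition time_increments (t : R) : set_system R :=
  within [set h | 0 <= t + h] (0 : R)^'.

Definition time_derivable (g : R -> R) (t : R) : Prop :=
  cvg (time_quotient g t @ time_increments t).

Definition time_derive (g : R -> R) (t : R) : R :=
  lim (time_quotient g t @ time_increments t).

End time_derivative.

Section space_time.
Context {R : realType} {d : nat}.
Implicit Types f : R -> 'rV[R]_d -> R.

(* Iterated partial derivatives in (t, x): [None] stands for d/dt and [Some i]
   for d/dx_i; the head of the list is the outermost derivative. *)
Fixpoint iter_partial (s : seq (option 'I_d)) f : R -> 'rV[R]_d -> R :=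
  match s with
  | [::] => f
  | None :: s' => fun t x => time_derive (fun r => iter_partial s' f r x) t
  | Some i :: s' => fun t x => 'D_(evec i) (iter_partial s' f t) x
  end.

(* Smoothness up to the boundary on [0, +oo[ x R^d. *)
Definition smooth f : Prop := forall s,
  {within [set p : R * 'rV[R]_d | 0 <= p.1],
    continuous (fun p => iter_partial s f p.1 p.2)} /\
  forall t x, 0 <= t ->
    time_derivable (fun r => iter_partial s f r x) t /\
    forall i, derivable (iter_partial s f t) x (evec i).

Definition fast_decaying f : Prop := forall s (N : nat) (T : R),
  exists M : R, forall t x, 0 <= t <= T ->
    enorm x ^+ N * `|iter_partial s f t x| <= M.

Definition smooth_decaying f : Prop := smooth f /\ fast_decaying f.

Definition smooth_decaying_field (u : R -> 'rV[R]_d -> 'rV[R]_d) : Prop :=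
  forall i, smooth_decaying (fun t x => u t x ord0 i).

Definition divergence_free (u : R -> 'rV[R]_d -> 'rV[R]_d) : Prop :=
  forall t x, 0 <= t -> divergence (u t) x = 0.

Definition transport_solution (u : R -> 'rV[R]_d -> 'rV[R]_d)
    (theta : R -> 'rV[R]_d -> R) (theta0 : 'rV[R]_d -> R) : Prop :=
  (forall t x, 0 <= t ->
    time_derive (fun r => theta r x) t
    + divergence (fun y => theta t y *: u t y) x = 0) /\
  (forall x, theta 0 x = theta0 x).

Definition Wt (theta : R -> 'rV[R]_d -> R) (t : R) : \bar R :=
  Wfunc (fun x => (theta t x)%:C).

End space_time.

(* Main.v *)
Require Import Defs.
From mathcomp Require Import all_boot all_order all_algebra.
From mathcomp Require Import complex ring lra.
From mathcomp Require Import all_classical all_reals all_analysis.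
From mathcomp Require Import measurable_realfun ess_sup_inf.

Set Implicit Arguments.
Unset Strict Implicit.
Unset Printing Implicit Defensive.

Import Order.TTheory GRing.Theory Num.Theory.
Import numFieldNormedType.Exports.

Local Open Scope classical_set_scope.
Local Open Scope ring_scope.

(** The Fourier multiplier [L f = - 1/2 \int_a^b (P_s f - e^{-4 pi^2 s} f) ds/s], with [P_s] the heat
semigroup, has a symbol bounded by [|ln |xi||] that tends to [ln |xi|] as [a -> 0] and [b -> oo]
(Frullani), so [W f] is the limit of [|L f|_2^2].  Along the flow the derivative of [W theta] is the
limit of [- 2 <L theta, L (u . grad theta)>]; as [u . grad] is skew-symmetric, only its commutator
with [L] contributes, and this is up to a constant the increment over [0, 1] of
[Psi rho = \int_a^b <P_((1-rho)s) g, u . grad P_(rho s) theta> ds/s], with [g = L theta].  Since [u] is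
divergence free, [Psi'] only contains the trilinear forms
[\int_a^b <d_i u_j, d_k P_(rho s) theta  d_l P_((1-rho)s) g> ds].  They are bounded by
[|d_i u_j|_oo |theta|_2 |g|_2] (energy identity) and by [|d_i u_j|_2 |theta|_oo |g|_2]: in the second
case [d_i u_j] is replaced with [P_(gamma s) (d_i u_j)], the case [gamma = rho] is a Carleson
estimate, and the dependence on [gamma] is controlled by its derivative.  The intermediate exponents
follow by a dyadic decomposition of the level sets of both functions.  As the [L^qt] norm of [theta]
is conserved and [|g|_2 <= sqrt (W theta)], this bounds the derivative of [sqrt W] wherever
[W theta <> 0]; if [W theta] vanishes at some time, then so does [theta] at all times, because the
Fourier transform is then supported in the unit sphere, a null set. *)

(** Every final bound must be uniform in the cut-offs [a] and [b]; constants that depend on them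
    occur only to justify exchanges of limits, or in front of a parameter that tends to 0. If
    [theta] is merely bounded, |grad P_s theta|^2 dx ds is a Carleson measure, and such a measure
    can only be tested against functions already smoothed at the scale s. This is why d_i u_j has to
    be regularised. Removing the regularisation costs a logarithm of 1 - rho, which a small power
    absorbs; the resulting weight rho^(-1/2) (1 - rho)^(-3/4) is integrable on ]0, 1[, and this
    integrability is what allows the increment of Psi over the whole interval to be bounded. The
    subtracted e^{-4 pi^2 s} is the heat multiplier on the unit sphere; it acts as a scalar, so it
    drops out of the commutator. The cut-offs are removed at a fixed time: the derivative of W is
    first identified as twice a polar form, by a Taylor expansion of [theta] in time whose remainder
    has energy of order |h|^3, and only that polar form is then approximated by means of L. *)

Definition intg d (T : measurableType d) (R : realType)
    (mu : {measure set T -> \bar R}) (f : T -> R) :=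
  mu.-integrable [set: T] (EFin \o f).

(** * Integration *)

Section intg.
Context d (T : measurableType d) (R : realType).
Variable mu : {measure set T -> \bar R}.
Implicit Types f g : T -> R.

Lemma intg_measurable f : intg mu f -> measurable_fun [set: T] f.
Proof. by move=> /measurable_int /measurable_EFinP. Qed.

Lemma intg_le f g : measurable_fun [set: T] f -> (forall x, `|f x| <= g x) ->
  intg mu g -> intg mu f.
Proof.
move=> mf fg ig; apply: (le_integrable _ _ _ ig) => //.
  exact/measurable_EFinP.
by move=> x _ /=; rewrite lee_fin (le_trans (fg x))// ler_norm.
Qed.

Lemma intgD f g : intg mu f -> intg mu g -> intg mu (fun x => f x + g x).
Proof. by move=> fi gi; exact: (integrableD measurableT fi gi). Qed.

Lemma intgB f g : intg mu f -> intg mu g -> intg mu (fun x => f x - g x).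
Proof. by move=> fi gi; exact: (integrableB measurableT fi gi). Qed.

Lemma intgZ (k : R) f : intg mu f -> intg mu (fun x => k * f x).
Proof. by move=> fi; exact: (integrableZl measurableT k fi). Qed.

Lemma intgN f : intg mu f -> intg mu (fun x => - f x).
Proof. by move=> fi; exact: (integrableN fi). Qed.

Lemma intg0 : intg mu (fun=> 0).
Proof. exact: integrable0. Qed.

Lemma intg_norm f : intg mu f -> intg mu (fun x => `|f x|).
Proof. by move=> ?; exact: integrable_norm. Qed.

Lemma intg_sum (I : Type) (r : seq I) (P : pred I) (F : I -> T -> R) :
  (forall i, P i -> intg mu (F i)) ->
  intg mu (fun x => \sum_(i <- r | P i) F i x).
Proof.
move=> iF; elim: r => [|i r ih].
  by under eq_fun do rewrite big_nil; exact: intg0.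
under eq_fun do rewrite big_cons.
case Pi : (P i) => //; apply: intgD => //; exact: iF.
Qed.

Lemma intg_bounded_mul f g (M : R) : measurable_fun [set: T] f ->
  (forall x, `|f x| <= M) -> intg mu g -> intg mu (fun x => f x * g x).
Proof.
move=> mf fM ig; apply: (@intg_le _ (fun x => M * `|g x|)).
- by apply: measurable_funM => //; exact: intg_measurable.
- by move=> x; rewrite normrM ler_wpM2r.
- exact/intgZ/intg_norm.
Qed.

Lemma eq_Rint f g : f =1 g -> \int[mu]_x f x = \int[mu]_x g x.
Proof. by move=> fg; apply: eq_Rintegral => x _; exact: fg. Qed.

Lemma eq_intg f g : f =1 g -> intg mu f -> intg mu g.
Proof. by move=> /funext->. Qed.

Lemma RintD f g : intg mu f -> intg mu g ->
  \int[mu]_x (f x + g x) = \int[mu]_x f x + \int[mu]_x g x.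
Proof. by move=> ? ?; exact: RintegralD. Qed.

Lemma RintB f g : intg mu f -> intg mu g ->
  \int[mu]_x (f x - g x) = \int[mu]_x f x - \int[mu]_x g x.
Proof. by move=> ? ?; exact: RintegralB. Qed.

Lemma RintZ k f : intg mu f -> \int[mu]_x (k * f x) = k * \int[mu]_x f x.
Proof. by move=> ?; exact: RintegralZl. Qed.

Lemma RintN f : intg mu f -> \int[mu]_x (- f x) = - \int[mu]_x f x.
Proof.
by move=> ?; under eq_Rintegral do rewrite -mulN1r; rewrite RintZ// mulN1r.
Qed.

Lemma Rint0 : \int[mu]_x (fun=> 0 : R) x = 0.
Proof. by rewrite /Rintegral integral0_eq. Qed.

Lemma Rint_sum (I : Type) (r : seq I) (P : pred I) (F : I -> T -> R) :
  (forall i, P i -> intg mu (F i)) ->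
  \int[mu]_x (\sum_(i <- r | P i) F i x) =
  \sum_(i <- r | P i) \int[mu]_x F i x.
Proof.
move=> iF; elim: r => [|i r ih].
  by under eq_Rintegral do rewrite big_nil; rewrite Rint0 big_nil.
under eq_Rintegral do rewrite big_cons.
rewrite big_cons; case: ifPn => // Pi.
by rewrite RintD ?ih//; [exact: iF|exact: intg_sum].
Qed.

Lemma Rint_le f g : intg mu f -> intg mu g -> (forall x, f x <= g x) ->
  \int[mu]_x f x <= \int[mu]_x g x.
Proof. by move=> ? ? fg; apply: le_Rintegral => // x _; exact: fg. Qed.

Lemma Rint_ge0 f : (forall x, 0 <= f x) -> 0 <= \int[mu]_x f x.
Proof. by move=> f0; apply: Rintegral_ge0 => x _; exact: f0. Qed.

Lemma Rint_norm f : intg mu f -> `|\int[mu]_x f x| <= \int[mu]_x `|f x|.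
Proof. by move=> ?; exact: le_normr_Rintegral. Qed.

Lemma Rint_norm_le f g : intg mu f -> intg mu g -> (forall x, `|f x| <= g x) ->
  `|\int[mu]_x f x| <= \int[mu]_x g x.
Proof.
by move=> fi gi fg; rewrite (le_trans (Rint_norm fi))// Rint_le//; exact: intg_norm.
Qed.

Lemma EFin_Rint f : intg mu f ->
  (\int[mu]_x f x)%:E = (\int[mu]_x (f x)%:E)%E.
Proof. by move=> fi; rewrite fineK//; exact: integrable_fin_num. Qed.

Lemma intg_lty f : measurable_fun [set: T] f -> (forall x, 0 <= f x) ->
  (\int[mu]_x (f x)%:E < +oo)%E -> intg mu f.
Proof.
move=> mf f0 fy; apply/integrableP; split; first exact/measurable_EFinP.
rewrite (eq_integral (fun x => (f x)%:E))// => x _ /=; by rewrite ger0_norm.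
Qed.

Lemma intg_ltyP f : (forall x, 0 <= f x) -> intg mu f ->
  (\int[mu]_x (f x)%:E < +oo)%E.
Proof. by move=> f0 fi; rewrite -EFin_Rint// ltry. Qed.

(** A quadratic polynomial in [t] has a nonpositive discriminant if it is nonnegative; [0 <= C]
    makes positive [t] sufficient. This is the common core of the Cauchy-Schwarz inequalities
    [ST_CS] and [Qr_CS]. *)
Lemma sqr_le_mul (A B C : R) : 0 <= A -> 0 <= B -> 0 <= C ->
  (forall t, 0 < t -> 2 * t * C <= t ^+ 2 * A + B) -> C ^+ 2 <= A * B.
Proof.
move=> A0 B0 C0 h; have [A0'|] := eqVneq A 0.
  have [->|Cn0] := eqVneq C 0; first by rewrite expr0n/= mulr_ge0.
  have C1 : 0 < C by rewrite lt_neqAle eq_sym Cn0.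
  (* For [A = 0] this choice of [t] turns the hypothesis into [B + 1 <= B]. *)
  have := h ((B + 1) / (2 * C)); rewrite divr_gt0 ?mulr_gt0// ?ltr_wpDl//.
  move/(_ isT); rewrite A0' mulr0 add0r.
  have -> : 2 * ((B + 1) / (2 * C)) * C = B + 1 by field; rewrite gt_eqF.
  lra.
move=> An0; have A1 : 0 < A by rewrite lt_neqAle eq_sym An0.
have [->|Cn0] := eqVneq C 0; first by rewrite expr0n/= mulr_ge0.
have C1 : 0 < C by rewrite lt_neqAle eq_sym Cn0.
have := h (C / A) (divr_gt0 C1 A1).
have -> : 2 * (C / A) * C = 2 * (C ^+ 2 / A) by field.
have -> : (C / A) ^+ 2 * A = C ^+ 2 / A by field.
have CE : C ^+ 2 = (C ^+ 2 / A) * A by field.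
move: CE; set D := C ^+ 2 / A => -> h1.
by rewrite mulrC ler_pM2l//; lra.
Qed.

End intg.

Section param.
Context d1 d2 (T1 : measurableType d1) (T2 : measurableType d2) (R : realType).
Variables (m1 : {sigma_finite_measure set T1 -> \bar R})
  (m2 : {sigma_finite_measure set T2 -> \bar R}).

(** Tonelli applies to the positive and negative parts separately and [fine] is measurable, so the
    default value taken where the integral diverges does no harm. *)
Lemma measurable_Rint_param (f : T1 * T2 -> R) :
  measurable_fun [set: T1 * T2] f ->
  measurable_fun [set: T1] (fun x => \int[m2]_y f (x, y)).
Proof.
move=> mf; have mF : measurable_fun [set: T1 * T2] (EFin \o f).
  exact/measurable_EFinP.
apply: (measurableT_comp (fine_measurable measurableT)).
  rewrite /=.
under eq_fun do rewrite integralE.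
apply: emeasurable_funB.
- rewrite (_ : (fun _ => _) = fubini_F m2 ((EFin \o f)^\+)%E).
    apply: measurable_fun_fubini_tonelli_F; [exact: measurable_funepos|exact: funepos_ge0].
  by apply/funext => x; apply: eq_integral => y _; rewrite !funeposE.
- rewrite (_ : (fun _ => _) = fubini_F m2 ((EFin \o f)^\-)%E).
    apply: measurable_fun_fubini_tonelli_F; [exact: measurable_funeneg|exact: funeneg_ge0].
  by apply/funext => x; apply: eq_integral => y _; rewrite !funenegE.
Qed.

Lemma prod_intg (f : T1 * T2 -> R) : measurable_fun [set: T1 * T2] f ->
  (forall x, intg m2 (fun y => f (x, y))) ->
  intg m1 (fun x => \int[m2]_y `|f (x, y)|) ->
  (m1 \x m2)%E.-integrable [set: T1 * T2] (EFin \o f).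
Proof.
move=> mf sf iF; apply/integrable12ltyP; first exact/measurable_EFinP.
rewrite (eq_integral (fun x => (\int[m2]_y `|f (x, y)|)%:E)).
  by apply: intg_ltyP => // x; exact: Rint_ge0.
move=> x _; rewrite EFin_Rint; last exact: intg_norm.
exact: eq_integral.
Qed.

Lemma Rint_fubini (f : T1 * T2 -> R) : measurable_fun [set: T1 * T2] f ->
  (forall x, intg m2 (fun y => f (x, y))) ->
  (forall y, intg m1 (fun x => f (x, y))) ->
  intg m1 (fun x => \int[m2]_y `|f (x, y)|) ->
  \int[m1]_x \int[m2]_y f (x, y) = \int[m2]_y \int[m1]_x f (x, y).
Proof.
move=> mf s1 s2 iF; have /= h := Fubini (prod_intg mf s1 iF).
rewrite [in LHS]/Rintegral [in RHS]/Rintegral; congr fine.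
rewrite (eq_integral (fun x => (\int[m2]_y (f (x, y))%:E)%E)).
  rewrite h; apply: eq_integral => y _.
  by rewrite EFin_Rint.
by move=> x _; rewrite EFin_Rint.
Qed.

Lemma intg_Rint_swap (f : T1 * T2 -> R) : measurable_fun [set: T1 * T2] f ->
  (forall x, intg m2 (fun y => f (x, y))) ->
  (forall y, intg m1 (fun x => f (x, y))) ->
  intg m1 (fun x => \int[m2]_y `|f (x, y)|) ->
  intg m2 (fun y => \int[m1]_x `|f (x, y)|).
Proof.
move=> mf s1 s2 iF.
have mfa : measurable_fun [set: T1 * T2] (fun p => (`|f p|)%:E).
  by apply/measurable_EFinP; exact: measurableT_comp.
have E1 : (fun y => (\int[m1]_x `|f (x, y)|)%:E) =
    (fun y => \int[m1]_x (`|f (x, y)|)%:E)%E.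
  by apply/funext => y; rewrite EFin_Rint//; exact: intg_norm.
apply: intg_lty; last 2 first.
- by move=> y; exact: Rint_ge0.
- rewrite E1 -(@fubini_tonelli _ _ _ _ _ m1 m2 (fun p => (`|f p|)%:E))//=.
  rewrite (eq_integral (fun x => (\int[m2]_y `|f (x, y)|)%:E)).
    by apply: intg_ltyP => // x; exact: Rint_ge0.
  by move=> x _; rewrite EFin_Rint//; exact: intg_norm.
- apply/measurable_EFinP; rewrite /comp E1.
  by apply: (@measurable_fun_fubini_tonelli_G _ _ _ _ _ m1 (fun p => (`|f p|)%:E)).
Qed.

End param.

(** * Continuity and differentiation under the integral sign *)

Section ftc_under.
Context d (T : measurableType d) (R : realType).
Variable mu : {measure set T -> \bar R}.
Variables (u v : R) (F F' : R -> T -> R) (H : T -> R).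
Hypothesis iF : forall c, u < c < v -> intg mu (F c).
Hypothesis mF' : forall c, u < c < v -> measurable_fun [set: T] (F' c).
Hypothesis dF : forall c x, u < c < v -> is_derive c 1 (F ^~ x) (F' c x).
Hypothesis cF' : forall c x, u < c < v -> {for c, continuous (F' ^~ x)}.
Hypothesis iH : intg mu H.
Hypothesis FH : forall c x, u < c < v -> `|F' c x| <= H x.

Lemma under_continuous c : u < c < v ->
  {for c, continuous (fun c => \int[mu]_x F' c x)}.
Proof.
move=> uv; apply: (@continuity_under_integral _ _ _ mu F' [set: T] measurableT u v
   _ _ H iH).
- move=> c'; rewrite /= in_itv/= => uv'; apply: (intg_le (mF' uv') _ iH) => x.
  exact: FH.
- apply: aeW => x _ c'; rewrite inE/= in_itv/= => uv'; exact: cF'.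
- move=> c'; rewrite /= in_itv/= => uv'; apply: aeW => x _; exact: FH.
- by rewrite inE/= in_itv.
Qed.

Lemma under_is_derive c : u < c < v ->
  is_derive c 1 (fun c => \int[mu]_x F c x) (\int[mu]_x F' c x).
Proof.
move=> uv; have Ic : `]u, v[%classic c by rewrite /= in_itv.
have E : forall c x, u < c < v -> partial1of2 F c x = F' c x.
  by move=> c' x uv'; rewrite partial1of2E; case: (dF x uv').
have H0 y : 0 <= H y by rewrite (le_trans _ (FH y uv)).
have iFc c' : `]u, v[%classic c' -> mu.-integrable [set: T] (EFin \o F c').
  by rewrite /= in_itv/= => ?; exact: iF.
have dFc c' x : `]u, v[%classic c' -> [set: T] x -> derivable (F ^~ x) c' 1.
  by rewrite /= in_itv/= => uv' _; case: (dF x uv').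
have FHc c' x : `]u, v[%classic c' -> [set: T] x -> `|partial1of2 F c' x| <= H x.
  by rewrite /= in_itv/= => uv' _; rewrite E// FH.
split; first exact: (derivable_under_integral measurableT Ic iFc dFc H0 iH FHc).
rewrite -derive1E.
rewrite (differentiation_under_integral measurableT Ic iFc dFc H0 iH FHc).
by apply: eq_Rintegral => x _; rewrite E.
Qed.

End ftc_under.

Section ftc.
Context (R : realType).

Lemma FTC_Rint (F f : R -> R) (a b : R) : a <= b ->
  (forall c, a <= c <= b -> is_derive c 1 F (f c)) ->
  (forall c, a <= c <= b -> {for c, continuous f}) ->
  \int[lebesgue_measure]_(c in `[a, b]) f c = F b - F a.
Proof.
rewrite le_eqVlt => /predU1P[->|ab] dF cf.
  by rewrite set_itv1 Rintegral_set1 subrr.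
rewrite /Rintegral (@continuous_FTC2 _ f F a b ab)//.
- apply: continuous_in_subspaceT => c; rewrite inE/= in_itv/=; exact: cf.
- have dc c : a <= c <= b -> {for c, continuous F}.
    move=> cab; apply: differentiable_continuous; apply/derivable1_diffP.
    by have [] := dF _ cab.
  split.
  + move=> c; rewrite in_itv/= => /andP[ac cb].
    by have [|] := dF c _ => //; rewrite !ltW.
  + by apply: cvg_at_right_filter; apply: dc; rewrite lexx ltW.
  + by apply: cvg_at_left_filter; apply: dc; rewrite lexx ltW.
- move=> c; rewrite in_itv/= => /andP[ac cb]; rewrite derive1E.
  by have [_ ->] : is_derive c 1 F (f c) by apply: dF; rewrite !ltW.
Qed.

End ftc.

(** * Affine changes of variable on the line *)

Section affine1.
Context (R : realType).
Local Notation leb := (@lebesgue_measure R).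

Definition affine (s a : R) (t : measurableTypeR R) : measurableTypeR R :=
  (s * (t : R) + a : R).

Lemma measurable_affine (s a : R) :
  measurable_fun [set: measurableTypeR R] (affine s a).
Proof. by apply: measurable_funD => //; exact: measurable_funM. Qed.

(** By uniqueness of Lebesgue measure it is enough to compute |s| times the pushforward on half-open
    intervals; a negative [s] exchanges the open and the closed end, which does not change the
    length. *)
Lemma lebesgue_affine (s a : R) (A : set (measurableTypeR R)) : s != 0 ->
  measurable A ->
  pushforward leb (affine s a) A = (`|s|^-1%:E * leb A)%E.
Proof.
move=> s0 mA.
have ns : 0 < `|s| by rewrite normr_gt0.
have mS := measurable_affine s a.
have nng : 0 <= `|s| by rewrite ltW.
suff -> : leb A = mscale (NngNum nng) (measure_function_pushforward__canonical__measure_function_Measure leb mS) A.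
  by rewrite /mscale/= muleA -EFinM mulVf ?gt_eqF// mul1e.
apply: lebesgue_measure_unique => //= _ [[x y] _ <-].
rewrite /mscale /= /pushforward /=.
have [s1|s1] := ltP 0 s.
  rewrite (_ : _ @^-1` _ = `](x - a) / s, (y - a) / s]%classic); last first.
    apply/seteqP; split=> t /=; rewrite /affine !in_itv/= ltr_pdivrMr// ler_pdivlMr//;
    by move=> /andP[h1 h2]; apply/andP; split; lra.
  rewrite !lebesgue_measure_itv/= !lte_fin ltr_pM2r ?invr_gt0// ltrD2r.
  case: ifPn => xy; last by rewrite mule0.
  by rewrite -!EFinB -EFinM (gtr0_norm s1) -mulrBl; congr EFin; field.
have {}s1 : s < 0 by rewrite lt_neqAle s0.
rewrite (_ : _ @^-1` _ = `[(y - a) / s, (x - a) / s[%classic); last first.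
  apply/seteqP; split=> t /=; rewrite /affine !in_itv/= ler_ndivrMr// ltr_ndivlMr//;
  by move=> /andP[h1 h2]; apply/andP; split; lra.
rewrite !lebesgue_measure_itv/= !lte_fin ltr_nM2r ?invr_lt0// ltrD2r.
case: ifPn => xy; last by rewrite mule0.
by rewrite -!EFinB -EFinM (ltr0_norm s1) -mulrBl; congr EFin; field.
Qed.

Lemma ge0_integral_affine (s a : R) (f : R -> \bar R) : s != 0 ->
  measurable_fun [set: R] f -> (forall x, (0 <= f x)%E) ->
  (\int[leb]_t f (s * t + a)%R = `|s|^-1%:E * \int[leb]_t f t)%E.
Proof.
move=> s0 mf f0.
have ns : 0 <= `|s|^-1 by rewrite invr_ge0.
have mS := measurable_affine s a.
have /= E := @ge0_integral_pushforward _ _ _ _ R _ mS leb setT f measurableT mf (fun x _ => f0 x).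
rewrite preimage_setT in E.
transitivity (\int[leb]_x (f \o affine s a) x)%E => //; rewrite -E.
have <- := @ge0_integral_mscale _ _ R leb setT measurableT (NngNum ns) f
  mf (fun x _ => f0 x).
apply: (@eq_measure_integral _ _ R setT (mscale (NngNum ns) leb)
  (measure_function_pushforward__canonical__measure_function_Measure leb mS)).
by move=> A mA _; rewrite -[LHS]/(pushforward leb (affine s a) A) lebesgue_affine.
Qed.

End affine1.

(** * Integration on R^n *)

Section rV.
Context (R : realType).
Local Notation leb := (@lebesgue_measure R).
Local Notation mu := (lebesgue_rV R).

Lemma measurable_dotp n d (T : measurableType d) (f g : T -> 'rV[R]_n) :
  measurable_fun [set: T] f -> measurable_fun [set: T] g ->
  measurable_fun [set: T] (fun t => dotp (f t) (g t)).
Proof.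
move=> /measurable_fun_rVP mf /measurable_fun_rVP mg.
by apply: measurable_sum => i; apply: measurable_funM.
Qed.

Lemma measurable_rVD n d (T : measurableType d) (f g : T -> 'rV[R]_n) :
  measurable_fun [set: T] f -> measurable_fun [set: T] g ->
  measurable_fun [set: T] (fun t => f t + g t).
Proof.
move=> /measurable_fun_rVP mf /measurable_fun_rVP mg; apply/measurable_fun_rVP => i.
by under eq_fun do rewrite mxE; exact: measurable_funD.
Qed.

Lemma measurable_rVZ n d (T : measurableType d) (k : T -> R) (f : T -> 'rV[R]_n) :
  measurable_fun [set: T] k -> measurable_fun [set: T] f ->
  measurable_fun [set: T] (fun t => k t *: f t).
Proof.
move=> mk /measurable_fun_rVP mf; apply/measurable_fun_rVP => i.
by under eq_fun do rewrite mxE; exact: measurable_funM.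
Qed.

Lemma measurable_rVB n d (T : measurableType d) (f g : T -> 'rV[R]_n) :
  measurable_fun [set: T] f -> measurable_fun [set: T] g ->
  measurable_fun [set: T] (fun t => f t - g t).
Proof.
move=> /measurable_fun_rVP mf /measurable_fun_rVP mg; apply/measurable_fun_rVP => i.
by under eq_fun do rewrite !mxE; exact: measurable_funB.
Qed.

Lemma integral_rVS n (f : 'rV[R]_n.+1 -> \bar R) :
  measurable_fun [set: 'rV[R]_n.+1] f -> (forall x, (0 <= f x)%E) ->
  (\int[mu n.+1]_x f x = \int[leb]_t \int[mu n]_y f (rV_cons (t, y)))%E.
Proof.
move=> mf f0; have mc := @measurable_rV_cons R n.
rewrite [LHS](@ge0_integral_pushforward _ _ _ _ R _ mc (leb \x mu n)%E setT f
  measurableT mf (fun x _ => f0 x)) preimage_setT.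
rewrite (@fubini_tonelli1 _ _ _ _ _ leb (mu n) (f \o rV_cons))//.
  exact: measurableT_comp.
by move=> x /=.
Qed.

Lemma rV_cons_affine n (s : R) (a : 'rV[R]_n.+1) t y :
  s *: rV_cons (t, y) + a =
  rV_cons (s * t + a ord0 ord0, s *: y + \row_i a ord0 (lift ord0 i)).
Proof.
have cE m (v b : 'rV[R]_m) i : (s *: v + b) ord0 i = s * v ord0 i + b ord0 i.
  by rewrite !mxE.
apply/rowP => i; rewrite cE; case: (unliftP ord0 i) => [j|] ->.
  by rewrite !rV_consS cE mxE.
by rewrite !rV_cons0.
Qed.

(** Induction on the dimension: peeling off the first coordinate contributes one factor 1/|s|. *)
Lemma ge0_integral_rV_affine n (s : R) (a : 'rV[R]_n) (f : 'rV[R]_n -> \bar R) :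
  s != 0 -> measurable_fun [set: 'rV[R]_n] f -> (forall x, (0 <= f x)%E) ->
  (\int[mu n]_x f (s *: x + a)%R = (`|s| ^- n)%:E * \int[mu n]_x f x)%E.
Proof.
move=> s0; elim: n a f => [|n ih] a f mf f0.
  rewrite expr0 invr1 mul1e; apply: eq_integral => x _; congr f.
  by apply/rowP; case.
have maff m (b : 'rV[R]_m) : measurable_fun [set: 'rV[R]_m] (fun x => s *: x + b).
  by apply: measurable_rVD => //; exact: measurable_rVZ.
rewrite integral_rVS; [|exact: (measurableT_comp mf (maff _ a))|by []].
rewrite integral_rVS//.
have mcs t : measurable_fun [set: 'rV[R]_n] (fun y : 'rV[R]_n => rV_cons (t, y)).
  by apply: (measurableT_comp (@measurable_rV_cons R n)); exact: measurable_fun_pair.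
have mF : measurable_fun [set: R] (fun t => (\int[mu n]_y f (rV_cons (t, y)))%E).
  apply: (@measurable_fun_fubini_tonelli_F _ _ _ _ _ (mu n) (f \o rV_cons)) => //.
  - by apply: (measurableT_comp mf); exact: measurable_rV_cons.
  - by move=> x; exact: f0.
under eq_integral => t _.
  under eq_integral do rewrite rV_cons_affine.
  rewrite (ih _ (fun y => f (rV_cons (s * t + a ord0 ord0, y)))); last first.
  - by [].
  - exact: (measurableT_comp mf (mcs _)).
  over.
rewrite (@ge0_integral_affine R s (a ord0 ord0)
  (fun t => ((`|s| ^- n)%:E * \int[mu n]_y f (rV_cons (t, y)))%E)) => //; first last.
- by move=> x; rewrite mule_ge0 ?lee_fin ?invr_ge0 ?exprn_ge0// integral_ge0.
- by apply: measurable_funeM.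
rewrite ge0_integralZl//; last by move=> t _; exact: integral_ge0.
by rewrite muleA -EFinM exprS invfM.
Qed.

Lemma emeasurable_prodT d (T : measurableType d) (I : Type) (r : seq I)
    (F : I -> T -> \bar R) : (forall i, measurable_fun [set: T] (F i)) ->
  measurable_fun [set: T] (fun x => \prod_(i <- r) F i x)%E.
Proof.
move=> mF; elim: r => [|i r ih].
  by under eq_fun do rewrite big_nil; exact: measurable_cst.
by under eq_fun do rewrite big_cons; exact: emeasurable_funM.
Qed.

Lemma integral_rV_prod n (F : 'I_n -> R -> \bar R) :
  (forall i, measurable_fun [set: R] (F i)) -> (forall i t, (0 <= F i t)%E) ->
  (\int[mu n]_x (\prod_(i < n) F i (x ord0 i)) = \prod_(i < n) \int[leb]_t F i t)%E.
Proof.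
elim: n F => [|n ih] F mF F0.
  by rewrite big_ord0; under eq_integral do rewrite big_ord0;
    rewrite integral_cst//= diracT mul1e.
rewrite integral_rVS; last 2 first.
- apply: emeasurable_prodT => i; apply: (measurableT_comp (mF i)).
  exact: measurable_coord_rV.
- by move=> x; exact: prode_ge0.
rewrite big_ord_recl -(ih (fun i => F (lift ord0 i)))//.
under eq_integral => t _.
  under eq_integral => y _.
    rewrite big_ord_recl rV_cons0/=.
    under eq_bigr do rewrite rV_consS/=.
    over.
  rewrite ge0_integralZl//; last 2 first.
  - apply: emeasurable_prodT => i; apply: (measurableT_comp (mF _)).
    exact: measurable_coord_rV.
  - by move=> x _; exact: prode_ge0.
  over.
rewrite ge0_integralZr//; first exact: mF.
by apply: integral_ge0 => x _; exact: prode_ge0.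
Qed.

Lemma intg_rV_affine n (s : R) (a : 'rV[R]_n) (f : 'rV[R]_n -> R) : s != 0 ->
  intg (mu n) f -> intg (mu n) (fun x => f (s *: x + a)).
Proof.
move=> s0 fi; have mf := intg_measurable fi.
have maff : measurable_fun [set: 'rV[R]_n] (fun x => s *: x + a).
  by apply: measurable_rVD => //; exact: measurable_rVZ.
apply/integrableP; split.
  by apply/measurable_EFinP; exact: (measurableT_comp mf maff).
rewrite /= (@ge0_integral_rV_affine n s a (fun x => `|(f x)%:E|%E))//.
  move/integrableP: fi => [_]; rewrite /= => h.
  by apply: lte_mul_pinfty => //; rewrite lee_fin invr_ge0 exprn_ge0.
by apply: measurableT_comp => //; exact/measurable_EFinP.
Qed.

Lemma Rint_rV_affine n (s : R) (a : 'rV[R]_n) (f : 'rV[R]_n -> R) : s != 0 ->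
  intg (mu n) f ->
  \int[mu n]_x f (s *: x + a) = `|s| ^- n * \int[mu n]_x f x.
Proof.
move=> s0 fi; have mf := intg_measurable fi.
apply: EFin_inj; rewrite EFinM !EFin_Rint//; last exact: intg_rV_affine.
have mF : measurable_fun [set: 'rV[R]_n] (EFin \o f) by exact/measurable_EFinP.
rewrite [LHS]integralE [in RHS]integralE muleBr//; last first.
  apply: fin_num_adde_defl; rewrite fin_numN.
  exact: (integrable_neg_fin_num measurableT fi).
congr (_ - _)%E.
- rewrite -(ge0_integral_rV_affine a s0 (measurable_funepos mF)) ?funepos_ge0//.
  by apply: eq_integral => x _; rewrite !funeposE.
- rewrite -(ge0_integral_rV_affine a s0 (measurable_funeneg mF)) ?funeneg_ge0//.
  by apply: eq_integral => x _; rewrite !funenegE.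
Qed.

Lemma Rint_rV_shift n (a : 'rV[R]_n) (f : 'rV[R]_n -> R) : intg (mu n) f ->
  \int[mu n]_x f (x + a) = \int[mu n]_x f x.
Proof.
move=> fi; rewrite -[RHS]mul1r -[X in X * _]invr1 -(expr1n _ n) -(normr1 R).
rewrite -(Rint_rV_affine a (oner_neq0 R) fi).
by apply: eq_Rintegral => x _; rewrite scale1r.
Qed.

Lemma intg_rV_shift n (a : 'rV[R]_n) (f : 'rV[R]_n -> R) : intg (mu n) f ->
  intg (mu n) (fun x => f (x + a)).
Proof.
move=> /(intg_rV_affine a (oner_neq0 R)).
by rewrite (_ : (fun _ => _) = fun x => f (x + a))//; apply/funext => x; rewrite scale1r.
Qed.

Lemma Rint_rV_reflect n (a : 'rV[R]_n) (f : 'rV[R]_n -> R) : intg (mu n) f ->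
  \int[mu n]_x f (a - x) = \int[mu n]_x f x.
Proof.
have N1 : (-1 : R) != 0 by rewrite oppr_eq0 oner_neq0.
move=> fi; rewrite -[RHS]mul1r -[X in X * _]invr1 -(expr1n _ n) -(normrN1 R).
rewrite -(Rint_rV_affine a N1 fi).
by apply: eq_Rintegral => x _; rewrite scaleN1r addrC.
Qed.

Lemma intg_rV_reflect n (a : 'rV[R]_n) (f : 'rV[R]_n -> R) : intg (mu n) f ->
  intg (mu n) (fun x => f (a - x)).
Proof.
have N1 : (-1 : R) != 0 by rewrite oppr_eq0 oner_neq0.
move=> /(intg_rV_affine a N1).
rewrite (_ : (fun _ => _) = fun x => f (a - x))//; apply/funext => x.
by rewrite scaleN1r addrC.
Qed.

(** The sigma-algebra is generated by the coordinates, so its relation to the topology has to be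
    established. A continuous function is the pointwise limit of its values at the corners of grids
    of mesh [1 / k.+1], and a function that is constant on the countably many cells of a grid is
    measurable. *)
Lemma continuous_rV_measurable n (f : 'rV[R]_n -> R) : continuous f ->
  measurable_fun [set: 'rV[R]_n] f.
Proof.
move=> cf.
pose r (k : nat) (x : 'rV[R]_n) : 'rV[int]_n := \row_i Num.floor (x ord0 i * k.+1%:R).
pose g (k : nat) (z : 'rV[int]_n) : 'rV[R]_n := \row_i ((z ord0 i)%:~R / k.+1%:R).
have rgx x : (fun k => g k (r k x)) @ \oo --> x.
  apply/cvg_ballP => e e0; near=> k; split=> // i j.
  have -> : i = ord0 by exact: ord1.
  rewrite /ball/= !mxE.
  have k0 : 0 < k.+1%:R :> R by rewrite ltr0n.
  pose y : R := x ord0 j; rewrite -/y; have /andP[f1 f2] := floor_itv (y * k.+1%:R).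
  have ek : k.+1%:R^-1 < e.
    by near: k; exact: (near_infty_natSinv_lt (PosNum e0)).
  have d1 : (Num.floor (y * k.+1%:R))%:~R / k.+1%:R <= y by rewrite ler_pdivrMr.
  have d2 : y < (Num.floor (y * k.+1%:R))%:~R / k.+1%:R + k.+1%:R^-1.
    by rewrite -[X in _ + X]mul1r -mulrDl ltr_pdivlMr// -[1]/(1%:~R) -intrD.
  by rewrite ger0_norm ?subr_ge0// ltrBlDl (lt_trans d2)// ltrD2l.
have mr k (z : 'rV[int]_n) : measurable [set x | r k x = z].
  have -> : [set x : 'rV[R]_n | r k x = z] = \bigcap_(i in [set: 'I_n])
      [set x : 'rV[R]_n | (x ord0 i * k.+1%:R) \in `[(z ord0 i)%:~R, (z ord0 i + 1)%:~R[].
    apply/seteqP; split=> x /=.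
      by move=> <- i _ /=; rewrite in_itv/= mxE floor_itv.
    move=> h; apply/rowP => i; rewrite mxE; have := h i I; rewrite /= in_itv/=.
    by move/floor_def.
  apply: fin_bigcap_measurable => // i _.
  have mi : measurable_fun [set: 'rV[R]_n] (fun x => x ord0 i * k.+1%:R).
    by apply: measurable_funM => //; exact: measurable_coord_rV.
  by have := mi measurableT _ (measurable_itv `[(z ord0 i)%:~R, (z ord0 i + 1)%:~R[); rewrite setTI.
have mfr k : measurable_fun [set: 'rV[R]_n] (fun x => f (g k (r k x))).
  move=> _ A mA; rewrite setTI.
  rewrite (_ : _ @^-1` _ = \bigcup_m (if unpickle m is Some z then
      (if `[< A (f (g k z)) >] then [set x | r k x = z] else set0) else set0)).
    apply: bigcup_measurable => m _; case: (unpickle m) => [z|] //.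
    by case: ifPn => // _; exact: mr.
  apply/seteqP; split=> x /=.
    move=> Ax; exists (pickle (r k x)) => //=; rewrite pickleK.
    by case: asboolP.
  move=> [m _]; case: (unpickle m) => [z|] //.
  by case: asboolP => // Az /= rz; rewrite /preimage/= rz.
apply: (measurable_fun_cvg mfr) => x _.
by apply: (cvg_comp _ _ (rgx x)); exact: cf.
Unshelve. all: by end_near. Qed.

Section lines.
Variables (n : nat) (i : 'I_n).
Implicit Types (F G : 'rV[R]_n -> R).

Lemma is_derive_line F (x : 'rV[R]_n) (t l : R) :
  is_derive (x + t *: evec i) (evec i) F l ->
  is_derive t 1 (fun s => F (x + s *: evec i)) l.
Proof.
have E : (fun h => h^-1 *: ((F \o shift (x + t *: evec i)) (h *: evec i) - F (x + t *: evec i))) =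
   (fun h => h^-1 *: (((fun s => F (x + s *: evec i)) \o shift t) (h *: (1:R)) - F (x + t *: evec i))).
  apply/funext => h /=; congr (_ *: (F _ - _)).
  by rewrite [h%:A]mulr1 scalerDl addrCA.
case=> d1 d2; split; last by rewrite -d2 /derive E.
by move: d1; rewrite /derivable E.
Qed.

Lemma is_derive_line0 F (x : 'rV[R]_n) (l : R) :
  is_derive (0 : R) 1 (fun s => F (x + s *: evec i)) l ->
  is_derive x (evec i) F l.
Proof.
have E : (fun h => h^-1 *: ((F \o shift x) (h *: evec i) - F x)) =
   (fun h => h^-1 *: (((fun s => F (x + s *: evec i)) \o shift 0) (h *: (1:R)) - F (x + (0:R) *: evec i))).
  apply/funext => h /=; congr (_ *: (F _ - F _)); last by rewrite scale0r addr0.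
  by rewrite addr0 [h%:A]mulr1 addrC.
case=> d1 d2; split; last by rewrite -d2 /derive E.
by move: d1; rewrite /derivable E.
Qed.

(** This is the continuity that the fundamental theorem of calculus asks for along a line. It
    follows from the existence of a derivative in the same direction, which makes it easy to
    propagate through products and convolutions. *)
Definition line_continuous F :=
  forall x, continuous (fun s : R => F (x + s *: evec i)).

Lemma line_continuousM F G : line_continuous F -> line_continuous G ->
  line_continuous (fun x => F x * G x).
Proof. by move=> cF cG x s; apply: continuousM; [exact: cF|exact: cG]. Qed.

Lemma line_continuousD F G : line_continuous F -> line_continuous G ->
  line_continuous (fun x => F x + G x).
Proof. by move=> cF cG x s; apply: continuousD; [exact: cF|exact: cG]. Qed.

Lemma is_derive_line_continuous F F' :
  (forall x, is_derive x (evec i) F (F' x)) -> line_continuous F.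
Proof.
move=> dF x s; apply: differentiable_continuous; apply/derivable1_diffP.
by have [] := is_derive_line (dF (x + s *: evec i)).
Qed.

Lemma continuous_line_continuous F : continuous F -> line_continuous F.
Proof.
move=> cF x s; apply: (@cvg_comp _ _ _ (fun s => x + s *: evec i) F); last exact: cF.
apply: cvgD; first exact: cvg_cst.
by apply: cvgZr_tmp => //; exact: cvg_id.
Qed.

Lemma FTC_line F F' (x : 'rV[R]_n) (a b : R) : a <= b ->
  (forall x, is_derive x (evec i) F (F' x)) -> line_continuous F' ->
  \int[leb]_(s in `[a, b]) F' (x + s *: evec i) =
  F (x + b *: evec i) - F (x + a *: evec i).
Proof.
move=> ab dF cF'.
apply: (@FTC_Rint R (fun s => F (x + s *: evec i)) (fun s => F' (x + s *: evec i))) => //.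
  by move=> c _; exact: is_derive_line.
by move=> c _; exact: cF'.
Qed.

(** By translation invariance the integral of [F'] equals its average over the translations by
    [s *: evec i], [s] in [0, 1]. Fubini and the fundamental theorem of calculus turn the average
    into the integral of [F (x + evec i) - F x], which vanishes by translation invariance again.
    Integrability thus plays the part of decay at infinity. *)
Lemma Rint_derive0 F F' :
  (forall x, is_derive x (evec i) F (F' x)) -> line_continuous F' ->
  intg (mu n) F -> intg (mu n) F' -> \int[mu n]_x F' x = 0.
Proof.
move=> dF cF' iF iF'.
pose f (p : R * 'rV[R]_n) := \1_(`[0, 1]%classic) p.1 * F' (p.2 + p.1 *: evec i).
have mF' := intg_measurable iF'.
have mf : measurable_fun [set: R * 'rV[R]_n] f.
  apply: measurable_funM.
    have mi : measurable_fun [set: R] (\1_(`[0, 1]%classic) : R -> R).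
      exact: measurable_indic.
    exact: (measurableT_comp mi (@measurable_fst _ _ R 'rV[R]_n)).
  apply: (measurableT_comp mF'); apply: measurable_rVD => //.
  by apply: measurable_rVZ.
have s1 s : intg (mu n) (fun x => f (s, x)).
  rewrite /f/=; have := intgZ (\1_(`[0, 1]%classic) s : R) (intg_rV_shift (s *: evec i) iF').
  exact.
have Ef x : (fun s => f (s, x)) = (fun s => F' (x + s *: evec i)) \_ `[0, 1].
  by apply/funext => s; rewrite /f/= patchE indicE; case: ifPn; rewrite ?(mul1r, mul0r).
have s2 x : intg leb (fun s => f (s, x)).
  rewrite Ef /intg -restrict_EFin; apply/integrable_restrict => //.
  rewrite setTI; apply: continuous_compact_integrable; first exact: segment_compact.
  by apply: continuous_subspaceT => s; exact: cF'.
have N s : \int[mu n]_x `|f (s, x)| = \1_(`[0, 1]%classic) s * \int[mu n]_x `|F' x|.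
  rewrite -(Rint_rV_shift (s *: evec i) (intg_norm iF')).
  rewrite -RintZ; last by apply: intg_norm; exact: intg_rV_shift.
  by apply: eq_Rintegral => x _; rewrite normrM ger0_norm// indicE.
have N' s : \int[mu n]_x f (s, x) = \1_(`[0, 1]%classic) s * \int[mu n]_x F' x.
  by rewrite /f/= (RintZ _ (intg_rV_shift (s *: evec i) iF')) Rint_rV_shift.
have i1 (k : R) : intg leb (fun s => \1_(`[0, 1]%classic) s * k).
  under eq_fun do rewrite mulrC; apply: intgZ; exact: integrable_indic_itv.
have := @Rint_fubini _ _ _ _ R leb (mu n) f mf s1 s2.
have i2 : intg leb (fun s => \int[mu n]_y `|f (s, y)|).
  by rewrite (funext N); exact: i1.
move=> /(_ i2).
have -> : \int[leb]_s \int[mu n]_y f (s, y) = \int[mu n]_x F' x.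
  rewrite (eq_Rintegral leb (fun s _ => N' s)).
  under eq_Rintegral do rewrite mulrC.
  rewrite RintZ; last exact: integrable_indic_itv.
  rewrite /Rintegral integral_indic//= setIT lebesgue_measure_itv/= lte_fin ltr01.
  by rewrite -EFinB subr0 mulr1.
move=> ->.
have E x : \int[leb]_s f (s, x) = F (x + (1 : R) *: evec i) - F x.
  transitivity (\int[leb]_s ((fun s => F' (x + s *: evec i)) \_ `[0, 1]) s).
    by apply: eq_Rintegral => s _; rewrite -Ef.
  by rewrite -Rintegral_mkcond FTC_line ?ler01// scale0r addr0.
rewrite (eq_Rintegral (mu n) (fun x _ => E x)) RintB//; last exact: intg_rV_shift.
by rewrite Rint_rV_shift// subrr.
Qed.

End lines.

End rV.

(** * Rules of differentiation *)

Section derive_aux.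
Context (R : realType).

Lemma is_deriveE (V : normedModType R) (f g : V -> R) (x v : V) (l l' : R) :
  is_derive x v f l -> f =1 g -> l = l' -> is_derive x v g l'.
Proof. by move=> h /funext <- <-. Qed.

Section dirs.
Context (V : normedModType R) (x v : V).
Implicit Types f g : V -> R.

Lemma derM f g df dg : is_derive x v f df -> is_derive x v g dg ->
  is_derive x v (fun y => f y * g y) (df * g x + f x * dg).
Proof.
move=> h1 h2; apply: (is_deriveE (is_deriveM h1 h2)) => //.
by rewrite addrC mulrC.
Qed.

Lemma derD f g df dg : is_derive x v f df -> is_derive x v g dg ->
  is_derive x v (fun y => f y + g y) (df + dg).
Proof. by move=> h1 h2; exact: (is_deriveE (is_deriveD h1 h2)). Qed.

Lemma derB f g df dg : is_derive x v f df -> is_derive x v g dg ->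
  is_derive x v (fun y => f y - g y) (df - dg).
Proof. by move=> h1 h2; exact: (is_deriveE (is_deriveB h1 h2)). Qed.

Lemma derN f df : is_derive x v f df -> is_derive x v (fun y => - f y) (- df).
Proof. by move=> h1; exact: (is_deriveE (is_deriveN h1)). Qed.

Lemma derZ (k : R) f df : is_derive x v f df ->
  is_derive x v (fun y => k * f y) (k * df).
Proof. by move=> h1; exact: (is_deriveE (is_deriveZ k h1)). Qed.

Lemma derC (k : R) : is_derive x v (fun=> k) 0.
Proof. exact: is_derive_cst. Qed.

Lemma der_sqr f df : is_derive x v f df ->
  is_derive x v (fun y => f y ^+ 2) (2 * f x * df).
Proof.
move=> h; apply: (is_deriveE (derM h h)) => //.
by rewrite (mulrC df) mulr_natl mulr2n mulrDl.
Qed.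

Lemma der_sum (n : nat) (h : 'I_n -> V -> R) (dh : 'I_n -> R) :
  (forall i, is_derive x v (h i) (dh i)) ->
  is_derive x v (fun y => \sum_(i < n) h i y) (\sum_(i < n) dh i).
Proof.
move=> hd; apply: (is_deriveE (is_derive_sum hd)) => // y.
by rewrite fct_sumE.
Qed.

End dirs.

Lemma der_comp (h f : R -> R) (x a b : R) :
  is_derive (f x) 1 h a -> is_derive x 1 f b ->
  is_derive x 1 (fun y => h (f y)) (a * b).
Proof. by move=> h1 h2; exact: is_derive1_comp. Qed.

Lemma der_id (x : R) : is_derive x 1 (fun y : R => y) 1.
Proof. exact: is_derive_id. Qed.

Lemma der_continuous (f : R -> R) (x l : R) : is_derive x 1 f l ->
  {for x, continuous f}.
Proof.
move=> [d1 _]; apply: differentiable_continuous.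
exact/derivable1_diffP.
Qed.

Lemma der_inv (x : R) : x != 0 -> is_derive x 1 (fun y : R => y^-1) (- x ^- 2).
Proof.
move=> x0; apply: (is_deriveE (is_deriveV (f := fun y : R => y) x0 (der_id x))) => //.
by rewrite [_ *: _]mulr1.
Qed.

Lemma measurable_inv : measurable_fun [set: R] (fun x : R => x^-1).
Proof.
rewrite (_ : (fun _ => _) = (fun x : R => x * (x ^+ 2) `^ (-1))).
  apply: measurable_funM => //.
  apply: (measurableT_comp (measurable_powR (-1))).
  exact: exprn_measurable.
apply/funext => x; rewrite powR_inv1 ?sqr_ge0//.
have [->|x0] := eqVneq x 0; first by rewrite invr0 mul0r.
by field.
Qed.

Lemma measurable_funV d (T : measurableType d) (f : T -> R) :
  measurable_fun [set: T] f -> measurable_fun [set: T] (fun x => (f x)^-1).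
Proof. by move=> mf; exact: (measurableT_comp measurable_inv). Qed.

End derive_aux.

(** * The heat semigroup *)

Section gauss.
Context (R : realType) (d : nat).
Local Notation leb := (@lebesgue_measure R).
Local Notation mu := (lebesgue_rV R d).
Implicit Types (c : R) (z : 'rV[R]_d) (i j : 'I_d).

Lemma dotpC (x y : 'rV[R]_d) : dotp x y = dotp y x.
Proof. by apply: eq_bigr => i _; rewrite mulrC. Qed.

Lemma dotpDl (x y z : 'rV[R]_d) : dotp (x + y) z = dotp x z + dotp y z.
Proof. by rewrite -big_split; apply: eq_bigr => i _; rewrite mxE mulrDl. Qed.

Lemma dotpZl (k : R) (x z : 'rV[R]_d) : dotp (k *: x) z = k * dotp x z.
Proof. by rewrite mulr_sumr; apply: eq_bigr => i _; rewrite mxE mulrA. Qed.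

Lemma dotpDr (x y z : 'rV[R]_d) : dotp z (x + y) = dotp z x + dotp z y.
Proof. by rewrite !(dotpC z) dotpDl. Qed.

Lemma dotpZr (k : R) (x z : 'rV[R]_d) : dotp z (k *: x) = k * dotp z x.
Proof. by rewrite !(dotpC z) dotpZl. Qed.

Lemma dotpNN (x : 'rV[R]_d) : dotp (- x) (- x) = dotp x x.
Proof. by apply: eq_bigr => i _; rewrite !mxE mulrNN. Qed.

Lemma dotp_ge0 (x : 'rV[R]_d) : 0 <= dotp x x.
Proof. by apply: sumr_ge0 => i _; rewrite -expr2 sqr_ge0. Qed.

Lemma evecE i j : evec i ord0 j = (i == j)%:R :> R.
Proof. by rewrite mxE eqxx eq_sym. Qed.

Lemma dotp_evec (x : 'rV[R]_d) i : dotp x (evec i) = x ord0 i.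
Proof.
rewrite /dotp (bigD1 i)//= evecE eqxx mulr1 big1 ?addr0// => j ji.
by rewrite evecE eq_sym (negbTE ji) mulr0.
Qed.

Lemma coord_sqr_le (x : 'rV[R]_d) i : x ord0 i ^+ 2 <= dotp x x.
Proof.
rewrite /dotp (bigD1 i)//= -expr2 lerDl; apply: sumr_ge0 => j _.
by rewrite -expr2 sqr_ge0.
Qed.

Lemma dotp_line (x : 'rV[R]_d) i (s : R) :
  dotp (x + s *: evec i) (x + s *: evec i) = dotp x x + 2 * s * x ord0 i + s ^+ 2.
Proof.
have ee : dotp (evec i) (evec i) = 1 :> R by rewrite dotp_evec evecE eqxx.
rewrite !(dotpDl, dotpDr, dotpZl, dotpZr) ee (dotpC (evec i)) dotp_evec.
by ring.
Qed.

(** The heat kernel at time [c], with the normalisation (4 pi c)^(-d/2) inside the exponential so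
    that products of kernels become sums of exponents. [G1] and [G2] are its first and second space
    derivatives. *)
Definition Gk c z : R := expR (- (d%:R / 2) * ln (4 * pi * c) - dotp z z / (4 * c)).
Definition G1 i c z : R := - (z ord0 i / (2 * c)) * Gk c z.
Definition G2 i j c z : R :=
  (z ord0 i * z ord0 j / (4 * c ^+ 2) - (i == j)%:R / (2 * c)) * Gk c z.

Lemma Gk_gt0 c z : 0 < Gk c z. Proof. exact: expR_gt0. Qed.

Lemma GkN c z : Gk c (- z) = Gk c z. Proof. by rewrite /Gk dotpNN. Qed.

Lemma is_derive_Gk i c z : 0 < c -> is_derive z (evec i) (Gk c) (G1 i c z).
Proof.
move=> c0; apply: is_derive_line0.
pose L := - (d%:R / 2) * ln (4 * pi * c) - dotp z z / (4 * c).
have d1 : is_derive (0 : R) 1 (fun s : R => L - (2 * z ord0 i / (4 * c)) * s - (4 * c)^-1 * s ^+ 2)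
    (- (z ord0 i / (2 * c))).
  apply: (is_deriveE (derB (derB (derC _ _ L) (derZ _ (der_id _))) (derZ _ (der_sqr (der_id _))))) => //.
  by field; rewrite gt_eqF.
apply: (is_deriveE (der_comp (is_derive_expR _) d1)) => [s|].
  rewrite /Gk dotp_line; congr expR; rewrite /L; field; by rewrite gt_eqF.
rewrite /G1 /Gk /L mulrC mulr0 expr0n/= !subr0; congr (_ * expR _).
by rewrite mulr0 subr0.
Qed.

Lemma is_derive_coord i j z :
  is_derive z (evec j) (fun y : 'rV[R]_d => y ord0 i) (i == j)%:R.
Proof.
apply: is_derive_line0.
apply: (is_deriveE (derD (derC _ _ (z ord0 i)) (derZ (j == i)%:R (der_id _)))).
  by move=> s; rewrite !mxE eqxx eq_sym mulrC.
by rewrite add0r mulr1 eq_sym.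
Qed.

Lemma is_derive_G1 i j c z : 0 < c -> is_derive z (evec j) (G1 i c) (G2 i j c z).
Proof.
move=> c0.
have d1 : is_derive z (evec j) (fun y : 'rV[R]_d => - (y ord0 i / (2 * c))) (- ((i == j)%:R / (2 * c))).
  apply: (is_deriveE (derZ (- (2 * c)^-1) (is_derive_coord i j z))).
    by move=> y; rewrite mulNr mulrC.
  by rewrite mulNr mulrC.
apply: (is_deriveE (derM d1 (is_derive_Gk j z c0))) => //.
rewrite /G1 /G2; field; by rewrite gt_eqF.
Qed.

(** This is the heat equation; it converts every derivative in the time parameter into a trace of
    second space derivatives, to which integration by parts applies. *)
Lemma is_derive_Gk_time c z : 0 < c ->
  is_derive c 1 (Gk ^~ z) (\sum_(i < d) G2 i i c z).
Proof.
move=> c0; have p0 : 0 < 4 * pi * c by rewrite !mulr_gt0// pi_gt0.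
have d1 : is_derive c 1 (fun c : R => 4 * pi * c) (4 * pi).
  by apply: (is_deriveE (derZ (4 * pi) (der_id c))) => //; rewrite mulr1.
have d2 := derZ (- (d%:R / 2)) (der_comp (is_derive1_ln p0) d1).
have cn0 : c != 0 by rewrite gt_eqF.
have d3 := derZ (dotp z z / 4) (der_inv cn0).
apply: (is_deriveE (der_comp (is_derive_expR _) (derB d2 d3))).
  by move=> y; rewrite /Gk; congr expR; congr (_ - _); rewrite invfM mulrA.
have Gc : expR (- (d%:R / 2) * ln (4 * pi * c) - dotp z z / 4 * c^-1) = Gk c z.
  by rewrite /Gk; congr expR; congr (_ - _); rewrite invfM mulrA.
rewrite Gc /G2 -mulr_suml mulrC; congr (_ * _).
rewrite big_split/= sumrN.
under [X in _ = _ - X]eq_bigr do rewrite eqxx.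
rewrite sumr_const card_ord -mulr_suml -/(dotp z z) -[X in _ = _ - X]mulr_natl.
rewrite (_ : true%:R = 1 :> R)//; have pn : pi != 0 :> R by rewrite gt_eqF// pi_gt0.
have -> : (4 * pi * c)^-1 * (4 * pi) = c^-1.
  by rewrite invfM mulrAC mulVf ?mul1r// mulf_neq0.
by field.
Qed.

Lemma measurable_Gk d' (T : measurableType d') (c : T -> R) (z : T -> 'rV[R]_d) :
  measurable_fun [set: T] c -> measurable_fun [set: T] z ->
  measurable_fun [set: T] (fun t => Gk (c t) (z t)).
Proof.
move=> mc mz; apply: measurableT_comp => //; apply: measurable_funB.
  apply: measurable_funM => //; apply: (measurableT_comp (@measurable_ln R)).
  exact: measurable_funM.
apply: measurable_funM; first exact: measurable_dotp.
by apply: measurable_funV; exact: measurable_funM.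
Qed.

Lemma measurable_G1 i d' (T : measurableType d') (c : T -> R) (z : T -> 'rV[R]_d) :
  measurable_fun [set: T] c -> measurable_fun [set: T] z ->
  measurable_fun [set: T] (fun t => G1 i (c t) (z t)).
Proof.
move=> mc mz; apply: measurable_funM; last exact: measurable_Gk.
apply: measurableT_comp => //; apply: measurable_funM.
  exact: (proj1 (measurable_fun_rVP _) mz).
by apply: measurable_funV; exact: measurable_funM.
Qed.

Lemma measurable_G2 i j d' (T : measurableType d') (c : T -> R) (z : T -> 'rV[R]_d) :
  measurable_fun [set: T] c -> measurable_fun [set: T] z ->
  measurable_fun [set: T] (fun t => G2 i j (c t) (z t)).
Proof.
move=> mc mz; have mi k := proj1 (measurable_fun_rVP _) mz k.
apply: measurable_funM; last exact: measurable_Gk.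
apply: measurable_funB; apply: measurable_funM => //.
- exact: measurable_funM.
- by apply: measurable_funV; apply: measurable_funM => //; exact: measurable_funX.
- by apply: measurable_funV; exact: measurable_funM.
Qed.

(** The kernel is the product over the coordinates of centred normal densities of variance
    [2 * c]. *)
Lemma integral_Gk c : 0 < c -> (\int[mu]_z (Gk c z)%:E = 1)%E.
Proof.
move=> c0; pose s := Num.sqrt (2 * c).
have s2 : s ^+ 2 = 2 * c by rewrite sqr_sqrtr// mulr_ge0// ltW.
have s0 : s != 0 by rewrite gt_eqF// sqrtr_gt0 mulr_gt0.
have p0 : 0 < 4 * pi * c by rewrite !mulr_gt0// pi_gt0.
have E z : (Gk c z)%:E = (\prod_(i < d) (normal_pdf 0 s (z ord0 i))%:E)%E.
  rewrite -(big_morph EFin EFinM (erefl _)); congr EFin; rewrite /Gk.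
  transitivity (\prod_(i < d) expR (- (2^-1) * ln (4 * pi * c) - z ord0 i ^+ 2 / (4 * c))).
    rewrite -expR_sum; congr expR; rewrite big_split/= sumr_const card_ord sumrN -mulr_suml.
    have -> : \sum_(i < d) z ord0 i ^+ 2 = dotp z z.
      by apply: eq_bigr => i _; rewrite expr2.
    by congr (_ - _); rewrite -[RHS]mulr_natl mulrA mulrN.
  apply: eq_bigr => i _; rewrite normal_pdfE// expRD; congr (_ * _).
    rewrite /normal_peak s2; have -> : 2 * c * pi *+ 2 = 4 * pi * c by ring.
    rewrite mulNr expRN; congr (_^-1); rewrite -powR12_sqrt ?ltW//.
    by rewrite /powR gt_eqF// mulrC.
  rewrite /normal_fun s2 subr0; congr expR.
  by field; rewrite gt_eqF.
under eq_integral do rewrite E.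
rewrite (@integral_rV_prod R d (fun=> EFin \o normal_pdf 0 s)).
- by rewrite big1// => i _; exact: integral_normal_pdf.
- by move=> i; apply/measurable_EFinP; exact: measurable_normal_pdf.
- by move=> i t; rewrite lee_fin normal_pdf_ge0.
Qed.

Lemma intg_Gk c : 0 < c -> intg mu (Gk c).
Proof.
move=> c0; apply: intg_lty.
- exact: measurable_Gk.
- by move=> z; rewrite ltW// Gk_gt0.
- by rewrite integral_Gk// ltry.
Qed.

Lemma Rint_Gk c : 0 < c -> \int[mu]_z Gk c z = 1.
Proof. by move=> c0; rewrite /Rintegral integral_Gk. Qed.

Definition Gsup c : R := expR (- (d%:R / 2) * ln (4 * pi * c)).

Lemma Gk_le_sup c z : 0 < c -> Gk c z <= Gsup c.
Proof.
move=> c0; by rewrite ler_expR lerBlDr lerDl divr_ge0 ?dotp_ge0// mulr_ge0// ltW.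
Qed.

(* c <= c1 costs the ratio (c1/c)^(d/2) of the normalising constants *)
Lemma Gk_mono c c1 z : 0 < c -> c <= c1 ->
  Gk c z <= (c1 / c) `^ (d%:R / 2) * Gk c1 z.
Proof.
move=> c0 cc1; have c10 : 0 < c1 by exact: lt_le_trans cc1.
have r0 : 0 < c1 / c by rewrite divr_gt0.
rewrite /powR gt_eqF// -expRD ler_expR ln_div// !lnM ?posrE ?mulr_gt0 ?pi_gt0//.
have : dotp z z / (4 * c1) <= dotp z z / (4 * c).
  rewrite ler_wpM2l ?dotp_ge0// lef_pV2 ?posrE ?mulr_gt0// ler_pM2l//.
by move=> ?; lra.
Qed.

(** Constants of [G1_le] and [G2_le]: the power of 2 comes from doubling the time in [gauss_half],
    the factors 2 and 4 from bounding a polynomial by the exponential that is given up there. *)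
Definition K1 : R := 2 * 2 `^ (d%:R / 2).
Definition K2 : R := 4 * 2 `^ (d%:R / 2).

(** A derivative of the kernel is a polynomial times the kernel. Giving up half of the exponent
    leaves the kernel at the doubled time, and the half that is given up dominates the
    polynomial. *)
Lemma gauss_half (c : R) z : 0 < c ->
  expR (dotp z z / (8 * c)) * Gk c z = 2 `^ (d%:R / 2) * Gk (2 * c) z.
Proof.
move=> c0; rewrite /Gk /powR gt_eqF// -!expRD; congr expR.
rewrite !lnM ?posrE ?mulr_gt0 ?pi_gt0//.
by field; rewrite gt_eqF.
Qed.

Lemma K1_ge0 : 0 <= K1. Proof. by rewrite mulr_ge0// powR_ge0. Qed.
Lemma K2_ge0 : 0 <= K2. Proof. by rewrite mulr_ge0// powR_ge0. Qed.

Lemma Gk_le2 c z : 0 < c -> Gk c z <= 2 `^ (d%:R / 2) * Gk (2 * c) z.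
Proof.
move=> c0; rewrite -gauss_half// ler_peMl ?(ltW (Gk_gt0 _ _))//.
by rewrite -expR0 ler_expR divr_ge0 ?dotp_ge0// mulr_ge0// ltW.
Qed.

Lemma G1_le i c z : 0 < c -> `|G1 i c z| <= K1 / Num.sqrt c * Gk (2 * c) z.
Proof.
move=> c0; have -> : K1 / Num.sqrt c * Gk (2 * c) z = 2 / Num.sqrt c * expR (dotp z z / (8 * c)) * Gk c z.
  by rewrite -[RHS]mulrA gauss_half// /K1 !mulrA; congr (_ * _); rewrite mulrAC.
rewrite normrM normrN (ger0_norm (ltW (Gk_gt0 _ _))) ler_wpM2r ?(ltW (Gk_gt0 _ _))//.
set u := dotp z z / (8 * c).
have u0 : 0 <= u by rewrite divr_ge0 ?dotp_ge0// mulr_ge0// ltW.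
have sc : 0 < Num.sqrt c by rewrite sqrtr_gt0.
rewrite -ler_sqr ?nnegrE ?mulr_ge0 ?invr_ge0 ?sqrtr_ge0 ?expR_ge0//.
rewrite real_normK ?num_real// expr_div_n exprMn exprMn expr_div_n.
rewrite sqr_sqrtr ?(ltW c0)// -expRM_natl.
have eu : u <= expR (2 * u).
  rewrite (le_trans _ (expR_ge1Dx _))//; lra.
rewrite ler_pdivrMr ?exprn_gt0 ?mulr_gt0//.
apply: (le_trans (coord_sqr_le z i)).
have -> : dotp z z = 8 * c * u by rewrite /u; field; rewrite gt_eqF.
have -> : 2 ^+ 2 / c * expR (2 * u) * (2 ^+ 2 * c ^+ 2) = 16 * c * expR (2 * u).
  by field; rewrite gt_eqF.
have e0 := expR_ge0 (2 * u).
by nra.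
Qed.

Lemma G2_le i j c z : 0 < c -> `|G2 i j c z| <= K2 / c * Gk (2 * c) z.
Proof.
move=> c0; have -> : K2 / c * Gk (2 * c) z = 4 / c * expR (dotp z z / (8 * c)) * Gk c z.
  by rewrite -[RHS]mulrA gauss_half// /K2 !mulrA; congr (_ * _); rewrite mulrAC.
rewrite normrM (ger0_norm (ltW (Gk_gt0 _ _))) ler_wpM2r ?(ltW (Gk_gt0 _ _))//.
set u := dotp z z / (8 * c).
have u0 : 0 <= u by rewrite divr_ge0 ?dotp_ge0// mulr_ge0// ltW.
have zz : `|z ord0 i * z ord0 j| <= 8 * c * u.
  have -> : 8 * c * u = dotp z z by rewrite /u; field; rewrite gt_eqF.
  have := coord_sqr_le z i; have := coord_sqr_le z j.
  rewrite normrM -(real_normK (num_real (z ord0 i))) -(real_normK (num_real (z ord0 j))).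
  by have : 0 <= (`|z ord0 i| - `|z ord0 j|) ^+ 2 by [exact: sqr_ge0]; nra.
have eu := expR_ge1Dx u.
apply: (le_trans (ler_normB _ _)).
rewrite normrM (ger0_norm (_ : 0 <= (4 * c ^+ 2)^-1)) ?invr_ge0 ?mulr_ge0 ?sqr_ge0 ?(ltW c0)//.
rewrite (ger0_norm (_ : 0 <= (i == j)%:R / (2 * c))); last first.
  by rewrite divr_ge0// mulr_ge0// ltW.
have h1 : `|z ord0 i * z ord0 j| / (4 * c ^+ 2) <= 2 * u / c.
  rewrite ler_pdivrMr ?mulr_gt0 ?exprn_gt0//.
  have -> : 2 * u / c * (4 * c ^+ 2) = 8 * c * u by field; rewrite gt_eqF.
  by [].
have h2 : (i == j)%:R / (2 * c) <= 1 / c.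
  rewrite invfM mulrA ler_pM2r ?invr_gt0//.
  have : (i == j)%:R <= 1 :> R by case: (i == j); rewrite ?ler01.
  lra.
have h3 : 2 * u / c + 1 / c <= 4 / c * expR u.
  by rewrite -mulrDl mulrAC ler_pM2r ?invr_gt0//; lra.
by lra.
Qed.

End gauss.

#[global] Opaque Gk.

Lemma eq_ler (R : realType) (x y : R) : x = y -> x <= y.
Proof. by move=> ->. Qed.

(** * Convolution with kernels dominated by a Gaussian *)

Section heat.
Context (R : realType) (d : nat).
Local Notation mu := (lebesgue_rV R d).
Implicit Types (c A : R) (x y z : 'rV[R]_d) (i j : 'I_d) (K f g : 'rV[R]_d -> R).

(** Bounded integrable functions form an algebra, lie in every L^p with p at least 1 and are stable
    under convolution with the kernels used here, so that products of any number of factors can be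
    integrated. *)
Definition bint f := [/\ measurable_fun [set: 'rV[R]_d] f,
  (exists M : R, forall x, `|f x| <= M) & intg mu f].

Lemma bint_measurable f : bint f -> measurable_fun [set: 'rV[R]_d] f.
Proof. by case. Qed.

Lemma bint_intg f : bint f -> intg mu f. Proof. by case. Qed.

Lemma bint_bound f : bint f -> exists2 M : R, 0 <= M & forall x, `|f x| <= M.
Proof.
move=> [_ [M fM] _]; exists `|M| => // x.
by rewrite (le_trans (fM x))// ler_norm.
Qed.

Lemma bint_norm f : bint f -> bint (fun x => `|f x|).
Proof.
move=> [mf [M fM] fi]; split; [exact: measurableT_comp| |exact: intg_norm].
by exists M => x; rewrite normr_id.
Qed.

Lemma bint_mull f g M : measurable_fun [set: 'rV[R]_d] f ->
  (forall x, `|f x| <= M) -> bint g -> bint (fun x => f x * g x).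
Proof.
move=> mf fM [mg [N gN] gi]; split.
- exact: measurable_funM.
- by exists (M * N) => x; rewrite normrM ler_pM.
- exact: (intg_bounded_mul mf fM).
Qed.

Lemma bintM f g : bint f -> bint g -> bint (fun x => f x * g x).
Proof. by move=> [mf [M fM] _] Xg; exact: bint_mull mf fM Xg. Qed.

Lemma bintZ (k : R) f : bint f -> bint (fun x => k * f x).
Proof.
move=> Xf; have mk : measurable_fun [set: 'rV[R]_d] (cst k) by exact: measurable_cst.
exact: (bint_mull (M := `|k|) mk).
Qed.

Lemma bintD f g : bint f -> bint g -> bint (fun x => f x + g x).
Proof.
move=> [mf [M fM] fi] [mg [N gN] gi]; split.
- exact: measurable_funD.
- by exists (M + N) => x; rewrite (le_trans (ler_normD _ _))// lerD.
- exact: intgD.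
Qed.

Lemma bintN f : bint f -> bint (fun x => - f x).
Proof.
move=> Xf; have := bintZ (-1) Xf.
by rewrite (_ : (fun _ => _) = (fun x => - f x))//; apply/funext => x; rewrite mulN1r.
Qed.

Lemma bintB f g : bint f -> bint g -> bint (fun x => f x - g x).
Proof. by move=> Xf Xg; apply: bintD => //; exact: bintN. Qed.

Lemma bint0 : bint (fun=> 0).
Proof. by split; [exact: measurable_cst|exists 0 => x; rewrite normr0|exact: intg0]. Qed.

Lemma bint_sum (I : Type) (r : seq I) (F : I -> 'rV[R]_d -> R) :
  (forall k, bint (F k)) -> bint (fun x => \sum_(k <- r) F k x).
Proof.
move=> XF; elim: r => [|k r ih].
  by under eq_fun do rewrite big_nil; exact: bint0.
by under eq_fun do rewrite big_cons; exact: bintD.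
Qed.

Lemma bint_sqr f : bint f -> intg mu (fun x => f x ^+ 2).
Proof. by move=> Xf; apply: bint_intg; under eq_fun do rewrite expr2; exact: bintM. Qed.

Lemma bint_mul_intg f g : bint f -> bint g -> intg mu (fun x => f x * g x).
Proof. by move=> Xf Xg; apply: bint_intg; exact: bintM. Qed.

Lemma measurable_subx d' (T : measurableType d') (h k : T -> 'rV[R]_d) K :
  measurable_fun [set: 'rV[R]_d] K ->
  measurable_fun [set: T] h -> measurable_fun [set: T] k ->
  measurable_fun [set: T] (fun t => K (h t - k t)).
Proof. by move=> mK mh mk; apply: (measurableT_comp mK); exact: measurable_rVB. Qed.

Definition conv K f x : R := \int[mu]_y (K (x - y) * f y).

(** The heat kernel and its derivatives all satisfy such a bound, with the time doubled for the
    derivatives. Sup and L^2 estimates for the convolution then follow from the positivity and the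
    unit mass of the Gaussian alone. *)
Definition gkernel K A c := [/\ 0 < c, 0 <= A, measurable_fun [set: 'rV[R]_d] K &
  forall z, `|K z| <= A * Gk c z].

Section gkernel.
Variables (K : 'rV[R]_d -> R) (A c : R).
Hypothesis hK : gkernel K A c.

Lemma gkernel_measurable : measurable_fun [set: 'rV[R]_d] K. Proof. by case: hK. Qed.

Lemma gkernel_bound z : `|K z| <= A * Gsup d c.
Proof.
case: hK => c0 A0 _ KA; rewrite (le_trans (KA z))// ler_wpM2l//.
exact: Gk_le_sup.
Qed.

Lemma gkernel_intg : intg mu K.
Proof.
case: hK => c0 A0 mK KA; apply: (intg_le mK KA); apply: intgZ; exact: intg_Gk.
Qed.

Lemma gkernel_sub x : measurable_fun [set: 'rV[R]_d] (fun y => K (x - y)).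
Proof. by apply: measurable_subx => //; exact: gkernel_measurable. Qed.

Lemma conv_intg f x : intg mu f -> intg mu (fun y => K (x - y) * f y).
Proof.
move=> fi; apply: (intg_bounded_mul (gkernel_sub x)) => // y.
exact: gkernel_bound.
Qed.

Lemma conv_swap f x : intg mu f -> conv K f x = \int[mu]_y (K y * f (x - y)).
Proof.
move=> fi; have h := conv_intg x fi.
rewrite /conv -(Rint_rV_reflect x h); apply: eq_Rint => y.
by rewrite opprB addrCA subrr addr0.
Qed.

Lemma conv_le_sup f M x : intg mu f -> (forall y, `|f y| <= M) ->
  `|conv K f x| <= A * M.
Proof.
move=> fi fM; rewrite conv_swap//; case: hK => c0 A0 mK KA.
have ki : intg mu (fun y => K y * f (x - y)).
  have := intg_rV_reflect x (conv_intg x fi); apply: eq_intg => y.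
  by rewrite opprB addrCA subrr addr0.
apply: (le_trans (Rint_norm_le (g := fun y => (A * M) * Gk c y) ki _ _)).
- by apply: intgZ; exact: intg_Gk.
- move=> y; rewrite normrM mulrAC ler_pM//.
- by rewrite RintZ ?Rint_Gk ?mulr1//; exact: intg_Gk.
Qed.

Lemma measurable_conv f : measurable_fun [set: 'rV[R]_d] f ->
  measurable_fun [set: 'rV[R]_d] (conv K f).
Proof.
move=> mf.
have mF : measurable_fun [set: 'rV[R]_d * 'rV[R]_d] (fun p => K (p.1 - p.2) * f p.2).
  apply: measurable_funM; last exact: (measurableT_comp mf).
  by apply: measurable_subx => //; exact: gkernel_measurable.
exact: (measurable_Rint_param mu mF).
Qed.

(** Conditions for Fubini when a convolution is paired with a function [g] that is only bounded:
    [g = 1] gives integrability and conservation of mass, a cosine or a sine gives the Fourier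
    transform. *)
Lemma conv_fubini_aux f g : bint f -> (exists M : R, forall x, `|g x| <= M) ->
  measurable_fun [set: 'rV[R]_d] g ->
  let F p := g p.2 * (K (p.2 - p.1) * f p.1) in
  [/\ measurable_fun [set: 'rV[R]_d * 'rV[R]_d] F,
    (forall y, intg mu (fun x => F (y, x))),
    (forall x, intg mu (fun y => F (y, x))) &
    intg mu (fun y => \int[mu]_x `|F (y, x)|)].
Proof.
move=> [mf [N fN] fi] [M gM] mg F; have mK := gkernel_measurable.
case: (hK) => c0 A0 _ KA.
have mF : measurable_fun [set: 'rV[R]_d * 'rV[R]_d] F.
  apply: measurable_funM; first exact: (measurableT_comp mg).
  apply: measurable_funM; last exact: (measurableT_comp mf).
  exact: measurable_subx.
have s1 y : intg mu (fun x => F (y, x)).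
  apply: (@intg_bounded_mul _ _ _ _ g _ M) => //.
  have := intgZ (f y) (intg_rV_shift (- y) gkernel_intg).
  by apply: eq_intg => x /=; rewrite mulrC.
have s2 x : intg mu (fun y => F (y, x)).
  by have := intgZ (g x) (conv_intg x fi); exact.
split=> //.
apply: (@intg_le _ _ _ _ _ (fun y => (M * A) * `|f y|)).
- apply: (@measurable_Rint_param _ _ _ _ R mu (fun p => `|F p|)).
  exact: measurableT_comp.
- move=> y; rewrite ger0_norm; last exact: Rint_ge0.
  apply: (le_trans (Rint_le (g := fun x => (M * A * `|f y|) * Gk c (x - y)) _ _ _)).
  + exact: intg_norm.
  + by apply: intgZ; apply: (intg_rV_shift (- y)); exact: intg_Gk.
  + move=> x; rewrite /F/= !normrM -!mulrA ler_pM// [`|f y| * _]mulrC mulrA ler_pM//.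
  + rewrite RintZ; last by apply: (intg_rV_shift (- y)); exact: intg_Gk.
    by rewrite Rint_rV_shift ?Rint_Gk ?mulr1//; exact: intg_Gk.
- by apply: intgZ; exact: intg_norm.
Qed.

Lemma Rint_conv_mul f g : bint f -> (exists M : R, forall x, `|g x| <= M) ->
  measurable_fun [set: 'rV[R]_d] g ->
  \int[mu]_x (g x * conv K f x) = \int[mu]_y (f y * \int[mu]_x (K (x - y) * g x)).
Proof.
move=> Xf bg mg; have [mF s1 s2 iF] := conv_fubini_aux Xf bg mg.
transitivity (\int[mu]_x \int[mu]_y (g x * (K (x - y) * f y))).
  by apply: eq_Rint => x; rewrite -RintZ//; apply: conv_intg; exact: bint_intg.
rewrite -(Rint_fubini mF s1 s2 iF) /=.
apply: eq_Rint => y; rewrite -RintZ.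
  by apply: eq_Rint => x; ring.
case: bg => M gM; under eq_fun do rewrite mulrC.
by apply: (intg_bounded_mul mg gM); exact: (intg_rV_shift (- y) gkernel_intg).
Qed.

Lemma intg_conv f : bint f -> intg mu (conv K f).
Proof.
move=> Xf; have m1 : measurable_fun [set: 'rV[R]_d] (fun=> 1 : R) by exact: measurable_cst.
have b1 : exists M : R, forall x : 'rV[R]_d, `|(1 : R)| <= M by exists 1 => _; rewrite normr1.
have [mF s1 s2 iF] := conv_fubini_aux Xf b1 m1.
have iF' := intg_Rint_swap mF s1 s2 iF.
apply: (intg_le _ _ iF'); first by apply: measurable_conv; exact: bint_measurable.
move=> x; apply: (le_trans _ (Rint_norm (s2 x))).
by apply: eq_ler; congr `|_|; apply: eq_Rint => y /=; rewrite mul1r.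
Qed.

Lemma bint_conv f : bint f -> bint (conv K f).
Proof.
move=> Xf; have [M _ fM] := bint_bound Xf; split.
- by apply: measurable_conv; exact: bint_measurable.
- by exists (A * M) => x; apply: conv_le_sup => //; exact: bint_intg.
- exact: intg_conv.
Qed.

End gkernel.

Lemma Gk_gkernel c : 0 < c -> gkernel (Gk c) 1 c.
Proof.
move=> c0; split=> //; first exact: measurable_Gk.
by move=> z; rewrite mul1r ger0_norm// ltW// Gk_gt0.
Qed.

Lemma conv_ge0 c f x : (forall y, 0 <= f y) -> 0 <= conv (Gk c) f x.
Proof. by move=> f0; apply: Rint_ge0 => y; rewrite mulr_ge0// ltW// Gk_gt0. Qed.

Lemma Rint_convGk c f : 0 < c -> bint f -> \int[mu]_x conv (Gk c) f x = \int[mu]_x f x.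
Proof.
move=> c0 Xf; have m1 : measurable_fun [set: 'rV[R]_d] (fun=> 1 : R) by exact: measurable_cst.
have b1 : exists M : R, forall x : 'rV[R]_d, `|(1 : R)| <= M by exists 1 => _; rewrite normr1.
transitivity (\int[mu]_x (1 * conv (Gk c) f x)); first by apply: eq_Rint => x; rewrite mul1r.
rewrite (Rint_conv_mul (Gk_gkernel c0) Xf b1 m1).
apply: eq_Rint => y; rewrite -[RHS]mulr1; congr (_ * _).
under eq_Rint do rewrite mulr1.
by rewrite (Rint_rV_shift (- y)) ?Rint_Gk//; exact: intg_Gk.
Qed.

Lemma conv_norm_le K A c f x : gkernel K A c -> intg mu f ->
  `|conv K f x| <= A * conv (Gk c) (fun y => `|f y|) x.
Proof.
move=> hK fi; have [c0 A0 mK KA] := hK.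
rewrite /conv -RintZ; last by apply: (conv_intg (Gk_gkernel c0)); exact: intg_norm.
apply: Rint_norm_le; first exact: (conv_intg hK).
  by apply: intgZ; apply: (conv_intg (Gk_gkernel c0)); exact: intg_norm.
by move=> y; rewrite normrM mulrA ler_wpM2r.
Qed.

(* Jensen for the probability density Gk c, from the variance around the mean m. *)
Lemma conv_sqr_le c f x : 0 < c -> bint f ->
  conv (Gk c) f x ^+ 2 <= conv (Gk c) (fun y => f y ^+ 2) x.
Proof.
move=> c0 Xf; have hG := Gk_gkernel c0.
set m := conv (Gk c) f x.
have i1 := conv_intg hG x (bint_intg Xf).
have i2 := conv_intg hG x (bint_sqr Xf).
have i0 : intg mu (fun y => Gk c (x - y)) by apply: (intg_rV_reflect x); exact: intg_Gk.
have : 0 <= \int[mu]_y (Gk c (x - y) * f y ^+ 2 - (2 * m) * (Gk c (x - y) * f y) + m ^+ 2 * Gk c (x - y)).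
  apply: Rint_ge0 => y.
  have -> : Gk c (x - y) * f y ^+ 2 - 2 * m * (Gk c (x - y) * f y) + m ^+ 2 * Gk c (x - y)
    = Gk c (x - y) * (f y - m) ^+ 2 by ring.
  by rewrite mulr_ge0 ?sqr_ge0// ltW// Gk_gt0.
rewrite RintD; [|by apply: intgB => //; exact: intgZ|exact: intgZ].
rewrite RintB//; last exact: intgZ.
rewrite !RintZ// (Rint_rV_reflect x (intg_Gk d c0)) Rint_Gk//.
by rewrite -/(conv _ _ _) -/(conv _ _ _) -/m; lra.
Qed.

(** The convolution is dominated by [A] times the Gaussian average of |f|; Jensen bounds the square
    of that average by the average of the square, whose integral is preserved. *)
Lemma conv_L2 K A c f : gkernel K A c -> bint f ->
  \int[mu]_x conv K f x ^+ 2 <= A ^+ 2 * \int[mu]_x f x ^+ 2.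
Proof.
move=> hK Xf; have [c0 A0 mK KA] := hK; have hG := Gk_gkernel c0.
have Xf2 : bint (fun x => f x ^+ 2) by under eq_fun do rewrite expr2; exact: bintM.
rewrite -(Rint_convGk c0 Xf2) -RintZ; last exact: (intg_conv hG).
apply: Rint_le; [exact/bint_sqr/(bint_conv hK)|by apply: intgZ; exact: (intg_conv hG)|].
move=> x; rewrite -real_normK ?num_real//.
apply: (@le_trans _ _ ((A * conv (Gk c) (fun y => `|f y|) x) ^+ 2)).
  rewrite ler_sqr ?nnegrE ?mulr_ge0 ?conv_ge0//; apply: conv_norm_le => //.
  exact: bint_intg.
rewrite exprMn ler_wpM2l ?sqr_ge0//.
apply: (le_trans (conv_sqr_le x c0 (bint_norm Xf))).
apply: eq_ler; apply: eq_Rint => y.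
by rewrite real_normK ?num_real.
Qed.

Lemma conv_is_derive K K' A A' c c' f i x : gkernel K A c -> gkernel K' A' c' ->
  (forall z, is_derive z (evec i) K (K' z)) -> intg mu f ->
  is_derive x (evec i) (conv K f) (conv K' f x).
Proof.
move=> hK hK' dK fi; apply: is_derive_line0.
have E : conv K' f x = \int[mu]_y (K' (x + (0 : R) *: evec i - y) * f y).
  by apply: eq_Rint => y; rewrite scale0r addr0.
rewrite E.
apply: (@under_is_derive _ _ R mu (-1) 1 (fun s y => K (x + s *: evec i - y) * f y)
  (fun s y => K' (x + s *: evec i - y) * f y) (fun y => (A' * Gsup d c') * `|f y|)).
- by move=> s _; exact: (conv_intg hK).
- move=> s y _; have h := is_derive_line (dK (x - y + s *: evec i)).
  by apply: (is_deriveE (derM h (derC _ _ (f y)))) => [r|];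
    rewrite ?mulr0 ?addr0 addrAC.
- by apply: intgZ; exact: intg_norm.
- by move=> s y _; rewrite normrM ler_wpM2r//; exact: (gkernel_bound hK').
- by rewrite oppr_lt0 ltr01.
Qed.

Lemma conv_line_continuous K A c f i : gkernel K A c -> line_continuous i K ->
  intg mu f -> line_continuous i (conv K f).
Proof.
move=> hK cK fi x s.
apply: (@under_continuous _ _ R mu (s - 1) (s + 1)
  (fun s y => K (x + s *: evec i - y) * f y) (fun y => (A * Gsup d c) * `|f y|)).
- move=> t _; apply: measurable_funM; last exact: intg_measurable fi.
  by apply: (gkernel_sub hK).
- move=> t y _; apply: continuousM; last exact: cst_continuous.
  have := cK (x - y) t; rewrite (_ : (fun s => K (x - y + _)) = (fun s => K (x + s *: evec i - y)))//.
  by apply/funext => r; rewrite addrAC.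
- by apply: intgZ; exact: intg_norm.
- by move=> t y _; rewrite normrM ler_wpM2r//; exact: (gkernel_bound hK).
- have h (r : R) : r - 1 < r < r + 1 by rewrite ltrBlDr ltrDl ltr01.
  exact: h.
Qed.

End heat.

(** * The heat flow and its derivatives *)

Section semigroup.
Context (R : realType) (d : nat).
Local Notation mu := (lebesgue_rV R d).
Implicit Types (c : R) (x y z : 'rV[R]_d) (i j : 'I_d) (f g : 'rV[R]_d -> R).

Definition heat c f := conv (Gk c) f.
Definition dheat i c f := conv (G1 i c) f.
Definition ddheat i j c f := conv (G2 i j c) f.

Lemma G1_gkernel i c : 0 < c -> gkernel (G1 i c) (K1 R d / Num.sqrt c) (2 * c).
Proof.
move=> c0; split; [exact: mulr_gt0| |exact: measurable_G1|].
- by rewrite divr_ge0 ?K1_ge0 ?sqrtr_ge0.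
- by move=> z; exact: G1_le.
Qed.

Lemma G2_gkernel i j c : 0 < c -> gkernel (G2 i j c) (K2 R d / c) (2 * c).
Proof.
move=> c0; split; [exact: mulr_gt0| |exact: measurable_G2|].
- by rewrite divr_ge0 ?K2_ge0 ?ltW.
- by move=> z; exact: G2_le.
Qed.

Lemma bint_heat c f : 0 < c -> bint f -> bint (heat c f).
Proof. by move=> c0; exact: (bint_conv (Gk_gkernel d c0)). Qed.

Lemma bint_dheat i c f : 0 < c -> bint f -> bint (dheat i c f).
Proof. by move=> c0; exact: (bint_conv (G1_gkernel i c0)). Qed.

Lemma bint_ddheat i j c f : 0 < c -> bint f -> bint (ddheat i j c f).
Proof. by move=> c0; exact: (bint_conv (G2_gkernel i j c0)). Qed.

Lemma heat_derive c f i x : 0 < c -> bint f ->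
  is_derive x (evec i) (heat c f) (dheat i c f x).
Proof.
move=> c0 Xf; apply: (conv_is_derive x (Gk_gkernel d c0) (G1_gkernel i c0)).
  by move=> z; exact: is_derive_Gk.
exact: bint_intg.
Qed.

Lemma dheat_derive c f i j x : 0 < c -> bint f ->
  is_derive x (evec j) (dheat i c f) (ddheat i j c f x).
Proof.
move=> c0 Xf; apply: (conv_is_derive x (G1_gkernel i c0) (G2_gkernel i j c0)).
  by move=> z; exact: is_derive_G1.
exact: bint_intg.
Qed.

Lemma G2_line_continuous c i j k : 0 < c -> line_continuous k (G2 i j c).
Proof.
move=> c0 x s; apply: (@der_continuous R).
have dd (l : 'I_d) := is_derive_line (is_derive_coord l k (x + s *: evec k)).
apply: (derM (derB (derM (derM (dd i) (dd j)) (derC _ _ _)) (derC _ _ _))).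
by apply: is_derive_line; exact: is_derive_Gk.
Qed.

Lemma ddheat_lc c f i j k : 0 < c -> bint f -> line_continuous k (ddheat i j c f).
Proof.
move=> c0 Xf; apply: (conv_line_continuous (G2_gkernel i j c0)).
  exact: G2_line_continuous.
exact: bint_intg.
Qed.

Lemma dheat_lc c f i k : 0 < c -> bint f -> line_continuous k (dheat i c f).
Proof.
move=> c0 Xf; apply: is_derive_line_continuous => x; exact: dheat_derive.
Qed.

Lemma heat_lc c f k : 0 < c -> bint f -> line_continuous k (heat c f).
Proof.
move=> c0 Xf; apply: is_derive_line_continuous => x; exact: heat_derive.
Qed.

Lemma G2C i j c z : G2 i j c z = G2 j i c z.
Proof. by rewrite /G2 eq_sym [z ord0 i * _]mulrC. Qed.

Lemma ddheatC i j c f x : ddheat i j c f x = ddheat j i c f x.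
Proof. by apply: eq_Rint => y; rewrite G2C. Qed.

(** Constant of a common majorant: for [a <= c <= b] the kernel and its derivatives up to order two
    are bounded by [domc a b] times the Gaussian at time [2 * b]. It serves only to differentiate
    and integrate in [c], and enters no final estimate. *)
Definition domc (a b : R) : R :=
  (b / a) `^ (d%:R / 2) * (2 `^ (d%:R / 2) + K1 R d / Num.sqrt a + K2 R d / a).

Lemma domc_ge0 a b : 0 < a -> 0 <= domc a b.
Proof.
move=> a0; rewrite mulr_ge0 ?powR_ge0// !addr_ge0 ?powR_ge0// divr_ge0 ?K1_ge0 ?K2_ge0 ?sqrtr_ge0//.
exact: ltW.
Qed.

Section dom.
Variables (a b : R).
Hypothesis a0 : 0 < a.

Lemma Gk2_dom c z : a <= c <= b -> Gk (2 * c) z <= (b / a) `^ (d%:R / 2) * Gk (2 * b) z.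
Proof.
move=> /andP[ac cb]; have c0 : 0 < c by exact: lt_le_trans ac.
apply: (le_trans (@Gk_mono R d (2 * c) (2 * b) z _ _)); rewrite ?mulr_gt0 ?ler_pM2l//.
rewrite ler_wpM2r ?(ltW (Gk_gt0 _ _))// ge0_ler_powR ?nnegrE ?divr_ge0//.
- by rewrite mulr_ge0// (le_trans (ltW c0)).
- by rewrite mulr_ge0// ltW.
- by rewrite (le_trans (ltW c0)).
- exact: ltW.
- rewrite invfM mulrACA divff ?mul1r//; apply: ler_pM; rewrite ?invr_ge0 ?(ltW c0)//.
    by rewrite (le_trans (ltW c0)).
  by rewrite lef_pV2.
Qed.

Lemma dom_aux c z (k : R) (h : R) (A : R) : a <= c <= b -> 0 <= A -> h <= A * Gk (2 * c) z ->
  A <= 2 `^ (d%:R / 2) + K1 R d / Num.sqrt a + K2 R d / a ->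
  h <= domc a b * Gk (2 * b) z.
Proof.
move=> acb A0 hA AB; apply: (le_trans hA).
apply: (le_trans (ler_wpM2l A0 (Gk2_dom z acb))).
rewrite mulrA ler_wpM2r ?(ltW (Gk_gt0 _ _))// mulrC /domc ler_wpM2l// powR_ge0//.
Qed.

Lemma Gk_dom c z : a <= c <= b -> `|Gk c z| <= domc a b * Gk (2 * b) z.
Proof.
move=> acb; have /andP[ac cb] := acb; have c0 : 0 < c by exact: lt_le_trans ac.
apply: (dom_aux 0 acb (powR_ge0 _ _) (A := 2 `^ (d%:R / 2))).
  by rewrite ger0_norm ?(ltW (Gk_gt0 _ _))//; exact: Gk_le2.
by rewrite -addrA lerDl addr_ge0// divr_ge0 ?K1_ge0 ?K2_ge0 ?sqrtr_ge0// ltW.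
Qed.

Lemma G1_dom i c z : a <= c <= b -> `|G1 i c z| <= domc a b * Gk (2 * b) z.
Proof.
move=> acb; have /andP[ac cb] := acb; have c0 : 0 < c by exact: lt_le_trans ac.
apply: (dom_aux 0 acb _ (G1_le i z c0)); first by rewrite divr_ge0 ?K1_ge0 ?sqrtr_ge0.
rewrite -addrA ler_wpDl ?powR_ge0// ler_wpDr ?divr_ge0 ?K2_ge0 ?(ltW a0)//.
by rewrite ler_wpM2l ?K1_ge0// lef_pV2 ?posrE ?sqrtr_gt0// ler_wsqrtr.
Qed.

Lemma G2_dom i j c z : a <= c <= b -> `|G2 i j c z| <= domc a b * Gk (2 * b) z.
Proof.
move=> acb; have /andP[ac cb] := acb; have c0 : 0 < c by exact: lt_le_trans ac.
apply: (dom_aux 0 acb _ (G2_le i j z c0)); first by rewrite divr_ge0 ?K2_ge0 ?(ltW c0).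
rewrite ler_wpDl ?addr_ge0 ?powR_ge0// ?divr_ge0 ?K1_ge0 ?sqrtr_ge0//.
by rewrite ler_wpM2l ?K2_ge0// lef_pV2.
Qed.

Lemma conv_dom (K : 'rV[R]_d -> R) f x : a <= b -> measurable_fun [set: 'rV[R]_d] K ->
  (forall z, `|K z| <= domc a b * Gk (2 * b) z) -> bint f ->
  `|conv K f x| <= domc a b * heat (2 * b) (fun y => `|f y|) x.
Proof.
move=> ab mK KA Xf; apply: conv_norm_le; last exact: bint_intg.
split=> //; last exact: domc_ge0.
by rewrite mulr_gt0// (lt_le_trans a0).
Qed.

Lemma heat_dom c f x : a <= c <= b -> bint f ->
  `|heat c f x| <= domc a b * heat (2 * b) (fun y => `|f y|) x.
Proof.
move=> acb Xf; apply: conv_dom => //; first by case/andP: acb; exact: le_trans.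
  exact: measurable_Gk.
by move=> z; exact: Gk_dom.
Qed.

Lemma dheat_dom i c f x : a <= c <= b -> bint f ->
  `|dheat i c f x| <= domc a b * heat (2 * b) (fun y => `|f y|) x.
Proof.
move=> acb Xf; apply: conv_dom => //; first by case/andP: acb; exact: le_trans.
  exact: measurable_G1.
by move=> z; exact: G1_dom.
Qed.

Lemma ddheat_dom i j c f x : a <= c <= b -> bint f ->
  `|ddheat i j c f x| <= domc a b * heat (2 * b) (fun y => `|f y|) x.
Proof.
move=> acb Xf; apply: conv_dom => //; first by case/andP: acb; exact: le_trans.
  exact: measurable_G2.
by move=> z; exact: G2_dom.
Qed.

End dom.

Lemma half_itv c r : c / 2 < r < 2 * c -> c / 2 <= r <= 2 * c.
Proof. by move=> /andP[? ?]; rewrite !ltW. Qed.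

Lemma in_half_itv c : 0 < c -> c / 2 < c < 2 * c.
Proof. by move=> c0; apply/andP; split; lra. Qed.

Lemma conv_time_continuous (K : R -> 'rV[R]_d -> R) c f x : 0 < c -> bint f ->
  (forall r, measurable_fun [set: 'rV[R]_d] (K r)) ->
  (forall r z, c / 2 <= r <= 2 * c ->
    `|K r z| <= domc (c / 2) (2 * c) * Gk (2 * (2 * c)) z) ->
  (forall r z, 0 < r -> {for r, continuous (K ^~ z)}) ->
  {for c, continuous (fun r => conv (K r) f x)}.
Proof.
move=> c0 Xf mK Kd cK; have c20 : 0 < c / 2 by lra.
apply: (@under_continuous _ _ R mu (c / 2) (2 * c)
  (fun r y => K r (x - y) * f y)
  (fun y => (domc (c / 2) (2 * c) * Gsup d (2 * (2 * c))) * `|f y|)).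
- move=> r _; apply: measurable_funM; last exact: bint_measurable.
  by apply: measurable_subx.
- move=> r y /andP[cr _]; apply: continuousM; last exact: cst_continuous.
  by apply: cK; lra.
- by apply: intgZ; apply: intg_norm; exact: bint_intg.
- move=> r y /half_itv rc; rewrite normrM ler_wpM2r// (le_trans (Kd _ _ rc))//.
  by rewrite ler_wpM2l ?domc_ge0// Gk_le_sup; lra.
- exact: in_half_itv.
Qed.

Lemma Gk_time_continuous c z : 0 < c -> {for c, continuous (fun r : R => Gk r z)}.
Proof. by move=> c0; exact: (der_continuous (is_derive_Gk_time z c0)). Qed.

Lemma heat_time_continuous c f x : 0 < c -> bint f ->
  {for c, continuous (fun r => heat r f x)}.
Proof.
move=> c0 Xf; apply: conv_time_continuous => //.
- by move=> r; exact: measurable_Gk.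
- by move=> r z; apply: Gk_dom; lra.
- by move=> r z; exact: Gk_time_continuous.
Qed.

Lemma dheat_time_continuous i c f x : 0 < c -> bint f ->
  {for c, continuous (fun r => dheat i r f x)}.
Proof.
move=> c0 Xf; apply: conv_time_continuous => //.
- by move=> r; exact: measurable_G1.
- by move=> r z; apply: G1_dom; lra.
- move=> r z r0.
  have r1 : 2 * r != 0 by rewrite mulf_neq0// gt_eqF.
  have dr := der_comp (der_inv r1) (derZ 2 (der_id r)).
  exact: (der_continuous (derM (derN (derM (derC _ _ (z ord0 i)) dr))
    (is_derive_Gk_time z r0))).
Qed.

Lemma ddheat_time_continuous i j c f x : 0 < c -> bint f ->
  {for c, continuous (fun r => ddheat i j r f x)}.
Proof.
move=> c0 Xf; apply: conv_time_continuous => //.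
- by move=> r; exact: measurable_G2.
- by move=> r z; apply: G2_dom; lra.
- move=> r z r0.
  have r1 : 2 * r != 0 by rewrite mulf_neq0// gt_eqF.
  have r2 : 4 * r ^+ 2 != 0 by rewrite mulf_neq0// expf_neq0// gt_eqF.
  have d1 := der_comp (der_inv r1) (derZ 2 (der_id r)).
  have d2' : is_derive r 1 (fun y : R => 4 * y ^+ 2) (4 * (2 * r * 1)).
    exact: (derZ 4 (der_sqr (der_id r))).
  have d2 := der_comp (f := fun y : R => 4 * y ^+ 2) (der_inv r2) d2'.
  exact: (der_continuous (derM (derB (derM (derC _ _ (z ord0 i * z ord0 j)) d2)
    (derM (derC _ _ (i == j)%:R) d1)) (is_derive_Gk_time z r0))).
Qed.

Lemma heat_time c f x : 0 < c -> bint f ->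
  is_derive c 1 (fun r => heat r f x) (\sum_(i < d) ddheat i i c f x).
Proof.
move=> c0 Xf; have c20 : 0 < c / 2 by lra.
have E : \sum_(i < d) ddheat i i c f x = \int[mu]_y ((\sum_(i < d) G2 i i c (x - y)) * f y).
  rewrite -Rint_sum; last by move=> i _; apply: (conv_intg (G2_gkernel i i c0)); exact: bint_intg.
  by apply: eq_Rint => y; rewrite mulr_suml.
rewrite E.
apply: (@under_is_derive _ _ R mu (c / 2) (2 * c) (fun r y => Gk r (x - y) * f y)
  (fun r y => (\sum_(i < d) G2 i i r (x - y)) * f y)
  (fun y => (d%:R * (domc (c / 2) (2 * c) * Gsup d (2 * (2 * c)))) * `|f y|)).
- move=> r /andP[cr _]; have r0 : 0 < r by lra.
  by apply: (conv_intg (Gk_gkernel d r0)); exact: bint_intg.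
- move=> r y /andP[cr _]; have r0 : 0 < r by lra.
  by apply: (is_deriveE (derM (is_derive_Gk_time (x - y) r0) (derC _ _ (f y)))) => //;
    rewrite mulr0 addr0.
- by apply: intgZ; apply: intg_norm; exact: bint_intg.
- move=> r y rc; have /half_itv rc' := rc; rewrite normrM ler_wpM2r//.
  apply: (le_trans (ler_norm_sum _ _ _)).
  rewrite mulr_natl -[X in _ *+ X]card_ord -sumr_const ler_sum// => i _.
  apply: (le_trans (G2_dom c20 _ _ _ rc')).
  by rewrite ler_wpM2l ?domc_ge0// Gk_le_sup; lra.
- exact: in_half_itv.
Qed.

Lemma heat_le_sup c f M x : 0 < c -> bint f -> (forall y, `|f y| <= M) ->
  `|heat c f x| <= M.
Proof.
move=> c0 Xf fM; rewrite -[leRHS]mul1r; apply: (conv_le_sup (Gk_gkernel d c0)) => //.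
exact: bint_intg.
Qed.

Lemma dheat_le_sup i c f M x : 0 < c -> bint f -> (forall y, `|f y| <= M) ->
  `|dheat i c f x| <= K1 R d / Num.sqrt c * M.
Proof.
by move=> c0 Xf fM; apply: (conv_le_sup (G1_gkernel i c0)) => //; exact: bint_intg.
Qed.

Lemma ddheat_le_sup i j c f M x : 0 < c -> bint f -> (forall y, `|f y| <= M) ->
  `|ddheat i j c f x| <= K2 R d / c * M.
Proof.
by move=> c0 Xf fM; apply: (conv_le_sup (G2_gkernel i j c0)) => //; exact: bint_intg.
Qed.

Lemma heat_L2 c f : 0 < c -> bint f ->
  \int[mu]_x heat c f x ^+ 2 <= \int[mu]_x f x ^+ 2.
Proof.
move=> c0 Xf; rewrite -[leRHS]mul1r -[X in X * _](expr1n _ 2).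
exact: (conv_L2 (Gk_gkernel d c0)).
Qed.

Lemma dheat_L2 i c f : 0 < c -> bint f ->
  \int[mu]_x dheat i c f x ^+ 2 <= K1 R d ^+ 2 / c * \int[mu]_x f x ^+ 2.
Proof.
move=> c0 Xf; apply: (le_trans (conv_L2 (G1_gkernel i c0) Xf)).
by rewrite expr_div_n sqr_sqrtr// ltW.
Qed.

Lemma heat_selfadj c f g : 0 < c -> bint f -> bint g ->
  \int[mu]_x (heat c f x * g x) = \int[mu]_x (f x * heat c g x).
Proof.
move=> c0 Xf Xg; have [M _ gM] := bint_bound Xg.
rewrite (eq_Rint _ (g := fun x => g x * heat c f x)); last by move=> x; rewrite mulrC.
rewrite (Rint_conv_mul (Gk_gkernel d c0) Xf (ex_intro _ M gM) (bint_measurable Xg)).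
have E y : \int[mu]_x (Gk c (x - y) * g x) = heat c g y.
  by apply: eq_Rint => x; rewrite -GkN opprB.
by apply: eq_Rint => y; exact: (congr1 (fun r => f y * r) (E y)).
Qed.

Lemma is_derive_reflect (K K' : 'rV[R]_d -> R) i x y :
  (forall z, is_derive z (evec i) K (K' z)) ->
  is_derive y (evec i) (fun y => K (x - y)) (- K' (x - y)).
Proof.
move=> dK.
have h : is_derive (- 0 : R) 1 (fun s : R => K ((x - y) + s *: evec i)) (K' (x - y)).
  have : is_derive (x - y + (- 0 : R) *: evec i) (evec i) K (K' (x - y)).
    by rewrite oppr0 scale0r addr0.
  exact: is_derive_line.
apply: is_derive_line0.
apply: (is_deriveE (der_comp h (derN (der_id 0)))); last by rewrite mulrN1.
by move=> s; rewrite scaleNr opprD addrA.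
Qed.

(** The derivative in [y] of [Gk c (x - y) * f y] has integral zero, which moves the derivative from
    [f] to the kernel. *)
Lemma heat_dcomm i c f f' : 0 < c -> bint f -> bint f' ->
  (forall x, is_derive x (evec i) f (f' x)) -> line_continuous i f' ->
  forall x, heat c f' x = dheat i c f x.
Proof.
move=> c0 Xf Xf' df cf' x; have hG := Gk_gkernel d c0.
have dG y := is_derive_reflect x y (fun z => is_derive_Gk i z c0).
have h := Rint_derive0 (fun y => derM (dG y) (df y)).
have i1 := conv_intg (G1_gkernel i c0) x (bint_intg Xf).
have i2 := conv_intg hG x (bint_intg Xf').
have e : 0 = \int[mu]_y (Gk c (x - y) * f' y - G1 i c (x - y) * f y).
  rewrite -[LHS]h.
  - by apply: eq_Rint => y; rewrite mulNr addrC.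
  - apply: line_continuousD; apply: line_continuousM.
    + have dG1 y := derN (is_derive_reflect x y (fun z => is_derive_G1 i i z c0)).
      exact: is_derive_line_continuous dG1.
    + exact: is_derive_line_continuous df.
    + exact: is_derive_line_continuous dG.
    + exact: cf'.
  - exact: (conv_intg hG x (bint_intg Xf)).
  - apply: intgD => //; under eq_fun do rewrite mulNr; exact: intgN.
by move: e; rewrite RintB// => /eqP; rewrite eq_sym subr_eq0 => /eqP.
Qed.

(** The l^1 distance is the one produced by changing one coordinate at a time, and it splits the
    first moment of the Gaussian into coordinates. *)
Definition lip (L : R) f := forall x y, `|f x - f y| <= L * \sum_(i < d) `|x ord0 i - y ord0 i|.

(** The first moment of the Gaussian is already available: [Gk c y] times |y_i| equals [2 * c] times
    the absolute value of [G1 i c y], so [G1_le] bounds its integral by a multiple of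
    [Num.sqrt c]. *)
Lemma heat_approx c f L x : 0 < c -> bint f -> 0 <= L -> lip L f ->
  `|heat c f x - f x| <= L * (d%:R * (2 * K1 R d)) * Num.sqrt c.
Proof.
move=> c0 Xf L0 lf; have hG := Gk_gkernel d c0.
have KL i y := G1_le i y c0.
move: (K1 R d) KL => k1 KL.
have sc : 0 < Num.sqrt c by rewrite sqrtr_gt0.
have i1 := intg_rV_reflect x (conv_intg hG x (bint_intg Xf)).
have {}i1 : intg mu (fun y => Gk c y * f (x - y)).
  by move: i1; apply: eq_intg => y; rewrite opprB addrCA subrr addr0.
have iG := intg_Gk d c0.
have iG2 : intg mu (@Gk R d (2 * c)) by apply: intg_Gk; rewrite mulr_gt0.
rewrite [heat _ _ _](conv_swap hG); last exact: bint_intg.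
have -> : f x = \int[mu]_y (f x * Gk c y) by rewrite RintZ// Rint_Gk// mulr1.
rewrite -RintB//; last exact: intgZ.
have -> : L * (d%:R * (2 * k1)) * Num.sqrt c =
    \int[mu]_y (L * (d%:R * (2 * k1)) * Num.sqrt c * Gk (2 * c) y).
  by rewrite RintZ// Rint_Gk ?mulr1// mulr_gt0.
apply: Rint_norm_le; [by apply: intgB => //; exact: intgZ|exact: intgZ|].
move=> y; rewrite [f x * _]mulrC -mulrBr normrM ger0_norm ?(ltW (Gk_gt0 _ _))//.
apply: (le_trans (ler_wpM2l (ltW (Gk_gt0 _ _)) (lf _ _))).
rewrite mulrCA -!mulrA ler_wpM2l// mulr_sumr.
rewrite [leRHS]mulr_natl -[X in _ *+ X]card_ord -sumr_const ler_sum// => i _.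
have -> : (x - y) ord0 i - x ord0 i = - y ord0 i by rewrite !mxE; ring.
rewrite normrN; have h := KL i y.
have -> : Gk c y * `|y ord0 i| = 2 * c * `|G1 i c y|.
  rewrite /G1 normrM normrN normrM normfV (ger0_norm (ltW (Gk_gt0 _ _))).
  by rewrite (ger0_norm (_ : 0 <= 2 * c)) ?mulr_ge0 ?(ltW c0)//; field; rewrite gt_eqF.
apply: (@le_trans _ _ (2 * c * (k1 / Num.sqrt c * Gk (2 * c) y))).
  by rewrite ler_wpM2l// mulr_ge0// ltW.
apply: eq_ler; rewrite -{1}(sqr_sqrtr (ltW c0)).
by field; rewrite gt_eqF.
Qed.

End semigroup.

#[global] Opaque conv heat dheat ddheat.

Section itv_integral.
Context (R : realType) (a b : R).
Local Notation leb := (@lebesgue_measure R).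
Implicit Types F G : R -> R.

Lemma Rint_itv_intgD F G : leb.-integrable `[a, b] (EFin \o F) ->
  leb.-integrable `[a, b] (EFin \o G) ->
  leb.-integrable `[a, b] (EFin \o (fun c => F c + G c)).
Proof.
move=> iF iG; rewrite (_ : _ \o _ = (EFin \o F) \+ (EFin \o G))%E//.
exact: integrableD.
Qed.

Lemma Rint_itv_intgZ (k : R) F : leb.-integrable `[a, b] (EFin \o F) ->
  leb.-integrable `[a, b] (EFin \o (fun c => k * F c)).
Proof.
move=> iF; rewrite (_ : _ \o _ = (fun c => k%:E * (EFin \o F) c))%E//.
exact: integrableZl.
Qed.

Lemma Rint_itv_intg_sum n (F : 'I_n -> R -> R) :
  (forall i, leb.-integrable `[a, b] (EFin \o F i)) ->
  leb.-integrable `[a, b] (EFin \o (fun c => \sum_(i < n) F i c)).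
Proof.
elim: n F => [|n ih] F iF.
  rewrite (_ : _ \o _ = cst 0%E); first exact: integrable0.
  by apply/funext => c /=; rewrite big_ord0.
rewrite (_ : _ \o _ = EFin \o (fun c => F ord0 c + \sum_(i < n) F (lift ord0 i) c)).
  by apply: Rint_itv_intgD => //; exact: (ih (fun i => F (lift ord0 i))).
by apply/funext => c /=; rewrite big_ord_recl.
Qed.

Lemma Rint_itvD F G : leb.-integrable `[a, b] (EFin \o F) ->
  leb.-integrable `[a, b] (EFin \o G) ->
  \int[leb]_(c in `[a, b]) (F c + G c) =
  \int[leb]_(c in `[a, b]) F c + \int[leb]_(c in `[a, b]) G c.
Proof. by move=> iF iG; exact: RintegralD. Qed.

Lemma Rint_itvZ (k : R) F : leb.-integrable `[a, b] (EFin \o F) ->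
  \int[leb]_(c in `[a, b]) (k * F c) = k * \int[leb]_(c in `[a, b]) F c.
Proof. by move=> iF; exact: RintegralZl. Qed.

Lemma Rint_itv_le F G : leb.-integrable `[a, b] (EFin \o F) ->
  leb.-integrable `[a, b] (EFin \o G) -> (forall c, a <= c <= b -> F c <= G c) ->
  \int[leb]_(c in `[a, b]) F c <= \int[leb]_(c in `[a, b]) G c.
Proof.
by move=> iF iG FG; apply: le_Rintegral => // c; rewrite /= in_itv/=; exact: FG.
Qed.

End itv_integral.

(** * Energy and Carleson estimates *)

Section energy.
Context (R : realType) (d : nat).
Local Notation mu := (lebesgue_rV R d).
Local Notation leb := (@lebesgue_measure R).
Implicit Types (c : R) (x y z : 'rV[R]_d) (i j : 'I_d) (f g : 'rV[R]_d -> R).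

(* One-parameter families, c > 0, that may be differentiated and integrated in c
   under the space integral. *)
Definition tame (h : R -> 'rV[R]_d -> R) := [/\
  forall c, 0 < c -> bint (h c),
  forall c x, 0 < c -> {for c, continuous (fun r => h r x)} &
  forall u v, 0 < u -> u <= v -> exists2 H, bint H &
    forall c x, u <= c <= v -> `|h c x| <= H x].

Lemma tame_bint h c : tame h -> 0 < c -> bint (h c).
Proof. by case=> + _ _; apply. Qed.

Lemma tameM h k : tame h -> tame k -> tame (fun c x => h c x * k c x).
Proof.
move=> [h1 h2 h3] [k1 k2 k3]; split.
- by move=> c c0; apply: bintM; [exact: h1|exact: k1].
- by move=> c x c0; apply: continuousM; [exact: h2|exact: k2].
- move=> u v u0 uv; have [H XH hH] := h3 _ _ u0 uv; have [K XK kK] := k3 _ _ u0 uv.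
  exists (fun x => H x * K x); first exact: bintM.
  by move=> c x cuv; rewrite normrM ler_pM// ?hH ?kK.
Qed.

Lemma tameD h k : tame h -> tame k -> tame (fun c x => h c x + k c x).
Proof.
move=> [h1 h2 h3] [k1 k2 k3]; split.
- by move=> c c0; apply: bintD; [exact: h1|exact: k1].
- by move=> c x c0; apply: continuousD; [exact: h2|exact: k2].
- move=> u v u0 uv; have [H XH hH] := h3 _ _ u0 uv; have [K XK kK] := k3 _ _ u0 uv.
  exists (fun x => H x + K x); first exact: bintD.
  by move=> c x cuv; rewrite (le_trans (ler_normD _ _))// lerD// ?hH ?kK.
Qed.

Lemma tameZ (r : R) h : tame h -> tame (fun c x => r * h c x).
Proof.
move=> [h1 h2 h3]; split.
- by move=> c c0; apply: bintZ; exact: h1.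
- by move=> c x c0; apply: continuousM; [exact: cst_continuous|exact: h2].
- move=> u v u0 uv; have [H XH hH] := h3 _ _ u0 uv.
  exists (fun x => `|r| * H x); first exact: bintZ.
  by move=> c x cuv; rewrite normrM ler_wpM2l// hH.
Qed.

Lemma tame_cst f : bint f -> tame (fun=> f).
Proof.
move=> Xf; split=> // [c x _|u v _ _]; first exact: cst_continuous.
by exists (fun x => `|f x|) => //; exact: bint_norm.
Qed.

Lemma tame_sum (n : nat) (h : 'I_n -> R -> 'rV[R]_d -> R) : (forall k, tame (h k)) ->
  tame (fun c x => \sum_(k < n) h k c x).
Proof.
elim: n h => [|n ih] h th.
  have := tame_cst (@bint0 R d); congr tame; apply/funext => c; apply/funext => x.
  by rewrite big_ord0.
have := tameD (th ord0) (ih (fun k => h (lift ord0 k)) (fun k => th _)).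
by congr tame; apply/funext => c; apply/funext => x; rewrite big_ord_recl.
Qed.

Lemma tame_heat f : bint f -> tame (fun c => heat c f).
Proof.
move=> Xf; split.
- by move=> c c0; exact: bint_heat.
- by move=> c x c0; exact: heat_time_continuous.
- move=> u v u0 uv; have v0 : 0 < 2 * v by rewrite mulr_gt0// (lt_le_trans u0).
  exists (fun x => domc d u v * heat (2 * v) (fun y => `|f y|) x).
    by apply: bintZ; apply: bint_heat => //; exact: bint_norm.
  by move=> c x cuv; exact: heat_dom.
Qed.

Lemma tame_dheat i f : bint f -> tame (fun c => dheat i c f).
Proof.
move=> Xf; split.
- by move=> c c0; exact: bint_dheat.
- by move=> c x c0; exact: dheat_time_continuous.
- move=> u v u0 uv; have v0 : 0 < 2 * v by rewrite mulr_gt0// (lt_le_trans u0).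
  exists (fun x => domc d u v * heat (2 * v) (fun y => `|f y|) x).
    by apply: bintZ; apply: bint_heat => //; exact: bint_norm.
  by move=> c x cuv; exact: dheat_dom.
Qed.

Lemma tame_ddheat i j f : bint f -> tame (fun c => ddheat i j c f).
Proof.
move=> Xf; split.
- by move=> c c0; exact: bint_ddheat.
- by move=> c x c0; exact: ddheat_time_continuous.
- move=> u v u0 uv; have v0 : 0 < 2 * v by rewrite mulr_gt0// (lt_le_trans u0).
  exists (fun x => domc d u v * heat (2 * v) (fun y => `|f y|) x).
    by apply: bintZ; apply: bint_heat => //; exact: bint_norm.
  by move=> c x cuv; exact: ddheat_dom.
Qed.

Lemma tame_continuous h c : tame h -> 0 < c ->
  {for c, continuous (fun r => \int[mu]_x h r x)}.
Proof.
move=> [h1 h2 h3] c0; have c20 : 0 < c / 2 by lra.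
have [H XH hH] := h3 (c / 2) (2 * c) c20 ltac:(lra).
apply: (@under_continuous _ _ R mu (c / 2) (2 * c) h H).
- by move=> r /andP[cr _]; apply: bint_measurable; apply: h1; lra.
- by move=> r x /andP[cr _]; apply: h2; lra.
- exact: bint_intg.
- by move=> r x /half_itv; exact: hH.
- exact: in_half_itv.
Qed.

Lemma tame_derive h h' c : tame h -> tame h' ->
  (forall (r : R) x, 0 < r -> is_derive r 1 (fun s => h s x) (h' r x)) -> 0 < c ->
  is_derive c 1 (fun r => \int[mu]_x h r x) (\int[mu]_x h' c x).
Proof.
move=> [h1 _ _] [k1 k2 k3] dh c0; have c20 : 0 < c / 2 by lra.
have [H XH hH] := k3 (c / 2) (2 * c) c20 ltac:(lra).
apply: (@under_is_derive _ _ R mu (c / 2) (2 * c) h h' H).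
- by move=> r /andP[cr _]; apply: bint_intg; apply: h1; lra.
- by move=> r x /andP[cr _]; apply: dh; lra.
- exact: bint_intg.
- by move=> r x /half_itv; exact: hH.
- exact: in_half_itv.
Qed.

Lemma tame_FTC h h' (a b : R) : tame h -> tame h' ->
  (forall (r : R) x, 0 < r -> is_derive r 1 (fun s => h s x) (h' r x)) -> 0 < a -> a <= b ->
  \int[leb]_(c in `[a, b]) (\int[mu]_x h' c x) = \int[mu]_x h b x - \int[mu]_x h a x.
Proof.
move=> th th' dh a0 ab.
apply: (@FTC_Rint R (fun c => \int[mu]_x h c x)) => // c /andP[ac cb].
- by apply: tame_derive => //; exact: lt_le_trans ac.
- by apply: tame_continuous => //; exact: lt_le_trans ac.
Qed.

Lemma tame_intg_itv h (a b : R) : tame h -> 0 < a ->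
  leb.-integrable `[a, b] (EFin \o (fun c => \int[mu]_x h c x)).
Proof.
move=> th a0; apply: continuous_compact_integrable; first exact: segment_compact.
apply: continuous_in_subspaceT => c; rewrite inE/= in_itv/= => /andP[ac cb].
by apply: tame_continuous => //; exact: lt_le_trans ac.
Qed.

Lemma Rint_ibp i (F F' G G' : 'rV[R]_d -> R) :
  (forall x, is_derive x (evec i) F (F' x)) ->
  (forall x, is_derive x (evec i) G (G' x)) ->
  line_continuous i F' -> line_continuous i G' ->
  bint F -> bint G -> bint F' -> bint G' ->
  \int[mu]_x (F x * G' x) = - \int[mu]_x (F' x * G x).
Proof.
move=> dF dG cF' cG' XF XG XF' XG'.
have h := Rint_derive0 (fun x => derM (dF x) (dG x)).
have e : 0 = \int[mu]_x (F' x * G x) + \int[mu]_x (F x * G' x).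
  rewrite -RintD; [|exact: bint_mul_intg|exact: bint_mul_intg].
  apply/esym/h.
  - by apply: line_continuousD; apply: line_continuousM => //;
      [exact: is_derive_line_continuous dG|exact: is_derive_line_continuous dF].
  - exact: bint_mul_intg.
  - by apply: intgD; exact: bint_mul_intg.
by apply/eqP; rewrite -addr_eq0 addrC -e.
Qed.

Lemma heat_ibp i c f h h' : 0 < c -> bint f ->
  (forall x, is_derive x (evec i) h (h' x)) -> line_continuous i h' ->
  bint h -> bint h' ->
  \int[mu]_x (h x * ddheat i i c f x) = - \int[mu]_x (h' x * dheat i c f x).
Proof.
move=> c0 Xf dh ch' Xh Xh'; apply: (Rint_ibp dh) => //.
- by move=> x; exact: dheat_derive.
- exact: ddheat_lc.
- exact: bint_dheat.
- exact: bint_ddheat.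
Qed.

Definition grad2 c f : R := \sum_(i < d) \int[mu]_x dheat i c f x ^+ 2.

Lemma tame_sqr h : tame h -> tame (fun c x => h c x ^+ 2).
Proof. by move=> th; under eq_fun do under eq_fun do rewrite expr2; exact: tameM. Qed.

(** The heat equation and one integration by parts give d/dc |P_c f|_2^2 = - 2 |grad P_c f|_2^2,
    which is then integrated over [[a, b]]. *)
Lemma heat_energy f (a b : R) : bint f -> 0 < a -> a <= b ->
  \int[leb]_(c in `[a, b]) (2 * grad2 c f) =
  \int[mu]_x heat a f x ^+ 2 - \int[mu]_x heat b f x ^+ 2.
Proof.
move=> Xf a0 ab.
pose h' c x := 2 * heat c f x * \sum_(i < d) ddheat i i c f x.
have th' : tame h'.
  apply: tameM; first by apply: tameZ; exact: tame_heat.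
  by apply: tame_sum => i; exact: tame_ddheat.
have := tame_FTC (tame_sqr (tame_heat Xf)) th'
  (fun r x r0 => der_sqr (heat_time x r0 Xf)) a0 ab.
move=> e; rewrite -[RHS]opprB -e.
transitivity (\int[leb]_(c in `[a, b]) (- \int[mu]_x h' c x)).
  apply: eq_Rintegral => c; rewrite inE/= in_itv/= => /andP[ac _].
  have c0 : 0 < c by exact: lt_le_trans ac.
  have E x : h' c x = \sum_(i < d) 2 * (heat c f x * ddheat i i c f x).
    by rewrite /h' mulr_sumr; apply: eq_bigr => i _; rewrite mulrA.
  have ii i : intg mu (fun x => heat c f x * ddheat i i c f x).
    by apply: bint_mul_intg; [exact: bint_heat|exact: bint_ddheat].
  rewrite (eq_Rint _ E) Rint_sum; last by move=> i _; exact: intgZ.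
  rewrite -sumrN /grad2 mulr_sumr; apply: eq_bigr => i _.
  rewrite RintZ// (heat_ibp c0 Xf (fun x => heat_derive i x c0 Xf)).
  - by rewrite mulrN opprK.
  - exact: dheat_lc.
  - exact: bint_heat.
  - exact: bint_dheat.
rewrite -mulN1r -RintegralZl//; last exact: tame_intg_itv.
by apply: eq_Rintegral => c _; rewrite mulN1r.
Qed.

Lemma heat_energy_le f (a b : R) : bint f -> 0 < a -> a <= b ->
  \int[leb]_(c in `[a, b]) (2 * grad2 c f) <= \int[mu]_x f x ^+ 2.
Proof.
move=> Xf a0 ab; rewrite heat_energy// (le_trans _ (heat_L2 a0 Xf))// lerBlDr lerDl.
by apply: Rint_ge0 => x; exact: sqr_ge0.
Qed.

(** The derivative in [c] of [heat c f x ^+ 2 * heat c g x ^+ 2]. *)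
Definition carleson_der c f g x : R :=
  (2 * heat c f x * \sum_(i < d) ddheat i i c f x) * heat c g x ^+ 2 +
  heat c f x ^+ 2 * (2 * heat c g x * \sum_(i < d) ddheat i i c g x).

Lemma carleson_key c f g (M : R) : 0 < c -> bint f -> bint g ->
  (forall x, `|f x| <= M) ->
  \int[mu]_x carleson_der c f g x <=
  - (\sum_(i < d) \int[mu]_x (heat c g x * dheat i c f x) ^+ 2) +
  14 * M ^+ 2 * grad2 c g.
Proof.
move=> c0 Xf Xg fM.
have M0 : 0 <= M by exact: le_trans (fM 0).
pose V c x := heat c f x; pose S c x := heat c g x.
have XV : bint (V c) by exact: bint_heat.
have XS : bint (S c) by exact: bint_heat.
have XdV i : bint (dheat i c f) by exact: bint_dheat.
have XdS i : bint (dheat i c g) by exact: bint_dheat.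
have XddV i : bint (ddheat i i c f) by exact: bint_ddheat.
have XddS i : bint (ddheat i i c g) by exact: bint_ddheat.
have sq (k : 'rV[R]_d -> R) : bint k -> bint (fun x => k x ^+ 2).
  by move=> Xk; under eq_fun do rewrite expr2; exact: bintM.
pose H1 x := V c x * S c x ^+ 2; pose H2 x := V c x ^+ 2 * S c x.
have XH1 : bint H1 by apply: bintM => //; exact: sq.
have XH2 : bint H2 by apply: bintM => //; exact: sq.
pose H1' i x := dheat i c f x * S c x ^+ 2 + V c x * (2 * S c x * dheat i c g x).
pose H2' i x := (2 * V c x * dheat i c f x) * S c x + V c x ^+ 2 * dheat i c g x.
have XH1' i : bint (H1' i).
  apply: bintD; apply: bintM => //; [exact: sq|apply: bintM => //; exact: bintZ].
have XH2' i : bint (H2' i).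
  apply: bintD; apply: bintM => //; [by apply: bintM => //; exact: bintZ|exact: sq].
have lV i : line_continuous i (V c) by exact: heat_lc.
have lS i : line_continuous i (S c) by exact: heat_lc.
have ldV i : line_continuous i (dheat i c f) by exact: dheat_lc.
have ldS i : line_continuous i (dheat i c g) by exact: dheat_lc.
have lsq i (k : 'rV[R]_d -> R) : line_continuous i k -> line_continuous i (fun x => k x ^+ 2).
  by move=> lk; under eq_fun do rewrite expr2; exact: line_continuousM.
have lZ i (r : R) (k : 'rV[R]_d -> R) : line_continuous i k -> line_continuous i (fun x => r * k x).
  by move=> lk; apply: line_continuousM => // x s; exact: cst_continuous.
have lH1' i : line_continuous i (H1' i).
  apply: line_continuousD; apply: line_continuousM => //; first exact: lsq.
  by apply: line_continuousM => //; exact: lZ.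
have lH2' i : line_continuous i (H2' i).
  apply: line_continuousD; apply: line_continuousM => //; last exact: lsq.
  by apply: line_continuousM => //; exact: lZ.
have dH1 i x : is_derive x (evec i) H1 (H1' i x).
  exact: (derM (heat_derive i x c0 Xf) (der_sqr (heat_derive i x c0 Xg))).
have dH2 i x : is_derive x (evec i) H2 (H2' i x).
  exact: (derM (der_sqr (heat_derive i x c0 Xf)) (heat_derive i x c0 Xg)).
have E x : carleson_der c f g x = \sum_(i < d) (2 * (H1 x * ddheat i i c f x) + 2 * (H2 x * ddheat i i c g x)).
  rewrite /carleson_der big_split/= -!mulr_sumr; congr (_ + _).
    by rewrite /H1 /V /S; ring.
  by rewrite /H2 /V /S; ring.
rewrite (eq_Rint _ E) Rint_sum; last first.
  by move=> i _; apply: intgD; apply: intgZ; exact: bint_mul_intg.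
rewrite /grad2 mulr_sumr -sumrN -big_split/=; apply: ler_sum => i _.
rewrite RintD; try by apply: intgZ; exact: bint_mul_intg.
rewrite !RintZ; try exact: bint_mul_intg.
rewrite (heat_ibp c0 Xf (dH1 i) (lH1' i) XH1 (XH1' i)).
rewrite (heat_ibp c0 Xg (dH2 i) (lH2' i) XH2 (XH2' i)).
have iA : intg mu (fun x => H1' i x * dheat i c f x) by exact: bint_mul_intg.
have iB : intg mu (fun x => H2' i x * dheat i c g x) by exact: bint_mul_intg.
have iC : intg mu (fun x => (S c x * dheat i c f x) ^+ 2).
  by apply: bint_intg; apply: sq; exact: bintM.
have iD : intg mu (fun x => dheat i c g x ^+ 2) by exact/bint_intg/sq.
suff : \int[mu]_x (S c x * dheat i c f x) ^+ 2 <=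
    14 * M ^+ 2 * \int[mu]_x dheat i c g x ^+ 2 +
    (2 * \int[mu]_x (H1' i x * dheat i c f x) + 2 * \int[mu]_x (H2' i x * dheat i c g x)).
  by rewrite /S => ?; lra.
rewrite -(RintZ 2 iA) -(RintZ 2 iB) -(RintZ (14 * M ^+ 2) iD).
rewrite -(RintD (intgZ 2 iA) (intgZ 2 iB)).
rewrite -(RintD (intgZ (14 * M ^+ 2) iD) (intgD (intgZ 2 iA) (intgZ 2 iB))).
apply: (Rint_le iC (intgD (intgZ (14 * M ^+ 2) iD) (intgD (intgZ 2 iA) (intgZ 2 iB)))).
move=> x; rewrite /H1' /H2'.
have vM : V c x ^+ 2 <= M ^+ 2.
  by rewrite -[V c x ^+ 2]real_normK ?num_real// ler_sqr ?nnegrE//; exact: heat_le_sup.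
set v := V c x in vM *; set s := S c x; set p := dheat i c f x; set q := dheat i c g x.
(* Completing the square absorbs the cross term [8 v s p q] at the price of [16 v^2 q^2]. Of these,
   [2 v^2 q^2] are already present; the remaining 14 give the constant. *)
have h1 : 0 <= (s * p + 4 * v * q) ^+ 2 by exact: sqr_ge0.
have h2 : v ^+ 2 * q ^+ 2 <= M ^+ 2 * q ^+ 2 by rewrite ler_wpM2r ?sqr_ge0.
by nra.
Qed.

(* int |theta_c|^2 |sigma_c|^2 is differentiated in c; the cross term is absorbed
   using |theta_c| <= M and the energy identity for sigma. *)
Lemma carleson_le f g (M a b : R) : bint f -> bint g -> (forall x, `|f x| <= M) ->
  0 < a -> a <= b ->
  \int[leb]_(c in `[a, b]) (\sum_(i < d) \int[mu]_x (heat c g x * dheat i c f x) ^+ 2)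
  <= 8 * M ^+ 2 * \int[mu]_x g x ^+ 2.
Proof.
move=> Xf Xg fM a0 ab.
have A1 (p r s t : R) : p <= - r + 14 * t * s -> r + p <= 7 * t * (2 * s) by lra.
have A2 (p m r GG II q : R) : 0 <= p -> 0 <= m -> r <= m * q -> GG <= q ->
    II + (p - r) <= 7 * m * GG -> II <= 8 * m * q.
  by move=> p0 m0 r0 h2 h3; have := ler_wpM2l m0 h2; lra.
pose V c x := heat c f x; pose S c x := heat c g x.
pose h c x := V c x ^+ 2 * S c x ^+ 2.
pose h' c x := (2 * V c x * \sum_(i < d) ddheat i i c f x) * S c x ^+ 2 +
  V c x ^+ 2 * (2 * S c x * \sum_(i < d) ddheat i i c g x).
have tV := tame_heat Xf; have tS := tame_heat Xg.
have tdV i := tame_dheat i Xf; have tdS i := tame_dheat i Xg.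
have th : tame h by apply: tameM; exact: tame_sqr.
have th' : tame h'.
  apply: tameD; apply: tameM; try exact: tame_sqr.
    apply: tameM; first exact: tameZ.
    by apply: tame_sum => i; exact: tame_ddheat.
  apply: tameM; first exact: tameZ.
  by apply: tame_sum => i; exact: tame_ddheat.
have e := tame_FTC th th' (fun r x r0 => derM (der_sqr (heat_time x r0 Xf))
  (der_sqr (heat_time x r0 Xg))) a0 ab.
pose I1 c := \sum_(i < d) \int[mu]_x (S c x * dheat i c f x) ^+ 2.
have M0 : 0 <= M by exact: le_trans (fM 0).
have key c : 0 < c -> I1 c + \int[mu]_x h' c x <= 7 * M ^+ 2 * (2 * grad2 c g).
  by move=> c0; apply: A1; exact: carleson_key.
have iI0 : leb.-integrable `[a, b] (EFin \o I1).
  apply: Rint_itv_intg_sum => i.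
  exact: (tame_intg_itv b (tame_sqr (tameM tS (tdV i))) a0).
have iG0 : leb.-integrable `[a, b] (EFin \o (fun c => 2 * grad2 c g)).
  apply: Rint_itv_intgZ; apply: Rint_itv_intg_sum => i.
  exact: (tame_intg_itv b (tame_sqr (tdS i)) a0).
have ih : leb.-integrable `[a, b] (EFin \o (fun c => \int[mu]_x h' c x)) by exact: tame_intg_itv.
have : \int[leb]_(c in `[a, b]) I1 c + \int[leb]_(c in `[a, b]) (\int[mu]_x h' c x) <=
   (7 * M ^+ 2) * \int[leb]_(c in `[a, b]) (2 * grad2 c g).
  rewrite -(Rint_itvD iI0 ih) -(Rint_itvZ _ iG0).
  apply: (Rint_itv_le (Rint_itv_intgD iI0 ih) (Rint_itv_intgZ _ iG0)) => c /andP[ac _].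
  exact: key c (lt_le_trans a0 ac).
rewrite e; clear e ih.
have hE := heat_energy_le Xg a0 ab.
have hb : 0 <= \int[mu]_x h b x by apply: Rint_ge0 => x; rewrite mulr_ge0 ?sqr_ge0.
have ha : \int[mu]_x h a x <= M ^+ 2 * \int[mu]_x g x ^+ 2.
  apply: (@le_trans _ _ (\int[mu]_x (M ^+ 2 * S a x ^+ 2))).
    apply: Rint_le; [by apply: bint_intg; exact: (tame_bint th)|apply: intgZ|].
      by apply: bint_sqr; exact: bint_heat.
    move=> x; rewrite ler_wpM2r ?sqr_ge0//.
    by rewrite -[V a x ^+ 2]real_normK ?num_real// ler_sqr ?nnegrE//; exact: heat_le_sup.
  rewrite RintZ; last by apply: bint_sqr; exact: bint_heat.
  by rewrite ler_wpM2l ?sqr_ge0//; exact: heat_L2.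
have M2 : 0 <= M ^+ 2 by exact: sqr_ge0.
(* The constant is 8 = 7 + 1: the gradient of [g] costs 14/2 by the energy identity, the value at
   [a] costs one more, and the value at [b] has the favourable sign. *)
exact: A2 hb M2 ha hE.
Qed.

End energy.

(** * The semigroup law *)

Section semigroup.
Context (R : realType) (d : nat).
Local Notation mu := (lebesgue_rV R d).
Implicit Types (a b c : R) (x y : 'rV[R]_d) (i j : 'I_d) (f : 'rV[R]_d -> R).

Transparent Gk.

(** Completing the square in [y]: the product is a Gaussian in [x] times a normalised Gaussian in
    [y] with shifted centre, which integrates to one. *)
Lemma Gk_mul a b x y : 0 < a -> 0 < b ->
  Gk a (x - y) * Gk b y =
  Gk (a + b) x * Gk (a * b / (a + b)) (y + (- (b / (a + b))) *: x).
Proof.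
move=> a0 b0; have ab0 : 0 < a + b by rewrite addr_gt0.
rewrite /Gk -!expRD; congr expR.
rewrite !lnM ?posrE ?mulr_gt0 ?pi_gt0 ?invr_gt0// lnV ?posrE//.
have -> : dotp (x - y) (x - y) = dotp x x - 2 * dotp x y + dotp y y.
  by rewrite -(scaleN1r y) !(dotpDl, dotpDr, dotpZl, dotpZr) (dotpC y x); ring.
rewrite !(dotpDl, dotpDr, dotpZl, dotpZr) (dotpC y x).
by field; rewrite !gt_eqF.
Qed.

Opaque Gk.

Lemma Rint_Gk_mul a b x : 0 < a -> 0 < b ->
  \int[mu]_y (Gk a (x - y) * Gk b y) = Gk (a + b) x.
Proof.
move=> a0 b0; have c0 : 0 < a * b / (a + b) by rewrite divr_gt0 ?mulr_gt0 ?addr_gt0.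
rewrite (eq_Rint _ (fun y => Gk_mul x y a0 b0)) RintZ.
  by rewrite Rint_rV_shift ?Rint_Gk ?mulr1//; exact: intg_Gk.
by apply: intg_rV_shift; exact: intg_Gk.
Qed.

Lemma heat_semigroup a b f x : 0 < a -> 0 < b -> bint f ->
  heat a (heat b f) x = heat (a + b) f x.
Proof.
move=> a0 b0 Xf.
have mG : measurable_fun [set: 'rV[R]_d] (fun y => Gk a (x - y)).
  exact: (gkernel_sub (Gk_gkernel d a0)).
have bG : exists M : R, forall y, `|Gk a (x - y)| <= M.
  by exists (1 * Gsup d a) => y; exact: (gkernel_bound (Gk_gkernel d a0)).
have := Rint_conv_mul (Gk_gkernel d b0) Xf bG mG.
rewrite -[LHS]/(heat a (heat b f) x) => ->.
apply: eq_Rint => z; rewrite mulrC; congr (_ * _).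
rewrite -(Rint_Gk_mul (x - z) a0 b0).
pose F y := Gk a (x - z - y) * Gk b y.
have iF : intg mu F.
  apply: (intg_bounded_mul (M := 1 * Gsup d a)).
  - exact: (gkernel_sub (Gk_gkernel d a0)).
  - by move=> y; exact: (gkernel_bound (Gk_gkernel d a0)).
  - exact: intg_Gk.
rewrite -[RHS](Rint_rV_shift (- z) iF).
apply: eq_Rint => y; rewrite /F mulrC; congr (Gk a _ * _).
by rewrite opprB addrA addrNK.
Qed.

Lemma is_derive_unique (V : normedModType R) (f g : V -> R) (x v : V) (l l' : R) :
  f =1 g -> is_derive x v f l -> is_derive x v g l' -> l = l'.
Proof. by move=> /funext <- [_ <-] [_ <-]. Qed.

(** Both sides are derivatives of the two expressions of the semigroup law, so uniqueness of the
    derivative identifies them. *)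
Lemma dheat_half i c f x : 0 < c -> bint f ->
  dheat i (c + c) f x = heat c (dheat i c f) x.
Proof.
move=> c0 Xf; have -> : heat c (dheat i c f) x = dheat i c (heat c f) x.
  apply: heat_dcomm => //; [exact: bint_heat|exact: bint_dheat| |exact: dheat_lc].
  by move=> y; exact: heat_derive.
apply: (is_derive_unique (fun y => esym (heat_semigroup y c0 c0 Xf))).
- by apply: heat_derive => //; rewrite addr_gt0.
- by apply: heat_derive => //; exact: bint_heat.
Qed.

Lemma ddheat_half i j c f x : 0 < c -> bint f ->
  ddheat i j (c + c) f x = dheat j c (dheat i c f) x.
Proof.
move=> c0 Xf; apply: (is_derive_unique (fun y => dheat_half i y c0 Xf)).
- by apply: dheat_derive => //; rewrite addr_gt0.
- by apply: heat_derive => //; exact: bint_dheat.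
Qed.

(** Half of the time is spent on one derivative, so that the other half leaves a first derivative,
    the only quantity that the energy identity controls. *)
Lemma ddheat_L2 i j c f : 0 < c -> bint f ->
  \int[mu]_x ddheat i j c f x ^+ 2 <=
  2 * K1 R d ^+ 2 / c * \int[mu]_x dheat i (c / 2) f x ^+ 2.
Proof.
move=> c0 Xf; have c20 : 0 < c / 2 by rewrite divr_gt0.
have e : c = c / 2 + c / 2 by rewrite -splitr.
rewrite {1}e (eq_Rint _ (fun x => congr1 (fun u => u ^+ 2) (ddheat_half i j x c20 Xf))).
apply: (le_trans (dheat_L2 j c20 (bint_dheat i c20 Xf))).
by rewrite invf_div mulrCA mulrA.
Qed.

End semigroup.

Section calculus.
Context (R : realType).
Local Notation leb := (@lebesgue_measure R).

Lemma der_diff_le (F G : R -> R) (F' G' : R -> R) (a b : R) : a <= b ->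
  (forall x, a <= x <= b -> is_derive x 1 F (F' x)) ->
  (forall x, a <= x <= b -> is_derive x 1 G (G' x)) ->
  (forall x, a <= x <= b -> F' x <= G' x) -> F b - F a <= G b - G a.
Proof.
move=> ab dF dG FG.
have dH x : a <= x <= b -> is_derive x 1 (fun y => G y - F y) (G' x - F' x).
  by move=> xab; apply: derB; [exact: dG|exact: dF].
have [x xab] : exists2 x, x \in `[a, b] &
    (G b - F b) - (G a - F a) = (G' x - F' x) * (b - a).
  apply: (@MVT_segment _ (fun y => G y - F y) (fun x => G' x - F' x)) => //.
    move=> x; rewrite in_itv/= => /andP[ax xb]; apply: dH; by rewrite !ltW.
  apply: continuous_in_subspaceT => x; rewrite inE/= in_itv/= => xab.
  exact: der_continuous (dH _ xab).
rewrite in_itv/= in xab => e.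
have : 0 <= (G' x - F' x) * (b - a) by rewrite mulr_ge0// subr_ge0// FG.
by rewrite -e; lra.
Qed.

Lemma norm_diff_le (F G : R -> R) (F' G' : R -> R) (a b : R) : a <= b ->
  (forall x, a <= x <= b -> is_derive x 1 F (F' x)) ->
  (forall x, a <= x <= b -> is_derive x 1 G (G' x)) ->
  (forall x, a <= x <= b -> `|F' x| <= G' x) -> `|F b - F a| <= G b - G a.
Proof.
move=> ab dF dG FG; rewrite ler_norml (der_diff_le ab dF dG) ?andbT; last first.
  by move=> x /FG; rewrite ler_norml => /andP[].
have := der_diff_le ab (fun x h => derN (dF x h)) dG.
move=> /(_ _)/wrap[x /FG|]; last by lra.
by rewrite ler_norml => /andP[h _]; lra.
Qed.

Lemma itv_is_derive (a b u v M c : R) (k k' : R -> R -> R) :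
  (forall c, u < c < v -> leb.-integrable `[a, b] (EFin \o k c)) ->
  (forall c s, u < c < v -> a <= s <= b -> is_derive c 1 (k ^~ s) (k' c s)) ->
  (forall c s, u < c < v -> a <= s <= b -> `|k' c s| <= M) ->
  u < c < v ->
  is_derive c 1 (fun c => \int[leb]_(s in `[a, b]) k c s)
    (\int[leb]_(s in `[a, b]) k' c s).
Proof.
move=> ik dk bk uv.
pose F c := k c \_ `[a, b]; pose F' c := k' c \_ `[a, b].
have e c' : \int[leb]_s F c' s = \int[leb]_(s in `[a, b]) k c' s by rewrite [RHS]Rintegral_mkcond.
rewrite [X in is_derive _ _ _ X]Rintegral_mkcond.
apply: (is_deriveE (f := fun c => \int[leb]_s F c s) (l := \int[leb]_s F' c s)) => //.
pose H (s : R) := M * \1_(`[a, b]%classic) s.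
apply: (@under_is_derive _ _ R leb u v F F' H) => //.
- move=> c' /ik; rewrite /intg /F => h.
  by rewrite -restrict_EFin; apply: (integrable_mkcond _ _).1 => //; exact: measurable_itv.
- move=> c' s cuv; rewrite /F /F' /patch; case: ifPn => [|_]; last exact: derC.
  by rewrite inE/= in_itv/= => sab; exact: dk.
- by apply: intgZ; exact: integrable_indic_itv.
- move=> c' s cuv; rewrite /F' /H /patch indicE; case: ifPn => sab.
    by rewrite mulr1; apply: bk => //; move: sab; rewrite inE/= in_itv/=.
  by rewrite mulr0 normr0.
Qed.

End calculus.

Section lipschitz.
Context (R : realType) (d : nat).
Implicit Types (x y : 'rV[R]_d) (i : 'I_d) (f : 'rV[R]_d -> R).

(** The segment from [x] to [y] is replaced by a path parallel to the axes, along which partial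
    derivatives suffice. *)
Lemma lip_der f (f' : 'I_d -> 'rV[R]_d -> R) (L : R) : 0 <= L ->
  (forall i x, is_derive x (evec i) f (f' i x)) -> (forall i x, `|f' i x| <= L) ->
  lip L f.
Proof.
move=> L0 df bf.
have one i x t : `|f (x + t *: evec i) - f x| <= L * `|t|.
  have dl (s : R) : is_derive s 1 (fun s => f (x + s *: evec i)) (f' i (x + s *: evec i)).
    exact: is_derive_line.
  have pos (s r : R) : s <= r -> `|f (x + r *: evec i) - f (x + s *: evec i)| <= L * (r - s).
    move=> sr; rewrite mulrBr.
    apply: (norm_diff_le (F := fun s => f (x + s *: evec i))
      (G := fun s => L * s) (G' := fun=> L * 1) sr (fun z _ => dl z)
      (fun z _ => derZ L (der_id z))) => z _.
    by rewrite mulr1.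
  have [t0|t0] := leP 0 t.
    by have := pos 0 t t0; rewrite scale0r addr0 subr0 (ger0_norm t0).
  by have := pos t 0 (ltW t0); rewrite scale0r addr0 sub0r distrC (ltr0_norm t0).
have key (s : seq 'I_d) x (h : 'I_d -> R) :
    `|f (x + \sum_(i <- s) h i *: evec i) - f x| <= L * \sum_(i <- s) `|h i|.
  elim: s x => [|i s IH] x; first by rewrite !big_nil addr0 subrr normr0 mulr0.
  rewrite !big_cons addrA mulrDr.
  apply: (le_trans (ler_distD (f (x + h i *: evec i)) _ _)).
  by rewrite [leLHS]addrC lerD.
move=> x y; rewrite distrC.
have e : y = x + \sum_(i < d) (y ord0 i - x ord0 i) *: evec i.
  apply/rowP => k; rewrite !mxE summxE (bigD1 k)//= big1 ?addr0.
    by rewrite !mxE !eqxx mulr1 addrC subrK.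
  by move=> i ik; rewrite !mxE eqxx/= eq_sym (negbTE ik) mulr0.
rewrite {1}e; apply: (le_trans (key _ _ _)).
by rewrite ler_wpM2l// ler_sum// => i _; rewrite distrC.
Qed.

End lipschitz.

(** * Space-time integrals *)

Section spacetime.
Context (R : realType) (d : nat) (a b : R).
Hypotheses (a0 : 0 < a) (ab : a <= b).
Local Notation mu := (lebesgue_rV R d).
Local Notation leb := (@lebesgue_measure R).
Implicit Types (h k : R -> 'rV[R]_d -> R).

Lemma tame_scale (r : R) h : 0 < r -> tame h -> tame (fun s => h (r * s)).
Proof.
move=> r0 [h1 h2 h3]; split.
- by move=> c c0; apply: h1; rewrite mulr_gt0.
- move=> c x c0; apply: (continuous_comp (f := fun s : R => r * s) (g := fun s => h s x)).
    exact: der_continuous (derZ r (der_id c)).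
  by apply: h2; rewrite mulr_gt0.
- move=> u v u0 uv; have [H XH hH] := h3 (r * u) (r * v) (mulr_gt0 r0 u0)
    (ler_wpM2l (ltW r0) uv).
  by exists H => // c x /andP[uc cv]; apply: hH; rewrite !ler_wpM2l// ltW.
Qed.

Definition ST h := \int[leb]_(s in `[a, b]) \int[mu]_x h s x.

Lemma ST_intg h : tame h ->
  leb.-integrable `[a, b] (EFin \o (fun s => \int[mu]_x h s x)).
Proof. by move=> th; exact: tame_intg_itv. Qed.

Lemma eq_ST h k : (forall s x, a <= s <= b -> h s x = k s x) -> ST h = ST k.
Proof.
move=> e; apply: eq_Rintegral => s; rewrite inE/= in_itv/= => sab.
by apply: eq_Rint => x; exact: e.
Qed.

Lemma ST_le h k : tame h -> tame k ->
  (forall s, a <= s <= b -> \int[mu]_x h s x <= \int[mu]_x k s x) -> ST h <= ST k.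
Proof. by move=> th tk hk; apply: (Rint_itv_le (ST_intg th) (ST_intg tk)). Qed.

Lemma ST_le_pt h k : tame h -> tame k ->
  (forall s x, 0 < s -> h s x <= k s x) -> ST h <= ST k.
Proof.
move=> th tk hk; apply: ST_le => // s /andP[as_ _].
have s0 : 0 < s by exact: lt_le_trans as_.
by apply: Rint_le => [||x]; [apply/bint_intg/(tame_bint th)|apply/bint_intg/(tame_bint tk)|exact: hk].
Qed.

Lemma STD h k : tame h -> tame k -> ST (fun s x => h s x + k s x) = ST h + ST k.
Proof.
move=> th tk; rewrite -(Rint_itvD (ST_intg th) (ST_intg tk)).
apply: eq_Rintegral => s; rewrite inE/= in_itv/= => /andP[as_ _].
have s0 : 0 < s by exact: lt_le_trans as_.
by rewrite RintD//; [apply/bint_intg/(tame_bint th)|apply/bint_intg/(tame_bint tk)].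
Qed.

Lemma STZ (r : R) h : tame h -> ST (fun s x => r * h s x) = r * ST h.
Proof.
move=> th; rewrite -(Rint_itvZ r (ST_intg th)).
apply: eq_Rintegral => s; rewrite inE/= in_itv/= => /andP[as_ _].
by rewrite RintZ//; apply/bint_intg/(tame_bint th)/(lt_le_trans a0 as_).
Qed.

Lemma ST_sum n (h : 'I_n -> R -> 'rV[R]_d -> R) : (forall i, tame (h i)) ->
  ST (fun s x => \sum_(i < n) h i s x) = \sum_(i < n) ST (h i).
Proof.
elim: n h => [|n IH] h th.
  rewrite big_ord0 (_ : ST _ = ST (fun=> (fun=> 0 * (0 : R)))).
    by rewrite STZ ?mul0r//; apply: tame_cst; exact: bint0.
  by apply: eq_ST => s x _; rewrite big_ord0 mul0r.
rewrite big_ord_recl -IH//= -STD//; last by apply: tame_sum => i; exact: th.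
by apply: eq_ST => s x _; rewrite big_ord_recl.
Qed.

Lemma ST_ge0 h : (forall s x, 0 < s -> 0 <= h s x) -> 0 <= ST h.
Proof.
move=> h0; apply: Rintegral_ge0 => s /=; rewrite in_itv/= => /andP[as_ _].
by apply: Rint_ge0 => x; apply: h0; exact: lt_le_trans as_.
Qed.

Lemma ST_CS h k : tame h -> tame k ->
  `|ST (fun s x => h s x * k s x)| <=
  Num.sqrt (ST (fun s x => h s x ^+ 2)) * Num.sqrt (ST (fun s x => k s x ^+ 2)).
Proof.
move=> th tk.
have h2 := tame_sqr th; have k2 := tame_sqr tk; have hk := tameM th tk.
have p1 : 0 <= ST (fun s x => h s x ^+ 2) by apply: ST_ge0 => s x _; exact: sqr_ge0.
have p2 : 0 <= ST (fun s x => k s x ^+ 2) by apply: ST_ge0 => s x _; exact: sqr_ge0.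
have main (e : R) : e = 1 \/ e = -1 -> forall t : R, 0 < t ->
    2 * t * (e * ST (fun s x => h s x * k s x)) <=
    t ^+ 2 * ST (fun s x => h s x ^+ 2) + ST (fun s x => k s x ^+ 2).
  move=> e1 t t0; rewrite -(STZ _ hk) -(STZ _ (tameZ _ hk)) -(STZ _ h2) -(STD (tameZ _ h2) k2).
  apply: ST_le_pt => [||s x _].
  - exact/tameZ/tameZ.
  - exact: tameD (tameZ _ h2) k2.
  - have := sqr_ge0 (t * h s x - e * k s x).
    have ee : e ^+ 2 = 1 by case: e1 => ->; rewrite ?sqrrN expr1n.
    by rewrite sqrrB !exprMn ee; lra.
rewrite -sqrtrM// -ler_sqr ?nnegrE ?sqrtr_ge0 ?normr_ge0// sqr_sqrtr ?mulr_ge0//.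
apply: sqr_le_mul => // t t0.
have [/ger0_norm ->|/ltr0_norm ->] := leP 0 (ST (fun s x => h s x * k s x)).
  by have := main 1 (or_introl erefl) t t0; rewrite mul1r.
by have := main (-1) (or_intror erefl) t t0; rewrite mulN1r.
Qed.

End spacetime.

Section scaling.
Context (R : realType) (d : nat) (a b : R).
Hypotheses (a0 : 0 < a) (ab : a <= b).
Local Notation mu := (lebesgue_rV R d).
Local Notation leb := (@lebesgue_measure R).
Implicit Types (h k : R -> 'rV[R]_d -> R) (f g : 'rV[R]_d -> R) (i : 'I_d).

Lemma Rint_itv_scale (r : R) (K : R -> R) : 0 < r -> (forall c, 0 <= K c) ->
  leb.-integrable `[r * a, r * b] (EFin \o K) ->
  \int[leb]_(s in `[a, b]) K (r * s) = r^-1 * \int[leb]_(c in `[r * a, r * b]) K c.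
Proof.
move=> r0 K0 iK; rewrite [LHS]Rintegral_mkcond [in RHS]Rintegral_mkcond.
pose f := EFin \o (K \_ `[r * a, r * b]).
have if_ : leb.-integrable setT f.
  by rewrite /f -restrict_EFin; apply: (integrable_mkcond _ _).1 => //; exact: measurable_itv.
have f0 x : (0 <= f x)%E by rewrite lee_fin /patch; case: ifP.
have e := ge0_integral_affine 0 (lt0r_neq0 r0) (measurable_int _ if_) f0.
rewrite (gtr0_norm r0) in e.
have -> : \int[leb]_c (K \_ `[r * a, r * b]) c = fine (\int[leb]_x f x) by [].
have -> : (r^-1 * fine (\int[leb]_x f x))%R = fine (r^-1%:E * \int[leb]_x f x).
  by rewrite fineM//; exact: integrable_fin_num.
rewrite -e; congr fine; apply: eq_integral => s _ /=.
rewrite addr0 /f /= /patch; congr (EFin (if _ then _ else _)).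
by apply/idP/idP; rewrite !inE/= !in_itv/= !ler_pM2l.
Qed.

(** The substitution [c = r * s] gives [r^-1] and the energy identity gives 1/2; the bound does not
    involve [a] and [b]. *)
Lemma ST_dheat (r : R) f i : 0 < r -> bint f ->
  ST a b (fun s x => dheat i (r * s) f x ^+ 2) <= (2 * r)^-1 * \int[mu]_x f x ^+ 2.
Proof.
move=> r0 Xf; have t1 := tame_sqr (tame_dheat i Xf).
rewrite /ST (Rint_itv_scale (K := fun c => \int[mu]_x dheat i c f x ^+ 2) r0).
- have ra0 : 0 < r * a by rewrite mulr_gt0.
  have := heat_energy_le Xf ra0 (ler_wpM2l (ltW r0) ab).
  set E2 := \int[leb]_(c in _) _ => hE.
  have : 2 * \int[leb]_(c in `[r * a, r * b]) (\int[mu]_x dheat i c f x ^+ 2) <= E2.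
    rewrite -Rint_itvZ; last exact: tame_intg_itv.
    apply: Rint_itv_le.
    - by apply: Rint_itv_intgZ; exact: tame_intg_itv.
    - apply: Rint_itv_intgZ; apply: Rint_itv_intg_sum => k.
      by apply: tame_intg_itv => //; exact/tame_sqr/tame_dheat.
    - move=> c _; rewrite ler_pM2l// /grad2 (bigD1 i)//= lerDl.
      by apply: sumr_ge0 => k _; apply: Rint_ge0 => x; exact: sqr_ge0.
  move=> /le_trans/(_ hE) h; rewrite invfM (mulrC 2^-1) -mulrA ler_pM2l ?invr_gt0//.
  by rewrite ler_pdivlMl.
- by move=> c; apply: Rint_ge0 => x; exact: sqr_ge0.
- by apply: tame_intg_itv => //; rewrite mulr_gt0.
Qed.

Lemma ST_carleson (r : R) f g i (M : R) : 0 < r -> bint f -> bint g ->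
  (forall x, `|f x| <= M) ->
  ST a b (fun s x => (heat (r * s) g x * dheat i (r * s) f x) ^+ 2) <=
  r^-1 * (8 * M ^+ 2 * \int[mu]_x g x ^+ 2).
Proof.
move=> r0 Xf Xg fM; have t1 (k : 'I_d) := tame_sqr (tameM (tame_heat Xg) (tame_dheat k Xf)).
rewrite /ST (Rint_itv_scale (K := fun c => \int[mu]_x (heat c g x * dheat i c f x) ^+ 2) r0).
- have ra0 : 0 < r * a by rewrite mulr_gt0.
  rewrite ler_pM2l ?invr_gt0//.
  apply: le_trans (carleson_le Xf Xg fM ra0 (ler_wpM2l (ltW r0) ab)).
  apply: Rint_itv_le.
  - exact: tame_intg_itv.
  - by apply: Rint_itv_intg_sum => k; apply: tame_intg_itv (t1 k) ra0.
  - move=> c _; rewrite (bigD1 i)//= lerDl.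
    by apply: sumr_ge0 => k _; apply: Rint_ge0 => x; exact: sqr_ge0.
- by move=> c; apply: Rint_ge0 => x; exact: sqr_ge0.
- by apply: tame_intg_itv => //; rewrite mulr_gt0.
Qed.

Lemma tame_cmul (phi : R -> R) h : (forall c, 0 < c -> {for c, continuous phi}) ->
  (forall c, 0 < c -> 0 <= phi c) -> {homo phi : x y / x <= y} ->
  tame h -> tame (fun s x => phi s * h s x).
Proof.
move=> cphi phi0 mphi [h1 h2 h3]; split.
- by move=> c c0; apply: bintZ; exact: h1.
- by move=> c x c0; apply: continuousM; [exact: cphi|exact: h2].
- move=> u v u0 uv; have [H XH hH] := h3 _ _ u0 uv.
  exists (fun x => phi v * H x); first exact: bintZ.
  move=> c x /andP[uc cv]; rewrite normrM ler_pM// ?hH ?uc//.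
  by rewrite ger0_norm ?mphi// phi0// (lt_le_trans u0).
Qed.

Lemma tame_idmul h : tame h -> tame (fun s x => s * h s x).
Proof.
apply: tame_cmul => [c c0|c /ltW//|//]; exact: der_continuous (der_id c).
Qed.

Lemma tame_sqrtmul h : tame h -> tame (fun s x => Num.sqrt s * h s x).
Proof.
apply: tame_cmul => [c c0||]; first exact: sqrt_continuous.
- by move=> c _; exact: sqrtr_ge0.
- by move=> x y xy; exact: ler_wsqrtr.
Qed.

Lemma ST_CS_le h k (A B : R) : tame h -> tame k -> 0 <= A -> 0 <= B ->
  ST a b (fun s x => h s x ^+ 2) <= A ^+ 2 -> ST a b (fun s x => k s x ^+ 2) <= B ^+ 2 ->
  `|ST a b (fun s x => h s x * k s x)| <= A * B.
Proof.
move=> th tk A0 B0 hA kB; apply: le_trans (ST_CS _ _ th tk) _ => //.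
apply: ler_pM; rewrite ?sqrtr_ge0//.
  by rewrite -(ger0_norm A0) -sqrtr_sqr; exact: ler_wsqrtr.
by rewrite -(ger0_norm B0) -sqrtr_sqr; exact: ler_wsqrtr.
Qed.

End scaling.

(** * Trilinear forms *)

Section trilinear.
Context (R : realType) (d : nat) (a b : R).
Hypotheses (a0 : 0 < a) (ab : a <= b).
Local Notation mu := (lebesgue_rV R d).
Local Notation leb := (@lebesgue_measure R).
Local Notation ST := (@ST R d a b).
Local Notation L2 f := (Num.sqrt (\int[mu]_x f x ^+ 2)).
Implicit Types (i j k : 'I_d) (rho gam : R) (x : 'rV[R]_d)
  (sig th f g : 'rV[R]_d -> R).

Lemma half_le_double (z : R) : 0 < z -> z / 2 <= 2 * z.
Proof. by lra. Qed.

Lemma sqrM3_le (z y v V : R) : v ^+ 2 <= V -> (z * (y * v)) ^+ 2 <= z ^+ 2 * V * y ^+ 2.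
Proof.
move=> vV; have -> : z ^+ 2 * V * y ^+ 2 = (z * y) ^+ 2 * V by ring.
have -> : (z * (y * v)) ^+ 2 = (z * y) ^+ 2 * v ^+ 2 by ring.
by rewrite ler_wpM2l// sqr_ge0.
Qed.

Lemma norm_telescope (t g' m' r' : R) :
  `|t| <= `|t - g'| + `|m' - g'| + `|r' - m'| + `|r'|.
Proof.
have := ler_normD (t - g') g'; have := ler_normD (g' - m') m'; have := ler_normD (m' - r') r'.
rewrite !subrK (distrC m' g') (distrC r' m'); lra.
Qed.

(** The heat time [s] is shared between [th] and [g] in the proportions [rho] and [1 - rho], as in
    the derivative of the interpolating function [Psi]. *)
Definition tril rho j k g sig th :=
  ST (fun s x => sig x * (dheat j (rho * s) th x * dheat k ((1 - rho) * s) g x)).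

Section weight.
Variable rho : R.
Hypothesis rho01 : 0 < rho < 1.
Local Notation p := (Num.sqrt rho).
Local Notation q := (Num.sqrt (1 - rho)).

Lemma rho0 : 0 < rho. Proof. by case/andP: rho01. Qed.
Lemma rho1 : 0 < 1 - rho. Proof. by case/andP: rho01; rewrite subr_gt0. Qed.
Lemma p0 : 0 < p. Proof. by rewrite sqrtr_gt0 rho0. Qed.
Lemma q0 : 0 < q. Proof. by rewrite sqrtr_gt0 rho1. Qed.
Lemma p2 : p ^+ 2 = rho. Proof. by rewrite sqr_sqrtr// ltW// rho0. Qed.
Lemma q2 : q ^+ 2 = 1 - rho. Proof. by rewrite sqr_sqrtr// ltW// rho1. Qed.

Variables (j k : 'I_d) (g sig th : 'rV[R]_d -> R).
Hypotheses (Xg : bint g) (Xsig : bint sig) (Xth : bint th).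

Let v s := dheat j (rho * s) th.
Let w s := dheat k ((1 - rho) * s) g.
Let tv : tame v. Proof. exact: tame_scale rho0 (tame_dheat j Xth). Qed.
Let tw : tame w. Proof. exact: tame_scale rho1 (tame_dheat k Xg). Qed.

Lemma L2_sqr f : L2 f ^+ 2 = \int[mu]_x f x ^+ 2.
Proof. by rewrite sqr_sqrtr// Rint_ge0// => x; exact: sqr_ge0. Qed.

Let ST_w : ST (fun s x => w s x ^+ 2) <= (L2 g / (Num.sqrt 2 * q)) ^+ 2.
Proof.
apply: (le_trans (ST_dheat a0 ab k rho1 Xg)).
by rewrite expr_div_n exprMn L2_sqr q2 sqr_sqrtr// mulrC.
Qed.

Let ST_w_ge0 : 0 <= L2 g / (Num.sqrt 2 * q).
Proof. by rewrite divr_ge0 ?mulr_ge0 ?sqrtr_ge0. Qed.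

(** Once [sig] is bounded by its supremum, Cauchy-Schwarz in space-time and one energy estimate for
    each of [th] and [g] conclude; each contributes a factor 1/sqrt 2. *)
Lemma tril_inf (M : R) : (forall x, `|sig x| <= M) ->
  `|tril rho j k g sig th| <= M * L2 th * L2 g / (2 * p * q).
Proof.
move=> sM; have M0 : 0 <= M by exact: le_trans (sM 0).
have -> : tril rho j k g sig th = ST (fun s x => (sig x * v s x) * w s x).
  by apply: eq_ST => s x _; rewrite mulrA.
have s2 : 0 < Num.sqrt 2 :> R by rewrite sqrtr_gt0.
have -> : M * L2 th * L2 g / (2 * p * q) =
    (M * L2 th / (Num.sqrt 2 * p)) * (L2 g / (Num.sqrt 2 * q)).
  have e2 : 2 = Num.sqrt 2 ^+ 2 :> R by rewrite sqr_sqrtr.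
  rewrite {1}e2; move: (Num.sqrt 2) s2 => z z0.
  by field; rewrite !gt_eqF ?p0 ?q0.
have tsv : tame (fun s x => sig x * v s x) by apply: tameM => //; exact: tame_cst.
apply: ST_CS_le => //; first by rewrite divr_ge0 ?mulr_ge0 ?sqrtr_ge0.
apply: (@le_trans _ _ (M ^+ 2 * ST (fun s x => v s x ^+ 2))).
  apply: le_trans (eq_ler (STZ b a0 (M ^+ 2) (tame_sqr tv))).
  apply: (ST_le_pt b a0 (tame_sqr tsv) (tameZ _ (tame_sqr tv))) => s x _; rewrite exprMn ler_wpM2r ?sqr_ge0//.
  by rewrite -[sig x ^+ 2]real_normK ?num_real// ler_sqr ?nnegrE//.
apply: (le_trans (ler_wpM2l (sqr_ge0 M) (ST_dheat a0 ab j rho0 Xth))).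
by rewrite expr_div_n !exprMn L2_sqr p2 sqr_sqrtr// mulrCA mulrC.
Qed.

Variable M : R.
Hypothesis thM : forall x, `|th x| <= M.

Let M0 : 0 <= M :> R. Proof. exact: le_trans (thM 0). Qed.
Let K1_0 : 0 <= K1 R d. Proof. exact: K1_ge0. Qed.
Let K2_0 : 0 <= K2 R d. Proof. exact: K2_ge0. Qed.
Let sqrt2_gt0 : 0 < Num.sqrt 2 :> R. Proof. by rewrite sqrtr_gt0. Qed.
Let sqrt2_sqr : Num.sqrt 2 ^+ 2 = 2 :> R. Proof. by rewrite sqr_sqrtr. Qed.

Let v_sqr (s : R) x : 0 < s -> v s x ^+ 2 <= K1 R d ^+ 2 / (rho * s) * M ^+ 2.
Proof.
move=> s0; have rs : 0 < rho * s by rewrite mulr_gt0// rho0.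
have := dheat_le_sup j x rs Xth thM; rewrite -/(v s x) => h.
rewrite -[v s x ^+ 2]real_normK ?num_real//.
have -> : K1 R d ^+ 2 / (rho * s) * M ^+ 2 = (K1 R d / Num.sqrt (rho * s) * M) ^+ 2.
  by move: (K1 R d) => z; rewrite !exprMn exprVn sqr_sqrtr// ltW.
by rewrite ler_sqr ?nnegrE// mulr_ge0// divr_ge0// sqrtr_ge0.
Qed.

(** At [gam = rho] the factors [sig] and [th] are smoothed at the same time, as the Carleson
    estimate requires; [gam -> 0] gives back [tril]. *)
Definition trilT gam := ST (fun s x => heat (gam * s) sig x * (v s x * w s x)).

Lemma tril_carleson : `|trilT rho| <= 2 * (L2 sig * M * L2 g) / (p * q).
Proof.
have -> : trilT rho = ST (fun s x => (heat (rho * s) sig x * v s x) * w s x).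
  by apply: eq_ST => s x _; rewrite mulrA.
have -> : 2 * (L2 sig * M * L2 g) / (p * q) =
    (2 * Num.sqrt 2 * M * L2 sig / p) * (L2 g / (Num.sqrt 2 * q)).
  move: (Num.sqrt 2) sqrt2_gt0 => z z0.
  by field; rewrite !gt_eqF ?p0 ?q0.
apply: ST_CS_le => //.
- by apply: tameM => //; exact: tame_scale rho0 (tame_heat Xsig).
- by rewrite divr_ge0 ?mulr_ge0 ?sqrtr_ge0.
- apply: (le_trans (ST_carleson a0 ab j rho0 Xth Xsig thM)).
  rewrite expr_div_n !exprMn L2_sqr p2 sqrt2_sqr.
  by apply: eq_ler; ring.
Qed.

Let trilT' gam := \int[leb]_(s in `[a, b])
  (s * \int[mu]_x ((\sum_(i < d) ddheat i i (gam * s) sig x) * (v s x * w s x))).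

Let trilT_der gam : 0 < gam -> is_derive gam 1 trilT (trilT' gam).
Proof.
move=> gam0.
pose h s x := v s x * w s x.
have th_ : tame h by exact: tameM.
have [H XH hH] : exists2 H, bint H & forall c x, a <= c <= b -> `|h c x| <= H x.
  by case: th_ => _ _; exact.
have tdd : tame (fun c x => \sum_(i < d) ddheat i i c sig x).
  by apply: tame_sum => i; exact: tame_ddheat.
have a0' : 0 < a := a0.
have [K XK hK] : exists2 K, bint K & forall c x, gam / 2 * a <= c <= 2 * gam * b ->
    `|\sum_(i < d) ddheat i i c sig x| <= K x.
  case: tdd => _ _; apply; first by rewrite mulr_gt0// divr_gt0.
  apply: ler_pM => //; [exact: ltW (divr_gt0 _ _)|exact: ltW|exact: half_le_double].
have uv : gam / 2 < gam < 2 * gam by exact: in_half_itv.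
have hint s (ss : a <= s <= b) := tame_bint th_ (lt_le_trans a0 (proj1 (andP ss))).
apply: (@itv_is_derive R a b (gam / 2) (2 * gam) (b * \int[mu]_x (K x * H x)) gam
   (fun c s => \int[mu]_x (heat (c * s) sig x * h s x))
   (fun c s => s * \int[mu]_x ((\sum_(i < d) ddheat i i (c * s) sig x) * h s x))) => //.
- move=> c /andP[gc _]; apply: ST_intg => //; apply: tameM => //.
  by apply: tame_scale (tame_heat Xsig); lra.
- move=> c s /andP[gc _] ss; have s0 : 0 < s by lra.
  have c0 : 0 < c by lra.
  have dx (r : R) x : 0 < r -> is_derive r 1 (fun r => heat r sig x * h s x)
      ((\sum_(i < d) ddheat i i r sig x) * h s x).
    move=> r0; apply: (is_deriveE (derM (heat_time x r0 Xsig) (derC _ _ (h s x)))) => //.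
    by rewrite mulr0 addr0.
  have D := tame_derive (tameM (tame_heat Xsig) (tame_cst (hint s ss)))
    (tameM tdd (tame_cst (hint s ss))) dx (mulr_gt0 s0 c0).
  apply: (is_deriveE (der_comp D (derZ s (der_id c)))) => [y|].
    by rewrite mulrC.
  by rewrite mulr1 mulrC (mulrC s c).
- move=> c s /andP[gc cg] ss; have s0 : 0 < s by lra.
  rewrite normrM (gtr0_norm s0); apply: ler_pM => //; first exact: ltW.
    by case/andP: ss.
  have c0 : 0 < c by lra.
  apply: Rint_norm_le; [|by apply/bint_mul_intg|].
    by apply: bint_mul_intg => //; [exact: tame_bint tdd (mulr_gt0 c0 s0)|exact: hint].
  move=> x; rewrite normrM; apply: ler_pM => //; last exact: hH.
  by apply: hK; case/andP: ss => as_ sb; rewrite !ler_pM//; lra.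
Qed.

Let E := L2 sig * M * L2 g.

Let L2_ge0 f : 0 <= L2 f. Proof. exact: sqrtr_ge0. Qed.

Let trilT'E gam : 0 < gam -> trilT' gam =
  \sum_(i < d) ST (fun s x => (s * (ddheat i i (gam * s) sig x * v s x)) * w s x).
Proof.
move=> gam0.
have tdd (i : 'I_d) : tame (fun s x => ddheat i i (gam * s) sig x * v s x).
  by apply: tameM => //; exact: tame_scale gam0 (tame_ddheat i i Xsig).
rewrite -(ST_sum b a0); last by move=> i; apply: tameM => //; exact: tame_idmul.
apply: eq_Rintegral => s; rewrite inE/= in_itv/= => /andP[as_ _].
have s0 : 0 < s by exact: lt_le_trans as_.
rewrite -RintZ; last first.
  apply: bint_mul_intg; last exact: tame_bint (tameM tv tw) s0.
  by apply: bint_sum => i; apply: bint_ddheat => //; rewrite mulr_gt0.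
apply: eq_Rint => x; rewrite mulr_suml mulr_sumr; apply: eq_bigr => i _.
by rewrite !mulrA.
Qed.

(** Both derivatives stay on [sig]. The factor 1/(p q) is the same as at [gam = rho], but [gam^-1]
    is not integrable at 0, so this bound is used only away from 0. *)
Lemma trilT'_lap gam : 0 < gam ->
  `|trilT' gam| <= d%:R * K1 R d ^+ 2 * E / (p * q) * gam^-1.
Proof.
move=> gam0; rewrite trilT'E//; apply: (le_trans (ler_norm_sum _ _ _)).
have -> : d%:R * K1 R d ^+ 2 * E / (p * q) * gam^-1 =
    \sum_(i < d) (K1 R d ^+ 2 * E / (p * q) * gam^-1).
  by rewrite sumr_const card_ord -[RHS]mulr_natl !mulrA.
apply: ler_sum => i _.
have -> : K1 R d ^+ 2 * E / (p * q) * gam^-1 =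
    (Num.sqrt 2 * K1 R d ^+ 2 * M * L2 sig / (p * gam)) * (L2 g / (Num.sqrt 2 * q)).
  rewrite /E; move: (Num.sqrt 2) sqrt2_gt0 (K1 R d) => z z0 y.
  by field; rewrite !gt_eqF ?p0 ?q0.
have g20 : 0 < gam / 2 by rewrite divr_gt0.
have t1 : tame (fun s x => s * (ddheat i i (gam * s) sig x * v s x)).
  apply: tame_idmul; apply: tameM => //; exact: tame_scale gam0 (tame_ddheat i i Xsig).
apply: ST_CS_le => //.
  by rewrite divr_ge0 ?mulr_ge0 ?sqr_ge0 ?(ltW gam0).
have t2 : tame (fun s x => dheat i (gam / 2 * s) sig x ^+ 2).
  by apply: tame_sqr; exact: tame_scale g20 (tame_dheat i Xsig).
(* The factor [s ^+ 2] cancels the losses [1/(rho s)] of [v_sqr] and [1/(gam s)] of [ddheat_L2], so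
   that no power of [s] is left. *)
pose C := 2 * K1 R d ^+ 4 * M ^+ 2 / (rho * gam).
apply: (@le_trans _ _ (C * ST (fun s x => dheat i (gam / 2 * s) sig x ^+ 2))).
  apply: le_trans (eq_ler (STZ b a0 C t2)).
  apply: (ST_le a0 (tame_sqr t1) (tameZ C t2)) => s /andP[as_ _]; have s0 : 0 < s by exact: lt_le_trans as_.
  have gs0 : 0 < gam * s by rewrite mulr_gt0.
  pose D := s ^+ 2 * (K1 R d ^+ 2 / (rho * s) * M ^+ 2).
  have D0 : 0 <= D.
    by rewrite mulr_ge0 ?sqr_ge0// mulr_ge0 ?sqr_ge0// divr_ge0 ?sqr_ge0// mulr_ge0 ?(ltW rho0)// ltW.
  apply: (@le_trans _ _ (D * \int[mu]_x ddheat i i (gam * s) sig x ^+ 2)).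
    have Xdd := bint_ddheat i i gs0 Xsig.
    rewrite -RintZ; last exact: bint_sqr.
    apply: Rint_le; [by apply: bint_sqr; exact: tame_bint t1 s0|by apply: intgZ; exact: bint_sqr|].
    by move=> x; apply: sqrM3_le; exact: v_sqr.
  have h := ddheat_L2 i i gs0 Xsig.
  apply: (le_trans (ler_wpM2l D0 h)).
  rewrite RintZ; last by apply: bint_intg; exact: tame_bint t2 s0.
  rewrite mulrA (_ : gam * s / 2 = gam / 2 * s); last by rewrite mulrAC.
  rewrite ler_wpM2r//; first by apply: Rint_ge0 => x; exact: sqr_ge0.
  rewrite /D /C; move: (K1 R d) => z; apply: eq_ler.
  by field; rewrite !gt_eqF// rho0.
have C0 : 0 <= C.
  by rewrite divr_ge0 ?mulr_ge0 ?exprn_ge0 ?(ltW rho0)// ltW.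
apply: (le_trans (ler_wpM2l C0 (ST_dheat a0 ab i g20 Xsig))).
rewrite /C !(exprMn, exprVn) L2_sqr p2 sqrt2_sqr.
move: (K1 R d) (\int[mu]_x _) => z y; apply: eq_ler.
by field; rewrite !gt_eqF// rho0.
Qed.

(** One derivative leaves [sig] and falls on [v] or on [w]. Each factor [Num.sqrt s] is meant to pay
    for one derivative: in the first term both go with the second derivative of [th], in the second
    they are divided between [th] and [g]. *)
Let grad_ibp i gam : 0 < gam ->
  ST (fun s x => (s * (ddheat i i (gam * s) sig x * v s x)) * w s x) =
  - (ST (fun s x => (s * (dheat i (gam * s) sig x * ddheat j i (rho * s) th x)) * w s x) +
     ST (fun s x => (Num.sqrt s * (dheat i (gam * s) sig x * v s x)) *
                    (Num.sqrt s * ddheat k i ((1 - rho) * s) g x))).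
Proof.
move=> gam0.
have tds := tame_scale gam0 (tame_dheat i Xsig).
have tdt := tame_scale rho0 (tame_ddheat j i Xth).
have tdg := tame_scale rho1 (tame_ddheat k i Xg).
have tA : tame (fun s x => (s * (dheat i (gam * s) sig x * ddheat j i (rho * s) th x)) * w s x).
  by apply: tameM => //; apply: tame_idmul; exact: tameM.
have tB : tame (fun s x => (Num.sqrt s * (dheat i (gam * s) sig x * v s x)) *
                    (Num.sqrt s * ddheat k i ((1 - rho) * s) g x)).
  by apply: tameM; apply: tame_sqrtmul => //; exact: tameM.
rewrite -(STD b a0 tA tB) -mulN1r -(STZ b a0 (-1) (tameD tA tB)).
apply: eq_Rintegral => s; rewrite inE/= in_itv/= => /andP[as_ _].
have s0 : 0 < s by exact: lt_le_trans as_.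
have gs0 : 0 < gam * s by rewrite mulr_gt0.
have rs0 : 0 < rho * s by rewrite mulr_gt0// rho0.
have qs0 : 0 < (1 - rho) * s by rewrite mulr_gt0// rho1.
have Xv := tame_bint tv s0; have Xw := tame_bint tw s0.
have Xdt := tame_bint tdt s0; have Xdg := tame_bint tdg s0.
have Xs := tame_bint tds s0.
pose F' x := ddheat j i (rho * s) th x * w s x + v s x * ddheat k i ((1 - rho) * s) g x.
have e : \int[mu]_x (v s x * w s x * ddheat i i (gam * s) sig x) =
    - \int[mu]_x (F' x * dheat i (gam * s) sig x).
  apply: heat_ibp => //.
  - by move=> x; apply: derM; exact: dheat_derive.
  - by apply: line_continuousD; apply: line_continuousM;
      [exact: ddheat_lc|exact: dheat_lc|exact: dheat_lc|exact: ddheat_lc].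
  - exact: bintM.
  - by apply: bintD; exact: bintM.
transitivity (s * \int[mu]_x (v s x * w s x * ddheat i i (gam * s) sig x)).
  rewrite -RintZ; last by apply: bint_mul_intg; [exact: bintM|exact: bint_ddheat].
  by apply: eq_Rint => x; rewrite !mulrA; ring.
rewrite e mulrN -mulNr -RintZ; last first.
  by apply: bint_mul_intg => //; apply: bintD; exact: bintM.
apply: eq_Rint => x; have ss : Num.sqrt s ^+ 2 = s by rewrite sqr_sqrtr// ltW.
by rewrite /F' -{1}ss; move: (Num.sqrt s) ss => z <-; ring.
Qed.

Let grad_A i gam : 0 < gam ->
  `|ST (fun s x => (s * (dheat i (gam * s) sig x * ddheat j i (rho * s) th x)) * w s x)| <=
  K2 R d * E / (2 * p ^+ 2 * q * Num.sqrt gam).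
Proof.
move=> gam0; have g0 : 0 < Num.sqrt gam by rewrite sqrtr_gt0.
have g2 : Num.sqrt gam ^+ 2 = gam by rewrite sqr_sqrtr// ltW.
have -> : K2 R d * E / (2 * p ^+ 2 * q * Num.sqrt gam) =
  (K2 R d * M * L2 sig / (Num.sqrt 2 * p ^+ 2 * Num.sqrt gam)) * (L2 g / (Num.sqrt 2 * q)).
  rewrite /E -{1}sqrt2_sqr; move: (Num.sqrt 2) sqrt2_gt0 (K2 R d) => z z0 y.
  by field; rewrite !gt_eqF ?p0 ?q0.
have tds := tame_scale gam0 (tame_dheat i Xsig).
have tdt := tame_scale rho0 (tame_ddheat j i Xth).
have t1 : tame (fun s x => s * (dheat i (gam * s) sig x * ddheat j i (rho * s) th x)).
  by apply: tame_idmul; exact: tameM.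
apply: ST_CS_le => //.
  by rewrite divr_ge0 ?mulr_ge0 ?sqr_ge0 ?sqrtr_ge0.
pose C := K2 R d ^+ 2 * M ^+ 2 / rho ^+ 2.
have C0 : 0 <= C by exact: divr_ge0 (mulr_ge0 (sqr_ge0 _) (sqr_ge0 _)) (sqr_ge0 _).
apply: (@le_trans _ _ (C * ST (fun s x => dheat i (gam * s) sig x ^+ 2))).
  apply: le_trans (eq_ler (STZ b a0 C (tame_sqr tds))).
  apply: (ST_le_pt b a0 (tame_sqr t1) (tameZ C (tame_sqr tds))) => s x s0; have rs0 : 0 < rho * s by rewrite mulr_gt0// rho0.
  apply: (@le_trans _ _ (s ^+ 2 * (K2 R d / (rho * s) * M) ^+ 2 * dheat i (gam * s) sig x ^+ 2)).
    apply: sqrM3_le; rewrite -[leLHS]real_normK ?num_real// ler_sqr ?nnegrE//.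
      exact: ddheat_le_sup.
    by rewrite mulr_ge0// divr_ge0// ltW.
  rewrite ler_wpM2r ?sqr_ge0// /C; move: (K2 R d) => z; apply: eq_ler.
  by field; rewrite !gt_eqF// rho0.
apply: (le_trans (ler_wpM2l C0 (ST_dheat a0 ab i gam0 Xsig))).
rewrite /C !(exprMn, exprVn) L2_sqr g2 sqrt2_sqr p2; move: (K2 R d) (\int[mu]_x _) => z y.
by apply: eq_ler; field; rewrite !gt_eqF// rho0.
Qed.

Let grad_B i gam : 0 < gam ->
  `|ST (fun s x => (Num.sqrt s * (dheat i (gam * s) sig x * v s x)) *
                    (Num.sqrt s * ddheat k i ((1 - rho) * s) g x))| <=
  K1 R d ^+ 2 * E / (p * q ^+ 2 * Num.sqrt gam).
Proof.
move=> gam0; have g0 : 0 < Num.sqrt gam by rewrite sqrtr_gt0.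
have g2 : Num.sqrt gam ^+ 2 = gam by rewrite sqr_sqrtr// ltW.
have -> : K1 R d ^+ 2 * E / (p * q ^+ 2 * Num.sqrt gam) =
  (K1 R d * M * L2 sig / (Num.sqrt 2 * p * Num.sqrt gam)) * (Num.sqrt 2 * K1 R d * L2 g / q ^+ 2).
  rewrite /E; move: (Num.sqrt 2) sqrt2_gt0 (K1 R d) => z z0 y.
  by field; rewrite !gt_eqF ?p0 ?q0.
have tds := tame_scale gam0 (tame_dheat i Xsig).
have tdg := tame_scale rho1 (tame_ddheat k i Xg).
have t1 : tame (fun s x => Num.sqrt s * (dheat i (gam * s) sig x * v s x)).
  by apply: tame_sqrtmul; exact: tameM.
have t2 := tame_sqrtmul tdg.
apply: ST_CS_le => //.
- by rewrite divr_ge0 ?mulr_ge0 ?sqrtr_ge0.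
- by rewrite divr_ge0 ?mulr_ge0 ?sqrtr_ge0 ?sqr_ge0.
- pose C := K1 R d ^+ 2 * M ^+ 2 / rho.
  have C0 : 0 <= C by rewrite divr_ge0 ?mulr_ge0 ?sqr_ge0 ?(ltW rho0).
  apply: (@le_trans _ _ (C * ST (fun s x => dheat i (gam * s) sig x ^+ 2))).
    apply: le_trans (eq_ler (STZ b a0 C (tame_sqr tds))).
    apply: (ST_le_pt b a0 (tame_sqr t1) (tameZ C (tame_sqr tds))) => s x s0; have rs0 : 0 < rho * s by rewrite mulr_gt0// rho0.
    apply: (le_trans (sqrM3_le (Num.sqrt s) _ (v_sqr x s0))).
    rewrite ler_wpM2r ?sqr_ge0// /C sqr_sqrtr ?(ltW s0)//; move: (K1 R d) => z; apply: eq_ler.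
    by field; rewrite !gt_eqF// rho0.
  apply: (le_trans (ler_wpM2l C0 (ST_dheat a0 ab i gam0 Xsig))).
  rewrite /C !(exprMn, exprVn) L2_sqr g2 sqrt2_sqr p2; move: (K1 R d) (\int[mu]_x _) => z y.
  by apply: eq_ler; field; rewrite !gt_eqF// rho0.
- have r20 : 0 < (1 - rho) / 2 by rewrite divr_gt0// rho1.
  have t3 : tame (fun s x => dheat k ((1 - rho) / 2 * s) g x ^+ 2).
    by apply: tame_sqr; exact: tame_scale r20 (tame_dheat k Xg).
  pose C := 2 * K1 R d ^+ 2 / (1 - rho).
  have C0 : 0 <= C by rewrite divr_ge0 ?mulr_ge0 ?sqr_ge0 ?(ltW rho1).
  apply: (@le_trans _ _ (C * ST (fun s x => dheat k ((1 - rho) / 2 * s) g x ^+ 2))).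
    apply: le_trans (eq_ler (STZ b a0 C t3)).
    apply: (ST_le a0 (tame_sqr t2) (tameZ C t3)) => s /andP[as_ _]; have s0 : 0 < s by exact: lt_le_trans as_.
    have qs0 : 0 < (1 - rho) * s by rewrite mulr_gt0// rho1.
    have -> : \int[mu]_x (Num.sqrt s * ddheat k i ((1 - rho) * s) g x) ^+ 2 =
        s * \int[mu]_x ddheat k i ((1 - rho) * s) g x ^+ 2.
      rewrite -RintZ; last by apply: bint_sqr; exact: bint_ddheat.
      by apply: eq_Rint => x; rewrite exprMn sqr_sqrtr// ltW.
    apply: (le_trans (ler_wpM2l (ltW s0) (ddheat_L2 k i qs0 Xg))).
    rewrite RintZ; last by apply: bint_intg; exact: tame_bint t3 s0.
    rewrite mulrA (_ : (1 - rho) * s / 2 = (1 - rho) / 2 * s); last by rewrite mulrAC.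
    rewrite ler_wpM2r//; first by apply: Rint_ge0 => x; exact: sqr_ge0.
    rewrite /C; move: (K1 R d) => z; apply: eq_ler.
    by field; rewrite !gt_eqF// rho1.
  apply: (le_trans (ler_wpM2l C0 (ST_dheat a0 ab k r20 Xg))).
  rewrite /C !(exprMn, exprVn) L2_sqr sqrt2_sqr q2; move: (K1 R d) (\int[mu]_x _) => z y.
  by apply: eq_ler; field; rewrite !gt_eqF// rho1.
Qed.

(** With a single derivative on [sig] the singularity is only [gam^(-1/2)], integrable at 0, at the
    price of one more factor 1/p or 1/q. *)
Lemma trilT'_grad gam : 0 < gam ->
  `|trilT' gam| <= d%:R * (K2 R d / (2 * p ^+ 2 * q) + K1 R d ^+ 2 / (p * q ^+ 2)) * E / Num.sqrt gam.
Proof.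
move=> gam0; have g0 : 0 < Num.sqrt gam by rewrite sqrtr_gt0.
rewrite trilT'E//; apply: (le_trans (ler_norm_sum _ _ _)).
have -> : d%:R * (K2 R d / (2 * p ^+ 2 * q) + K1 R d ^+ 2 / (p * q ^+ 2)) * E / Num.sqrt gam =
    \sum_(i < d) (K2 R d * E / (2 * p ^+ 2 * q * Num.sqrt gam) +
                  K1 R d ^+ 2 * E / (p * q ^+ 2 * Num.sqrt gam)).
  rewrite sumr_const card_ord -[RHS]mulr_natl; move: (K1 R d) (K2 R d) => y z.
  by field; rewrite !gt_eqF ?p0 ?q0.
apply: ler_sum => i _; rewrite (grad_ibp i gam0) normrN.
exact: (le_trans (ler_normD _ _) (lerD (grad_A i gam0) (grad_B i gam0))).
Qed.

(** By self-adjointness the regularisation is transferred from [sig] to the product of [v] and [w],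
    which is Lipschitz uniformly for [s] in [[a, b]]. The constant depends on [a] and [b], but it
    disappears as [gam -> 0]. *)
Let tril_lim : exists2 C : R, 0 <= C & forall gam, 0 < gam ->
  `|tril rho j k g sig th - trilT gam| <= C * Num.sqrt gam.
Proof.
pose F s x := v s x * w s x.
pose F' i s x := ddheat j i (rho * s) th x * w s x + v s x * ddheat k i ((1 - rho) * s) g x.
have tF : tame F by exact: tameM.
have tF' (i : 'I_d) : tame (F' i).
  apply: tameD; apply: tameM => //; first exact: tame_scale rho0 (tame_ddheat j i Xth).
  exact: tame_scale rho1 (tame_ddheat k i Xg).
have [L L0 FL] : exists2 L : R, 0 <= L & forall i s x, a <= s <= b -> `|F' i s x| <= L.
  have /choice[B hB] : forall i : 'I_d, exists B : R, 0 <= B /\ forall s x, a <= s <= b -> `|F' i s x| <= B.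
    move=> i; have [_ _ /(_ a b a0 ab)[H XH hH]] := tF' i.
    have [B B0 HB] := bint_bound XH; exists B; split=> // s x ss.
    by apply: (le_trans (hH _ _ ss)); apply: le_trans (HB x); exact: ler_norm.
  exists (\sum_(i < d) B i); first by apply: sumr_ge0 => i _; case: (hB i).
  move=> i s x ss; apply: (le_trans ((hB i).2 s x ss)).
  by rewrite (bigD1 i)//= lerDl sumr_ge0// => l _; case: (hB l).
pose D := L * (d%:R * (2 * K1 R d)) * Num.sqrt b.
have D0 : 0 <= D by rewrite mulr_ge0 ?sqrtr_ge0// mulr_ge0// mulr_ge0// mulr_ge0.
pose N := \int[mu]_x `|sig x|.
have N0 : 0 <= N by apply: Rint_ge0 => x; exact: normr_ge0.
have XG : bint (@Gk R d 1).
  split; [exact: measurable_Gk| |exact: intg_Gk].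
  by exists (Gsup d 1) => x; rewrite gtr0_norm ?Gk_gt0// Gk_le_sup.
(* A bound that is constant in [s] is written as the space integral of [eps * Gk 1], the Gaussian
   having mass one, so that the comparison lemmas for [ST] apply. *)
pose c0 := ST (fun=> Gk 1).
have c00 : 0 <= c0 by apply: (ST_ge0 b a0) => s x _; exact/ltW/Gk_gt0.
exists (N * D * c0) => [|gam gam0]; first by rewrite mulr_ge0// mulr_ge0.
have t1 : tame (fun s x => sig x * F s x) by apply: tameM => //; exact: tame_cst.
have t2 : tame (fun s x => heat (gam * s) sig x * F s x).
  by apply: tameM => //; exact: tame_scale gam0 (tame_heat Xsig).
pose eps := N * D * Num.sqrt gam.
have t3 : tame (fun (_ : R) x => eps * Gk 1 x) by apply: tameZ; exact: tame_cst.
have e3 : ST (fun (_ : R) x => eps * Gk 1 x) = N * D * c0 * Num.sqrt gam.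
  by rewrite (STZ b a0 eps (tame_cst XG)) /eps -/c0; ring.
have key s : a <= s <= b -> `|\int[mu]_x (sig x * F s x) - \int[mu]_x (heat (gam * s) sig x * F s x)| <= eps.
  move=> ss; have s0 : 0 < s by case/andP: ss => as_ _; exact: lt_le_trans as_.
  have gs0 : 0 < gam * s by rewrite mulr_gt0.
  have XF := tame_bint tF s0; have XhF := bint_heat gs0 XF.
  rewrite (heat_selfadj gs0 Xsig XF) -RintB; [|exact: bint_mul_intg|exact: bint_mul_intg].
  have rs0 : 0 < rho * s by rewrite mulr_gt0// rho0.
  have qs0 : 0 < (1 - rho) * s by rewrite mulr_gt0// rho1.
  have lipF : lip L (F s).
    apply: (@lip_der _ _ _ (fun i => F' i s)) => // i x; last exact: FL.
    by apply: derM; exact: dheat_derive.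
  have -> : eps = \int[mu]_x (D * Num.sqrt gam * `|sig x|).
    rewrite RintZ -/N; last by apply: intg_norm; exact: bint_intg.
    by rewrite /eps; ring.
  apply: Rint_norm_le.
  - by apply: intgB; exact: bint_mul_intg.
  - by apply: intgZ; apply: intg_norm; exact: bint_intg.
  move=> x; rewrite -mulrBr normrM mulrC; apply: ler_wpM2r => //; rewrite distrC.
  apply: (le_trans (heat_approx x gs0 XF L0 lipF)); rewrite /D -[leRHS]mulrA.
  apply: ler_wpM2l; first by rewrite mulr_ge0// mulr_ge0// mulr_ge0.
  rewrite -sqrtrM ?(le_trans (ltW a0))//; apply: ler_wsqrtr.
  by rewrite mulrC; apply: ler_wpM2r; [exact: ltW|case/andP: ss].
rewrite -e3 ler_norml; apply/andP; split.
  rewrite lerNl opprB lerBlDl /tril /trilT -(STD b a0 t1 t3); apply: ST_le => //; first exact: tameD.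
  move=> s ss; have s0 : 0 < s by case/andP: ss => as_ _; exact: lt_le_trans as_.
  rewrite RintD; [|exact: bint_intg (tame_bint t1 s0)|exact: bint_intg (tame_bint t3 s0)].
  rewrite RintZ ?Rint_Gk ?intg_Gk// mulr1.
  by have := key s ss; rewrite ler_norml => /andP[+ _]; rewrite lerNl opprB lerBlDl.
rewrite lerBlDl /tril /trilT -(STD b a0 t2 t3); apply: ST_le => //; first exact: tameD.
move=> s ss; have s0 : 0 < s by case/andP: ss => as_ _; exact: lt_le_trans as_.
rewrite RintD; [|exact: bint_intg (tame_bint t2 s0)|exact: bint_intg (tame_bint t3 s0)].
rewrite RintZ ?Rint_Gk ?intg_Gk// mulr1.
by have := key s ss; rewrite ler_norml => /andP[_]; rewrite lerBlDl.
Qed.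

Lemma ler_sqrt_eps (X C B m : R) : 0 <= C -> 0 < m ->
  (forall gam, 0 < gam <= m -> X <= C * Num.sqrt gam + B) -> X <= B.
Proof.
move=> C0 m0 h; apply/ler_addgt0Pr => e e0.
have C1 : 0 < C + 1 by rewrite ltr_wpDl.
pose y := (e / (C + 1)) ^+ 2.
have y0 : 0 < y by rewrite exprn_gt0// divr_gt0.
have /h hh : 0 < Num.min m y <= m by rewrite lt_min m0 y0 ge_min lexx.
apply: (le_trans hh); rewrite [leRHS]addrC lerD2r.
apply: (@le_trans _ _ (C * (e / (C + 1)))).
  apply: ler_wpM2l => //; rewrite -[leRHS]ger0_norm ?(ltW (divr_gt0 _ _))// -sqrtr_sqr.
  by apply: ler_wsqrtr; rewrite ge_min lexx orbT.
by rewrite mulrA ler_pdivrMr// mulrC ler_wpM2l// ?(ltW e0)// lerDl.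
Qed.

(** Integrating [gam^(-1/2)] up to [m] yields [2 * Num.sqrt m], and [Num.sqrt m <= p, q] cancels
    exactly the extra factor 1/p or 1/q of [trilT'_grad]. *)
Let trilT_grad (m gam : R) : 0 < gam -> gam <= m -> m <= rho -> m <= 1 - rho ->
  `|trilT m - trilT gam| <= d%:R * (K2 R d + 2 * K1 R d ^+ 2) * E / (p * q).
Proof.
move=> gam0 gm mp mq; have m0 : 0 < m by exact: lt_le_trans gm.
pose C := d%:R * (K2 R d / (2 * p ^+ 2 * q) + K1 R d ^+ 2 / (p * q ^+ 2)) * E.
have E0 : 0 <= E by rewrite mulr_ge0 ?mulr_ge0 ?sqrtr_ge0.
have C0 : 0 <= C.
  apply: mulr_ge0 E0; apply: mulr_ge0 => //; apply: addr_ge0.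
    exact: divr_ge0 K2_0 (mulr_ge0 (mulr_ge0 (ler0n _ 2) (sqr_ge0 _)) (sqrtr_ge0 _)).
  exact: divr_ge0 (sqr_ge0 _) (mulr_ge0 (sqrtr_ge0 _) (sqr_ge0 _)).
have h : `|trilT m - trilT gam| <= 2 * C * Num.sqrt m - 2 * C * Num.sqrt gam.
  have D1 (x : R) : gam <= x <= m -> is_derive x 1 trilT (trilT' x).
    by move=> /andP[gx _]; apply: trilT_der; exact: lt_le_trans gx.
  have D2 (x : R) : gam <= x <= m ->
      is_derive x 1 (fun y : R => 2 * C * Num.sqrt y) (2 * C * (2 * Num.sqrt x)^-1).
    by move=> /andP[gx _]; apply: derZ; apply: is_derive1_sqrt; exact: lt_le_trans gx.
  apply: (norm_diff_le gm D1 D2) => x /andP[gx _]; have x0 : 0 < x by exact: lt_le_trans gx.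
  apply: (le_trans (trilT'_grad x0)); rewrite -/C; apply: eq_ler.
  by field; rewrite gt_eqF// sqrtr_gt0.
apply: (le_trans h); apply: (@le_trans _ _ (2 * C * Num.sqrt m)).
  by rewrite gerBl mulr_ge0 ?sqrtr_ge0// mulr_ge0.
have mp' : Num.sqrt m <= p by exact: ler_wsqrtr.
have mq' : Num.sqrt m <= q by exact: ler_wsqrtr.
have -> : 2 * C * Num.sqrt m = d%:R * E * (K2 R d / (p ^+ 2 * q) * Num.sqrt m + 2 * K1 R d ^+ 2 / (p * q ^+ 2) * Num.sqrt m).
  rewrite /C; move: (K1 R d) (K2 R d) => y z; by field; rewrite !gt_eqF ?p0 ?q0.
have -> : d%:R * (K2 R d + 2 * K1 R d ^+ 2) * E / (p * q) =
    d%:R * E * (K2 R d / (p ^+ 2 * q) * p + 2 * K1 R d ^+ 2 / (p * q ^+ 2) * q).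
  move: (K1 R d) (K2 R d) => y z; by field; rewrite !gt_eqF ?p0 ?q0.
apply: ler_wpM2l; first by rewrite mulr_ge0.
apply: lerD; apply: ler_wpM2l => //; rewrite divr_ge0 ?mulr_ge0 ?sqr_ge0 ?sqrtr_ge0//.
Qed.

(** Sum of three contributions: [d (K2 + 2 K1^2)] for [gam] below the minimum of [rho] and
    [1 - rho], [4 d K1^2] between this minimum and [rho], and 2 for the Carleson estimate at
    [gam = rho]. *)
Definition trilC : R := d%:R * (K2 R d + 6 * K1 R d ^+ 2) + 2.

Lemma tril_two : `|tril rho j k g sig th| <=
  trilC * (L2 sig * M * L2 g) / (p * q * Num.sqrt q).
Proof.
have E0 : 0 <= E by rewrite mulr_ge0 ?mulr_ge0 ?sqrtr_ge0.
have [C C0 hC] := tril_lim.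
(* The path in [gam] goes from [rho] to [m] with the bound in [gam^-1], and from [m] to 0 with the
   bound in [gam^(-1/2)]. The first piece is nontrivial only for [rho > 1 - rho]. *)
pose m := Num.min rho (1 - rho).
have m0 : 0 < m by rewrite lt_min rho0 rho1.
have mp : m <= rho by rewrite ge_min lexx.
have mq : m <= 1 - rho by rewrite ge_min lexx orbT.
pose r := Num.sqrt q; have r0 : 0 < r by rewrite sqrtr_gt0 q0.
have r1 : r <= 1.
  rewrite /r -[leRHS]sqrtr1; apply: ler_wsqrtr; rewrite -[leRHS]sqrtr1; apply: ler_wsqrtr.
  by rewrite gerBl; exact: ltW rho0.
have lap : `|trilT rho - trilT m| <= d%:R * K1 R d ^+ 2 * E / (p * q) * (4 / r).
  have [h|h] := leP rho (1 - rho).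
    rewrite /m min_l// subrr normr0 mulr_ge0// ?divr_ge0 ?mulr_ge0 ?sqr_ge0 ?sqrtr_ge0//.
  rewrite /m min_r ?(ltW h)//.
  pose D := d%:R * K1 R d ^+ 2 * E / (p * q).
  have D0 : 0 <= D by rewrite divr_ge0 ?mulr_ge0 ?sqr_ge0 ?sqrtr_ge0.
  apply: (@le_trans _ _ (D * ln rho - D * ln (1 - rho))).
    have D1 (x : R) : 1 - rho <= x <= rho -> is_derive x 1 trilT (trilT' x).
      by move=> /andP[gx _]; apply: trilT_der; exact: lt_le_trans rho1 gx.
    have D2 (x : R) : 1 - rho <= x <= rho -> is_derive x 1 (fun y : R => D * ln y) (D * x^-1).
      by move=> /andP[gx _]; apply: derZ; apply: is_derive1_ln; exact: lt_le_trans rho1 gx.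
    apply: (norm_diff_le (ltW h) D1 D2) => x /andP[gx _].
    by apply: trilT'_lap; exact: lt_le_trans rho1 gx.
  rewrite -mulrBr; apply: ler_wpM2l => //.
  (* The logarithm of [rho / (1 - rho)] is at most [- 4 * ln r <= 4 / r]. This is the origin of the
     additional factor [Num.sqrt q] in the denominator. *)
  have e4 : 1 - rho = r ^+ 4 by rewrite -q2 -[q](@sqr_sqrtr _ q) ?sqrtr_ge0// -exprM.
  have l1 : ln rho <= 0 by apply: ln_le0; case/andP: rho01 => _ /ltW.
  have l2 : ln r^-1 < r^-1 by apply: ln_sublinear; rewrite invr_gt0.
  rewrite lnV ?posrE// in l2.
  rewrite e4 lnXn// -[ln r *+ 4]mulr_natl lerBlDr (le_trans l1)// -mulrDr mulr_ge0//.
  by rewrite -lerBlDr sub0r ltW.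
pose B := trilC * E / (p * q * r).
apply: (@ler_sqrt_eps _ C B m) => // gam /andP[gam0 gm].
have h1 := hC _ gam0; have h2 := trilT_grad gam0 gm mp mq.
have h3 := tril_carleson; rewrite -/E in h3.
apply: (le_trans (norm_telescope _ (trilT gam) (trilT m) (trilT rho))).
rewrite -!addrA; apply: lerD h1 _.
apply: (@le_trans _ _ (d%:R * (K2 R d + 2 * K1 R d ^+ 2) * E / (p * q) * r^-1 +
   (d%:R * K1 R d ^+ 2 * E / (p * q) * (4 / r) + 2 * E / (p * q) * r^-1))).
  have r1' : 1 <= r^-1 by rewrite invf_ge1.
  apply: lerD.
    apply: (le_trans h2); rewrite ler_peMr//.
    by apply: (le_trans _ h2).
  apply: lerD lap _; apply: (le_trans h3); rewrite ler_peMr//.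
  by rewrite divr_ge0 ?mulr_ge0 ?sqrtr_ge0.
rewrite /B /trilC; move: (K1 R d) (K2 R d) => y z; apply: eq_ler.
by field; rewrite !gt_eqF ?p0 ?q0.
Qed.

End weight.
End trilinear.

(** * Interpolation *)

Section interpolation.
Context (R : realType) (d : nat).
Local Notation mu := (lebesgue_rV R d).
Local Notation L2 f := (Num.sqrt (\int[mu]_x f x ^+ 2)).
Implicit Types (f g S T : 'rV[R]_d -> R).

(** The square is summed by diagonals: the index [m] collects [j - i = m] and [i - j = m.+1], so
    that the main diagonal is counted once. *)
Lemma sum_square_diag (V : zmodType) (F : nat -> nat -> V) (n : nat) :
  \sum_(i < n) \sum_(j < n) F i j =
  \sum_(m < n) (\sum_(i < n - m) F i (i + m)%N + \sum_(i < n - m.+1) F (i + m.+1)%N i).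
Proof.
elim: n => [|n IH]; first by rewrite !big_ord0.
have -> : \sum_(i < n.+1) \sum_(j < n.+1) F i j =
    \sum_(i < n) \sum_(j < n) F i j + (\sum_(i < n.+1) F i n + \sum_(j < n) F n j).
  rewrite big_ord_recr/= (eq_bigr (fun i : 'I_n => \sum_(j < n) F i j + F i n)); last first.
    by move=> i _; rewrite big_ord_recr.
  by rewrite big_split/= !big_ord_recr/= -!addrA; congr (_ + (_ + _)); rewrite addrC.
have hA : \sum_(m < n.+1) \sum_(i < n.+1 - m) F i (i + m)%N =
    \sum_(m < n) \sum_(i < n - m) F i (i + m)%N + \sum_(i < n.+1) F i n.
  rewrite (eq_bigr (fun m : 'I_n.+1 => \sum_(i < n - m) F i (i + m)%N + F (n - m)%N n)).
    rewrite big_split/= big_ord_recr/= subnn big_ord0 addr0; congr (_ + _).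
    rewrite [RHS](reindex_inj rev_ord_inj)/=.
    by apply: eq_bigr => i _; rewrite subSS.
  by move=> m _; rewrite subSn ?leq_ord// big_ord_recr/= subnK// leq_ord.
have hB : \sum_(m < n.+1) \sum_(i < n.+1 - m.+1) F (i + m.+1)%N i =
    \sum_(m < n) \sum_(i < n - m.+1) F (i + m.+1)%N i + \sum_(j < n) F n j.
  rewrite big_ord_recr/= subnn big_ord0 addr0 [X in _ + X](reindex_inj rev_ord_inj)/= -big_split/=.
  by apply: eq_bigr => m _; rewrite subSn// big_ord_recr/= subnK.
by rewrite !big_split/= hA hB IH big_split/= addrACA.
Qed.

Variable beta : ('rV[R]_d -> R) -> ('rV[R]_d -> R) -> R.
Hypothesis betaDl : forall f f' g, bint f -> bint f' -> bint g ->
  beta (fun x => f x + f' x) g = beta f g + beta f' g.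
Hypothesis betaDr : forall f g g', bint f -> bint g -> bint g' ->
  beta f (fun x => g x + g' x) = beta f g + beta f g'.
Hypothesis betaZl : forall (k : R) f g, bint f -> bint g -> beta (fun x => k * f x) g = k * beta f g.
Hypothesis betaZr : forall (k : R) f g, bint f -> bint g -> beta f (fun x => k * g x) = k * beta f g.

Lemma beta_0l g : bint g -> beta (fun=> 0) g = 0.
Proof.
move=> Xg; have e := betaZl 0 (bint0 R d) Xg; rewrite [RHS]mul0r in e.
by rewrite -[RHS]e; congr (beta _ _); apply/funext => x; rewrite mul0r.
Qed.

Lemma beta_0r f : bint f -> beta f (fun=> 0) = 0.
Proof.
move=> Xf; have e := betaZr 0 Xf (bint0 R d); rewrite [RHS]mul0r in e.
by rewrite -[RHS]e; congr (beta _ _); apply/funext => x; rewrite mul0r.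
Qed.

(* The average over the signs of [beta (S + s) (T + t)] and
   [beta (S - s) (T - t)] kills the off-diagonal terms. *)
Lemma beta_signs (B : R) n (s t : 'I_n -> 'rV[R]_d -> R) S T :
  (forall i, bint (s i)) -> (forall i, bint (t i)) -> bint S -> bint T ->
  (forall e : 'I_n -> bool, `|beta (fun x => S x + \sum_(i < n) (-1) ^+ e i * s i x)
     (fun x => T x + \sum_(i < n) (-1) ^+ e i * t i x)| <= B) ->
  `|beta S T + \sum_(i < n) beta (s i) (t i)| <= B.
Proof.
elim: n s t S T => [|n IH] s t S T Xs Xt XS XT h.
  have := h (fun=> false); rewrite big_ord0 addr0; congr (`|beta _ _| <= _);
  by apply/funext => x; rewrite big_ord0 addr0.
have step (b : bool) : `|beta (fun x => S x + (-1) ^+ b * s ord0 x) (fun x => T x + (-1) ^+ b * t ord0 x)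
    + \sum_(i < n) beta (s (lift ord0 i)) (t (lift ord0 i))| <= B.
  apply: IH => //; [by apply: bintD => //; exact: bintZ|by apply: bintD => //; exact: bintZ|].
  move=> e; have := h (fun i => if unlift ord0 i is Some j then e j else b).
  congr (`|beta _ _| <= _); apply/funext => x; rewrite big_ord_recl unlift_none addrA; congr (_ + _);
  by apply: eq_bigr => i _; rewrite liftK.
have := step true; have := step false; rewrite expr0 expr1.
rewrite !(betaDl, betaDr, betaZl, betaZr)//; try (by exact: bintZ); try (by apply: bintD => //; exact: bintZ).
rewrite big_ord_recl !mul1r.
set p := beta S T; set q := beta _ T; set r := beta S _; set u := beta _ _; set v := \sum_(i < n) _.
by rewrite !ler_norml => /andP[? ?] /andP[? ?]; apply/andP; split; lra.
Qed.

Variable K : R.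
Hypothesis K0 : 0 <= K.
Hypothesis beta_inf : forall f g (M : R), bint f -> bint g -> (forall x, `|f x| <= M) ->
  `|beta f g| <= K * (M * L2 g).
Hypothesis beta_two : forall f g (M : R), bint f -> bint g -> (forall x, `|g x| <= M) ->
  `|beta f g| <= K * (L2 f * M).

(** At most one term survives, hence neither the signs nor the number of terms matter. The terms
    will be the pieces of a function on disjoint level sets, evaluated at a point. *)
Lemma sum_disjoint n (P : 'I_n -> bool) (F : 'I_n -> R) (e : 'I_n -> bool) (B : R) :
  0 <= B -> (forall i j, P i -> P j -> i = j) -> (forall i, P i -> `|F i| <= B) ->
  `|\sum_(i < n) (-1) ^+ e i * ((P i)%:R * F i)| <= B.
Proof.
move=> B0 Pi FB; have [[i Pi0]|nP] := pselect (exists i, P i).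
  rewrite (bigD1 i)//= big1 ?addr0.
    by rewrite Pi0 mul1r normrM normrX normrN1 expr1n mul1r FB.
  move=> j ji; case Pj : (P j); last by rewrite mul0r mulr0.
  by rewrite (Pi _ _ Pj Pi0) eqxx in ji.
rewrite big1 ?normr0// => i _; case Pj : (P i); last by rewrite mul0r mulr0.
by exfalso; apply: nP; exists i.
Qed.

Lemma L2_le f (h : 'rV[R]_d -> R) (B : R) : bint f -> intg mu h -> 0 <= B ->
  (forall x, f x ^+ 2 <= B ^+ 2 * h x) -> \int[mu]_x h x <= 1 -> L2 f <= B.
Proof.
move=> Xf ih B0 fh h1; rewrite -(ger0_norm B0) -sqrtr_sqr; apply: ler_wsqrtr.
apply: (@le_trans _ _ (B ^+ 2 * \int[mu]_x h x)).
  by rewrite -RintZ//; apply: Rint_le => //; [exact: bint_sqr|exact: intgZ].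
by rewrite ler_piMr// sqr_ge0.
Qed.

Section normalized.
Variables (p r : R) (f g : 'rV[R]_d -> R).
Hypotheses (p2 : 2 < p) (pr : p <= r) (hpr : p^-1 + r^-1 = 2^-1).
Hypotheses (Xf : bint f) (Xg : bint g).
Hypothesis nf : \int[mu]_x (`|f x| `^ p) <= 1.
Hypothesis ng : \int[mu]_x (`|g x| `^ r) <= 1.

Let pp0 : 0 < p. Proof. exact: lt_trans p2. Qed.
Let rr0 : 0 < r. Proof. exact: lt_le_trans pp0 pr. Qed.

Lemma intg_powR (h : 'rV[R]_d -> R) (t : R) : 2 <= t -> bint h ->
  intg mu (fun x => `|h x| `^ t).
Proof.
move=> t2 Xh; have [M M0 hM] := bint_bound Xh.
apply: (@intg_le _ _ _ _ _ (fun x => M `^ (t - 2) * h x ^+ 2)).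
- apply: (measurableT_comp (measurable_powR t)).
  by apply: measurableT_comp => //; exact: bint_measurable.
- move=> x; rewrite ger0_norm ?powR_ge0// -real_normK ?num_real// -powR_mulrn//.
  have [->|h0] := eqVneq `|h x| 0.
    by rewrite powR0 ?powR0 ?mulr0// gt_eqF// (lt_le_trans _ t2).
  have -> : `|h x| `^ t = `|h x| `^ (t - 2) * `|h x| `^ 2.
    by rewrite -powRD ?subrK// h0 implybT.
  apply: ler_wpM2r; first exact: powR_ge0.
  by apply: ge0_ler_powR; rewrite ?nnegrE ?subr_ge0.
- by apply: intgZ; exact: bint_sqr.
Qed.

Variables (J : R).
Hypotheses (J0 : 0 < J) (fJ : forall x, `|f x| `^ (p / r) <= J) (gJ : forall x, `|g x| <= J).

(** Dyadic thresholds below a common upper bound [J] of the two functions that are sliced; [J]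
    leaves no trace in the final estimate. *)
Let A (i : nat) : R := J / 2 ^+ i.
Let A0 i : 0 < A i. Proof. by rewrite divr_gt0// exprn_gt0. Qed.
Let AS i : A i = 2 * A i.+1.
Proof. by rewrite /A exprS invfM mulrCA !mulrA mulfK. Qed.
Let Amono i j : (i <= j)%N -> A j <= A i.
Proof. by move=> ij; rewrite ler_pM2l// lef_pV2 ?posrE ?exprn_gt0// ler_weXn2l// ler1n. Qed.

Let level (z : R) i : bool := A i.+1 < z <= A i.
Let level_uniq z i j : level z i -> level z j -> i = j.
Proof.
wlog ij : i j / (i < j)%N => [H hi hj|].
  by have [ij|ji|//] := ltngtP i j; [exact: H|apply/esym; exact: H].
move=> /andP[h1 _] /andP[_ h2]; have := le_lt_trans h2 (le_lt_trans (Amono ij) h1).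
by rewrite ltxx.
Qed.

(** The levels of [f] are those of |f|^(p/r): its r-th power is |f|^p, so it has the same
    homogeneity as |g|, and the difference of the indices of two levels measures how far the pair is
    from the extremal case. *)
Let ff x : R := `|f x| `^ (p / r).
Let fl i x : R := (level (ff x) i)%:R * f x.
Let gl i x : R := (level `|g x| i)%:R * g x.

Let measurable_level (h : 'rV[R]_d -> R) i : measurable_fun [set: 'rV[R]_d] h ->
  measurable_fun [set: 'rV[R]_d] (fun x => (level (h x) i)%:R : R).
Proof.
move=> mh; rewrite (_ : (fun _ => _) = (fun x => \1_(`]A i.+1, A i]%classic) (h x))).
  by apply: measurableT_comp => //; apply: measurable_indic; exact: measurable_itv.
apply/funext => x; rewrite indicE; congr (_%:R); congr nat_of_bool.
by apply/idP/idP; rewrite inE/= in_itv.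
Qed.

Let level_le1 z i : `|(level z i)%:R : R| <= 1.
Proof. by case: level; rewrite ?normr1// normr0. Qed.

Let Xfl i : bint (fl i).
Proof.
apply: (bint_mull (M := 1)) => //; apply: measurable_level.
apply: (measurableT_comp (measurable_powR _)); apply: measurableT_comp => //.
exact: bint_measurable.
Qed.

Let Xgl i : bint (gl i).
Proof.
apply: (bint_mull (M := 1)) => //; apply: measurable_level.
by apply: measurableT_comp => //; exact: bint_measurable.
Qed.

Let rp1 : 1 <= r / p. Proof. by rewrite ler_pdivlMr// mul1r. Qed.
(** The relation between the exponents, in the form that makes |f|^(p/r) |f| equal to |f|^(p/2),
    whose L^2 norm is at most one. *)
Let expp : 2 * (p / r) + 2 = p.
Proof.
have -> : r^-1 = 2^-1 - p^-1 by rewrite -hpr addrC addKr.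
by field; rewrite gt_eqF.
Qed.
Let expr_ : 2 * (r / p) + 2 = r.
Proof.
have -> : p^-1 = 2^-1 - r^-1 by rewrite -hpr addrK.
by field; rewrite gt_eqF.
Qed.

Let sqr_pow (z t e : R) : 0 < z -> 2 * e + 2 = t -> (z `^ e) ^+ 2 * z ^+ 2 = z `^ t.
Proof.
move=> z0 <-; rewrite powRD; last by rewrite (gt_eqF z0) implybT.
by rewrite -!powR_mulrn ?powR_ge0// ?ltW// -powRrM (mulrC e).
Qed.

Let ff_gt0 x i : level (ff x) i -> 0 < `|f x|.
Proof.
move=> /andP[h _]; rewrite lt_neqAle normr_ge0 andbT eq_sym; apply/eqP => f0.
move: h; rewrite /ff f0 powR0; first by rewrite ltNge ltW.
by rewrite gt_eqF// divr_gt0.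
Qed.

Let fl_le x i : level (ff x) i -> `|f x| <= A i `^ (r / p).
Proof.
move=> h; have f0 := ff_gt0 h; case/andP: h => _ h.
have -> : `|f x| = ff x `^ (r / p).
  by rewrite /ff -powRrM mulrA divfK ?gt_eqF// divff ?gt_eqF// powRr1// ltW.
by apply: ge0_ler_powR => //; rewrite ?nnegrE ?powR_ge0//; [exact: ltW (divr_gt0 _ _)|exact: ltW].
Qed.

(** Here [g] is the smaller factor. After rescaling the pieces of [f] by [A i] and those of [g] by
    its inverse, the first are at most 2 |f|^(p/2) and the second at most 2^-m. [beta_signs] makes
    the whole diagonal a single pairing of such functions, to which [beta_two] applies. *)
Let diag_up m n : `|\sum_(i < n) beta (fl i) (gl (i + m)%N)| <= K * 2 / 2 ^+ m.
Proof.
have e : \sum_(i < n) beta (fl i) (gl (i + m)%N) =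
    beta (fun=> 0) (fun=> 0) + \sum_(i < n) beta (fun x => A i * fl i x) (fun x => (A i)^-1 * gl (i + m)%N x).
  have -> : beta (fun=> 0) (fun=> 0) = 0.
    by apply: beta_0l; exact: bint0.
  rewrite add0r; apply: eq_bigr => i _; rewrite betaZl//; last by apply: bintZ.
  by rewrite betaZr// mulrA divff ?mul1r// gt_eqF.
rewrite e; apply: beta_signs => [i|i|||s]; try exact: bintZ; try exact: bint0.
have E1 : (fun x => 0 + \sum_(i < n) (-1) ^+ s i * (A i * fl i x)) =
   (fun x => \sum_(i < n) (-1) ^+ s i * ((level (ff x) i)%:R * (A i * f x))).
  by apply/funext => x; rewrite add0r; apply: eq_bigr => i _; rewrite /fl (mulrCA (A i)).
have E2 : (fun x => 0 + \sum_(i < n) (-1) ^+ s i * ((A i)^-1 * gl (i + m)%N x)) =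
   (fun x => \sum_(i < n) (-1) ^+ s i * ((level `|g x| (i + m)%N)%:R * ((A i)^-1 * g x))).
  by apply/funext => x; rewrite add0r; apply: eq_bigr => i _; rewrite /gl (mulrCA (A i)^-1).
rewrite E1 E2.
have X1 : bint (fun x => \sum_(i < n) (-1) ^+ s i * ((level (ff x) i)%:R * (A i * f x))).
  by rewrite -E1; apply: bintD; [exact: bint0|apply: bint_sum => i; do 2 apply: bintZ].
have X2 : bint (fun x => \sum_(i < n) (-1) ^+ s i * ((level `|g x| (i + m)%N)%:R * ((A i)^-1 * g x))).
  by rewrite -E2; apply: bintD; [exact: bint0|apply: bint_sum => i; do 2 apply: bintZ].
have B2 x : `|\sum_(i < n) (-1) ^+ s i * ((level `|g x| (i + m)%N)%:R * ((A i)^-1 * g x))| <= 2 ^- m.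
  apply: sum_disjoint => [|i j hi hj|i /andP[_ h]]; first by rewrite invr_ge0 exprn_ge0.
    by apply/val_inj/(@addIn m); exact: level_uniq hi hj.
  rewrite normrM gtr0_norm ?invr_gt0// ler_pdivrMl//.
  by apply: (le_trans h); rewrite /A exprD invfM mulrA.
apply: (le_trans (beta_two X1 X2 B2)); rewrite -mulrA; apply: ler_wpM2l => //.
apply: ler_wpM2r; first by rewrite invr_ge0 exprn_ge0.
apply: (@L2_le _ (fun x => `|f x| `^ p)) => //; first by apply: intg_powR => //; exact: ltW.
move=> x; rewrite -[leLHS]real_normK ?num_real//.
have -> : 2 ^+ 2 * `|f x| `^ p = (2 * Num.sqrt (`|f x| `^ p)) ^+ 2.
  by rewrite exprMn sqr_sqrtr// powR_ge0.
have R0 : 0 <= 2 * Num.sqrt (`|f x| `^ p) by rewrite mulr_ge0 ?sqrtr_ge0.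
rewrite ler_sqr ?nnegrE//; apply: sum_disjoint => // [i j hi hj|i h].
  by apply/val_inj; exact: level_uniq hi hj.
have f0 := ff_gt0 h; rewrite normrM gtr0_norm// -(sqr_pow f0 expp) -exprMn sqrtr_sqr.
rewrite (ger0_norm (mulr_ge0 (powR_ge0 _ _) (normr_ge0 _))) mulrA; apply: ler_wpM2r => //.
by rewrite AS; case/andP: h => h _; rewrite ler_pM2l// ltW.
Qed.

(** Here [f] is the smaller factor and [beta_inf] is used. The pieces of [g] are at most 2^(r/p)
    |g|^(r/2), and the offset [m.+1] rather than [m] pays for 2^(r/p); what is left, 2^(-m r/p), is
    at most 2^-m because [p <= r]. *)
Let diag_down m n : `|\sum_(i < n) beta (fl (i + m.+1)%N) (gl i)| <= K / 2 ^+ m.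
Proof.
pose a i := A i `^ (r / p).
have a0 i : 0 < a i by rewrite powR_gt0.
have e : \sum_(i < n) beta (fl (i + m.+1)%N) (gl i) =
    beta (fun=> 0) (fun=> 0) + \sum_(i < n) beta (fun x => (a i)^-1 * fl (i + m.+1)%N x) (fun x => a i * gl i x).
  have -> : beta (fun=> 0) (fun=> 0) = 0.
    by apply: beta_0l; exact: bint0.
  rewrite add0r; apply: eq_bigr => i _; rewrite betaZl//; last by apply: bintZ.
  by rewrite betaZr// mulrA mulVf ?mul1r// gt_eqF.
rewrite e; apply: beta_signs => [i|i|||s]; try exact: bintZ; try exact: bint0.
have E1 : (fun x => 0 + \sum_(i < n) (-1) ^+ s i * ((a i)^-1 * fl (i + m.+1)%N x)) =
   (fun x => \sum_(i < n) (-1) ^+ s i * ((level (ff x) (i + m.+1)%N)%:R * ((a i)^-1 * f x))).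
  by apply/funext => x; rewrite add0r; apply: eq_bigr => i _; rewrite /fl (mulrCA (a i)^-1).
have E2 : (fun x => 0 + \sum_(i < n) (-1) ^+ s i * (a i * gl i x)) =
   (fun x => \sum_(i < n) (-1) ^+ s i * ((level `|g x| i)%:R * (a i * g x))).
  by apply/funext => x; rewrite add0r; apply: eq_bigr => i _; rewrite /gl (mulrCA (a i)).
rewrite E1 E2.
have X1 : bint (fun x => \sum_(i < n) (-1) ^+ s i * ((level (ff x) (i + m.+1)%N)%:R * ((a i)^-1 * f x))).
  by rewrite -E1; apply: bintD; [exact: bint0|apply: bint_sum => i; do 2 apply: bintZ].
have X2 : bint (fun x => \sum_(i < n) (-1) ^+ s i * ((level `|g x| i)%:R * (a i * g x))).
  by rewrite -E2; apply: bintD; [exact: bint0|apply: bint_sum => i; do 2 apply: bintZ].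
pose c : R := (2 ^- m.+1) `^ (r / p).
have c0 : 0 <= c by exact: powR_ge0.
have B1 x : `|\sum_(i < n) (-1) ^+ s i * ((level (ff x) (i + m.+1)%N)%:R * ((a i)^-1 * f x))| <= c.
  apply: sum_disjoint => [//|i j hi hj|i h].
    by apply/val_inj/(@addIn m.+1); exact: level_uniq hi hj.
  rewrite normrM gtr0_norm ?invr_gt0// ler_pdivrMl//.
  apply: (le_trans (fl_le h)); rewrite /a /c -powRM ?invr_ge0 ?exprn_ge0 ?(ltW (A0 _))//.
  by rewrite /A exprD invfM mulrA.
apply: (le_trans (beta_inf X1 X2 B1)); apply: ler_wpM2l => //.
apply: (@le_trans _ _ (c * 2 `^ (r / p))).
  apply: ler_wpM2l => //.
  apply: (@L2_le _ (fun x => `|g x| `^ r)) => //.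
  - by apply: intg_powR => //; apply: le_trans pr; exact: ltW.
  move=> x; rewrite -[leLHS]real_normK ?num_real//.
  have -> : (2 `^ (r / p)) ^+ 2 * `|g x| `^ r = (2 `^ (r / p) * Num.sqrt (`|g x| `^ r)) ^+ 2.
    by rewrite exprMn sqr_sqrtr// powR_ge0.
  have R0 : 0 <= 2 `^ (r / p) * Num.sqrt (`|g x| `^ r) by rewrite mulr_ge0 ?sqrtr_ge0 ?powR_ge0.
  rewrite ler_sqr ?nnegrE//; apply: sum_disjoint => // [i j hi hj|i /andP[h _]].
    by apply/val_inj; exact: level_uniq hi hj.
  have g0 : 0 < `|g x| by exact: lt_trans h.
  rewrite normrM gtr0_norm// -(sqr_pow g0 expr_) -exprMn sqrtr_sqr.
  rewrite (ger0_norm (mulr_ge0 (powR_ge0 _ _) (normr_ge0 _))) mulrA; apply: ler_wpM2r => //.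
  rewrite -powRM// /a AS; apply: ge0_ler_powR; rewrite ?nnegrE ?divr_ge0 ?mulr_ge0 ?(ltW pp0) ?(ltW rr0)//.
    exact: ltW.
  by rewrite ler_pM2l// ltW.
rewrite /c -powRM ?invr_ge0 ?exprn_ge0// exprS invfM mulrAC mulVf ?mul1r//.
rewrite -[leRHS]powRr1 ?invr_ge0 ?exprn_ge0//.
by apply: ger_powR; rewrite ?invr_gt0 ?exprn_gt0//= invf_le1 ?exprn_gt0// exprn_ege1// ler1n.
Qed.

Let geom n : \sum_(m < n) 2 ^- m <= 2 :> R.
Proof.
suff -> : \sum_(m < n) 2 ^- m = 2 - 2 * 2 ^- n :> R.
  by rewrite gerBl mulr_ge0// invr_ge0 exprn_ge0.
elim: n => [|n IH]; first by rewrite big_ord0 expr0 invr1 mulr1 subrr.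
by rewrite big_ord_recr/= IH exprS invfM; field; rewrite expf_neq0.
Qed.

Let levels_le n : `|beta (fun x => \sum_(i < n) fl i x) (fun x => \sum_(i < n) gl i x)| <= 6 * K.
Proof.
have sumL m (F : 'I_m -> 'rV[R]_d -> R) h : (forall i, bint (F i)) -> bint h ->
    beta (fun x => \sum_(i < m) F i x) h = \sum_(i < m) beta (F i) h.
  elim: m F => [|m IH] F XF Xh.
    rewrite big_ord0 -[RHS](beta_0l Xh).
    by congr (beta _ _); apply/funext => x; rewrite big_ord0.
  rewrite big_ord_recr/= -IH// -betaDl//; last exact: bint_sum.
  by congr (beta _ _); apply/funext => x; rewrite big_ord_recr.
have sumR m (F : 'I_m -> 'rV[R]_d -> R) h : (forall i, bint (F i)) -> bint h ->
    beta h (fun x => \sum_(i < m) F i x) = \sum_(i < m) beta h (F i).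
  elim: m F => [|m IH] F XF Xh.
    rewrite big_ord0 -[RHS](beta_0r Xh).
    by congr (beta _ _); apply/funext => x; rewrite big_ord0.
  rewrite big_ord_recr/= -IH// -betaDr//; last exact: bint_sum.
  by congr (beta _ _); apply/funext => x; rewrite big_ord_recr.
rewrite sumL//; last exact: bint_sum.
rewrite (eq_bigr (fun i : 'I_n => \sum_(j < n) beta (fl i) (gl j))); last by move=> i _; rewrite sumR.
rewrite (sum_square_diag (fun i j => beta (fl i) (gl j))).
apply: (le_trans (ler_norm_sum _ _ _)).
(* The upper diagonal contributes [2 * K] and the lower one [K]; the geometric series doubles the
   sum to [6 * K]. *)
apply: (@le_trans _ _ (\sum_(m < n) (3 * K * 2 ^- m))).
  apply: ler_sum => m _; apply: (le_trans (ler_normD _ _)).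
  by apply: (le_trans (lerD (diag_up _ _) (diag_down _ _))); apply: eq_ler; ring.
rewrite -mulr_sumr; have := ler_wpM2l (mulr_ge0 (ler0n R 3) K0) (geom n).
by move=> /le_trans; apply; apply: eq_ler; ring.
Qed.

Let residual (z : R) n : z <= J -> 0 <= z -> A n < z -> exists2 i : 'I_n, level z i & true.
Proof.
elim: n => [|n IH] zJ z0; first by rewrite /A expr0 divr1 ltNge zJ.
move=> h; have [h'|h'] := ltP (A n) z; first by have [i hi _] := IH zJ z0 h'; exists (widen_ord (leqnSn n) i).
by exists ord_max => //; apply/andP.
Qed.

Let residual_sum (z y : R) n : z <= J -> 0 <= z ->
  y - \sum_(i < n) (level z i)%:R * y = (z <= A n)%R%:R * y.
Proof.
move=> zJ z0; have [h|h] := leP z (A n).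
  rewrite mul1r big1 ?subr0// => i _; case E : (level z i); last by rewrite mul0r.
  move: E => /andP[h1 _]; have := le_lt_trans (le_trans h (Amono (ltn_ord i))) h1.
  by rewrite ltxx.
have [i hi _] := residual zJ z0 h.
rewrite mul0r (bigD1 i)//= hi mul1r big1 ?addr0 ?subrr// => j ji.
case E : (level z j); last by rewrite mul0r.
by rewrite (val_inj (level_uniq E hi)) eqxx in ji.
Qed.

Lemma interpolation_normalized : `|beta f g| <= 6 * K.
Proof.
apply/ler_addgt0Pr => e e0.
pose B := K * (L2 g + L2 f).
have B0 : 0 <= B by rewrite mulr_ge0 ?addr_ge0 ?sqrtr_ge0.
have [n hn] : exists n, A n <= 1 /\ A n * B <= e.
  pose X := J * (B / e + 1).
  have [n Xn] : exists n : nat, X <= 2 ^+ n.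
    exists (Num.truncn X).+1; apply: le_trans (ltW (truncnS_gt X)) _.
    by rewrite -natrX ler_nat ltnW// ltn_expl.
  have n0 : 0 < 2 ^+ n :> R by rewrite exprn_gt0.
  exists n; rewrite /A; split.
    rewrite ler_pdivrMr// mul1r; apply: le_trans Xn.
    by rewrite ler_peMr ?(ltW J0)// lerDr divr_ge0// ltW.
  rewrite mulrAC ler_pdivrMr// -ler_pdivrMl// mulrC; apply: le_trans Xn.
  by rewrite -mulrA ler_wpM2l ?(ltW J0)// lerDl.
pose F x := \sum_(i < n) fl i x; pose G x := \sum_(i < n) gl i x.
have XF : bint F by exact: bint_sum.
have XG : bint G by exact: bint_sum.
have fF x : f x - F x = (ff x <= A n)%R%:R * f x.
  by apply: residual_sum; [exact: fJ|exact: powR_ge0].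
have gG x : g x - G x = (`|g x| <= A n)%R%:R * g x by exact: residual_sum.
have e1 : f = (fun x => F x + (f x - F x)) by apply/funext => x; rewrite addrC subrK.
have e2 : g = (fun x => G x + (g x - G x)) by apply/funext => x; rewrite addrC subrK.
have -> : beta f g = beta F G + (beta F (fun x => g x - G x) + beta (fun x => f x - F x) g).
  have h1 := etrans (congr1 (beta ^~ g) e1) (betaDl XF (bintB Xf XF) Xg).
  have h2 := etrans (congr1 (beta F) e2) (betaDr XF XG (bintB Xg XG)).
  by rewrite addrA -h2.
apply: (le_trans (ler_normD _ _)); apply: lerD; first exact: levels_le.
apply: (le_trans (ler_normD _ _)); apply: le_trans hn.2.
have -> : A n * B = K * (L2 f * A n) + K * (A n * L2 g) by rewrite /B; ring.
apply: lerD.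
  have h : forall x, `|g x - G x| <= A n.
    by move=> x; rewrite gG; case: (leP `|g x| (A n)) => h; rewrite ?mul1r// mul0r normr0 ltW.
  apply: (le_trans (beta_two XF (bintB Xg XG) h)); apply: ler_wpM2l => //.
  apply: ler_wpM2r; first exact: ltW.
  apply: ler_wsqrtr; apply: Rint_le; [exact: bint_sqr|exact: bint_sqr|move=> x].
  have -> : F x = (~~ (ff x <= A n)%R)%:R * f x.
    have := fF x; case: (ff x <= A n) => /=; rewrite ?mul1r ?mul0r => h0.
      by apply/eqP; rewrite -(subr_eq0) -oppr_eq0; apply/eqP; move: h0; lra.
    by move: h0; lra.
  by case: (ff x <= A n); rewrite ?mul1r// mul0r expr0n/= sqr_ge0.
have h : forall x, `|f x - F x| <= A n.
  move=> x; rewrite fF; case: (leP (ff x) (A n)) => h; rewrite ?mul1r ?mul0r ?normr0; last exact: ltW.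
  have -> : `|f x| = ff x `^ (r / p).
    have [f0|f0] := eqVneq `|f x| 0.
      by rewrite /ff f0 !powR0// gt_eqF// divr_gt0.
    by rewrite /ff -powRrM mulrA divfK ?gt_eqF// divff ?gt_eqF// powRr1.
  apply: (@le_trans _ _ (A n `^ (r / p))).
    by apply: ge0_ler_powR => //; rewrite ?nnegrE ?powR_ge0//; [exact: ltW (divr_gt0 _ _)|exact: ltW].
  rewrite -[leRHS]powRr1 ?(ltW (A0 n))//; apply: ger_powR => //.
  by rewrite A0 hn.1.
by apply: (le_trans (beta_inf (bintB Xf XF) Xg h)).
Qed.

End normalized.

End interpolation.

(** * Lebesgue norms and the interpolated bound *)

Section Lq.
Context (R : realType) (d : nat).
Local Notation mu := (lebesgue_rV R d).
Local Notation L2 f := (Num.sqrt (\int[mu]_x f x ^+ 2)).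
Implicit Types (f g : 'rV[R]_d -> R).

(** A null measure would give the Gaussian integral 0 instead of 1. The norm of exponent [+oo] is an
    essential supremum only for a measure of positive mass, hence this fact is used to unfold it. *)
Lemma lebesgue_rV_gt0 : (0 < mu [set: 'rV[R]_d])%E.
Proof.
rewrite lt0e measure_ge0 andbT; apply/eqP => m0.
have := integral_Gk d (@ltr01 R).
rewrite null_set_integral//.
- by move=> /eqP; rewrite eq_sym onee_eq0.
- by apply/measurable_EFinP; exact: measurable_Gk.
Qed.

Lemma integral_powR_fin f (p : R) : 2 <= p -> bint f ->
  (\int[mu]_x (`|(f x)%:E| `^ p) = (\int[mu]_x (`|f x| `^ p))%:E)%E.
Proof. by move=> p2 Xf; rewrite EFin_Rint//; exact: intg_powR. Qed.

Lemma Lqnorm_powR f (p A : R) : 2 <= p -> bint f -> (Lqnorm p%:E f <= A%:E)%E ->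
  0 <= A /\ \int[mu]_x (`|f x| `^ p) <= A `^ p.
Proof.
move=> p2 Xf fA; have A0 : 0 <= A by rewrite -lee_fin (le_trans _ fA)// Lnorm_ge0.
split=> //; rewrite -lee_fin -integral_powR_fin// -poweR_EFin.
have p0 : p != 0 by rewrite gt_eqF// (lt_le_trans _ p2).
have -> : (\int[mu]_x (`|(f x)%:E| `^ p) = Lqnorm p%:E f `^ p)%E by rewrite poweR_Lnorm.
apply: gt0_ler_poweR => //; rewrite ?in_itv/= ?Lnorm_ge0 ?leey ?lee_fin ?A0//.
by rewrite (le_trans _ p2).
Qed.

Lemma Lqnorm_inf f (A : R) : bint f -> (Lqnorm +oo%E f <= A%:E)%E ->
  0 <= A /\ \forall x \ae mu, `|f x| <= A.
Proof.
move=> Xf fA; split; first by rewrite -lee_fin (le_trans _ fA)// Lnorm_ge0.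
move: fA; rewrite /Lqnorm unlock lebesgue_rV_gt0 => /ess_supP.
by apply: filterS => x; rewrite /= lee_fin.
Qed.

Lemma Lqnorm_two f (A : R) : bint f -> (Lqnorm 2%:E f <= A%:E)%E -> L2 f <= A.
Proof.
move=> Xf /(Lqnorm_powR (lexx _) Xf)[A0 h].
rewrite -(ger0_norm A0) -sqrtr_sqr; apply: ler_wsqrtr.
move: h; rewrite powR_mulrn//; congr (_ <= _); apply: eq_Rint => x.
by rewrite powR_mulrn// real_normK// num_real.
Qed.

Lemma ler_mul_eps (X c A B : R) : 0 <= c -> 0 <= A -> 0 <= B ->
  (forall e, 0 < e <= 1 -> X <= c * ((A + e) * (B + e))) -> X <= c * (A * B).
Proof.
move=> c0 A0 B0 h; apply/ler_addgt0Pr => e e0.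
pose D := c * (A + B + 1) + 1.
have D0 : 0 < D by rewrite ltr_wpDl// mulr_ge0// !addr_ge0.
pose e' := Num.min 1 (e / D).
have e'0 : 0 < e' by rewrite lt_min ltr01 divr_gt0.
have e'1 : e' <= 1 by rewrite ge_min lexx.
have e'2 : D * e' <= e by rewrite mulrC -ler_pdivlMr// ge_min lexx orbT.
apply: (le_trans (h e' _)); first by rewrite e'0.
have -> : c * ((A + e') * (B + e')) = c * (A * B) + c * (A + B + e') * e' by ring.
rewrite lerD2l; apply: le_trans e'2; apply: ler_wpM2r; first exact: ltW.
rewrite /D (le_trans (y := c * (A + B + 1)))//; last by rewrite lerDl.
by apply: ler_wpM2l => //; rewrite lerD2l.
Qed.

(** The bilinear bounds ask for a pointwise bound, whereas the norm of exponent [+oo] gives one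
    almost everywhere. Truncation changes the function by something of zero L^2 norm, which the form
    cannot detect by [beta_two]. *)
Lemma truncation f (A : R) : bint f -> 0 <= A -> (\forall x \ae mu, `|f x| <= A) ->
  exists f', [/\ bint f', forall x, `|f' x| <= A & \int[mu]_x (f x - f' x) ^+ 2 = 0].
Proof.
move=> Xf A0 fA; pose f' x := Num.min A (Num.max (- A) (f x)).
have mf' : measurable_fun [set: 'rV[R]_d] f'.
  apply: measurable_minr => //; apply: measurable_maxr => //; exact: bint_measurable.
have f'A x : `|f' x| <= A.
  rewrite /f' ler_norml ge_min lexx andbT le_min le_max lexx andbT.
  by rewrite (le_trans _ A0)// oppr_le0.
have f'f x : `|f' x| <= `|f x|.
  rewrite /f'; have [h|h] := leP (- A) (f x); last first.
    rewrite min_r ?(le_trans _ A0) ?oppr_le0// normrN ger0_norm// ltr0_norm.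
      by rewrite lerNr ltW.
    by apply: (lt_le_trans h); rewrite oppr_le0.
  have [h'|h'] := leP A (f x); last by [].
  by rewrite (ger0_norm A0) (le_trans h')// ler_norm.
exists f'; split=> //.
  split=> //; first by exists A.
  by apply: intg_le mf' f'f _; apply: intg_norm; exact: bint_intg.
rewrite /Rintegral (ae_eq_integral (cst 0%E)) ?integral0//.
  apply/measurable_EFinP; apply: measurable_funX; apply: measurable_funB => //.
  exact: bint_measurable.
apply: filterS fA => x h _ /=; congr EFin; rewrite /f'.
by move: h; rewrite ler_norml => /andP[h1 h2]; rewrite max_r// min_r// subrr expr0n.
Qed.

Section bilinear.
Variable beta : ('rV[R]_d -> R) -> ('rV[R]_d -> R) -> R.
Hypothesis betaDl : forall f f' g, bint f -> bint f' -> bint g ->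
  beta (fun x => f x + f' x) g = beta f g + beta f' g.
Hypothesis betaDr : forall f g g', bint f -> bint g -> bint g' ->
  beta f (fun x => g x + g' x) = beta f g + beta f g'.
Hypothesis betaZl : forall (k : R) f g, bint f -> bint g -> beta (fun x => k * f x) g = k * beta f g.
Hypothesis betaZr : forall (k : R) f g, bint f -> bint g -> beta f (fun x => k * g x) = k * beta f g.
Variable K : R.
Hypothesis K0 : 0 <= K.
Hypothesis beta_inf : forall f g (M : R), bint f -> bint g -> (forall x, `|f x| <= M) ->
  `|beta f g| <= K * (M * L2 g).
Hypothesis beta_two : forall f g (M : R), bint f -> bint g -> (forall x, `|g x| <= M) ->
  `|beta f g| <= K * (L2 f * M).

Lemma interpolation_inf f g (A B : R) : bint f -> bint g -> 0 <= A -> (\forall x \ae mu, `|f x| <= A) ->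
  L2 g <= B -> `|beta f g| <= K * (A * B).
Proof.
move=> Xf Xg A0 fA gB; have [f' [Xf' f'A f0]] := truncation Xf A0 fA.
have [M M0 gM] := bint_bound Xg.
have e1 : f = (fun x => f' x + (f x - f' x)) by apply/funext => x; rewrite addrC subrK.
have -> : beta f g = beta f' g.
  have := etrans (congr1 (beta ^~ g) e1) (betaDl Xf' (bintB Xf Xf') Xg); rewrite /= => ->.
  have := beta_two (bintB Xf Xf') Xg gM.
  by rewrite f0 sqrtr0 mul0r mulr0 normr_le0 => /eqP ->; rewrite addr0.
apply: (le_trans (beta_inf Xf' Xg f'A)); apply: ler_wpM2l => //.
exact: ler_wpM2l.
Qed.

Lemma interpolation_fin (p r : R) f g (A B : R) : 2 < p -> p <= r -> p^-1 + r^-1 = 2^-1 ->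
  bint f -> bint g -> 0 <= A -> 0 <= B ->
  \int[mu]_x (`|f x| `^ p) <= A `^ p -> \int[mu]_x (`|g x| `^ r) <= B `^ r ->
  `|beta f g| <= 6 * K * (A * B).
Proof.
move=> p2 pr hpr Xf Xg A0 B0 fA gB.
have p0 : 0 < p by exact: lt_trans p2.
have r0 : 0 < r by exact: lt_le_trans pr.
(* The functions are normalised by [A + e] and [B + e], since [A] or [B] may be 0. *)
apply: ler_mul_eps => //; first by rewrite mulr_ge0.
move=> e /andP[e0 _].
have A1 : 0 < A + e by rewrite ltr_wpDl.
have B1 : 0 < B + e by rewrite ltr_wpDl.
have norm1 h (t C : R) : 2 < t -> 0 <= C -> bint h -> \int[mu]_x (`|h x| `^ t) <= C `^ t ->
    \int[mu]_x (`|(C + e)^-1 * h x| `^ t) <= 1.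
  move=> t2 C0 Xh hC; have C1 : 0 < C + e by rewrite ltr_wpDl.
  have -> : \int[mu]_x (`|(C + e)^-1 * h x| `^ t) = ((C + e) `^ t)^-1 * \int[mu]_x (`|h x| `^ t).
    rewrite -RintZ; last by apply: intg_powR => //; exact: ltW.
    apply: eq_Rint => x; rewrite normrM powRM// gtr0_norm ?invr_gt0//.
    by rewrite -powR_inv1 ?(ltW C1)// -powRrM mulN1r powRN.
  rewrite ler_pdivrMl ?powR_gt0// mulr1; apply: (le_trans hC).
  by apply: ge0_ler_powR; rewrite ?nnegrE ?(ltW C1) ?lerDl ?(ltW e0)// ltW// (lt_trans _ t2).
pose f' x := (A + e)^-1 * f x; pose g' x := (B + e)^-1 * g x.
have Xf' : bint f' by exact: bintZ.
have Xg' : bint g' by exact: bintZ.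
have [M1 M10 fM] := bint_bound Xf'; have [M2 M20 gM] := bint_bound Xg'.
pose J := M1 `^ (p / r) + M2 + 1.
have J0 : 0 < J by rewrite ltr_wpDl ?addr_ge0 ?powR_ge0.
have f'J x : `|f' x| `^ (p / r) <= J.
  apply: (@le_trans _ _ (M1 `^ (p / r))); last by rewrite /J -addrA lerDl addr_ge0.
  by apply: ge0_ler_powR; rewrite ?nnegrE ?fM//; exact: ltW (divr_gt0 _ _).
have g'J x : `|g' x| <= J.
  apply: (le_trans (gM x)); rewrite /J (addrC (_ `^ _)) -addrA lerDl addr_ge0//.
  exact: powR_ge0.
have := interpolation_normalized betaDl betaDr betaZl betaZr K0 beta_inf beta_two
  p2 pr hpr Xf' Xg' (norm1 _ _ _ p2 A0 Xf fA) (norm1 _ _ _ (lt_le_trans p2 pr) B0 Xg gB) J0 f'J g'J.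
rewrite /f' /g' betaZl// betaZr// !normrM (@gtr0_norm _ (A + e)^-1) ?invr_gt0// (@gtr0_norm _ (B + e)^-1) ?invr_gt0//.
rewrite mulrA -invfM ler_pdivrMl ?mulr_gt0//; move=> h; apply: (le_trans h).
by apply: eq_ler; ring.
Qed.

End bilinear.

Lemma interpolation beta (K : R) : 0 <= K ->
  (forall f f' g, bint f -> bint f' -> bint g ->
    beta (fun x => f x + f' x) g = beta f g + beta f' g) ->
  (forall f g g', bint f -> bint g -> bint g' ->
    beta f (fun x => g x + g' x) = beta f g + beta f g') ->
  (forall (k : R) f g, bint f -> bint g -> beta (fun x => k * f x) g = k * beta f g) ->
  (forall (k : R) f g, bint f -> bint g -> beta f (fun x => k * g x) = k * beta f g) ->
  (forall f g (M : R), bint f -> bint g -> (forall x, `|f x| <= M) ->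
    `|beta f g| <= K * (M * L2 g)) ->
  (forall f g (M : R), bint f -> bint g -> (forall x, `|g x| <= M) ->
    `|beta f g| <= K * (L2 f * M)) ->
  forall (q qt : \bar R), (2%:E <= q)%E -> (2%:E <= qt)%E -> (q^-1 + qt^-1 = (2^-1)%:E)%E ->
  forall f g (A B : R), bint f -> bint g ->
  (Lqnorm q f <= A%:E)%E -> (Lqnorm qt g <= B%:E)%E -> `|beta f g| <= 6 * K * (A * B).
Proof.
move=> K0 Dl Dr Zl Zr binf btwo q qt q2 qt2 hq f g A B Xf Xg fA gB.
have le6 (X Y : R) : 0 <= Y -> X <= K * Y -> X <= 6 * K * Y.
  by move=> Y0 h; apply: (le_trans h); have := mulr_ge0 K0 Y0; lra.
have sDl := fun f g g' Xf Xg Xg' => Dr f g g' Xf Xg Xg'.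
case: q q2 hq fA => [p| |] p2 hq fA; last by [].
- case: qt qt2 hq gB => [r| |] r2 hq gB; last by [].
  + rewrite !lee_fin in p2 r2.
    have p0 : 0 < p by exact: lt_le_trans p2.
    have r0 : 0 < r by exact: lt_le_trans r2.
    have hpr : p^-1 + r^-1 = 2^-1.
      by move: hq; rewrite !inver !gt_eqF// -EFinD => -[].
    have p2' : 2 < p.
      rewrite -ltf_pV2 ?posrE//; rewrite -hpr ltrDl invr_gt0//.
    have r2' : 2 < r.
      rewrite -ltf_pV2 ?posrE//; rewrite -hpr ltrDr invr_gt0//.
    have [A0 fA'] := Lqnorm_powR p2 Xf fA; have [B0 gB'] := Lqnorm_powR r2 Xg gB.
    have [pr|/ltW rp] := leP p r.
      exact: (interpolation_fin Dl Dr Zl Zr K0 binf btwo p2' pr hpr).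
    (* For [r <= p] the two arguments of the form are exchanged, and with them its two endpoint
       bounds. *)
    rewrite (mulrC A); rewrite addrC in hpr.
    apply: (@interpolation_fin (fun g f => beta f g) _ _ _ _ K K0 _ _ r p) => //.
    * by move=> ? ? ? ? ? ?; exact: Dr.
    * by move=> ? ? ? ? ? ?; exact: Dl.
    * by move=> ? ? ? ? ?; exact: Zr.
    * by move=> ? ? ? ? ?; exact: Zl.
    * by move=> h k M Xh Xk hM; rewrite (mulrC M); exact: btwo.
    * by move=> h k M Xh Xk hM; rewrite mulrC (mulrC _ M) mulrC; exact: binf.
  + have p2e : p = 2.
      move: hq; rewrite invey adde0 inver; case: eqP => // _ -[] /(congr1 GRing.inv).
      by rewrite !invrK.
    rewrite p2e in fA; have [B0 gB'] := Lqnorm_inf Xg gB.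
    have fA' := Lqnorm_two Xf fA.
    apply: le6; first by rewrite mulr_ge0// (le_trans _ fA')// sqrtr_ge0.
    rewrite (mulrC A); apply: (@interpolation_inf (fun g f => beta f g) _ K K0 _ _ g f) => //.
    * by move=> ? ? ? ? ? ?; exact: Dr.
    * by move=> h k M Xh Xk hM; rewrite (mulrC M); exact: btwo.
    * by move=> h k M Xh Xk hM; rewrite (mulrC _ M); exact: binf.
- have r2e : qt = 2%:E.
    move: hq; rewrite invey add0e => /(congr1 inve); rewrite inveK => ->.
    by rewrite inver invr_eq0 pnatr_eq0/= invrK.
  rewrite r2e in gB; have [A0 fA'] := Lqnorm_inf Xf fA.
  have gB' := Lqnorm_two Xg gB.
  apply: le6; first by rewrite mulr_ge0// (le_trans _ gB')// sqrtr_ge0.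
  exact: (interpolation_inf Dl K0 binf btwo).
Qed.

End Lq.

Section linearity.
Context (R : realType) (d : nat).
Local Notation mu := (lebesgue_rV R d).
Implicit Types (j : 'I_d) (c : R) (f g : 'rV[R]_d -> R).

Transparent conv heat dheat ddheat.

Lemma convD (K : 'rV[R]_d -> R) (A c : R) f g x : gkernel K A c -> bint f -> bint g ->
  conv K (fun y => f y + g y) x = conv K f x + conv K g x.
Proof.
move=> hK Xf Xg; rewrite /conv -RintD; last 2 first.
- by apply: (conv_intg hK); exact: bint_intg.
- by apply: (conv_intg hK); exact: bint_intg.
by apply: eq_Rint => y; rewrite mulrDr.
Qed.

Lemma convZ (K : 'rV[R]_d -> R) (A c r : R) f x : gkernel K A c -> bint f ->
  conv K (fun y => r * f y) x = r * conv K f x.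
Proof.
move=> hK Xf; rewrite /conv -RintZ; last by apply: (conv_intg hK); exact: bint_intg.
by apply: eq_Rint => y; rewrite mulrCA.
Qed.

Lemma heatD c f g x : 0 < c -> bint f -> bint g ->
  heat c (fun y => f y + g y) x = heat c f x + heat c g x.
Proof. by move=> c0; exact: convD (Gk_gkernel d c0). Qed.

Lemma heatZ c (r : R) f x : 0 < c -> bint f -> heat c (fun y => r * f y) x = r * heat c f x.
Proof. by move=> c0; exact: convZ (Gk_gkernel d c0). Qed.

Lemma dheatD j c f g x : 0 < c -> bint f -> bint g ->
  dheat j c (fun y => f y + g y) x = dheat j c f x + dheat j c g x.
Proof. by move=> c0; exact: convD (G1_gkernel j c0). Qed.

Lemma dheatZ j c (r : R) f x : 0 < c -> bint f -> dheat j c (fun y => r * f y) x = r * dheat j c f x.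
Proof. by move=> c0; exact: convZ (G1_gkernel j c0). Qed.

Opaque conv heat dheat ddheat.

Lemma heatB c f g x : 0 < c -> bint f -> bint g ->
  heat c (fun y => f y - g y) x = heat c f x - heat c g x.
Proof.
move=> c0 Xf Xg; rewrite -mulN1r -heatZ// -heatD//; last exact: bintZ.
by congr (heat c _ x); apply/funext => y; rewrite mulN1r.
Qed.

End linearity.

Section trilinear_interpolation.
Context (R : realType) (d : nat) (a b : R).
Hypotheses (a0 : 0 < a) (ab : a <= b).
Local Notation mu := (lebesgue_rV R d).
Local Notation ST := (@ST R d a b).
Local Notation L2 f := (Num.sqrt (\int[mu]_x f x ^+ 2)).
Implicit Types (j k : 'I_d) (sig th f g : 'rV[R]_d -> R).

(** This is rho^(-1/2) (1 - rho)^(-3/4): each of [th] and [g] loses the square root of its share of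
    the time, and the last factor absorbs the logarithm in [tril_two]. *)
Definition weight (rho : R) : R :=
  (Num.sqrt rho * Num.sqrt (1 - rho) * Num.sqrt (Num.sqrt (1 - rho)))^-1.

Variables (rho : R) (j k : 'I_d) (g : 'rV[R]_d -> R).
Hypotheses (rho01 : 0 < rho < 1) (Xg : bint g).

Lemma trilC_ge2 : 2 <= trilC R d.
Proof. by rewrite lerDr mulr_ge0// addr_ge0 ?mulr_ge0 ?sqr_ge0 ?K1_ge0 ?K2_ge0. Qed.

Lemma weight_ge0 r : 0 <= weight r.
Proof. by rewrite invr_ge0 !mulr_ge0 ?sqrtr_ge0. Qed.

Lemma tril_le (q qt : \bar R) sig th (A B : R) :
  (2%:E <= q)%E -> (2%:E <= qt)%E -> (q^-1 + qt^-1 = (2^-1)%:E)%E ->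
  bint sig -> bint th -> (Lqnorm q sig <= A%:E)%E -> (Lqnorm qt th <= B%:E)%E ->
  `|tril a b rho j k g sig th| <= 6 * (trilC R d * L2 g * weight rho) * (A * B).
Proof.
move=> q2 qt2 hq Xsig Xth sA tB.
have r0 := rho0 rho01; have r1 := rho1 rho01.
have tt f : bint f -> tame (fun s => dheat j (rho * s) f).
  by move=> Xf; exact: tame_scale r0 (tame_dheat j Xf).
have tg : tame (fun s => dheat k ((1 - rho) * s) g) by exact: tame_scale r1 (tame_dheat k Xg).
have tl f h : bint f -> bint h ->
    tame (fun s x => f x * (dheat j (rho * s) h x * dheat k ((1 - rho) * s) g x)).
  by move=> Xf Xh; apply: (tameM (tame_cst Xf)); exact: (tameM (tt _ Xh) tg).
have rs s : a <= s <= b -> 0 < rho * s.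
  by move=> /andP[as_ _]; rewrite mulr_gt0// (lt_le_trans a0).
have p0' := p0 rho01; have q0' := q0 rho01.
have K0 : 0 <= trilC R d * L2 g * weight rho.
  by rewrite !mulr_ge0 ?weight_ge0 ?sqrtr_ge0// (le_trans _ trilC_ge2).
apply: (interpolation (beta := tril a b rho j k g) K0 _ _ _ _ _ _ q2 qt2 hq Xsig Xth sA tB).
- move=> f f' h Xf Xf' Xh; rewrite /tril -(STD b a0 (tl _ _ Xf Xh) (tl _ _ Xf' Xh)).
  by apply: eq_ST => s x _; rewrite mulrDl.
- move=> f h h' Xf Xh Xh'; rewrite /tril -(STD b a0 (tl _ _ Xf Xh) (tl _ _ Xf Xh')).
  by apply: eq_ST => s x /rs rs0; rewrite dheatD// mulrDl mulrDr.
- move=> r f h Xf Xh; rewrite /tril -(STZ b a0 r (tl _ _ Xf Xh)).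
  by apply: eq_ST => s x _; exact: esym (mulrA _ _ _).
- move=> r f h Xf Xh; rewrite /tril -(STZ b a0 r (tl _ _ Xf Xh)).
  by apply: eq_ST => s x /rs rs0; rewrite dheatZ// -(mulrA r) mulrCA.
- move=> f h M Xf Xh fM; have M0 : 0 <= M by exact: le_trans (fM 0).
  apply: (le_trans (tril_inf a0 ab rho01 j k Xg Xf Xh fM)).
  have r0' : 0 < Num.sqrt (Num.sqrt (1 - rho)) by rewrite sqrtr_gt0.
  have r1' : Num.sqrt (Num.sqrt (1 - rho)) <= 1.
    rewrite -[leRHS]sqrtr1; apply: ler_wsqrtr; rewrite -[leRHS]sqrtr1; apply: ler_wsqrtr.
    by rewrite gerBl ltW.
  rewrite /weight; move: (Num.sqrt rho) (Num.sqrt (1 - rho)) p0' q0' r0' r1' => p z p0 z0 r0' r1'.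
  have -> : trilC R d * L2 g / (p * z * Num.sqrt z) * (M * L2 h) =
     (M * L2 h * L2 g / (2 * p * z)) * (2 * trilC R d / Num.sqrt z).
    move: (trilC R d) => C; by field; rewrite !gt_eqF.
  rewrite ler_peMr//; first by rewrite !mulr_ge0 ?invr_ge0 ?mulr_ge0 ?sqrtr_ge0 ?(ltW p0) ?(ltW z0).
  rewrite ler_pdivlMr// mul1r (le_trans r1')//; have := trilC_ge2; move: (trilC R d) => C; lra.
- move=> f h M Xf Xh hM.
  apply: (le_trans (tril_two a0 ab rho01 j k Xg Xf Xh hM)); rewrite /weight.
  by apply: eq_ler; move: (trilC R d) => C; rewrite !mulrA; ring.
Qed.

End trilinear_interpolation.

(** * Families of iterated derivatives *)

Section schwartz.
Context (R : realType) (d : nat).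
Local Notation mu := (lebesgue_rV R d).
Implicit Types (i j k : 'I_d) (f : 'rV[R]_d -> R) (x : 'rV[R]_d) (D : seq 'I_d -> 'rV[R]_d -> R).

(* [D s] is the iterated partial derivative of [D [::]] along [s], the head of [s] being the
   outermost one. *)
Definition sch D := (forall s, bint (D s)) /\
  forall s i x, is_derive x (evec i) (D s) (D (i :: s) x).

Lemma sch_lc D s k : sch D -> line_continuous k (D s).
Proof. by case=> _ dD; apply: is_derive_line_continuous => x; exact: dD. Qed.

Lemma sch_lip D s : sch D -> exists2 L : R, 0 <= L & lip L (D s).
Proof.
move=> [XD dD].
have /choice[B hB] : forall i : 'I_d, exists B : R, 0 <= B /\ forall x, `|D (i :: s) x| <= B.
  by move=> i; have [B B0 hB] := bint_bound (XD (i :: s)); exists B.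
have B0 i : 0 <= B i by case: (hB i).
have S0 : 0 <= \sum_(i < d) B i by exact: sumr_ge0.
exists (\sum_(i < d) B i) => //.
apply: (lip_der S0 (fun i x => dD s i x)) => i x.
by apply: (le_trans ((hB i).2 x)); rewrite (bigD1 i)//= lerDl sumr_ge0.
Qed.

Lemma heat_eq0 f L x : bint f -> 0 <= L -> lip L f ->
  (forall c, 0 < c -> heat c f x = 0) -> f x = 0.
Proof.
move=> Xf L0 Lf h; apply/eqP; rewrite -normr_le0.
apply: (@ler_sqrt_eps R _ (L * (d%:R * (2 * K1 R d))) 0 1) => //.
  by rewrite !mulr_ge0// K1_ge0.
move=> c /andP[c0 _]; rewrite addr0.
by have := heat_approx x c0 Xf L0 Lf; rewrite h// sub0r normrN.
Qed.

Lemma sch_heat D i s c x : sch D -> 0 < c -> heat c (D (i :: s)) x = dheat i c (D s) x.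
Proof.
move=> SD c0; have [XD dD] := SD.
by apply: heat_dcomm => //; exact: sch_lc.
Qed.

Lemma sch_dheatC D i j s c x : sch D -> 0 < c ->
  dheat i c (D (j :: s)) x = dheat j c (D (i :: s)) x.
Proof.
move=> SD c0; have [XD dD] := SD.
have e k l y : dheat k c (D (l :: s)) y = ddheat l k c (D s) y.
  apply: (is_derive_unique (fun y => sch_heat l s y SD c0)).
    exact: heat_derive.
  exact: dheat_derive.
by rewrite !e ddheatC.
Qed.

(** After the heat flow both mixed derivatives are expressed by [ddheat], whose explicit kernel is
    symmetric in the two indices; letting the heat time tend to 0 removes the flow, because the
    functions are Lipschitz. *)
Lemma sch_clairaut D i j s x : sch D -> D (i :: j :: s) x = D (j :: i :: s) x.
Proof.
move=> SD; have [XD dD] := SD; apply/eqP; rewrite -subr_eq0; apply/eqP.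
have [L1 L10 h1] := sch_lip (i :: j :: s) SD; have [L2 L20 h2] := sch_lip (j :: i :: s) SD.
apply: (@heat_eq0 (fun x => D (i :: j :: s) x - D (j :: i :: s) x) (L1 + L2)).
- exact: bintB.
- exact: addr_ge0.
- move=> y z; rewrite mulrDl.
  have -> : D (i :: j :: s) y - D (j :: i :: s) y - (D (i :: j :: s) z - D (j :: i :: s) z) =
     (D (i :: j :: s) y - D (i :: j :: s) z) - (D (j :: i :: s) y - D (j :: i :: s) z) by ring.
  by apply: (le_trans (ler_normB _ _)); rewrite lerD.
- move=> c c0.
  by rewrite heatB// !sch_heat// (sch_dheatC i j)// subrr.
Qed.

(** By the semigroup law the difference is the flow of [heat e f - f], and the flow does not
    increase the supremum. *)
Lemma heat_holder f L (r e : R) x : bint f -> 0 <= L -> lip L f -> 0 < r -> 0 < e ->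
  `|heat (r + e) f x - heat r f x| <= L * (d%:R * (2 * K1 R d)) * Num.sqrt e.
Proof.
move=> Xf L0 Lf r0 e0.
have Xh := bint_heat e0 Xf.
have -> : heat (r + e) f x - heat r f x = heat r (fun y => heat e f y - f y) x.
  by rewrite heatB// heat_semigroup.
apply: heat_le_sup => //; first exact: bintB.
by move=> y; exact: heat_approx.
Qed.

End schwartz.

(** * The commutator *)

Section commutator.
Context (R : realType) (d : nat) (a b : R).
Hypotheses (a0 : 0 < a) (ab : a <= b).
Local Notation mu := (lebesgue_rV R d).
Local Notation leb := (@lebesgue_measure R).
Local Notation ST := (@ST R d a b).
Local Notation L2 f := (Num.sqrt (\int[mu]_x f x ^+ 2)).
Implicit Types (i j k : 'I_d) (f : 'rV[R]_d -> R) (x : 'rV[R]_d) (h g : R -> 'rV[R]_d -> R).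

Lemma Rint_itv_bound (F : R -> R) (M : R) : leb.-integrable `[a, b] (EFin \o F) ->
  (forall s, a <= s <= b -> `|F s| <= M) ->
  `|\int[leb]_(s in `[a, b]) F s| <= M * (b - a).
Proof.
move=> iF FM.
have cst_int (N : R) : leb.-integrable `[a, b] (EFin \o (fun _ : R => N)).
  apply: continuous_compact_integrable; first exact: segment_compact.
  by apply: continuous_subspaceT => x; exact: cst_continuous.
have cstE (N : R) : \int[leb]_(s in `[a, b]) N = N * (b - a).
  rewrite mulrBr; apply: (@FTC_Rint R (fun s => N * s) (fun=> N)) => // s _; last exact: cst_continuous.
  by apply: (is_deriveE (derZ N (der_id s))) => //; rewrite mulr1.
rewrite ler_norml -mulNr -!cstE; apply/andP; split.
  by apply: Rint_itv_le => // s /FM; rewrite ler_norml => /andP[].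
by apply: Rint_itv_le => // s /FM; rewrite ler_norml => /andP[].
Qed.

Lemma mixed_derive h h' g g' (c s : R) : tame h -> tame h' -> tame g -> tame g' ->
  (forall (r : R) x, 0 < r -> is_derive r 1 (fun s => h s x) (h' r x)) ->
  (forall (r : R) x, 0 < r -> is_derive r 1 (fun s => g s x) (g' r x)) ->
  0 < c < 1 -> 0 < s ->
  is_derive c 1 (fun c => \int[mu]_x (h ((1 - c) * s) x * g (c * s) x))
    (s * \int[mu]_x (h ((1 - c) * s) x * g' (c * s) x - h' ((1 - c) * s) x * g (c * s) x)).
Proof.
move=> th th' tg tg' dh dg /andP[c0 c1] s0.
have dom (k : R -> 'rV[R]_d -> R) : tame k -> exists2 H, bint H &
    forall r x, Num.min (c / 2) ((1 - c) / 2) * s <= r <= s -> `|k r x| <= H x.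
  case=> _ _; apply; first by rewrite mulr_gt0// lt_min !divr_gt0 ?subr_gt0.
  by rewrite ler_piMl ?(ltW s0)// ge_min; apply/orP; left; lra.
have [H1 X1 hH1] := dom _ th; have [H2 X2 hH2] := dom _ th'.
have [G1' Y1 hG1] := dom _ tg; have [G2' Y2 hG2] := dom _ tg'.
have rg (r : R) : c / 2 < r < (1 + c) / 2 ->
   [/\ 0 < r, 0 < 1 - r, Num.min (c / 2) ((1 - c) / 2) * s <= r * s <= s &
     Num.min (c / 2) ((1 - c) / 2) * s <= (1 - r) * s <= s].
  move=> /andP[r1 r2]; have r0 : 0 < r by lra.
  have r0' : 0 < 1 - r by lra.
  split=> //.
    rewrite ler_wpM2r ?(ltW s0)//; last by rewrite ge_min (ltW r1).
    by rewrite ler_piMl ?(ltW s0)//; lra.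
  rewrite ler_wpM2r ?(ltW s0)//; last by rewrite ge_min; apply/orP; right; lra.
  by rewrite ler_piMl ?(ltW s0)//; lra.
have -> : s * \int[mu]_x (h ((1 - c) * s) x * g' (c * s) x - h' ((1 - c) * s) x * g (c * s) x) =
    \int[mu]_x (s * (h ((1 - c) * s) x * g' (c * s) x - h' ((1 - c) * s) x * g (c * s) x)).
  have cs : 0 < c * s by rewrite mulr_gt0.
  have cs' : 0 < (1 - c) * s by rewrite mulr_gt0// subr_gt0.
  rewrite RintZ//; apply: intgB; apply: bint_mul_intg.
  - exact: tame_bint th cs'.
  - exact: tame_bint tg' cs.
  - exact: tame_bint th' cs'.
  - exact: tame_bint tg cs.
apply: (@under_is_derive _ _ R mu (c / 2) ((1 + c) / 2)
  (fun c x => h ((1 - c) * s) x * g (c * s) x)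
  (fun c x => s * (h ((1 - c) * s) x * g' (c * s) x - h' ((1 - c) * s) x * g (c * s) x))
  (fun x => s * (H1 x * G2' x + H2 x * G1' x))).
- move=> r /rg[r0 r0' _ _]; apply: bint_mul_intg.
    exact: tame_bint th (mulr_gt0 r0' s0).
  exact: tame_bint tg (mulr_gt0 r0 s0).
- move=> r x /rg[r0 r0' _ _].
  have d1 := der_comp (dg _ x (mulr_gt0 s0 r0)) (derZ s (der_id r)).
  have d3 : is_derive r 1 (fun y : R => s * (1 - y)) (s * (0 - 1)).
    by apply: derZ; apply: derB.
  have d2 := @der_comp R (fun r => h r x) (fun y => s * (1 - y)) r _ _ (dh _ x (mulr_gt0 s0 r0')) d3.
  apply: (is_deriveE (derM d2 d1)) => [y|]; first by rewrite !(mulrC s).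
  by rewrite !(mulrC s) sub0r; ring.
- by apply: intgZ; apply: intgD; exact: bint_mul_intg.
- move=> r x /rg[r0 r0' rs rs']; rewrite normrM (gtr0_norm s0) ler_wpM2l ?(ltW s0)//.
  apply: (le_trans (ler_normB _ _)); rewrite !normrM.
  by apply: lerD; apply: ler_pM => //; [exact: hH1|exact: hG2|exact: hH2|exact: hG1].
- lra.
Qed.

Lemma mixed_tame h g (c : R) : tame h -> tame g -> 0 < c < 1 ->
  tame (fun s x => h ((1 - c) * s) x * g (c * s) x).
Proof.
move=> th tg /andP[c0 c1]; apply: tameM; apply: tame_scale => //; by rewrite subr_gt0.
Qed.

Definition Psi h g (c : R) :=
  \int[leb]_(s in `[a, b]) (s^-1 * \int[mu]_x (h ((1 - c) * s) x * g (c * s) x)).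

Lemma inv_tame_intg h : tame h ->
  leb.-integrable `[a, b] (EFin \o (fun s => s^-1 * \int[mu]_x h s x)).
Proof.
move=> th; apply: continuous_compact_integrable; first exact: segment_compact.
apply: continuous_in_subspaceT => c; rewrite inE/= in_itv/= => /andP[ac cb].
have c0 : 0 < c by exact: lt_le_trans ac.
apply: continuousM; last exact: tame_continuous.
exact: der_continuous (der_inv (lt0r_neq0 c0)).
Qed.

(** The chain rule produces a factor [s] that cancels the [s^-1] of the definition: the derivative
    is a plain space-time integral of commutator type. *)
Lemma Psi_derive h h' g g' (c : R) : tame h -> tame h' -> tame g -> tame g' ->
  (forall (r : R) x, 0 < r -> is_derive r 1 (fun s => h s x) (h' r x)) ->
  (forall (r : R) x, 0 < r -> is_derive r 1 (fun s => g s x) (g' r x)) ->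
  0 < c < 1 ->
  is_derive c 1 (Psi h g)
    (ST (fun s x => h ((1 - c) * s) x * g' (c * s) x - h' ((1 - c) * s) x * g (c * s) x)).
Proof.
move=> th th' tg tg' dh dg c01; have /andP[c0 c1] := c01.
have m0 : 0 < Num.min (c / 2) ((1 - c) / 2) * a.
  by rewrite mulr_gt0// lt_min !divr_gt0 ?subr_gt0.
have dom (k : R -> 'rV[R]_d -> R) : tame k -> exists2 H, bint H &
    forall r x, Num.min (c / 2) ((1 - c) / 2) * a <= r <= b -> `|k r x| <= H x.
  case=> _ _; apply => //; apply: le_trans ab.
  by rewrite ler_piMl ?(ltW a0)// ge_min; apply/orP; left; lra.
have [H1 X1 hH1] := dom _ th; have [H2 X2 hH2] := dom _ th'.
have [G1' Y1 hG1] := dom _ tg; have [G2' Y2 hG2] := dom _ tg'.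
have rg (r s : R) : c / 2 < r < (1 + c) / 2 -> a <= s <= b ->
   [/\ 0 < r < 1, 0 < s, Num.min (c / 2) ((1 - c) / 2) * a <= r * s <= b &
     Num.min (c / 2) ((1 - c) / 2) * a <= (1 - r) * s <= b].
  move=> /andP[r1 r2] /andP[as_ sb]; have r0 : 0 < r < 1 by lra.
  have a0' : 0 <= a by exact: ltW.
  have s0 : 0 < s by exact: lt_le_trans as_.
  have mm : 0 <= Num.min (c / 2) ((1 - c) / 2) by rewrite le_min; lra.
  split=> //; apply/andP; split.
  - by apply: ler_pM => //; rewrite ge_min (ltW r1).
  - by apply: le_trans sb; rewrite ler_piMl ?(ltW s0)//; lra.
  - by apply: ler_pM => //; rewrite ge_min; apply/orP; right; lra.
  - by apply: le_trans sb; rewrite ler_piMl ?(ltW s0)//; lra.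
apply: (@itv_is_derive R a b (c / 2) ((1 + c) / 2) (\int[mu]_x (H1 x * G2' x + H2 x * G1' x)) c
  (fun c s => s^-1 * \int[mu]_x (h ((1 - c) * s) x * g (c * s) x))
  (fun c s => \int[mu]_x (h ((1 - c) * s) x * g' (c * s) x - h' ((1 - c) * s) x * g (c * s) x))).
- move=> r /andP[r1 r2]; apply: inv_tame_intg; apply: mixed_tame => //; lra.
- move=> r s /rg /[apply] -[r01 s0 _ _].
  apply: (is_deriveE (derZ s^-1 (mixed_derive th th' tg tg' dh dg r01 s0))) => //.
  by rewrite mulrA mulVf ?mul1r// gt_eqF.
- move=> r s /rg /[apply] -[/andP[r0 r1] s0 rs rs'].
  have q1 : 0 < r * s by rewrite mulr_gt0.
  have q2 : 0 < (1 - r) * s by rewrite mulr_gt0// subr_gt0.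
  apply: Rint_norm_le.
  + apply: intgB; apply: bint_mul_intg.
    * exact: tame_bint th q2.
    * exact: tame_bint tg' q1.
    * exact: tame_bint th' q2.
    * exact: tame_bint tg q1.
  + by apply: intgD; exact: bint_mul_intg.
  move=> x; apply: (le_trans (ler_normB _ _)); rewrite !normrM.
  by apply: lerD; apply: ler_pM => //; [exact: hH1|exact: hG2|exact: hH2|exact: hG1].
- lra.
Qed.

Variables (D : seq 'I_d -> 'rV[R]_d -> R) (U : 'I_d -> seq 'I_d -> 'rV[R]_d -> R).
Hypotheses (SD : sch D) (SU : forall j, sch (U j)).
Hypothesis divU : forall x, \sum_(j < d) U j [:: j] x = 0.
Variables (gg : 'rV[R]_d -> R) (Lg : R).
Hypotheses (Xg : bint gg) (Lg0 : 0 <= Lg) (lipg : lip Lg gg).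

Let G c := heat c gg.
Let G' c x := \sum_(i < d) ddheat i i c gg x.
Let V c x := \sum_(j < d) U j [::] x * heat c (D [:: j]) x.
Let V' c x := \sum_(j < d) U j [::] x * \sum_(i < d) ddheat i i c (D [:: j]) x.

Let XD s : bint (D s). Proof. by case: SD. Qed.
Let XU j s : bint (U j s). Proof. by case: (SU j). Qed.
Let tG : tame G. Proof. exact: tame_heat. Qed.
Let tG' : tame G'. Proof. by apply: tame_sum => i; exact: tame_ddheat. Qed.
Let tV : tame V.
Proof. by apply: tame_sum => j; apply: (tameM (tame_cst (XU j [::]))); exact: tame_heat. Qed.
Let tV' : tame V'.
Proof.
apply: tame_sum => j; apply: (tameM (tame_cst (XU j [::]))).
by apply: tame_sum => i; exact: tame_ddheat.
Qed.
Let dG (r : R) x : 0 < r -> is_derive r 1 (fun s => G s x) (G' r x).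
Proof. by move=> r0; exact: heat_time. Qed.
Let dV (r : R) x : 0 < r -> is_derive r 1 (fun s => V s x) (V' r x).
Proof. by move=> r0; apply: der_sum => j; apply: derZ; exact: heat_time. Qed.

(** The derivative of the divergence, up to the order of the two derivatives. *)
Lemma divU_der i x : \sum_(j < d) U j [:: j; i] x = 0.
Proof.
rewrite (eq_bigr (fun j => U j [:: i; j] x)); last first.
  by move=> j _; exact: sch_clairaut.
have h : is_derive x (evec i) (fun x => \sum_(j < d) U j [:: j] x) (\sum_(j < d) U j [:: i; j] x).
  by apply: der_sum => j; case: (SU j) => _; exact.
exact: (is_derive_unique (divU : _ =1 fun=> 0) h (derC _ _ 0)).
Qed.

(** Green's formula: integrating by parts in both integrals, the terms without a derivative on [U]
    cancel. In what remains, a second derivative of [D] is integrated by parts once more, which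
    leaves first derivatives of [D] and [gg] against a first derivative of [U], and one term that
    the divergence condition removes after summation over [j]. *)
Let comm_ij (c1 c2 : R) i j : 0 < c1 -> 0 < c2 ->
  \int[mu]_x (G c1 x * (U j [::] x * ddheat i i c2 (D [:: j]) x)) -
  \int[mu]_x (ddheat i i c1 gg x * (U j [::] x * heat c2 (D [:: j]) x)) =
  \int[mu]_x (U j [:: i] x * (dheat j c2 (D [::]) x * dheat i c1 gg x)) +
  \int[mu]_x (U j [:: i] x * (dheat i c2 (D [::]) x * dheat j c1 gg x)) +
  \int[mu]_x (G c1 x * heat c2 (D [:: i]) x * U j [:: j; i] x).
Proof.
move=> c10 c20; have XG := bint_heat c10 Xg.
have XV k := bint_heat c20 (XD [:: k]).
have XGi k := bint_dheat k c10 Xg.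
have XVi k l := bint_dheat k c20 (XD [:: l]).
have dU s k x : is_derive x (evec k) (U j s) (U j (k :: s) x) by case: (SU j) => _; exact.
have lcU s k : line_continuous k (U j s) by exact: sch_lc.
have E1 : \int[mu]_x (G c1 x * U j [::] x * ddheat i i c2 (D [:: j]) x) =
    - \int[mu]_x ((dheat i c1 gg x * U j [::] x + G c1 x * U j [:: i] x) * dheat i c2 (D [:: j]) x).
  apply: heat_ibp => //.
  - by move=> x; apply: derM => //; exact: heat_derive.
  - by apply: line_continuousD; apply: line_continuousM => //; [exact: dheat_lc|exact: heat_lc].
  - exact: bintM.
  - by apply: bintD; exact: bintM.
have E2 : \int[mu]_x (U j [::] x * heat c2 (D [:: j]) x * ddheat i i c1 gg x) =
    - \int[mu]_x ((U j [:: i] x * heat c2 (D [:: j]) x + U j [::] x * dheat i c2 (D [:: j]) x) * dheat i c1 gg x).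
  apply: heat_ibp => //.
  - by move=> x; apply: derM => //; exact: heat_derive.
  - by apply: line_continuousD; apply: line_continuousM => //; [exact: heat_lc|exact: dheat_lc].
  - exact: bintM.
  - by apply: bintD; exact: bintM.
(* The second derivative of [D] is the one along [i] and [j]. Choosing the direction [j] makes the
   derivative that falls on [U j] a derivative of the divergence. *)
have E3 : \int[mu]_x (G c1 x * U j [:: i] x * dheat j c2 (D [:: i]) x) =
    - \int[mu]_x ((dheat j c1 gg x * U j [:: i] x + G c1 x * U j [:: j; i] x) * heat c2 (D [:: i]) x).
  apply: (@Rint_ibp _ _ j) => //.
  - by move=> x; apply: derM => //; exact: heat_derive.
  - by move=> x; exact: heat_derive.
  - by apply: line_continuousD; apply: line_continuousM => //; [exact: dheat_lc|exact: heat_lc].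
  - exact: dheat_lc.
  - exact: bintM.
  - by apply: bintD; exact: bintM.
have sym x : dheat i c2 (D [:: j]) x = dheat j c2 (D [:: i]) x by exact: sch_dheatC.
have hV k x : heat c2 (D [:: k]) x = dheat k c2 (D [::]) x by exact: sch_heat.
have -> : \int[mu]_x (G c1 x * (U j [::] x * ddheat i i c2 (D [:: j]) x)) =
    \int[mu]_x (G c1 x * U j [::] x * ddheat i i c2 (D [:: j]) x).
  by apply: eq_Rint => x; rewrite mulrA.
have -> : \int[mu]_x (ddheat i i c1 gg x * (U j [::] x * heat c2 (D [:: j]) x)) =
    \int[mu]_x (U j [::] x * heat c2 (D [:: j]) x * ddheat i i c1 gg x).
  by apply: eq_Rint => x; rewrite mulrC.
rewrite E1 E2 opprK.
have I3 f1 f2 f3 : bint f1 -> bint f2 -> bint f3 -> intg mu (fun x => f1 x * f2 x * f3 x).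
  by move=> X1 X2 X3; apply: bint_mul_intg => //; exact: bintM.
have F1 : \int[mu]_x ((dheat i c1 gg x * U j [::] x + G c1 x * U j [:: i] x) * dheat i c2 (D [:: j]) x) =
    \int[mu]_x (dheat i c1 gg x * U j [::] x * dheat i c2 (D [:: j]) x) +
    \int[mu]_x (G c1 x * U j [:: i] x * dheat j c2 (D [:: i]) x).
  by rewrite -RintD ?I3//; apply: eq_Rint => x; rewrite -sym mulrDl.
have F2 : \int[mu]_x ((U j [:: i] x * heat c2 (D [:: j]) x + U j [::] x * dheat i c2 (D [:: j]) x) * dheat i c1 gg x) =
    \int[mu]_x (U j [:: i] x * (dheat j c2 (D [::]) x * dheat i c1 gg x)) +
    \int[mu]_x (dheat i c1 gg x * U j [::] x * dheat i c2 (D [:: j]) x).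
  rewrite -RintD; last 2 first.
  - apply: bint_mul_intg => //; apply: bintM => //; exact: bint_dheat.
  - exact: I3.
  by apply: eq_Rint => x; rewrite -hV; ring.
have F3 : \int[mu]_x ((dheat j c1 gg x * U j [:: i] x + G c1 x * U j [:: j; i] x) * heat c2 (D [:: i]) x) =
    \int[mu]_x (U j [:: i] x * (dheat i c2 (D [::]) x * dheat j c1 gg x)) +
    \int[mu]_x (G c1 x * heat c2 (D [:: i]) x * U j [:: j; i] x).
  rewrite -RintD; last 2 first.
  - apply: bint_mul_intg => //; apply: bintM => //; exact: bint_dheat.
  - exact: I3.
  by apply: eq_Rint => x; rewrite -hV; ring.
rewrite F1 F2 E3 F3.
set z1 := \int[mu]_x _; set z2 := \int[mu]_x _; set z3 := \int[mu]_x _; set z4 := \int[mu]_x _.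
by ring.
Qed.

Lemma comm_identity (c1 c2 : R) : 0 < c1 -> 0 < c2 ->
  \int[mu]_x (G c1 x * V' c2 x - G' c1 x * V c2 x) =
  \sum_(i < d) \sum_(j < d)
   (\int[mu]_x (U j [:: i] x * (dheat j c2 (D [::]) x * dheat i c1 gg x)) +
    \int[mu]_x (U j [:: i] x * (dheat i c2 (D [::]) x * dheat j c1 gg x))).
Proof.
move=> c10 c20.
have XG := bint_heat c10 Xg.
have X1 i j : intg mu (fun x => G c1 x * (U j [::] x * ddheat i i c2 (D [:: j]) x)).
  by apply: bint_mul_intg => //; apply: bintM => //; exact: bint_ddheat.
have X2 i j : intg mu (fun x => ddheat i i c1 gg x * (U j [::] x * heat c2 (D [:: j]) x)).
  by apply: bint_mul_intg; [exact: bint_ddheat|apply: bintM => //; exact: bint_heat].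
have X3 i j : intg mu (fun x => G c1 x * heat c2 (D [:: i]) x * U j [:: j; i] x).
  by apply: bint_mul_intg => //; apply: bintM => //; exact: bint_heat.
transitivity (\sum_(i < d) \sum_(j < d)
  (\int[mu]_x (G c1 x * (U j [::] x * ddheat i i c2 (D [:: j]) x)) -
   \int[mu]_x (ddheat i i c1 gg x * (U j [::] x * heat c2 (D [:: j]) x)))).
  rewrite (eq_bigr (fun i => \int[mu]_x \sum_(j < d)
     (G c1 x * (U j [::] x * ddheat i i c2 (D [:: j]) x) - ddheat i i c1 gg x * (U j [::] x * heat c2 (D [:: j]) x)))).
    rewrite -Rint_sum; last first.
      by move=> i _; apply: intg_sum => j _; exact: intgB.
    apply: eq_Rint => x; rewrite /V /V' /G' (eq_bigr _ (fun i _ => sumrB _ _ _ _)) sumrB; congr (_ - _).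
      rewrite mulr_sumr exchange_big/=; apply: eq_bigr => j _.
      by rewrite -!mulr_sumr.
    by rewrite mulr_suml; apply: eq_bigr => i _; rewrite mulr_sumr.
  move=> i _; rewrite Rint_sum; last by move=> j _; exact: intgB.
  by apply: eq_bigr => j _; rewrite RintB.
rewrite (eq_bigr (fun i => \sum_(j < d)
   (\int[mu]_x (U j [:: i] x * (dheat j c2 (D [::]) x * dheat i c1 gg x)) +
    \int[mu]_x (U j [:: i] x * (dheat i c2 (D [::]) x * dheat j c1 gg x))))) // => i _.
rewrite (eq_bigr _ (fun j _ => comm_ij i j c10 c20)) big_split/= -[RHS]addr0; congr (_ + _).
rewrite -Rint_sum; last by move=> j _; exact: X3.
rewrite -[RHS](Rint0 mu); apply: eq_Rint => x.
by rewrite -mulr_sumr divU_der mulr0.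
Qed.

End commutator.

(** The interval is cut at 1/2. On the left the weight is at most 2 c^(-1/2), with primitive 4
    c^(1/2); on the right it is at most 2 (1 - c)^(-3/4), with primitive - 8 (1 - c)^(1/4). Hence
    the constant 12 = 4 + 8. *)
Lemma weight_diff_le (R : realType) (F F' : R -> R) (X e : R) :
  0 <= X -> 0 < e -> e <= 2^-1 ->
  (forall c : R, 0 < c < 1 -> is_derive c 1 F (F' c)) ->
  (forall c : R, 0 < c < 1 -> `|F' c| <= X * weight c) -> `|F (1 - e) - F e| <= 12 * X.
Proof.
move=> X0 e0 e12 dF FX.
have half : `|F 2^-1 - F e| <= X * 4.
  have D2 (x : R) : e <= x <= 2^-1 -> is_derive x 1 (fun y : R => X * 4 * Num.sqrt y) (X * 4 * (2 * Num.sqrt x)^-1).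
    by move=> /andP[ex _]; apply: derZ; apply: is_derive1_sqrt; exact: lt_le_trans ex.
  have D1 (x : R) : e <= x <= 2^-1 -> is_derive x 1 F (F' x).
    by move=> /andP[ex x2]; apply: dF; lra.
  apply: (le_trans (norm_diff_le e12 D1 D2 _)).
    move=> x /andP[ex x2]; have x01 : 0 < x < 1 by lra.
    apply: (le_trans (FX _ x01)); rewrite -mulrA; apply: ler_wpM2l => //.
    rewrite /weight; have p0' := p0 x01; have q0' := q0 x01.
    have r0' : 0 < Num.sqrt (Num.sqrt (1 - x)) by rewrite sqrtr_gt0.
    have x4 : 2^-1 <= 1 - x by lra.
    have h : 2^-1 <= Num.sqrt (1 - x) * Num.sqrt (Num.sqrt (1 - x)).
      have e1 : Num.sqrt (1 - x) ^+ 2 = 1 - x by rewrite sqr_sqrtr//; lra.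
      have e3 : Num.sqrt (1 - x) <= 1.
        by rewrite -[leRHS]sqrtr1; apply: ler_wsqrtr; lra.
      have e4 : Num.sqrt (1 - x) <= Num.sqrt (Num.sqrt (1 - x)).
        by rewrite -[leLHS]ger0_norm ?(ltW q0')// -sqrtr_sqr; apply: ler_wsqrtr; rewrite expr2 ler_piMl// ltW.
      by have := ler_wpM2l (ltW q0') e4; rewrite -expr2 e1; exact: le_trans.
    have -> : 4 * (2 * Num.sqrt x)^-1 = (Num.sqrt x)^-1 * 2 by field; rewrite gt_eqF.
    rewrite -mulrA invfM; apply: ler_wpM2l; first by rewrite invr_ge0 ltW.
    by rewrite -[leRHS]invrK lef_pV2 ?posrE ?invr_gt0 ?mulr_gt0.
  rewrite -mulrBr ler_piMr ?mulr_ge0// lerBlDr (le_trans (y := 1))// ?lerDl ?sqrtr_ge0//.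
  by rewrite -[leRHS]sqrtr1; apply: ler_wsqrtr; lra.
have half' : `|F (1 - e) - F 2^-1| <= X * 8.
  have e2' : 2^-1 <= 1 - e by lra.
  pose r (x : R) := Num.sqrt (Num.sqrt (1 - x)).
  have D2 (x : R) : 2^-1 <= x <= 1 - e -> is_derive x 1 (fun y : R => X * 8 * (1 - r y))
     (X * 8 * ((2 * r x)^-1 * (2 * Num.sqrt (1 - x))^-1)).
    move=> /andP[_ xe]; have x1 : 0 < 1 - x by lra.
    have s1 : is_derive x 1 (fun y : R => 1 - y) (0 - 1) by apply: derB.
    have s2 := @der_comp R Num.sqrt (fun y => 1 - y) x _ _ (is_derive1_sqrt x1) s1.
    have sx : 0 < Num.sqrt (1 - x) by rewrite sqrtr_gt0.
    have s3 := @der_comp R Num.sqrt (fun y => Num.sqrt (1 - y)) x _ _ (is_derive1_sqrt sx) s2.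
    apply: derZ; apply: (is_deriveE (derB (derC _ _ 1) s3)) => //.
    by rewrite /r; ring.
  have D1 (x : R) : 2^-1 <= x <= 1 - e -> is_derive x 1 F (F' x).
    by move=> /andP[ex x2]; apply: dF; lra.
  apply: (le_trans (norm_diff_le e2' D1 D2 _)).
    move=> x /andP[ex x2]; have x01 : 0 < x < 1 by lra.
    apply: (le_trans (FX _ x01)); rewrite -mulrA; apply: ler_wpM2l => //.
    have p0' := p0 x01; have q0' := q0 x01.
    have r0' : 0 < r x by rewrite sqrtr_gt0.
    have h : 2^-1 <= Num.sqrt x.
      have h0 : 0 <= 2^-1 :> R by rewrite invr_ge0.
      rewrite -[leLHS](ger0_norm h0) -sqrtr_sqr; apply: ler_wsqrtr.
      by apply: le_trans ex; rewrite expr2 ler_piMr//; lra.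
    rewrite /weight -/(r x); have -> : 8 * ((2 * r x)^-1 * (2 * Num.sqrt (1 - x))^-1) = 2 * (Num.sqrt (1 - x) * r x)^-1.
      by field; rewrite !gt_eqF.
    rewrite -mulrA invfM; apply: ler_wpM2r; first by rewrite invr_ge0 mulr_ge0 ?ltW.
    by rewrite -[leRHS]invrK lef_pV2 ?posrE ?invr_gt0.
  have rle (x : R) : 0 <= x -> r x <= 1.
    move=> x0; rewrite /r -[leRHS]sqrtr1; apply: ler_wsqrtr; rewrite -[leRHS]sqrtr1; apply: ler_wsqrtr.
    by rewrite gerBl.
  rewrite -mulrBr ler_piMr ?mulr_ge0//.
  have h1 : r 2^-1 <= 1 by apply: rle; rewrite invr_ge0.
  have h2 : 0 <= r (1 - e) by exact: sqrtr_ge0.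
  lra.
have := ler_normD (F (1 - e) - F 2^-1) (F 2^-1 - F e).
have -> : F (1 - e) - F 2^-1 + (F 2^-1 - F e) = F (1 - e) - F e by ring.
lra.
Qed.

Section commutator_bound.
Context (R : realType) (d : nat) (a b : R).
Hypotheses (a0 : 0 < a) (ab : a <= b).
Local Notation mu := (lebesgue_rV R d).
Local Notation leb := (@lebesgue_measure R).
Local Notation ST := (@ST R d a b).
Local Notation Psi := (@Psi R d a b).
Local Notation L2 f := (Num.sqrt (\int[mu]_x f x ^+ 2)).
Implicit Types (i j k : 'I_d) (f : 'rV[R]_d -> R) (x : 'rV[R]_d).

Variables (D : seq 'I_d -> 'rV[R]_d -> R) (U : 'I_d -> seq 'I_d -> 'rV[R]_d -> R).
Hypotheses (SD : sch D) (SU : forall j, sch (U j)).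
Hypothesis divU : forall x, \sum_(j < d) U j [:: j] x = 0.
Variables (gg : 'rV[R]_d -> R) (Lg : R).
Hypotheses (Xg : bint gg) (Lg0 : 0 <= Lg) (lipg : lip Lg gg).

Let G c := heat c gg.
Let G' c x := \sum_(i < d) ddheat i i c gg x.
Let V c x := \sum_(j < d) U j [::] x * heat c (D [:: j]) x.
Let V' c x := \sum_(j < d) U j [::] x * \sum_(i < d) ddheat i i c (D [:: j]) x.

Let XD s : bint (D s). Proof. by case: SD. Qed.
Let XU j s : bint (U j s). Proof. by case: (SU j). Qed.
Let tG : tame G. Proof. exact: tame_heat. Qed.
Let tG' : tame G'. Proof. by apply: tame_sum => i; exact: tame_ddheat. Qed.
Let tV : tame V.
Proof. by apply: tame_sum => j; apply: (tameM (tame_cst (XU j [::]))); exact: tame_heat. Qed.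
Let tV' : tame V'.
Proof.
apply: tame_sum => j; apply: (tameM (tame_cst (XU j [::]))).
by apply: tame_sum => i; exact: tame_ddheat.
Qed.
Let dG (r : R) x : 0 < r -> is_derive r 1 (fun s => G s x) (G' r x).
Proof. by move=> r0; exact: heat_time. Qed.
Let dV (r : R) x : 0 < r -> is_derive r 1 (fun s => V s x) (V' r x).
Proof. by move=> r0; apply: der_sum => j; apply: derZ; exact: heat_time. Qed.

Let V0 x := \sum_(j < d) U j [::] x * D [:: j] x.

Lemma uniform_bound (P : 'I_d -> R -> Prop) :
  (forall i (x y : R), x <= y -> P i x -> P i y) ->
  (forall i, exists2 M : R, 0 <= M & P i M) -> exists2 M : R, 0 <= M & forall i, P i M.
Proof.
move=> Pm Pe.
have /choice[M hM] : forall i, exists M : R, 0 <= M /\ P i M.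
  by move=> i; have [M M0 PM] := Pe i; exists M.
exists (\sum_(i < d) M i); first by apply: sumr_ge0 => i _; case: (hM i).
move=> i; apply: Pm (hM i).2; rewrite (bigD1 i)//= lerDl.
by apply: sumr_ge0 => j _; case: (hM j).
Qed.

Let cc : R := d%:R * (2 * K1 R d).
Let cc0 : 0 <= cc. Proof. by rewrite !mulr_ge0// K1_ge0. Qed.

(** [heat] at time 0 is not the identity, so the ends of [0, 1] are reached as limits. The constant
    depends on all the data, but the factor [Num.sqrt e] lets it vanish in [commutator_le]; the rate
    comes from the Lipschitz bounds on [gg] and on the derivatives of [D [::]]. *)
Lemma Psi_ends : exists2 C : R, 0 <= C & forall e, 0 < e <= 2^-1 ->
  `|Psi G V e - \int[leb]_(s in `[a, b]) (s^-1 * \int[mu]_x (G s x * V0 x))| <= C * Num.sqrt e /\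
  `|Psi G V (1 - e) - \int[leb]_(s in `[a, b]) (s^-1 * \int[mu]_x (gg x * V s x))| <= C * Num.sqrt e.
Proof.
have [Mg Mg0 hMg] := bint_bound Xg.
have [MD MD0 hMD] := uniform_bound (P := fun j M => forall x, `|D [:: j] x| <= M)
  (fun i (x y : R) xy h z => le_trans (h z) xy) (fun j => bint_bound (XD [:: j])).
have [LD LD0 hLD] : exists2 L : R, 0 <= L & forall j, lip L (D [:: j]).
  apply: (uniform_bound (P := fun j L => lip L (D [:: j]))) => [i x y xy h z w|j]; last exact: sch_lip.
  by apply: (le_trans (h z w)); apply: ler_wpM2r => //; exact: sumr_ge0.
pose W x := \sum_(j < d) `|U j [::] x|.
have XW : bint W by apply: bint_sum => j; exact: bint_norm.
have W0 x : 0 <= W x by exact: sumr_ge0.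
have sumW (F : 'I_d -> R) M x : (forall j, `|F j| <= M) -> `|\sum_(j < d) U j [::] x * F j| <= M * W x.
  move=> FM; apply: (le_trans (ler_norm_sum _ _ _)); rewrite mulr_sumr; apply: ler_sum => j _.
  by rewrite normrM mulrC; exact: ler_wpM2r.
have VM c x : 0 < c -> `|V c x| <= MD * W x.
  by move=> c0; apply: sumW => j; apply: heat_le_sup => //; exact: hMD.
have XV0 : bint V0 by apply: bint_sum => j; exact: bintM.
have b0 : 0 < b by exact: lt_le_trans ab.
pose C1 := (Lg * cc * Num.sqrt b * MD + Mg * (LD * cc * Num.sqrt b)) * \int[mu]_x W x.
have C10 : 0 <= C1.
  by rewrite mulr_ge0 ?Rint_ge0// addr_ge0 ?mulr_ge0 ?sqrtr_ge0.
have close (h1 h0 k1 k0 : 'rV[R]_d -> R) e : 0 < e -> bint h1 -> bint h0 -> bint k1 -> bint k0 ->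
    (forall x, `|h1 x - h0 x| <= Lg * cc * Num.sqrt (e * b)) -> (forall x, `|h0 x| <= Mg) ->
    (forall x, `|k1 x| <= MD * W x) -> (forall x, `|k1 x - k0 x| <= LD * cc * Num.sqrt (e * b) * W x) ->
    `|\int[mu]_x (h1 x * k1 x) - \int[mu]_x (h0 x * k0 x)| <= C1 * Num.sqrt e.
  move=> e0 Xh1 Xh0 Xk1 Xk0 hh h0M k1M kk.
  rewrite -RintB; [|exact: bint_mul_intg|exact: bint_mul_intg].
  have -> : C1 * Num.sqrt e = \int[mu]_x ((Lg * cc * Num.sqrt b * MD + Mg * (LD * cc * Num.sqrt b)) * Num.sqrt e * W x).
    by rewrite RintZ ?(bint_intg XW)// /C1 mulrAC.
  apply: Rint_norm_le; [by apply: intgB; exact: bint_mul_intg|by apply: intgZ; exact: bint_intg|].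
  move=> x; have -> : h1 x * k1 x - h0 x * k0 x = (h1 x - h0 x) * k1 x + h0 x * (k1 x - k0 x) by ring.
  apply: (le_trans (ler_normD _ _)); rewrite !normrM.
  have eb : Num.sqrt (e * b) = Num.sqrt e * Num.sqrt b by rewrite sqrtrM// ltW.
  apply: (@le_trans _ _ ((Lg * cc * Num.sqrt (e * b)) * (MD * W x) + Mg * (LD * cc * Num.sqrt (e * b) * W x))).
    by apply: lerD; apply: ler_pM.
  by rewrite eb; apply: eq_ler; ring.
have holder (r s e : R) f L x : bint f -> 0 <= L -> lip L f -> 0 < r -> 0 < e -> s <= b ->
    `|heat r f x - heat (r + e * s) f x| <= L * cc * Num.sqrt (e * b) \/ s <= 0.
  move=> Xf L0 lf r0 e0 sb; have [s0|s0] := ltP 0 s; last by right.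
  left; rewrite distrC; apply: (le_trans (heat_holder x Xf L0 lf r0 (mulr_gt0 e0 s0))).
  by apply: ler_wpM2l; [rewrite mulr_ge0|apply: ler_wsqrtr; rewrite ler_pM2l].
have approx (s e : R) f L x : bint f -> 0 <= L -> lip L f -> 0 < e -> 0 < s -> s <= b ->
    `|heat (e * s) f x - f x| <= L * cc * Num.sqrt (e * b).
  move=> Xf L0 lf e0 s0 sb; apply: (le_trans (heat_approx x (mulr_gt0 e0 s0) Xf L0 lf)).
  by apply: ler_wpM2l; [rewrite mulr_ge0|apply: ler_wsqrtr; rewrite ler_pM2l].
pose C := a^-1 * C1 * (b - a).
have C0 : 0 <= C.
  by apply: mulr_ge0; [apply: mulr_ge0 => //; rewrite invr_ge0 ltW|rewrite subr_ge0].
have fin (F1 F0 : R -> R) e : 0 < e -> leb.-integrable `[a, b] (EFin \o (fun s => s^-1 * F1 s)) ->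
   leb.-integrable `[a, b] (EFin \o (fun s => s^-1 * F0 s)) ->
   (forall s, a <= s <= b -> `|F1 s - F0 s| <= C1 * Num.sqrt e) ->
   `|\int[leb]_(s in `[a, b]) (s^-1 * F1 s) - \int[leb]_(s in `[a, b]) (s^-1 * F0 s)| <= C * Num.sqrt e.
  move=> e0 i1 i0 h.
  rewrite -[X in _ + X]mulN1r -(Rint_itvZ (-1) i0) -(Rint_itvD i1 (Rint_itv_intgZ (-1) i0)).
  have -> : C * Num.sqrt e = (a^-1 * (C1 * Num.sqrt e)) * (b - a) by rewrite /C; ring.
  apply: (Rint_itv_bound ab) => [|s ss]; first exact: (Rint_itv_intgD i1 (Rint_itv_intgZ (-1) i0)).
  have s0 : 0 < s by case/andP: ss => as_ _; exact: lt_le_trans as_.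
  rewrite mulN1r -mulrBr normrM gtr0_norm ?invr_gt0//.
  by apply: ler_pM => //; [rewrite invr_ge0 ltW|rewrite lef_pV2 ?posrE//; case/andP: ss|exact: h].
exists C => // e /andP[e0 e2]; have e01 : 0 < e < 1 by lra.
have e01' : 0 < 1 - e < 1 by lra.
have e1 : 0 < 1 - e by lra.
split.
- apply: fin => //; first by apply: inv_tame_intg => //; exact: (mixed_tame tG tV _).
    by apply: inv_tame_intg => //; apply: tameM => //; exact: tame_cst.
  move=> s /andP[as_ sb]; have s0 : 0 < s by exact: lt_le_trans as_.
  have q1 : 0 < (1 - e) * s by rewrite mulr_gt0.
  have q2 : 0 < e * s by rewrite mulr_gt0.
  apply: close => //.
  + exact: tame_bint tG q1.
  + exact: tame_bint tG s0.
  + exact: tame_bint tV q2.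
  + move=> x; have [|] := holder ((1 - e) * s) s e gg Lg x Xg Lg0 lipg q1 e0 sb; last by rewrite leNgt s0.
    by rewrite -mulrDl subrK mul1r.
  + by move=> x; exact: heat_le_sup.
  + by move=> x; exact: VM.
  + move=> x; rewrite /V /V0 -sumrB (eq_bigr (fun j => U j [::] x * (heat (e * s) (D [:: j]) x - D [:: j] x))).
      by apply: sumW => j; exact: approx.
    by move=> j _; rewrite mulrBr.
- apply: fin => //; first by apply: inv_tame_intg => //; exact: (mixed_tame tG tV _).
    by apply: inv_tame_intg => //; apply: tameM => //; exact: tame_cst.
  move=> s /andP[as_ sb]; have s0 : 0 < s by exact: lt_le_trans as_.
  have q1 : 0 < (1 - e) * s by rewrite mulr_gt0.
  have q2 : 0 < e * s by rewrite mulr_gt0.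
  rewrite (_ : 1 - (1 - e) = e); last by ring.
  apply: close => //.
  + exact: tame_bint tG q2.
  + exact: tame_bint tV q1.
  + exact: tame_bint tV s0.
  + by move=> x; exact: approx.
  + by move=> x; exact: VM.
  + move=> x; rewrite /V -sumrB (eq_bigr (fun j => U j [::] x * (heat ((1 - e) * s) (D [:: j]) x - heat s (D [:: j]) x))).
      apply: sumW => j; have [|] := holder ((1 - e) * s) s e _ LD x (XD [:: j]) LD0 (hLD j) q1 e0 sb; last by rewrite leNgt s0.
      by rewrite -mulrDl subrK mul1r.
    by move=> j _; rewrite mulrBr.
Qed.

Variables (q qt : \bar R) (A B : R).
Hypotheses (q2 : (2%:E <= q)%E) (qt2 : (2%:E <= qt)%E) (hq : (q^-1 + qt^-1 = (2^-1)%:E)%E).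
Hypothesis UA : forall i j, (Lqnorm q (U j [:: i]) <= A%:E)%E.
Hypothesis DB : (Lqnorm qt (D [::]) <= B%:E)%E.

(** There are [d * d] pairs of indices, and two trilinear forms per pair, each bounded with the
    constant [6 * trilC]. *)
Definition commC : R := d%:R * d%:R * (12 * trilC R d).

Let A0 i j : 0 <= A. Proof. by rewrite -lee_fin (le_trans _ (UA i j))// Lnorm_ge0. Qed.
Let B0 : 0 <= B. Proof. by rewrite -lee_fin (le_trans _ DB)// Lnorm_ge0. Qed.

Let Psi_der_le (c : R) : 0 < c < 1 ->
  `|ST (fun s x => G ((1 - c) * s) x * V' (c * s) x - G' ((1 - c) * s) x * V (c * s) x)| <=
  commC * L2 gg * (A * B) * weight c.
Proof.
move=> c01; have c0 := rho0 c01; have c1 := rho1 c01.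
have tt i j k : tame (fun s x => U j [:: i] x * (dheat j (c * s) (D [::]) x * dheat k ((1 - c) * s) gg x)).
  apply: (tameM (tame_cst (XU j [:: i]))); apply: tameM.
    exact: tame_scale c0 (tame_dheat _ (XD [::])).
  exact: tame_scale c1 (tame_dheat _ Xg).
have tt' i j : tame (fun s x => U j [:: i] x * (dheat i (c * s) (D [::]) x * dheat j ((1 - c) * s) gg x)).
  apply: (tameM (tame_cst (XU j [:: i]))); apply: tameM.
    exact: tame_scale c0 (tame_dheat _ (XD [::])).
  exact: tame_scale c1 (tame_dheat _ Xg).
have -> : ST (fun s x => G ((1 - c) * s) x * V' (c * s) x - G' ((1 - c) * s) x * V (c * s) x) =
    ST (fun s x => \sum_(i < d) \sum_(j < d)
      (U j [:: i] x * (dheat j (c * s) (D [::]) x * dheat i ((1 - c) * s) gg x) +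
       U j [:: i] x * (dheat i (c * s) (D [::]) x * dheat j ((1 - c) * s) gg x))).
  apply: eq_Rintegral => s; rewrite inE/= in_itv/= => /andP[as_ _].
  have s0 : 0 < s by exact: lt_le_trans as_.
  rewrite comm_identity ?mulr_gt0// Rint_sum; last first.
    by move=> i _; apply: intg_sum => j _; apply: intgD; [exact: bint_intg (tame_bint (tt i j i) s0)|exact: bint_intg (tame_bint (tt' i j) s0)].
  apply: eq_bigr => i _; rewrite Rint_sum; last first.
    by move=> j _; apply: intgD; [exact: bint_intg (tame_bint (tt i j i) s0)|exact: bint_intg (tame_bint (tt' i j) s0)].
  by apply: eq_bigr => j _; rewrite RintD//; [exact: bint_intg (tame_bint (tt i j i) s0)|exact: bint_intg (tame_bint (tt' i j) s0)].
rewrite ST_sum//; last by move=> i; apply: tame_sum => j; exact: tameD (tt i j i) (tt' i j).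
apply: (le_trans (ler_norm_sum _ _ _)).
have -> : commC * L2 gg * (A * B) * weight c =
    \sum_(i < d) \sum_(j < d) (12 * (trilC R d * L2 gg * weight c) * (A * B)).
  rewrite !sumr_const card_ord -!mulrnA -[RHS]mulr_natl natrM /commC.
  by move: (trilC R d) => z; ring.
apply: ler_sum => i _; rewrite ST_sum//; last by move=> j; exact: tameD (tt i j i) (tt' i j).
apply: (le_trans (ler_norm_sum _ _ _)); apply: ler_sum => j _.
rewrite (STD b a0 (tt i j i) (tt' i j)); apply: (le_trans (ler_normD _ _)).
have h k l : `|tril a b c k l gg (U j [:: i]) (D [::])| <= 6 * (trilC R d * L2 gg * weight c) * (A * B).
  exact: (tril_le a0 ab k l c01 Xg q2 qt2 hq).
apply: (le_trans (lerD (h j i) (h i j))); apply: eq_ler.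
by move: (trilC R d) => z; ring.
Qed.

Lemma commutator_le :
  `|\int[leb]_(s in `[a, b]) (s^-1 * \int[mu]_x (gg x * V s x)) -
    \int[leb]_(s in `[a, b]) (s^-1 * \int[mu]_x (G s x * V0 x))| <= 12 * (commC * L2 gg * (A * B)).
Proof.
set z1 := Rintegral _ _ _; set z0 := Rintegral _ _ _.
pose X := commC * L2 gg * (A * B).
have X0 : 0 <= X.
  (* The sign of [A] is read off from a bound on some component of the gradient, so an index is
     required; in dimension 0 the constant [commC] is 0. *)
  have [d0|/existsNP[i _]] := pselect (forall i : 'I_d, False).
    have dd : d = 0%N by case: (d) d0 => // n /(_ ord0).
    by rewrite /X /commC {1}dd !mul0r.
  rewrite /X /commC !mulr_ge0 ?sqrtr_ge0 ?(A0 i i) ?B0// (le_trans _ (trilC_ge2 R d))//.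
have [C C0 hC] := Psi_ends.
have C2 : 0 <= C + C by rewrite addr_ge0.
have h2 : 0 < 2^-1 :> R by rewrite invr_gt0.
apply: (ler_sqrt_eps C2 h2) => e /[dup] e2 /andP[e0 e12]; have [h0 h1] := hC e e2.
have dP (c : R) : 0 < c < 1 -> is_derive c 1 (Psi G V)
    (ST (fun s x => G ((1 - c) * s) x * V' (c * s) x - G' ((1 - c) * s) x * V (c * s) x)).
  by move=> c01; exact: (Psi_derive a0 ab tG tG' tV tV' dG dV c01).
have hw := weight_diff_le X0 e0 e12 dP (fun c c01 => Psi_der_le c01).
have tri (z p r w Y Z : R) : `|p - z| <= Y -> `|p - r| <= Z -> `|r - w| <= Y ->
    `|z - w| <= Y + Y + Z.
  move=> t1 t2 t3; have -> : z - w = (z - p) + ((p - r) + (r - w)) by ring.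
  rewrite -[leRHS]addrA (addrC Y Z); apply: (le_trans (ler_normD _ _)); apply: lerD.
    by rewrite distrC.
  by apply: (le_trans (ler_normD _ _)); apply: lerD.
by have := tri _ _ _ _ _ _ h1 hw h0; rewrite -mulrDl.
Qed.

End commutator_bound.

(** * Logarithm of the Laplacian *)

Section logop.
Context (R : realType) (d : nat) (a b : R).
Hypotheses (a0 : 0 < a) (ab : a <= b).
Local Notation mu := (lebesgue_rV R d).
Local Notation leb := (@lebesgue_measure R).
Local Notation L2 f := (Num.sqrt (\int[mu]_x f x ^+ 2)).
Implicit Types (i j k : 'I_d) (f g h : 'rV[R]_d -> R) (x : 'rV[R]_d).

Lemma Rint_itv_sum n (F : 'I_n -> R -> R) :
  (forall i : 'I_n, leb.-integrable `[a, b] (EFin \o F i)) ->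
  \int[leb]_(c in `[a, b]) \sum_(i < n) F i c = \sum_(i < n) \int[leb]_(c in `[a, b]) F i c.
Proof.
elim: n F => [|n ih] F iF.
  rewrite big_ord0; under eq_Rintegral do rewrite big_ord0.
  by rewrite Rintegral_mkcond (eq_Rint _ (g := fun=> 0)) ?Rint0// => c; rewrite patchE; case: ifP.
rewrite big_ord_recl -ih// -Rint_itvD//; last exact: Rint_itv_intg_sum.
by apply: eq_Rintegral => c _; rewrite big_ord_recl.
Qed.

Transparent heat conv.

Lemma measurable_heat f : measurable_fun [set: 'rV[R]_d] f ->
  measurable_fun [set: R * 'rV[R]_d] (fun p => heat p.1 f p.2).
Proof.
move=> mf; apply: (@measurable_Rint_param _ _ _ _ R mu
  (fun p : (R * 'rV[R]_d) * 'rV[R]_d => Gk p.1.1 (p.1.2 - p.2) * f p.2)).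
apply: measurable_funM; last exact: measurableT_comp.
apply: measurable_Gk; first by apply: measurableT_comp => //; exact: measurable_fst.
apply: measurable_rVB => //.
by apply: (measurableT_comp measurable_snd measurable_fst).
Qed.

Opaque heat conv.

(** The value of the Fourier multiplier of [heat s] at frequencies of norm one. *)
Definition esym (s : R) : R := expR (- (4 * pi ^+ 2) * s).

Lemma esym_le1 s : 0 <= s -> 0 <= esym s <= 1.
Proof.
by move=> s0; rewrite expR_ge0/= -expR0 ler_expR mulNr oppr_le0 mulr_ge0// mulr_ge0// sqr_ge0.
Qed.

(** Integrals over [[a, b]] are rewritten over the whole line with an indicator, the form in which
    the exchange of integrals is available. *)
Let chi (s : R) : R := \1_(`[a, b]%classic) s.
Let ker (s : R) : R := chi s * s^-1.
Let Phi f (p : R * 'rV[R]_d) : R := ker p.1 * (heat p.1 f p.2 - esym p.1 * f p.2).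

Lemma Rint_itv_indic (F : R -> R) : \int[leb]_(s in `[a, b]) F s = \int[leb]_s (chi s * F s).
Proof.
rewrite Rintegral_mkcond; apply: eq_Rint => s.
by rewrite /chi indicE /patch; case: ifP; rewrite ?mul1r ?mul0r.
Qed.

Let chiP s : (a <= s <= b /\ chi s = 1) \/ chi s = 0.
Proof.
rewrite /chi indicE; case: (boolP (s \in _)) => h; last by right.
by left; split=> //; move: h; rewrite inE/= in_itv.
Qed.

Let ker0 s : 0 <= ker s.
Proof.
have [[/andP[as_ _] e]|e] := chiP s; rewrite /ker e ?mul0r// mul1r invr_ge0.
exact: le_trans (ltW a0) as_.
Qed.

Let ker_le s : ker s <= a^-1 * chi s.
Proof.
have [[/andP[as_ _] e]|e] := chiP s; rewrite /ker e ?mul0r ?mulr0// mul1r mulr1.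
by rewrite lef_pV2 ?posrE// (lt_le_trans a0).
Qed.

Let ichi : intg leb chi. Proof. exact: integrable_indic_itv. Qed.

Let mker : measurable_fun [set: R] ker.
Proof.
apply: measurable_funM; last exact: measurable_inv.
exact: measurable_indic.
Qed.

Let mesym : measurable_fun [set: R] esym.
Proof. by apply: measurableT_comp => //; exact: measurable_funM. Qed.

Let mPhi f : measurable_fun [set: 'rV[R]_d] f -> measurable_fun [set: R * 'rV[R]_d] (Phi f).
Proof.
move=> mf; apply: measurable_funM; first by apply: measurableT_comp => //; exact: measurable_fst.
apply: measurable_funB; first exact: measurable_heat.
apply: measurable_funM; last by apply: measurableT_comp => //; exact: measurable_snd.
by apply: (measurableT_comp mesym); exact: measurable_fst.
Qed.

Let Phi_le f (M s : R) x : bint f -> (forall y, `|f y| <= M) -> `|Phi f (s, x)| <= 2 * M / a * chi s.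
Proof.
move=> Xf fM; have M0 : 0 <= M by exact: le_trans (fM 0).
rewrite /Phi/= normrM (ger0_norm (ker0 s)).
have [[/andP[as_ _] e]|e] := chiP s; last by rewrite /ker e !mul0r mulr0.
have s0 : 0 < s by exact: lt_le_trans as_.
have -> : 2 * M / a * chi s = (a^-1 * chi s) * (2 * M) by ring.
apply: ler_pM => //.
apply: (le_trans (ler_normB _ _)); rewrite mulr_natl mulr2n; apply: lerD; first exact: heat_le_sup.
have /andP[h0 h1] := esym_le1 (ltW s0).
by rewrite normrM (ger0_norm h0); apply: le_trans (fM x); rewrite ler_piMl.
Qed.

Let Phi_L1 f s : bint f ->
  intg mu (fun x => Phi f (s, x)) /\ \int[mu]_x `|Phi f (s, x)| <= (2 / a * \int[mu]_x `|f x|) * chi s.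
Proof.
move=> Xf; have [[/andP[as_ _] e]|e] := chiP s; last first.
  have E x : Phi f (s, x) = 0 by rewrite /Phi /ker/= e !mul0r.
  split; first by apply: eq_intg (intg0 mu) => x; rewrite E.
  rewrite e mulr0 (eq_Rint _ (g := fun=> 0)) ?Rint0// => x.
  by rewrite E normr0.
have s0 : 0 < s by exact: lt_le_trans as_.
have Xh := bint_heat s0 Xf; have Xa := bint_norm Xf.
have iP : intg mu (fun x => Phi f (s, x)).
  have : intg mu (fun x => ker s * (heat s f x - esym s * f x)); last by [].
  by apply: intgZ; apply: intgB; [exact: bint_intg|apply: intgZ; exact: bint_intg].
split=> //; have Xha := bint_heat s0 Xa.
apply: (@le_trans _ _ (\int[mu]_x (a^-1 * (heat s (fun y => `|f y|) x + `|f x|)))).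
  apply: Rint_le.
  - exact: intg_norm.
  - by apply: intgZ; apply: intgD; exact: bint_intg.
  move=> x; rewrite /Phi/= normrM (ger0_norm (ker0 s)).
  have := ker_le s; rewrite e mulr1 => kl; apply: ler_pM => //.
  apply: (le_trans (ler_normB _ _)); apply: lerD.
    by have := conv_norm_le x (Gk_gkernel d s0) (bint_intg Xf); rewrite mul1r; exact.
  have /andP[h0 h1] := esym_le1 (ltW s0).
  by rewrite normrM (ger0_norm h0) ler_piMl.
rewrite RintZ; last by apply: intgD; exact: bint_intg.
rewrite RintD; [|exact: bint_intg|exact: bint_intg].
have -> : \int[mu]_x heat s (fun y => `|f y|) x = \int[mu]_x `|f x| by exact: Rint_convGk.
by rewrite e; apply: eq_ler; ring.
Qed.

Let PhiL f : bint f -> forall x, intg leb (fun s => Phi f (s, x)).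
Proof.
move=> Xf x; have [M M0 fM] := bint_bound Xf.
have ih : intg leb (fun s : R => 2 * M / a * chi s) by exact: intgZ.
apply: (intg_le _ _ ih).
- by apply: (measurableT_comp (mPhi (bint_measurable Xf))); exact: pair2_measurable.
- by move=> s; exact: Phi_le.
Qed.

Let PhiN f g (C : R) : bint f -> measurable_fun [set: 'rV[R]_d] g -> (forall x, `|g x| <= C) ->
  intg leb (fun s => \int[mu]_x `|g x * Phi f (s, x)|).
Proof.
move=> Xf mg gC; have C0 : 0 <= C by exact: le_trans (gC 0).
have ih : intg leb (fun s : R => C * ((2 / a * \int[mu]_x `|f x|) * chi s)) by do 2 apply: intgZ.
apply: (intg_le _ _ ih).
- apply: (@measurable_Rint_param _ _ _ _ R mu (fun p => `|g p.2 * Phi f p|)).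
  apply: measurableT_comp => //; apply: measurable_funM; last exact: mPhi (bint_measurable Xf).
  by apply: measurableT_comp => //; exact: measurable_snd.
- move=> s; have [i1 h1] := Phi_L1 s Xf.
  have igP : intg mu (fun x => g x * Phi f (s, x)) by exact: (intg_bounded_mul mg gC i1).
  rewrite ger0_norm ?Rint_ge0//.
  apply: (@le_trans _ _ (\int[mu]_x (C * `|Phi f (s, x)|))).
    apply: Rint_le; [exact: intg_norm|by apply: intgZ; exact: intg_norm|move=> x].
    by rewrite normrM; exact: ler_wpM2r.
  by rewrite RintZ; [exact: ler_wpM2l|exact: intg_norm].
Qed.

(** The integral has a symbol that approximates minus the logarithm of |xi|^2; this explains the
    sign and the factor 1/2. *)
Definition Lop f x : R :=
  - 2^-1 * \int[leb]_(s in `[a, b]) (s^-1 * (heat s f x - esym s * f x)).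

Let LopE f x : Lop f x = - 2^-1 * \int[leb]_s Phi f (s, x).
Proof.
rewrite /Lop Rint_itv_indic; congr (_ * _); apply: eq_Rint => s.
by rewrite mulrA.
Qed.

Let fub f g (C : R) : bint f -> measurable_fun [set: 'rV[R]_d] g -> (forall x, `|g x| <= C) ->
  [/\ intg mu (fun x => \int[leb]_s (g x * Phi f (s, x))) &
   \int[mu]_x \int[leb]_s (g x * Phi f (s, x)) = \int[leb]_s \int[mu]_x (g x * Phi f (s, x))].
Proof.
move=> Xf mg gC.
pose F (p : R * 'rV[R]_d) := g p.2 * Phi f p.
have mF : measurable_fun [set: R * 'rV[R]_d] F.
  apply: measurable_funM; last exact: mPhi (bint_measurable Xf).
  by apply: measurableT_comp => //; exact: measurable_snd.
have F1 s : intg mu (fun x => F (s, x)) by apply: (intg_bounded_mul mg gC); case: (Phi_L1 s Xf).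
have F2 x : intg leb (fun s => F (s, x)) by exact: (intgZ (g x) (PhiL Xf x)).
have F3 : intg leb (fun s => \int[mu]_x `|F (s, x)|) by exact: (PhiN Xf mg gC).
split; last by have := @Rint_fubini _ _ _ _ R leb mu F mF F1 F2 F3; rewrite /F/= => <-.
have F4 := @intg_Rint_swap _ _ _ _ R leb mu F mF F1 F2 F3.
apply: (@intg_le _ _ _ _ _ (fun x => \int[leb]_s `|F (s, x)|)) => //.
  apply: (@measurable_Rint_param _ _ _ _ R leb (fun p : 'rV[R]_d * R => F (p.2, p.1))).
  by apply: (measurableT_comp mF); apply: measurable_fun_pair; [exact: measurable_snd|exact: measurable_fst].
by move=> x; exact: (Rint_norm (F2 x)).
Qed.

Lemma bint_Lop f : bint f -> bint (Lop f).
Proof.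
move=> Xf; have [M M0 fM] := bint_bound Xf.
have [i1 _] := @fub f (fun=> 1) 1 Xf (measurable_cst _) (fun _ => eq_ler (normr1 _)).
have i2 : intg mu (Lop f).
  apply: (@eq_intg _ _ _ _ (fun x => - 2^-1 * \int[leb]_s (1 * Phi f (s, x)))); last exact: intgZ.
  by move=> x; rewrite LopE; congr (_ * _); apply: eq_Rint => s; rewrite mul1r.
split=> //; first exact: intg_measurable i2.
exists (2^-1 * \int[leb]_s (2 * M / a * chi s)) => x.
have h0 : 0 <= 2^-1 :> R by rewrite invr_ge0.
rewrite LopE normrM normrN (ger0_norm h0); apply: (ler_wpM2l h0).
have ih : intg leb (fun s : R => 2 * M / a * chi s) by exact: intgZ.
by apply: (Rint_norm_le (PhiL Xf x) ih) => s; exact: Phi_le.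
Qed.

Lemma Rint_Lop f g (C : R) : bint f -> measurable_fun [set: 'rV[R]_d] g -> (forall x, `|g x| <= C) ->
  \int[mu]_x (g x * Lop f x) =
  - 2^-1 * \int[leb]_(s in `[a, b]) (s^-1 * (\int[mu]_x (g x * heat s f x) - esym s * \int[mu]_x (g x * f x))).
Proof.
move=> Xf mg gC; have [i1 e] := fub Xf mg gC.
transitivity (- 2^-1 * \int[mu]_x \int[leb]_s (g x * Phi f (s, x))).
  rewrite -RintZ//; apply: eq_Rint => x; rewrite LopE mulrCA; congr (_ * _).
  by rewrite RintZ//; exact: PhiL.
rewrite e Rint_itv_indic; congr (_ * _); apply: eq_Rint => s.
have [[/andP[as_ _] es]|es] := chiP s; last first.
  rewrite es mul0r (eq_Rint _ (g := fun=> 0)) ?Rint0// => x.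
  by rewrite /Phi /ker/= es !mul0r mulr0.
have s0 : 0 < s by exact: lt_le_trans as_.
have h1 : intg mu (fun x => g x * heat s f x).
  by apply: (intg_bounded_mul mg gC); apply: bint_intg; exact: bint_heat.
have h2 : intg mu (fun x => g x * f x) by apply: (intg_bounded_mul mg gC); exact: bint_intg.
rewrite -(RintZ (esym s))// -RintB//; last exact: intgZ.
rewrite mulrA -RintZ; last by apply: intgB => //; exact: intgZ.
by apply: eq_Rint => x; rewrite /Phi/=; rewrite -/(ker s); ring.
Qed.

Lemma Lop_derive f f' i x : bint f -> bint f' -> (forall x, is_derive x (evec i) f (f' x)) ->
  line_continuous i f' -> is_derive x (evec i) (Lop f) (Lop f' x).
Proof.
move=> Xf Xf' df cf'; apply: is_derive_line0; rewrite LopE.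
have [M M0 fM] := bint_bound Xf'.
apply: (is_deriveE (f := fun t : R => - 2^-1 * \int[leb]_s Phi f (s, x + t *: evec i))
  (l := - 2^-1 * \int[leb]_s Phi f' (s, x + 0 *: evec i))).
- apply: derZ.
  apply: (@under_is_derive _ _ R leb (-1) 1 (fun t s => Phi f (s, x + t *: evec i))
    (fun t s => Phi f' (s, x + t *: evec i)) (fun s => 2 * M / a * chi s)).
  + by move=> t _; exact: PhiL.
  + move=> t s _; rewrite /Phi/=; have [[/andP[as_ _] e]|e] := chiP s; last first.
      rewrite /ker e !mul0r; apply: (is_deriveE (derC _ _ 0)) => // y.
      by rewrite !mul0r.
    have s0 : 0 < s by exact: lt_le_trans as_.
    apply: derZ; apply: derB.
      apply: is_derive_line; rewrite (heat_dcomm s0 Xf Xf' df cf').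
      exact: heat_derive.
    apply: derZ; apply: is_derive_line; exact: df.
  + exact: intgZ.
  + by move=> t s _; exact: Phi_le.
  + by rewrite ltrN10 ltr01.
- by move=> t; rewrite LopE.
- by rewrite scale0r addr0.
Qed.

Lemma sch_Lop (D : seq 'I_d -> 'rV[R]_d -> R) : sch D -> sch (fun s => Lop (D s)).
Proof.
move=> SD; have [XD dD] := SD; split=> [s|s i x]; first exact: bint_Lop.
by apply: Lop_derive => //; exact: sch_lc.
Qed.

Variables (D : seq 'I_d -> 'rV[R]_d -> R) (U : 'I_d -> seq 'I_d -> 'rV[R]_d -> R).
Hypotheses (SD : sch D) (SU : forall j, sch (U j)).
Hypothesis divU : forall x, \sum_(j < d) U j [:: j] x = 0.
Variables (q qt : \bar R) (A B : R).
Hypotheses (q2 : (2%:E <= q)%E) (qt2 : (2%:E <= qt)%E) (hq : (q^-1 + qt^-1 = (2^-1)%:E)%E).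
Hypothesis UA : forall i j, (Lqnorm q (U j [:: i]) <= A%:E)%E.
Hypothesis DB : (Lqnorm qt (D [::]) <= B%:E)%E.

Let XD s : bint (D s). Proof. by case: SD. Qed.
Let XU j s : bint (U j s). Proof. by case: (SU j). Qed.

(** Twice the integrand is the divergence of [U H^2], minus [H^2] times the divergence of [U]. *)
Lemma transport_skew (H : seq 'I_d -> 'rV[R]_d -> R) : sch H ->
  \int[mu]_x (H [::] x * \sum_(j < d) U j [::] x * H [:: j] x) = 0.
Proof.
move=> SH; have [XH dH] := SH.
have dU s k j x : is_derive x (evec k) (U j s) (U j (k :: s) x) by case: (SU j) => _; exact.
have E j : \int[mu]_x (U j [:: j] x * H [::] x ^+ 2) + 2 * \int[mu]_x (H [::] x * (U j [::] x * H [:: j] x)) = 0.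
  have i1 : intg mu (fun x => U j [:: j] x * H [::] x ^+ 2).
    by apply: bint_mul_intg => //; exact: bintM.
  have i2 : intg mu (fun x => H [::] x * (U j [::] x * H [:: j] x)).
    by apply: bint_mul_intg => //; exact: bintM.
  rewrite -RintZ// -RintD//; last exact: intgZ.
  apply: (@Rint_derive0 R d j (fun x => U j [::] x * H [::] x ^+ 2)).
  - move=> x; apply: (is_deriveE (derM (dU [::] j j x) (der_sqr (dH [::] j x)))) => //.
    by ring.
  - apply: line_continuousD.
      apply: line_continuousM; first exact: sch_lc.
      by apply: line_continuousM; exact: sch_lc.
    apply: line_continuousM; first by move=> y t; exact: cst_continuous.
    by do 2 (apply: line_continuousM; first exact: sch_lc); exact: sch_lc.
  - by apply: bint_mul_intg => //; exact: bintM.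
  - by apply: intgD => //; exact: intgZ.
have -> : \int[mu]_x (H [::] x * \sum_(j < d) U j [::] x * H [:: j] x) =
    \sum_(j < d) \int[mu]_x (H [::] x * (U j [::] x * H [:: j] x)).
  rewrite -Rint_sum; last by move=> j _; apply: bint_mul_intg => //; exact: bintM.
  by apply: eq_Rint => x; rewrite mulr_sumr.
have S : \sum_(j < d) \int[mu]_x (U j [:: j] x * H [::] x ^+ 2) = 0.
  rewrite -Rint_sum; last by move=> j _; apply: bint_mul_intg => //; exact: bintM.
  rewrite -[RHS](Rint0 mu); apply: eq_Rint => x.
  by rewrite -mulr_suml divU mul0r.
have : \sum_(j < d) (\int[mu]_x (U j [:: j] x * H [::] x ^+ 2) + 2 * \int[mu]_x (H [::] x * (U j [::] x * H [:: j] x))) = 0.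
  by rewrite big1.
rewrite big_split/= S add0r -mulr_sumr => /eqP; rewrite mulf_eq0 pnatr_eq0/=.
by move/eqP.
Qed.

(** With [g = Lop (D [::])], self-adjointness turns the left-hand side into [- 2^-1 * (z0 - e0)].
    Pairing [g] with the transport of [g] gives [- 2^-1 * (z1 - e0)] with the same scalar
    contribution [e0], and this vanishes by [transport_skew]. Hence only [2^-1 * (z1 - z0)] is left,
    and the constant is 6 = 12/2. *)
Lemma Lop_commutator :
  `|\int[mu]_x (Lop (D [::]) x * Lop (fun y => \sum_(j < d) U j [::] y * D [:: j] y) x)| <=
  6 * (commC R d * L2 (Lop (D [::])) * (A * B)).
Proof.
have SL := sch_Lop SD; have [XL _] := SL.
pose g := Lop (D [::]).
have Xg : bint g by exact: (XL [::]).
have [Lg Lg0 lipg] := sch_lip [::] SL.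
pose V0 x := \sum_(j < d) U j [::] x * D [:: j] x.
pose V c x := \sum_(j < d) U j [::] x * heat c (D [:: j]) x.
have XV0 : bint V0 by apply: bint_sum => j; exact: bintM.
have tV : tame V.
  by apply: tame_sum => j; apply: (tameM (tame_cst (XU j [::]))); exact: tame_heat.
have [C C0 gC] := bint_bound Xg.
have main := commutator_le a0 ab SD SU divU Xg Lg0 lipg q2 qt2 hq UA DB.
pose z1 := \int[leb]_(s in `[a, b]) (s^-1 * \int[mu]_x (g x * V s x)).
pose z0 := \int[leb]_(s in `[a, b]) (s^-1 * \int[mu]_x (heat s g x * V0 x)).
pose e0 := \int[leb]_(s in `[a, b]) (s^-1 * (esym s * \int[mu]_x (g x * V0 x))).
have i1 : leb.-integrable `[a, b] (EFin \o (fun s => s^-1 * \int[mu]_x (g x * V s x))).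
  by apply: inv_tame_intg => //; apply: tameM => //; exact: tame_cst.
have i0 : leb.-integrable `[a, b] (EFin \o (fun s => s^-1 * \int[mu]_x (heat s g x * V0 x))).
  by apply: inv_tame_intg => //; apply: tameM; [exact: tame_heat|exact: tame_cst].
have iesym (k : R) : leb.-integrable `[a, b] (EFin \o (fun s => s^-1 * (esym s * k))).
  apply: continuous_compact_integrable; first exact: segment_compact.
  apply: continuous_in_subspaceT => c; rewrite inE/= in_itv/= => /andP[ac cb].
  have c0 : 0 < c by exact: lt_le_trans ac.
  apply: continuousM; first exact: der_continuous (der_inv (lt0r_neq0 c0)).
  apply: continuousM; last exact: cst_continuous.
  apply: der_continuous; exact: (@der_comp R expR (fun s => - (4 * pi ^+ 2) * s) c _ _ (is_derive_expR _) (derZ _ (der_id c))).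
have ie := iesym (\int[mu]_x (g x * V0 x)).
have H1 : \int[mu]_x (g x * Lop V0 x) = - 2^-1 * (z0 - e0).
  rewrite (Rint_Lop XV0 (bint_measurable Xg) gC); congr (_ * _).
  rewrite /z0 /e0 -[X in _ + X]mulN1r -(Rint_itvZ (-1) ie) -(Rint_itvD i0 (Rint_itv_intgZ (-1) ie)).
  apply: eq_Rintegral => s; rewrite inE/= in_itv/= => /andP[as_ _].
  have s0 : 0 < s by exact: lt_le_trans as_.
  by rewrite -(heat_selfadj s0 Xg XV0); ring.
have H2 : - 2^-1 * (z1 - e0) = 0.
  have := transport_skew SL; rewrite -/g => h0.
  rewrite -[RHS]h0.
  transitivity (\sum_(j < d) \int[mu]_x ((g x * U j [::] x) * Lop (D [:: j]) x)); last first.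
    rewrite -Rint_sum; last by move=> j _; apply: bint_mul_intg => //; exact: bintM.
    by apply: eq_Rint => x; rewrite mulr_sumr; apply: eq_bigr => j _; rewrite mulrA.
  have Xgu j : bint (fun x => g x * U j [::] x) by exact: bintM.
  have E j : \int[mu]_x ((g x * U j [::] x) * Lop (D [:: j]) x) = - 2^-1 *
    \int[leb]_(s in `[a, b]) (s^-1 * (\int[mu]_x (g x * U j [::] x * heat s (D [:: j]) x) -
        esym s * \int[mu]_x (g x * U j [::] x * D [:: j] x))).
    have [C' _ gC'] := bint_bound (Xgu j).
    exact: (Rint_Lop (XD [:: j]) (bint_measurable (Xgu j)) gC').
  rewrite (eq_bigr _ (fun j _ => E j)) -mulr_sumr; congr (_ * _).
  transitivity (\int[leb]_(s in `[a, b]) \sum_(j < d) (s^-1 * (\int[mu]_x (g x * U j [::] x * heat s (D [:: j]) x) -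
      esym s * \int[mu]_x (g x * U j [::] x * D [:: j] x)))).
    rewrite /z1 /e0 -[X in _ + X]mulN1r -(Rint_itvZ (-1) ie) -(Rint_itvD i1 (Rint_itv_intgZ (-1) ie)).
    apply: eq_Rintegral => s; rewrite inE/= in_itv/= => /andP[as_ _].
    have s0 : 0 < s by exact: lt_le_trans as_.
    have -> : \int[mu]_x (g x * V s x) = \sum_(j < d) \int[mu]_x (g x * U j [::] x * heat s (D [:: j]) x).
      rewrite -Rint_sum; last by move=> j _; apply: bint_mul_intg => //; exact: bint_heat.
      by apply: eq_Rint => x; rewrite mulr_sumr; apply: eq_bigr => j _; rewrite mulrA.
    have -> : \int[mu]_x (g x * V0 x) = \sum_(j < d) \int[mu]_x (g x * U j [::] x * D [:: j] x).
      rewrite -Rint_sum; last by move=> j _; exact: bint_mul_intg.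
      by apply: eq_Rint => x; rewrite mulr_sumr; apply: eq_bigr => j _; rewrite mulrA.
    by rewrite mulN1r -mulrBr mulr_sumr -sumrB mulr_sumr.
  apply: Rint_itv_sum => j.
  have ij : leb.-integrable `[a, b] (EFin \o (fun s => s^-1 * \int[mu]_x (g x * U j [::] x * heat s (D [:: j]) x))).
    by apply: inv_tame_intg => //; apply: tameM; [exact: tame_cst|exact: tame_heat].
  have := Rint_itv_intgD ij (Rint_itv_intgZ (-1) (iesym (\int[mu]_x (g x * U j [::] x * D [:: j] x)))).
  congr (_.-integrable _ _); apply/funext => s /=; congr EFin.
  by rewrite mulN1r mulrBr.
have -> : \int[mu]_x (Lop (D [::]) x * Lop (fun y => \sum_(j < d) U j [::] y * D [:: j] y) x) = 2^-1 * (z1 - z0).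
  by rewrite -[LHS]/(\int[mu]_x (g x * Lop V0 x)) H1; lra.
rewrite normrM ger0_norm ?invr_ge0//.
have -> : 6 * (commC R d * L2 (Lop (D [::])) * (A * B)) = 2^-1 * (12 * (commC R d * L2 g * (A * B))).
  by rewrite -/g; lra.
by apply: ler_wpM2l; rewrite ?invr_ge0.
Qed.

End logop.

(** * Limits of integrals *)

Section convergence.
Context d (T : measurableType d) (R : realType).
Variable mu : {measure set T -> \bar R}.
Variables (F : nat -> T -> R) (G : T -> R).
Hypothesis mF : forall n, measurable_fun [set: T] (F n).
Hypothesis FG : forall x, F n x @[n --> \oo] --> G x.

Lemma measurable_lim : measurable_fun [set: T] G.
Proof. by apply: (measurable_fun_cvg mF) => x _; exact: FG. Qed.

Lemma Rint_fatou (M : R) : (forall n x, 0 <= F n x) -> (forall n, intg mu (F n)) ->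
  (forall n, \int[mu]_x F n x <= M) -> intg mu G /\ \int[mu]_x G x <= M.
Proof.
move=> F0 iF FM; have mG := measurable_lim.
have G0 x : 0 <= G x.
  by apply: (ler_cvg_to (cvg_cst 0) (@FG x)); apply: nearW => n; exact: F0.
have h : (\int[mu]_x (G x)%:E <= M%:E)%E.
  have := @fatou _ _ _ mu setT measurableT (fun n x => (F n x)%:E)
    (fun n => measurableT_comp (@EFin_measurable R setT) (mF n)) (fun n x _ => F0 n x).
  rewrite (eq_integral (fun x => (G x)%:E)); last first.
    move=> x _; suff /cvg_limn_einf_sup[] : (F n x)%:E @[n --> \oo] --> (G x)%:E by [].
    by apply/fine_cvgP; split; [exact: nearW|exact: FG].
  move=> /le_trans; apply; rewrite limn_einf_lim; apply: lime_le; first exact: is_cvg_einfs.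
  apply: nearW => n; apply: (@le_trans _ _ (\int[mu]_x (F n x)%:E)%E).
    by apply: ereal_inf_lbound; exists n => //=.
  by rewrite -EFin_Rint// lee_fin.
have iG : intg mu G by apply: intg_lty => //; exact: le_lt_trans h (ltry _).
by split=> //; rewrite -lee_fin EFin_Rint.
Qed.

Lemma Rint_dct (H : T -> R) : intg mu H -> (forall n x, `|F n x| <= H x) ->
  intg mu G /\ \int[mu]_x F n x @[n --> \oo] --> \int[mu]_x G x.
Proof.
move=> iH FH; have mG := measurable_lim.
have [] := @dominated_convergence _ _ _ mu setT measurableT (fun n x => (F n x)%:E) (EFin \o G)
  (EFin \o H) (fun n => measurableT_comp (@EFin_measurable R setT) (mF n))
  (measurableT_comp (@EFin_measurable R setT) mG) _ iH _.
- by apply: aeW => x _; apply/fine_cvgP; split; [exact: nearW|exact: FG].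
- by apply: aeW => x n _; rewrite /= lee_fin.
move=> iG _ h; split=> //; rewrite -EFin_Rint// in h.
by have [_] := (fine_cvgP _ _).1 h.
Qed.

End convergence.

(** * Fourier transform *)

Section trig.
Context (R : realType) (d : nat).
Local Notation mu := (lebesgue_rV R d).
Implicit Types (c : R) (x y z xi : 'rV[R]_d) (i j : 'I_d) (f g : 'rV[R]_d -> R).

Definition phase xi x : R := 2 * pi * dotp xi x.

Lemma phaseC xi x : phase xi x = phase x xi. Proof. by rewrite /phase dotpC. Qed.

Lemma phaseB xi x y : phase xi (x - y) = phase xi x - phase xi y.
Proof. by rewrite /phase dotpDr -scaleN1r dotpZr; ring. Qed.

Lemma phaseN xi x : phase xi (- x) = - phase xi x.
Proof. by rewrite /phase -scaleN1r dotpZr; ring. Qed.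

Lemma phase_line xi x i (s : R) : phase xi (x + s *: evec i) = phase xi x + 2 * pi * xi ord0 i * s.
Proof. by rewrite /phase dotpDr dotpZr dotp_evec; ring. Qed.

Lemma phase0 x : phase 0 x = 0.
Proof. by rewrite /phase -(scale0r (0 : 'rV[R]_d)) dotpZl mul0r mulr0. Qed.

Lemma measurable_phase d' (T : measurableType d') (h k : T -> 'rV[R]_d) :
  measurable_fun [set: T] h -> measurable_fun [set: T] k ->
  measurable_fun [set: T] (fun t => phase (h t) (k t)).
Proof. by move=> mh mk; apply: measurable_funM => //; exact: measurable_dotp. Qed.

Lemma measurable_cos : measurable_fun [set: R] (@cos R).
Proof. by apply: continuous_measurable_fun; exact: continuous_cos. Qed.

Lemma measurable_sin : measurable_fun [set: R] (@sin R).
Proof. by apply: continuous_measurable_fun; exact: continuous_sin. Qed.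

Lemma measurable_cosp d' (T : measurableType d') (h k : T -> 'rV[R]_d) :
  measurable_fun [set: T] h -> measurable_fun [set: T] k ->
  measurable_fun [set: T] (fun t => cos (phase (h t) (k t))).
Proof. by move=> mh mk; apply: (measurableT_comp measurable_cos); exact: measurable_phase. Qed.

Lemma measurable_sinp d' (T : measurableType d') (h k : T -> 'rV[R]_d) :
  measurable_fun [set: T] h -> measurable_fun [set: T] k ->
  measurable_fun [set: T] (fun t => sin (phase (h t) (k t))).
Proof. by move=> mh mk; apply: (measurableT_comp measurable_sin); exact: measurable_phase. Qed.

Lemma measurable_cosx xi : measurable_fun [set: 'rV[R]_d] (fun x => cos (phase xi x)).
Proof. by apply: measurable_cosp => //; exact: measurable_cst. Qed.

Lemma measurable_sinx xi : measurable_fun [set: 'rV[R]_d] (fun x => sin (phase xi x)).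
Proof. by apply: measurable_sinp => //; exact: measurable_cst. Qed.

Lemma is_derive_cosp xi x i : is_derive x (evec i) (fun y => cos (phase xi y))
  (- sin (phase xi x) * (2 * pi * xi ord0 i)).
Proof.
apply: is_derive_line0.
have h := @der_comp R cos (fun s => phase xi x + 2 * pi * xi ord0 i * s) 0 _ _ (is_derive_cos _)
  (derD (derC _ _ _) (derZ _ (der_id 0))).
apply: (is_deriveE h) => [s|]; first by rewrite phase_line.
by rewrite mulr0 addr0 add0r mulr1.
Qed.

Lemma is_derive_sinp xi x i : is_derive x (evec i) (fun y => sin (phase xi y))
  (cos (phase xi x) * (2 * pi * xi ord0 i)).
Proof.
apply: is_derive_line0.
have h := @der_comp R sin (fun s => phase xi x + 2 * pi * xi ord0 i * s) 0 _ _ (is_derive_sin _)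
  (derD (derC _ _ _) (derZ _ (der_id 0))).
apply: (is_deriveE h) => [s|]; first by rewrite phase_line.
by rewrite mulr0 addr0 add0r mulr1.
Qed.

Lemma cosp_lc xi i : line_continuous i (fun y => cos (phase xi y)).
Proof. exact: is_derive_line_continuous (is_derive_cosp xi ^~ i). Qed.

Lemma sinp_lc xi i : line_continuous i (fun y => sin (phase xi y)).
Proof. exact: is_derive_line_continuous (is_derive_sinp xi ^~ i). Qed.

Definition gsym c xi : R := expR (- (4 * pi ^+ 2) * c * dotp xi xi).

Lemma gsym_gt0 c xi : 0 < gsym c xi. Proof. exact: expR_gt0. Qed.

Lemma gsym_le1 c xi : 0 <= c -> gsym c xi <= 1.
Proof.
move=> c0; rewrite -expR0 ler_expR !mulNr oppr_le0 !mulr_ge0// ?sqr_ge0// ?pi_ge0//.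
exact: dotp_ge0.
Qed.

Lemma GkE c z : Gk c z = expR (- (d%:R / 2) * ln (4 * pi * c) - dotp z z / (4 * c)).
Proof. by with_strategy transparent [Gk] rewrite /Gk. Qed.

(** The multiplier is a multiple of the heat kernel at the dual time, so the inverse transform of a
    Gaussian follows from the direct one. *)
Lemma gsymE c xi : 0 < c ->
  gsym c xi = expR (- (d%:R / 2) * ln (4 * pi * c)) * Gk (16 * pi ^+ 2 * c)^-1 xi.
Proof.
move=> c0; rewrite /gsym GkE -expRD; congr expR.
have p0 : 0 < pi :> R by exact: pi_gt0.
move: (@pi R) p0 => p p0.
have -> : 4 * p * (16 * p ^+ 2 * c)^-1 = (4 * p * c)^-1.
  by field; rewrite !lt0r_neq0.
rewrite lnV ?posrE; last by rewrite !mulr_gt0.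
by field; rewrite !lt0r_neq0.
Qed.

Section gaussian.
Variable c : R.
Hypothesis c0 : 0 < c.

Let iGc xi : intg mu (fun z => cos (phase xi z) * Gk c z).
Proof. by apply: (intg_bounded_mul (measurable_cosx xi) (fun x => cos_max _)); exact: intg_Gk. Qed.

Let phi xi := \int[mu]_z (cos (phase xi z) * Gk c z).

Let phi_ibp xi i : \int[mu]_z (sin (phase xi z) * G1 i c z) = - (2 * pi * xi ord0 i) * phi xi.
Proof.
have iG1 : intg mu (fun z => sin (phase xi z) * G1 i c z).
  by apply: (intg_bounded_mul (measurable_sinx xi) (fun x => sin_max _)); exact: (gkernel_intg (G1_gkernel i c0)).
have iG : intg mu (fun z => 2 * pi * xi ord0 i * (cos (phase xi z) * Gk c z)) by exact: intgZ.
rewrite mulNr; apply/eqP; rewrite -addr_eq0 /phi -RintZ// -RintD//; apply/eqP.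
have dGk z : is_derive z (evec i) (Gk c) (G1 i c z) by exact: is_derive_Gk.
apply: (@Rint_derive0 R d i (fun z => sin (phase xi z) * Gk c z)).
- move=> z; apply: (is_deriveE (derM (is_derive_sinp xi z i) (dGk z))) => //.
  by ring.
- apply: line_continuousD.
    apply: line_continuousM; first exact: sinp_lc.
    by apply: is_derive_line_continuous => z; exact: is_derive_G1.
  apply: line_continuousM; first by move=> y t; exact: cst_continuous.
  by apply: line_continuousM; [exact: cosp_lc|exact: is_derive_line_continuous dGk].
- by apply: (intg_bounded_mul (measurable_sinx xi) (fun x => sin_max _)); exact: intg_Gk.
- exact: intgD.
Qed.

Let phi_derive xi i : is_derive xi (evec i) phi (- (8 * pi ^+ 2 * c * xi ord0 i) * phi xi).
Proof.
apply: is_derive_line0.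
pose F (t : R) z := cos (phase (xi + t *: evec i) z) * Gk c z.
pose F' (t : R) z := (- sin (phase (xi + t *: evec i) z) * (2 * pi * z ord0 i)) * Gk c z.
have FE (t : R) z : F' t z = 4 * pi * c * (sin (phase (xi + t *: evec i) z) * G1 i c z).
  by rewrite /F' /G1; field; rewrite lt0r_neq0.
have iG1 := gkernel_intg (G1_gkernel i c0).
apply: (is_deriveE (f := fun t => \int[mu]_z F t z) (l := \int[mu]_z F' 0 z)) => //; last first.
  rewrite (eq_Rint _ (FE 0)) RintZ.
    by rewrite phi_ibp scale0r addr0; ring.
  by apply: (intg_bounded_mul (measurable_sinx _) (fun x => sin_max _)).
apply: (@under_is_derive _ _ R mu (-1) 1 F F' (fun z => 4 * pi * c * `|G1 i c z|)).
- by move=> t _; exact: iGc.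
- move=> t z _; rewrite /F /F'.
  have h1 : is_derive (xi + t *: evec i) (evec i) (fun y => cos (phase y z))
      (- sin (phase (xi + t *: evec i) z) * (2 * pi * z ord0 i)).
    apply: (is_deriveE (is_derive_cosp z (xi + t *: evec i) i)); first by move=> y; rewrite phaseC.
    by rewrite phaseC.
  apply: (is_deriveE (derM (is_derive_line h1) (derC _ _ (Gk c z)))) => //.
  by rewrite mulr0 addr0.
- by apply: intgZ; exact: intg_norm.
- move=> t z _; rewrite FE normrM ger0_norm; last by rewrite !mulr_ge0// ?pi_ge0// ltW.
  apply: ler_wpM2l; first by rewrite !mulr_ge0// ?pi_ge0// ltW.
  by rewrite normrM ler_piMl// sin_max.
- by rewrite ltrN10 ltr01.
Qed.

(** The cosine transform [phi] of the kernel satisfies a first order linear equation in each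
    frequency variable. Multiplied by the inverse of the expected Gaussian it has zero gradient, so
    it is constant, equal to the mass 1 of the kernel at frequency 0. *)
Lemma fourier_gauss xi : \int[mu]_z (cos (phase xi z) * Gk c z) = gsym c xi.
Proof.
pose psi xi := phi xi * expR (4 * pi ^+ 2 * c * dotp xi xi).
have dpsi i eta : is_derive eta (evec i) psi 0.
  have dd : is_derive eta (evec i) (fun y : 'rV[R]_d => expR (4 * pi ^+ 2 * c * dotp y y))
      (expR (4 * pi ^+ 2 * c * dotp eta eta) * (8 * pi ^+ 2 * c * eta ord0 i)).
    apply: is_derive_line0.
    have h := @der_comp R expR (fun s => 4 * pi ^+ 2 * c * (dotp eta eta + 2 * s * eta ord0 i + s ^+ 2)) 0 _ _ (is_derive_expR _)
      (derZ (4 * pi ^+ 2 * c) (derD (derD (derC _ _ (dotp eta eta))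
        (derM (derZ 2 (der_id 0)) (derC _ _ (eta ord0 i)))) (der_sqr (der_id 0)))).
    apply: (is_deriveE h) => [s|]; first by rewrite dotp_line.
    by rewrite mulr0 mul0r expr0n/= !addr0; congr (_ * _); ring.
  by apply: (is_deriveE (derM (phi_derive eta i) dd)) => //; ring.
have lp := lip_der (lexx 0) (f' := fun _ _ => 0) dpsi (fun _ _ => eq_ler (normr0 _)).
have := lp xi 0; rewrite mul0r normr_le0 subr_eq0 => /eqP.
have -> : psi 0 = 1.
  rewrite /psi -(scale0r (0 : 'rV[R]_d)) dotpZl mul0r mulr0 expR0 mulr1 scale0r /phi.
  by rewrite -(Rint_Gk d c0); apply: eq_Rint => z; rewrite phase0 cos0 mul1r.
move=> e; rewrite -[LHS]mulr1 -(expRxMexpNx_1 (4 * pi ^+ 2 * c * dotp xi xi)) mulrA.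
by rewrite -[X in X * _]/(psi xi) e mul1r /gsym !mulNr.
Qed.

Lemma fourier_gauss_sin xi : \int[mu]_z (sin (phase xi z) * Gk c z) = 0.
Proof.
have iG : intg mu (fun z => sin (phase xi z) * Gk c z).
  by apply: (intg_bounded_mul (measurable_sinx xi) (fun x => sin_max _)); exact: intg_Gk.
have := Rint_rV_reflect 0 iG.
rewrite (eq_Rint _ (g := fun z => - (sin (phase xi z) * Gk c z))); last first.
  by move=> z; rewrite sub0r phaseN sinN GkN mulNr.
by rewrite RintN// => e; lra.
Qed.

Lemma intg_gsym : intg mu (gsym c).
Proof.
have c1 : 0 < (16 * pi ^+ 2 * c)^-1 by rewrite invr_gt0 !mulr_gt0// ?exprn_gt0// ?pi_gt0.
apply: (@eq_intg _ _ _ _ (fun x => expR (- (d%:R / 2) * ln (4 * pi * c)) * Gk (16 * pi ^+ 2 * c)^-1 x)).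
  by move=> x; rewrite gsymE.
by apply: intgZ; exact: intg_Gk.
Qed.

End gaussian.

Lemma inverse_gauss c z : 0 < c -> \int[mu]_xi (cos (phase z xi) * gsym c xi) = Gk c z.
Proof.
move=> c0; have p0 : 0 < pi :> R by exact: pi_gt0.
have c1 : 0 < (16 * pi ^+ 2 * c)^-1 by rewrite invr_gt0 !mulr_gt0// exprn_gt0.
transitivity (expR (- (d%:R / 2) * ln (4 * pi * c)) *
  \int[mu]_x (cos (phase z x) * Gk (16 * pi ^+ 2 * c)^-1 x)).
  rewrite -RintZ; last first.
    by apply: (intg_bounded_mul (measurable_cosx z) (fun x => cos_max _)); exact: intg_Gk.
  by apply: eq_Rint => x; rewrite gsymE// mulrCA.
rewrite fourier_gauss// /gsym -expRD GkE.
move: (@pi R) p0 c1 => p p0 c1.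
by congr expR; congr (_ + _); field; rewrite !lt0r_neq0.
Qed.

End trig.

(** * Fourier inversion and Plancherel's identity *)

Section fourier_transform.
Context (R : realType) (d : nat).
Local Notation mu := (lebesgue_rV R d).
Implicit Types (c : R) (x y z xi : 'rV[R]_d) (i j : 'I_d) (f g : 'rV[R]_d -> R).

Lemma phaseD xi x y : phase xi (x + y) = phase xi x + phase xi y.
Proof. by rewrite /phase dotpDr mulrDr. Qed.

(** For real [f] the transform is [FC f - i FS f]. Thus [FF f g] is the real part of the transform
    of [f] times the conjugate of that of [g], and the computations stay in the reals. *)
Definition FC f xi : R := \int[mu]_x (cos (phase xi x) * f x).
Definition FS f xi : R := \int[mu]_x (sin (phase xi x) * f x).
Definition FF f g xi : R := FC f xi * FC g xi + FS f xi * FS g xi.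

Lemma measurable_FC f : measurable_fun [set: 'rV[R]_d] f -> measurable_fun [set: 'rV[R]_d] (FC f).
Proof.
move=> mf; apply: (@measurable_Rint_param _ _ _ _ R mu (fun p => cos (phase p.1 p.2) * f p.2)).
apply: measurable_funM; first by apply: measurable_cosp; [exact: measurable_fst|exact: measurable_snd].
by apply: measurableT_comp => //; exact: measurable_snd.
Qed.

Lemma measurable_FS f : measurable_fun [set: 'rV[R]_d] f -> measurable_fun [set: 'rV[R]_d] (FS f).
Proof.
move=> mf; apply: (@measurable_Rint_param _ _ _ _ R mu (fun p => sin (phase p.1 p.2) * f p.2)).
apply: measurable_funM; first by apply: measurable_sinp; [exact: measurable_fst|exact: measurable_snd].
by apply: measurableT_comp => //; exact: measurable_snd.
Qed.

Lemma measurable_FF f g : measurable_fun [set: 'rV[R]_d] f -> measurable_fun [set: 'rV[R]_d] g ->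
  measurable_fun [set: 'rV[R]_d] (FF f g).
Proof.
by move=> mf mg; apply: measurable_funD; apply: measurable_funM;
  [exact: measurable_FC|exact: measurable_FC|exact: measurable_FS|exact: measurable_FS].
Qed.

Lemma FC_intg f xi : intg mu f -> intg mu (fun x => cos (phase xi x) * f x).
Proof. by move=> fi; exact: (intg_bounded_mul (measurable_cosx xi) (fun x => cos_max _)). Qed.

Lemma FS_intg f xi : intg mu f -> intg mu (fun x => sin (phase xi x) * f x).
Proof. by move=> fi; exact: (intg_bounded_mul (measurable_sinx xi) (fun x => sin_max _)). Qed.

Lemma FC_le f xi : intg mu f -> `|FC f xi| <= \int[mu]_x `|f x|.
Proof.
move=> fi; apply: (Rint_norm_le (FC_intg xi fi) (intg_norm fi)) => x.
by rewrite normrM ler_piMl// cos_max.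
Qed.

Lemma FS_le f xi : intg mu f -> `|FS f xi| <= \int[mu]_x `|f x|.
Proof.
move=> fi; apply: (Rint_norm_le (FS_intg xi fi) (intg_norm fi)) => x.
by rewrite normrM ler_piMl// sin_max.
Qed.

Lemma FF_le f g xi : intg mu f -> intg mu g ->
  `|FF f g xi| <= 2 * (\int[mu]_x `|f x| * \int[mu]_x `|g x|).
Proof.
move=> fi gi; apply: (le_trans (ler_normD _ _)); rewrite !normrM mulr_natl mulr2n.
by apply: lerD; apply: ler_pM => //; [exact: FC_le|exact: FC_le|exact: FS_le|exact: FS_le].
Qed.

Lemma FCD f g xi : intg mu f -> intg mu g -> FC (fun x => f x + g x) xi = FC f xi + FC g xi.
Proof.
by move=> fi gi; rewrite /FC -RintD; [|exact: FC_intg|exact: FC_intg]; apply: eq_Rint => x; rewrite mulrDr.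
Qed.

Lemma FSD f g xi : intg mu f -> intg mu g -> FS (fun x => f x + g x) xi = FS f xi + FS g xi.
Proof.
by move=> fi gi; rewrite /FS -RintD; [|exact: FS_intg|exact: FS_intg]; apply: eq_Rint => x; rewrite mulrDr.
Qed.

Lemma FCZ (k : R) f xi : intg mu f -> FC (fun x => k * f x) xi = k * FC f xi.
Proof. by move=> fi; rewrite /FC -RintZ; [|exact: FC_intg]; apply: eq_Rint => x; rewrite mulrCA. Qed.

Lemma FSZ (k : R) f xi : intg mu f -> FS (fun x => k * f x) xi = k * FS f xi.
Proof. by move=> fi; rewrite /FS -RintZ; [|exact: FS_intg]; apply: eq_Rint => x; rewrite mulrCA. Qed.

Lemma FF_ge0 f xi : 0 <= FF f f xi.
Proof. by apply: addr_ge0; rewrite -expr2 sqr_ge0. Qed.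

(** Fourier inversion damped by a Gaussian, which makes the integrals absolutely convergent: the
    kernel is expressed by [inverse_gauss] and the order of integration exchanged. *)
Lemma heat_fourier c f x : 0 < c -> bint f ->
  heat c f x = \int[mu]_xi ((cos (phase xi x) * FC f xi + sin (phase xi x) * FS f xi) * gsym c xi).
Proof.
move=> c0 Xf; have fi := bint_intg Xf.
pose F (p : 'rV[R]_d * 'rV[R]_d) := f p.1 * (cos (phase (x - p.1) p.2) * gsym c p.2).
have mg : measurable_fun [set: 'rV[R]_d] (gsym c) by apply: intg_measurable (intg_gsym _ c0).
have mF : measurable_fun [set: 'rV[R]_d * 'rV[R]_d] F.
  apply: measurable_funM; first by apply: measurableT_comp; [exact: bint_measurable Xf|exact: measurable_fst].
  apply: measurable_funM; last by apply: measurableT_comp => //; exact: measurable_snd.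
  apply: measurable_cosp; last exact: measurable_snd.
  by apply: measurable_rVB; [exact: measurable_cst|exact: measurable_fst].
have F1 y : intg mu (fun xi => F (y, xi)).
  have : intg mu (fun xi => f y * (cos (phase (x - y) xi) * gsym c xi)); last by [].
  by apply: intgZ; apply: FC_intg; exact: intg_gsym.
have F2 xi : intg mu (fun y => F (y, xi)).
  apply: (@eq_intg _ _ _ _ (fun y => (cos (phase (x - y) xi) * gsym c xi) * f y)).
    by move=> y; rewrite /F/= mulrC.
  apply: (@intg_bounded_mul _ _ _ _ _ _ 1) => //.
    apply: measurable_funM; last exact: measurable_cst.
    by apply: measurable_cosp; [apply: measurable_rVB => //; exact: measurable_cst|exact: measurable_cst].
  move=> y; rewrite normrM (ger0_norm (ltW (gsym_gt0 _ _))).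
  by rewrite -[leRHS]mulr1; apply: ler_pM => //; [exact/ltW/gsym_gt0|exact: cos_max|exact/gsym_le1/ltW].
have F3 : intg mu (fun y => \int[mu]_xi `|F (y, xi)|).
  have ih : intg mu (fun y => (\int[mu]_xi gsym c xi) * `|f y|) by apply: intgZ; exact: intg_norm.
  apply: (intg_le _ _ ih).
    by apply: (@measurable_Rint_param _ _ _ _ R mu (fun p => `|F p|)); exact: measurableT_comp.
  move=> y; rewrite ger0_norm ?Rint_ge0// mulrC -RintZ; last exact: intg_gsym.
  apply: Rint_le; [exact: intg_norm|by apply: intgZ; exact: intg_gsym|].
  move=> xi; rewrite /F/= !normrM (ger0_norm (ltW (gsym_gt0 c xi))); apply: ler_wpM2l => //.
  by rewrite ler_piMl ?cos_max//; exact/ltW/gsym_gt0.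
transitivity (\int[mu]_y \int[mu]_xi F (y, xi)).
  with_strategy transparent [heat conv] rewrite /heat /conv.
  apply: eq_Rint => y; rewrite /F/= RintZ; last by apply: FC_intg; exact: intg_gsym.
  by rewrite inverse_gauss// mulrC.
rewrite (@Rint_fubini _ _ _ _ R mu mu F mF F1 F2 F3); apply: eq_Rint => xi.
transitivity (\int[mu]_y (gsym c xi * (cos (phase xi x) * (cos (phase xi y) * f y) +
    sin (phase xi x) * (sin (phase xi y) * f y)))).
  by apply: eq_Rint => y; rewrite /F/= phaseC phaseB cosB; ring.
rewrite RintZ; last by apply: intgD; apply: intgZ; [exact: FC_intg|exact: FS_intg].
rewrite RintD; [|by apply: intgZ; exact: FC_intg|by apply: intgZ; exact: FS_intg].
rewrite (RintZ _ (FC_intg xi fi)) (RintZ _ (FS_intg xi fi)).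
by rewrite mulrC.
Qed.

Lemma FF_gsym_intg c f g : 0 < c -> bint f -> bint g -> intg mu (fun xi => FF f g xi * gsym c xi).
Proof.
move=> c0 Xf Xg.
apply: (intg_bounded_mul _ (fun xi => FF_le xi (bint_intg Xf) (bint_intg Xg))) (intg_gsym _ c0).
by apply: measurable_FF; exact: bint_measurable.
Qed.

Lemma heat_pairing c f g : 0 < c -> bint f -> bint g ->
  \int[mu]_x (g x * heat c f x) = \int[mu]_xi (FF f g xi * gsym c xi).
Proof.
move=> c0 Xf Xg; have fi := bint_intg Xf; have gi := bint_intg Xg.
have mgs : measurable_fun [set: 'rV[R]_d] (gsym c) by apply: intg_measurable (intg_gsym _ c0).
pose K (p : 'rV[R]_d * 'rV[R]_d) := cos (phase p.2 p.1) * FC f p.2 + sin (phase p.2 p.1) * FS f p.2.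
pose F (p : 'rV[R]_d * 'rV[R]_d) := g p.1 * (K p * gsym c p.2).
have mK : measurable_fun [set: 'rV[R]_d * 'rV[R]_d] K.
  apply: measurable_funD; apply: measurable_funM.
  - by apply: measurable_cosp; [exact: measurable_snd|exact: measurable_fst].
  - by apply: (measurableT_comp (measurable_FC (bint_measurable Xf))); exact: measurable_snd.
  - by apply: measurable_sinp; [exact: measurable_snd|exact: measurable_fst].
  - by apply: (measurableT_comp (measurable_FS (bint_measurable Xf))); exact: measurable_snd.
pose N1 := \int[mu]_x `|f x|.
have KN p : `|K p| <= 2 * N1.
  apply: (le_trans (ler_normD _ _)); rewrite !normrM mulr_natl mulr2n.
  apply: lerD; rewrite -[leRHS]mul1r; apply: ler_pM => //.
  - exact: cos_max.
  - exact: FC_le.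
  - exact: sin_max.
  - exact: FS_le.
have mF : measurable_fun [set: 'rV[R]_d * 'rV[R]_d] F.
  apply: measurable_funM; first by apply: measurableT_comp; [exact: bint_measurable Xg|exact: measurable_fst].
  by apply: measurable_funM => //; apply: measurableT_comp => //; exact: measurable_snd.
have iK x : intg mu (fun xi => K (x, xi) * gsym c xi).
  apply: (intg_bounded_mul _ (fun xi => KN (x, xi))) (intg_gsym _ c0).
  by apply: (measurableT_comp mK); exact: pair1_measurable.
have F1 x : intg mu (fun xi => F (x, xi)) by exact: (intgZ (g x) (iK x)).
have F2 xi : intg mu (fun x => F (x, xi)).
  apply: (@eq_intg _ _ _ _ (fun x => (K (x, xi) * gsym c xi) * g x)).
    by move=> x; rewrite /F/= mulrC.
  apply: (@intg_bounded_mul _ _ _ _ _ _ (2 * N1)) => //.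
    apply: measurable_funM; last exact: measurable_cst.
    by apply: (measurableT_comp mK); exact: pair2_measurable.
  move=> x; rewrite normrM (ger0_norm (ltW (gsym_gt0 _ _))).
  rewrite -[leRHS]mulr1; apply: ler_pM => //; [exact/ltW/gsym_gt0|exact/gsym_le1/ltW].
have F3 : intg mu (fun x => \int[mu]_xi `|F (x, xi)|).
  have ih : intg mu (fun x => (2 * N1 * \int[mu]_xi gsym c xi) * `|g x|) by apply: intgZ; exact: intg_norm.
  apply: (intg_le _ _ ih).
    by apply: (@measurable_Rint_param _ _ _ _ R mu (fun p => `|F p|)); exact: measurableT_comp.
  move=> x; rewrite ger0_norm ?Rint_ge0// mulrC -RintZ; last exact: intg_gsym.
  rewrite -RintZ; last by apply: intgZ; exact: intg_gsym.
  apply: Rint_le; [exact: intg_norm|by do 2 apply: intgZ; exact: intg_gsym|].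
  move=> xi; rewrite /F/= !normrM (ger0_norm (ltW (gsym_gt0 c xi))); apply: ler_wpM2l => //.
  by apply: ler_wpM2r; [exact/ltW/gsym_gt0|exact: KN].
transitivity (\int[mu]_x \int[mu]_xi F (x, xi)).
  by apply: eq_Rint => x; rewrite (heat_fourier x c0 Xf) -RintZ//; exact: iK.
rewrite (@Rint_fubini _ _ _ _ R mu mu F mF F1 F2 F3); apply: eq_Rint => xi.
transitivity (\int[mu]_x (gsym c xi * (FC f xi * (cos (phase xi x) * g x) +
    FS f xi * (sin (phase xi x) * g x)))).
  by apply: eq_Rint => x; rewrite /F /K/=; ring.
rewrite RintZ; last by apply: intgD; apply: intgZ; [exact: FC_intg|exact: FS_intg].
rewrite RintD; [|by apply: intgZ; exact: FC_intg|by apply: intgZ; exact: FS_intg].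
rewrite (RintZ _ (FC_intg xi gi)) (RintZ _ (FS_intg xi gi)).
by rewrite mulrC.
Qed.

Lemma gsym_cvg xi : gsym (harmonic n ^+ 2) xi @[n --> \oo] --> (1 : R).
Proof.
have h : {for 0 * 0, continuous (fun t : R => expR (- (4 * pi ^+ 2) * t * dotp xi xi))}.
  exact: der_continuous (@der_comp R expR (fun s => - (4 * pi ^+ 2) * s * dotp xi xi) _ _ _ (is_derive_expR _)
    (derM (derZ _ (der_id _)) (derC _ _ _))).
have := continuous_cvg _ h (cvgM (@cvg_harmonic R) (@cvg_harmonic R)).
rewrite !mul0r mulr0 mul0r expR0 => /(_ _ _); under eq_fun do rewrite expr2.
exact.
Qed.

(** The identity holds with a Gaussian damping factor by [heat_pairing]. As the damping is removed,
    the right-hand side converges by the Lipschitz bound; Fatou then gives the integrability of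
    [FF f f], which in turn serves as the majorant for dominated convergence. The heat times are
    squares so that their square roots are [harmonic n]. *)
Lemma plancherel f (L : R) : bint f -> 0 <= L -> lip L f ->
  intg mu (FF f f) /\ \int[mu]_xi FF f f xi = \int[mu]_x f x ^+ 2.
Proof.
move=> Xf L0 lf; pose c n : R := harmonic n ^+ 2.
have h0 n : 0 < harmonic n :> R by rewrite /harmonic/= invr_gt0.
have c0 n : 0 < c n by rewrite exprn_gt0.
pose F n xi := FF f f xi * gsym (c n) xi.
have mFF : measurable_fun [set: 'rV[R]_d] (FF f f) by apply: measurable_FF; exact: bint_measurable.
have iF n : intg mu (F n) by exact: FF_gsym_intg.
have mF n : measurable_fun [set: 'rV[R]_d] (F n) by exact: intg_measurable (iF n).
have Fcv xi : F n xi @[n --> \oo] --> FF f f xi.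
  rewrite -[X in _ --> X]mulr1; apply: cvgM; [exact: cvg_cst|exact: gsym_cvg].
have f2 := bint_sqr Xf.
have e n : \int[mu]_xi F n xi = \int[mu]_x (f x * heat (c n) f x) by rewrite heat_pairing.
have gap n : `|\int[mu]_xi F n xi - \int[mu]_x f x ^+ 2| <=
    (L * (d%:R * (2 * K1 R d)) * \int[mu]_x `|f x|) * harmonic n.
  have fh := bint_mul_intg Xf (bint_heat (c0 n) Xf).
  rewrite e -RintB// mulrAC -RintZ; last exact/intg_norm/bint_intg.
  apply: Rint_norm_le; [exact: intgB|by apply/intgZ/intg_norm/bint_intg|move=> x].
  rewrite expr2 -mulrBr normrM mulrC; apply: ler_wpM2r => //.
  have := heat_approx x (c0 n) Xf L0 lf.
  by rewrite sqrtr_sqr (ger0_norm (ltW (h0 n))).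
have cv : \int[mu]_xi F n xi @[n --> \oo] --> \int[mu]_x f x ^+ 2.
  apply/cvgrPdist_le => eps eps0.
  pose K := L * (d%:R * (2 * K1 R d)) * \int[mu]_x `|f x|.
  have : K * harmonic n @[n --> \oo] --> (0 : R).
    by rewrite -[X in _ --> X](mulr0 K); apply: cvgM; [exact: cvg_cst|exact: cvg_harmonic].
  move=> /cvgrPdist_le/(_ _ eps0); apply: filterS => n; rewrite sub0r normrN => hn.
  by rewrite distrC; apply: (le_trans (gap n)); apply: (le_trans (ler_norm _) hn).
have up n : \int[mu]_xi F n xi <= \int[mu]_x f x ^+ 2 + L * (d%:R * (2 * K1 R d)) * \int[mu]_x `|f x|.
  rewrite -lerBlDl; apply: (le_trans (ler_norm _)); apply: (le_trans (gap n)).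
  rewrite ler_piMr//; last by rewrite /harmonic/= invf_le1 ?ler1n.
  by rewrite !mulr_ge0// ?K1_ge0//; exact: Rint_ge0.
have F0 n xi : 0 <= F n xi by apply: mulr_ge0; [exact: FF_ge0|exact/ltW/gsym_gt0].
have [iFF _] := Rint_fatou mF Fcv F0 iF up.
split=> //.
have Fle n xi : `|F n xi| <= FF f f xi.
  rewrite ger0_norm// ler_piMr ?FF_ge0//; exact/gsym_le1/ltW.
have [_ cv'] := Rint_dct mF Fcv iFF Fle.
exact: (cvg_unique _ cv' cv).
Qed.

Lemma FC_der f f' i xi : bint f -> bint f' -> (forall x, is_derive x (evec i) f (f' x)) ->
  line_continuous i f' -> FC f' xi = 2 * pi * xi ord0 i * FS f xi.
Proof.
move=> Xf Xf' df cf'; have fi := bint_intg Xf; have fi' := bint_intg Xf'.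
apply/eqP; rewrite -subr_eq0 /FC /FS -RintZ; last exact: FS_intg.
rewrite -RintB; [|exact: FC_intg|by apply: intgZ; exact: FS_intg]; apply/eqP.
apply: (@Rint_derive0 R d i (fun x => cos (phase xi x) * f x)).
- move=> x; apply: (is_deriveE (derM (is_derive_cosp xi x i) (df x))) => //.
  by ring.
- apply: line_continuousD; first by apply: line_continuousM => //; exact: cosp_lc.
  have h : line_continuous i (fun x => (- (2 * pi * xi ord0 i)) * (sin (phase xi x) * f x)).
    apply: line_continuousM; first by move=> y t; exact: cst_continuous.
    by apply: line_continuousM; [exact: sinp_lc|exact: is_derive_line_continuous df].
  by move=> x; under eq_fun do rewrite -mulNr; exact: h.
- exact: FC_intg.
- by apply: intgB; [exact: FC_intg|by apply: intgZ; exact: FS_intg].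
Qed.

Lemma FS_der f f' i xi : bint f -> bint f' -> (forall x, is_derive x (evec i) f (f' x)) ->
  line_continuous i f' -> FS f' xi = - (2 * pi * xi ord0 i) * FC f xi.
Proof.
move=> Xf Xf' df cf'; have fi := bint_intg Xf; have fi' := bint_intg Xf'.
apply/eqP; rewrite mulNr -addr_eq0 /FC /FS -RintZ; last exact: FC_intg.
rewrite -RintD; [|exact: FS_intg|by apply: intgZ; exact: FC_intg]; apply/eqP.
apply: (@Rint_derive0 R d i (fun x => sin (phase xi x) * f x)).
- move=> x; apply: (is_deriveE (derM (is_derive_sinp xi x i) (df x))) => //.
  by ring.
- apply: line_continuousD; first by apply: line_continuousM => //; exact: sinp_lc.
  apply: line_continuousM; first by move=> y t; exact: cst_continuous.
  by apply: line_continuousM; [exact: cosp_lc|exact: is_derive_line_continuous df].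
- exact: FS_intg.
- by apply: intgD; [exact: FS_intg|by apply: intgZ; exact: FC_intg].
Qed.

Lemma FF_der f f' i xi : bint f -> bint f' -> (forall x, is_derive x (evec i) f (f' x)) ->
  line_continuous i f' -> FF f' f' xi = (4 * pi ^+ 2) * (xi ord0 i ^+ 2 * FF f f xi).
Proof.
move=> Xf Xf' df cf'; rewrite /FF (FC_der xi Xf Xf' df cf') (FS_der xi Xf Xf' df cf').
by ring.
Qed.

Lemma FC_heat c f xi : 0 < c -> bint f -> FC (heat c f) xi = gsym c xi * FC f xi.
Proof.
move=> c0 Xf; rewrite /FC.
have hb : exists M : R, forall x, `|cos (phase xi x)| <= M by exists 1 => x; exact: cos_max.
have := @Rint_conv_mul _ _ _ _ _ (Gk_gkernel d c0) f (fun x => cos (phase xi x)) Xf hb (measurable_cosx xi).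
move=> E; transitivity (\int[mu]_y (f y * \int[mu]_x (Gk c (x - y) * cos (phase xi x)))).
  by rewrite -E; with_strategy transparent [heat] rewrite /heat.
rewrite -RintZ; last by apply: FC_intg; exact: bint_intg.
apply: eq_Rint => y; rewrite mulrCA [f y * _]mulrC mulrA; congr (_ * _).
have i1 := FC_intg xi (intg_Gk d c0).
have i2 := FS_intg xi (intg_Gk d c0).
rewrite -(@Rint_rV_shift _ _ y (fun x => Gk c (x - y) * cos (phase xi x))); last first.
  apply: (@eq_intg _ _ _ _ (fun x => cos (phase xi x) * Gk c (x - y))).
    by move=> x; rewrite mulrC.
  by apply: FC_intg; exact: (intg_rV_shift (- y) (intg_Gk d c0)).
transitivity (\int[mu]_x (cos (phase xi y) * (cos (phase xi x) * Gk c x) -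
    sin (phase xi y) * (sin (phase xi x) * Gk c x))).
  by apply: eq_Rint => x; rewrite addrK phaseD cosD; ring.
rewrite RintB; [|exact: intgZ|exact: intgZ].
rewrite (RintZ _ i1) (RintZ _ i2) fourier_gauss// fourier_gauss_sin//.
by rewrite mulr0 subr0 mulrC.
Qed.

Lemma FS_heat c f xi : 0 < c -> bint f -> FS (heat c f) xi = gsym c xi * FS f xi.
Proof.
move=> c0 Xf; rewrite /FS.
have hb : exists M : R, forall x, `|sin (phase xi x)| <= M by exists 1 => x; exact: sin_max.
have := @Rint_conv_mul _ _ _ _ _ (Gk_gkernel d c0) f (fun x => sin (phase xi x)) Xf hb (measurable_sinx xi).
move=> E; transitivity (\int[mu]_y (f y * \int[mu]_x (Gk c (x - y) * sin (phase xi x)))).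
  by rewrite -E; with_strategy transparent [heat] rewrite /heat.
rewrite -RintZ; last by apply: FS_intg; exact: bint_intg.
apply: eq_Rint => y; rewrite mulrCA [f y * _]mulrC mulrA; congr (_ * _).
have i1 := FC_intg xi (intg_Gk d c0).
have i2 := FS_intg xi (intg_Gk d c0).
rewrite -(@Rint_rV_shift _ _ y (fun x => Gk c (x - y) * sin (phase xi x))); last first.
  apply: (@eq_intg _ _ _ _ (fun x => sin (phase xi x) * Gk c (x - y))).
    by move=> x; rewrite mulrC.
  by apply: FS_intg; exact: (intg_rV_shift (- y) (intg_Gk d c0)).
transitivity (\int[mu]_x (sin (phase xi y) * (cos (phase xi x) * Gk c x) +
    cos (phase xi y) * (sin (phase xi x) * Gk c x))).
  by apply: eq_Rint => x; rewrite addrK phaseD sinD; ring.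
rewrite RintD; [|exact: intgZ|exact: intgZ].
rewrite (RintZ _ i1) (RintZ _ i2) fourier_gauss// fourier_gauss_sin//.
by rewrite mulr0 addr0 mulrC.
Qed.

End fourier_transform.

(** * Frullani's integral *)

Section frullani.
Context (R : realType) (K a b : R).
Hypotheses (K0 : 0 < K) (a0 : 0 < a) (ab : a <= b).
Local Notation leb := (@lebesgue_measure R).

(* Frullani's integral, up to sign: an approximation of [- ln rho] that is exact at [rho = 1]. *)
Definition frul (rho : R) : R :=
  \int[leb]_(s in `[a, b]) (s^-1 * (expR (- K * s * rho) - expR (- K * s))).

Lemma is_derive_exp_lin (k t : R) : is_derive t 1 (fun s => expR (k * s)) (expR (k * t) * (k * 1)).
Proof. exact: (@der_comp R expR (fun s => k * s) t _ _ (is_derive_expR _) (derZ _ (der_id t))). Qed.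

Lemma exp_lin_continuous (k t : R) : {for t, continuous (fun s => expR (k * s))}.
Proof. exact: der_continuous (is_derive_exp_lin k t). Qed.

Let b0 : 0 < b. Proof. exact: lt_le_trans ab. Qed.

Lemma frul_intg (rho : R) :
  leb.-integrable `[a, b] (EFin \o (fun s => s^-1 * (expR (- K * s * rho) - expR (- K * s)))).
Proof.
apply: continuous_compact_integrable; first exact: segment_compact.
apply: continuous_in_subspaceT => c; rewrite inE/= in_itv/= => /andP[ac cb].
have c0 : 0 < c by exact: lt_le_trans ac.
apply: continuousM; first exact: der_continuous (der_inv (lt0r_neq0 c0)).
apply: continuousB; last exact: exp_lin_continuous.
rewrite (_ : (fun x : R => _) = (fun s => expR (- K * rho * s))); first exact: exp_lin_continuous.
by apply/funext => s; rewrite mulrAC.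
Qed.

(** Differentiation in [rho] cancels the factor [s^-1], and what remains has an elementary primitive
    in [s]. *)
Let frul' (rho : R) := - ((expR (- K * a * rho) - expR (- K * b * rho)) / rho).

Lemma frul_derive (rho : R) : 0 < rho -> is_derive rho 1 frul (frul' rho).
Proof.
move=> r0; have E : \int[leb]_(s in `[a, b]) (- K * expR (- K * rho * s)) = frul' rho.
  transitivity (rho^-1 * expR (- K * rho * b) - rho^-1 * expR (- K * rho * a)); last first.
    by rewrite /frul' [- K * rho * b]mulrAC [- K * rho * a]mulrAC; ring.
  apply: (@FTC_Rint R (fun s => rho^-1 * expR (- K * rho * s))) => //.
  - move=> c _; apply: (is_deriveE (derZ rho^-1 (is_derive_exp_lin (- K * rho) c))) => //.
    by field; rewrite lt0r_neq0.
  - by move=> c _; apply: continuousM; [exact: cst_continuous|exact: exp_lin_continuous].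
rewrite -E.
apply: (is_deriveE (l := \int[leb]_(s in `[a, b]) (- K * expR (- K * s * rho)))
  (f := frul)) => //; last first.
  by apply: eq_Rintegral => s _; rewrite [- K * s * rho]mulrAC.
apply: (@itv_is_derive R a b 0 (rho + 1) K rho
  (fun rho s => s^-1 * (expR (- K * s * rho) - expR (- K * s))) (fun rho s => - K * expR (- K * s * rho))).
- by move=> c _; exact: frul_intg.
- move=> c s _ /andP[as_ _]; have s0 : 0 < s by exact: lt_le_trans as_.
  apply: (is_deriveE (derZ s^-1 (derB (is_derive_exp_lin (- K * s) c) (derC _ _ (expR (- K * s)))))) => //.
  by field; rewrite lt0r_neq0.
- move=> c s /andP[c0 _] /andP[as_ _]; have s0 : 0 < s by exact: lt_le_trans as_.
  rewrite normrM normrN (gtr0_norm K0) ger0_norm ?expR_ge0// ler_piMr ?(ltW K0)//.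
  by rewrite -expR0 ler_expR !mulNr oppr_le0 !mulr_ge0// ltW.
- by rewrite r0 ltrDl ltr01.
Qed.

Let frul1 : frul 1 = 0.
Proof.
rewrite /frul Rintegral_mkcond (eq_Rint _ (g := fun=> 0)) ?Rint0// => s.
by rewrite patchE mulr1 subrr mulr0; case: ifP.
Qed.

Let exp_bounds (r : R) : 0 < r -> [/\ 0 <= expR (- K * a * r) - expR (- K * b * r),
  expR (- K * a * r) - expR (- K * b * r) <= 1 &
  1 - (expR (- K * a * r) - expR (- K * b * r)) <= K * a * r + (K * b * r)^-1].
Proof.
move=> r0; have Kb : 0 < K * b * r by rewrite !mulr_gt0.
have Ka : 0 < K * a * r by rewrite !mulr_gt0.
rewrite !mulNr; split.
- by rewrite subr_ge0 ler_expR lerN2 ler_wpM2r ?ler_wpM2l// ltW.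
- rewrite lerBlDr; apply: ler_wpDr; first exact: expR_ge0.
  by rewrite -expR0 ler_expR oppr_le0 ltW.
- rewrite opprB addrA addrAC; apply: lerD.
    by have := expR_ge1Dx (- (K * a * r)); lra.
  rewrite expRN lef_pV2 ?posrE ?expR_gt0//.
  by apply: le_trans (expR_ge1Dx _); rewrite lerDr.
Qed.

Let der_ln_sum (r : R) : 0 < r -> is_derive r 1 (fun r => ln r + frul r) (r^-1 + frul' r).
Proof. by move=> r0; apply: derD; [exact: is_derive1_ln|exact: frul_derive]. Qed.

(** A primitive of the majorant of |1/r + frul' r| given by [exp_bounds]; its increments therefore
    bound those of [ln + frul], a function that vanishes at 1. *)
Let gap (r : R) := K * a * r - (K * b)^-1 * r^-1.

Let der_gap (r : R) : 0 < r -> is_derive r 1 gap (K * a + (K * b)^-1 * r ^- 2).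
Proof.
move=> r0; apply: (is_deriveE (derB (derZ (K * a) (der_id r)) (derZ (K * b)^-1 (der_inv (lt0r_neq0 r0))))) => //.
by rewrite mulr1 mulrN opprK.
Qed.

Let frul'_le (r : R) : 0 < r -> `|frul' r| <= r^-1.
Proof.
move=> r0; have [h1 h2 _] := exp_bounds r0; have i0 : 0 < r^-1 by rewrite invr_gt0.
by rewrite normrN normrM (ger0_norm h1) (gtr0_norm i0) ler_piMl// ltW.
Qed.

Let frul'_gap (r : R) : 0 < r -> `|r^-1 + frul' r| <= K * a + (K * b)^-1 * r ^- 2.
Proof.
move=> r0; have [h1 h2 h3] := exp_bounds r0; have i0 : 0 < r^-1 by rewrite invr_gt0.
have -> : r^-1 + frul' r = (1 - (expR (- K * a * r) - expR (- K * b * r))) * r^-1.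
  by rewrite /frul'; ring.
rewrite normrM (gtr0_norm i0) ger0_norm ?subr_ge0//.
apply: (le_trans (ler_wpM2r (ltW i0) h3)); apply: eq_ler.
by field; rewrite !lt0r_neq0.
Qed.

(** Both functions vanish at 1, and the derivative of [frul] is at most that of the logarithm in
    absolute value. *)
Lemma frul_le (r : R) : 0 < r -> `|frul r| <= `|ln r|.
Proof.
move=> r0; have [r1|r1] := lerP r 1.
  have := @norm_diff_le R frul (@ln R) frul' (fun x => x^-1) r 1 r1.
  rewrite frul1 ln1 !sub0r normrN => h; rewrite [leRHS]ler0_norm ?ln_le0//; apply: h.
  - by move=> x /andP[rx _]; apply: frul_derive; exact: lt_le_trans rx.
  - by move=> x /andP[rx _]; apply: is_derive1_ln; exact: lt_le_trans rx.
  - by move=> x /andP[rx _]; apply: frul'_le; exact: lt_le_trans rx.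
have := @norm_diff_le R frul (@ln R) frul' (fun x => x^-1) 1 r (ltW r1).
rewrite frul1 ln1 !subr0 => h; rewrite [leRHS]ger0_norm ?ln_ge0 ?(ltW r1)//; apply: h.
- by move=> x /andP[rx _]; apply: frul_derive; exact: lt_le_trans rx.
- by move=> x /andP[rx _]; apply: is_derive1_ln; exact: lt_le_trans rx.
- by move=> x /andP[rx _]; apply: frul'_le; exact: lt_le_trans rx.
Qed.

Lemma frul_gap (r : R) : 0 < r -> `|ln r + frul r| <= K * a * (r + 1) + (K * b)^-1 * (r^-1 + 1).
Proof.
move=> r0; have p1 : 0 <= K * a by rewrite mulr_ge0// ltW.
have p2 : 0 <= (K * b)^-1 by rewrite invr_ge0 mulr_ge0// ltW.
have p3 : 0 <= r^-1 by rewrite invr_ge0 ltW.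
have q1 := mulr_ge0 p1 (ltW r0); have q2 := mulr_ge0 p2 p3.
have [r1|r1] := lerP r 1.
  have := @norm_diff_le R (fun r => ln r + frul r) gap (fun r => r^-1 + frul' r)
    (fun x => K * a + (K * b)^-1 * x ^- 2) r 1 r1.
  rewrite frul1 ln1 addr0 sub0r normrN => h.
  apply: (@le_trans _ _ (gap 1 - gap r)); last by rewrite /gap invr1; lra.
  apply: h.
  - by move=> x /andP[rx _]; apply: der_ln_sum; exact: lt_le_trans rx.
  - by move=> x /andP[rx _]; apply: der_gap; exact: lt_le_trans rx.
  - by move=> x /andP[rx _]; apply: frul'_gap; exact: lt_le_trans rx.
have := @norm_diff_le R (fun r => ln r + frul r) gap (fun r => r^-1 + frul' r)
  (fun x => K * a + (K * b)^-1 * x ^- 2) 1 r (ltW r1).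
rewrite frul1 ln1 addr0 subr0 => h.
apply: (@le_trans _ _ (gap r - gap 1)); last by rewrite /gap invr1; lra.
apply: h.
- by move=> x /andP[rx _]; apply: der_ln_sum; exact: lt_le_trans rx.
- by move=> x /andP[rx _]; apply: der_gap; exact: lt_le_trans rx.
- by move=> x /andP[rx _]; apply: frul'_gap; exact: lt_le_trans rx.
Qed.

End frullani.

(** * The logarithmic symbol *)

Section log_symbol.
Context (R : realType) (d : nat).
Hypothesis hd : (1 <= d)%N.
Local Notation mu := (lebesgue_rV R d).
Local Notation leb := (@lebesgue_measure R).
Implicit Types (x y z xi : 'rV[R]_d) (i j : 'I_d) (f g : 'rV[R]_d -> R).

(** In dimension at least one the origin is a degenerate box, hence a null set. The bounds on the
    logarithmic symbol hold only outside it, because [ln 0] has a default value. *)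
Lemma Rint_off0 f g : measurable_fun [set: 'rV[R]_d] f -> measurable_fun [set: 'rV[R]_d] g ->
  (forall xi, xi != 0 -> f xi = g xi) -> \int[mu]_xi f xi = \int[mu]_xi g xi.
Proof.
move=> mf mg fg; rewrite /Rintegral; congr fine; apply: ae_eq_integral => //;
  [exact/measurable_EFinP|exact/measurable_EFinP|].
exists [set x : 'rV[R]_d | forall i, x ord0 i \in `[(0 : R), 0]]; split.
- rewrite (_ : mkset _ = \bigcap_(i in [set: 'I_d]) [set x : 'rV[R]_d | x ord0 i \in `[(0 : R), 0]]).
    apply: fin_bigcap_measurable => // i _.
    by have := measurable_coord_rV i measurableT (measurable_itv `[(0 : R), 0]); rewrite setTI.
  by apply/seteqP; split=> x /= h i; [move=> _|]; exact: h.
- apply: etrans (@lebesgue_rV_box R d (fun=> 0) (fun=> 0) (fun=> lexx 0)) _.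
  by rewrite big_const card_ord subrr; case: (d) hd => // n _; rewrite iterS mul0r.
- move=> x /= h i; have -> : x = 0; last by rewrite mxE in_itv/= lexx.
  apply/eqP; apply: contrapT => /negP x0; apply: h => _.
  by rewrite /= fg.
Qed.

Definition lnorm xi : R := 2^-1 * ln (dotp xi xi).

Lemma dotp_gt0 xi : xi != 0 -> 0 < dotp xi xi.
Proof.
move=> x0; rewrite lt_neqAle dotp_ge0 andbT eq_sym; apply: contra x0 => /eqP h.
apply/eqP/rowP => i; rewrite mxE; apply/eqP; rewrite -sqrf_eq0 eq_le sqr_ge0 andbT -h.
exact: coord_sqr_le.
Qed.

Lemma dotp0 : dotp (0 : 'rV[R]_d) 0 = 0.
Proof. by rewrite /dotp big1// => i _; rewrite mxE mul0r. Qed.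

Lemma ln_enorm xi : ln (enorm xi) = lnorm xi.
Proof.
rewrite /lnorm /enorm; have [->|x0] := eqVneq xi 0.
  by rewrite dotp0 sqrtr0 ln0// mulr0.
have h := dotp_gt0 x0; rewrite -{2}(sqr_sqrtr (ltW h)) lnXn ?sqrtr_gt0//.
by rewrite -(mulr_natl (ln _) 2) mulKf ?pnatr_eq0.
Qed.

Lemma measurable_lnorm : measurable_fun [set: 'rV[R]_d] lnorm.
Proof.
apply: measurable_funM => //; apply: (measurableT_comp (@measurable_ln R)).
by apply: measurable_dotp.
Qed.

Definition lsym (a b : R) xi : R := - 2^-1 * frul (4 * pi ^+ 2) a b (dotp xi xi).

Let K0 : 0 < 4 * pi ^+ 2 :> R. Proof. by rewrite mulr_gt0// exprn_gt0// pi_gt0. Qed.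

Section bounds.
Variables a b : R.
Hypotheses (a0 : 0 < a) (ab : a <= b).

Let Lop_aux f g : bint f -> measurable_fun [set: 'rV[R]_d] g -> (forall x, `|g x| <= 1) ->
  forall xi, (forall s, 0 < s -> \int[mu]_x (g x * heat s f x) = gsym s xi * \int[mu]_x (g x * f x)) ->
  \int[mu]_x (g x * Lop a b f x) = lsym a b xi * \int[mu]_x (g x * f x).
Proof.
move=> Xf mg g1 xi h; rewrite (Rint_Lop b a0 Xf mg g1) /lsym -mulrA; congr (_ * _).
rewrite [RHS]mulrC -(Rint_itvZ _ (frul_intg _ _ a0 _)).
apply: eq_Rintegral => s; rewrite inE/= in_itv/= => /andP[as_ _].
have s0 : 0 < s by exact: lt_le_trans as_.
by rewrite h// /gsym /esym; ring.
Qed.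

Lemma FC_Lop f xi : bint f -> FC (Lop a b f) xi = lsym a b xi * FC f xi.
Proof.
move=> Xf; apply: (Lop_aux Xf (measurable_cosx xi) (fun x => cos_max _)) => s s0.
exact: FC_heat.
Qed.

Lemma FS_Lop f xi : bint f -> FS (Lop a b f) xi = lsym a b xi * FS f xi.
Proof.
move=> Xf; apply: (Lop_aux Xf (measurable_sinx xi) (fun x => sin_max _)) => s s0.
exact: FS_heat.
Qed.

Lemma FF_Lop f xi : bint f -> FF (Lop a b f) (Lop a b f) xi = lsym a b xi ^+ 2 * FF f f xi.
Proof. by move=> Xf; rewrite /FF FC_Lop// FS_Lop//; ring. Qed.

Lemma lsym_le xi : xi != 0 -> lsym a b xi ^+ 2 <= lnorm xi ^+ 2.
Proof.
move=> /dotp_gt0 x0; rewrite /lsym /lnorm !exprMn sqrrN; apply: ler_wpM2l; first exact: sqr_ge0.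
by rewrite -(real_normK (num_real (frul _ _ _ _))) -(real_normK (num_real (ln _))) lerXn2r ?nnegrE// frul_le.
Qed.

Lemma lsym_gap xi : xi != 0 -> `|lnorm xi - lsym a b xi| <=
  2^-1 * (4 * pi ^+ 2 * a * (dotp xi xi + 1) + (4 * pi ^+ 2 * b)^-1 * ((dotp xi xi)^-1 + 1)).
Proof.
move=> /dotp_gt0 x0; rewrite /lsym /lnorm mulNr opprK -mulrDr normrM ger0_norm ?invr_ge0//.
by apply: ler_wpM2l; rewrite ?invr_ge0//; exact: frul_gap.
Qed.

Lemma measurable_lsym : measurable_fun [set: 'rV[R]_d] (lsym a b).
Proof.
apply: measurable_funM => //.
have -> : (fun xi => frul (4 * pi ^+ 2) a b (dotp xi xi)) = (fun xi => \int[leb]_s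
    (\1_(`[a, b]%classic) s * (s^-1 * (expR (- (4 * pi ^+ 2) * s * dotp xi xi) - expR (- (4 * pi ^+ 2) * s))))).
  by apply/funext => xi; rewrite /frul Rint_itv_indic.
apply: (@measurable_Rint_param _ _ _ _ R leb (fun p : 'rV[R]_d * R =>
  \1_(`[a, b]%classic) p.2 * (p.2^-1 * (expR (- (4 * pi ^+ 2) * p.2 * dotp p.1 p.1) - expR (- (4 * pi ^+ 2) * p.2))))).
apply: measurable_funM.
  have mi : measurable_fun [set: R] (\1_(`[a, b]%classic) : R -> R) by exact: measurable_indic.
  by apply: (measurableT_comp mi); exact: measurable_snd.
apply: measurable_funM; first by apply: measurable_funV; exact: measurable_snd.
apply: measurable_funB; apply: measurableT_comp => //; apply: measurable_funM => //; try exact: measurable_snd.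
  by apply: measurable_funM => //; exact: measurable_snd.
by apply: measurable_dotp; exact: measurable_fst.
Qed.

End bounds.

Lemma lsym_cvg xi : xi != 0 -> lsym (harmonic n) (harmonic n)^-1 xi @[n --> \oo] --> lnorm xi.
Proof.
move=> x0; have h0 n : 0 < harmonic n :> R by rewrite /harmonic/= invr_gt0.
pose C := 2^-1 * (4 * pi ^+ 2 * (dotp xi xi + 1) + (4 * pi ^+ 2)^-1 * ((dotp xi xi)^-1 + 1)).
have C0 : C * harmonic n @[n --> \oo] --> (0 : R).
  by rewrite -[X in _ --> X](mulr0 C); apply: cvgM; [exact: cvg_cst|exact: cvg_harmonic].
apply/cvgrPdist_le => eps eps0.
move: C0 => /cvgrPdist_le/(_ _ eps0); apply: filterS => n; rewrite sub0r normrN => hn.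
apply: le_trans (le_trans (ler_norm _) hn).
have h1 : harmonic n <= (harmonic n)^-1 :> R.
  apply: (@le_trans _ _ 1); first by rewrite /harmonic/= invf_le1 ?ler1n.
  by rewrite /harmonic/= invrK ler1n.
apply: le_trans (lsym_gap (h0 n) h1 x0) _; apply: eq_ler; rewrite /C invfM invrK.
by ring.
Qed.

Definition Wr f : R := \int[mu]_xi (lnorm xi ^+ 2 * FF f f xi).

Lemma Lop_L2_cvg (D : seq 'I_d -> 'rV[R]_d -> R) : sch D ->
  intg mu (fun xi => lnorm xi ^+ 2 * FF (D [::]) (D [::]) xi) ->
  \int[mu]_x Lop (harmonic n) (harmonic n)^-1 (D [::]) x ^+ 2 @[n --> \oo] --> Wr (D [::]).
Proof.
move=> SD iW; have [XD _] := SD; pose f := D [::].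
have h0 n : 0 < harmonic n :> R by rewrite /harmonic/= invr_gt0.
have h1 n : harmonic n <= (harmonic n)^-1 :> R.
  apply: (@le_trans _ _ 1); first by rewrite /harmonic/= invf_le1 ?ler1n.
  by rewrite /harmonic/= invrK ler1n.
have mFF : measurable_fun [set: 'rV[R]_d] (FF f f) by apply: measurable_FF; exact: bint_measurable (XD [::]).
pose F n xi := lsym (harmonic n) (harmonic n)^-1 xi ^+ 2 * FF f f xi.
have mF n : measurable_fun [set: 'rV[R]_d] (F n).
  by apply: measurable_funM => //; apply: measurable_funX; exact: measurable_lsym.
(* The integrands are set to 0 at the origin, where [lsym_le] and [lsym_cvg] say nothing, so that
   convergence and domination hold at every point. *)
pose F1 n xi := if xi == 0 then 0 else F n xi.
pose G xi := if xi == 0 then 0 else lnorm xi ^+ 2 * FF f f xi.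
have m0 : measurable_fun [set: 'rV[R]_d] (fun xi => xi == 0).
  have -> : (fun xi : 'rV[R]_d => xi == 0) = (fun xi => dotp xi xi == 0).
    apply/funext => xi; have [->|/dotp_gt0 h] := eqVneq xi 0; first by rewrite dotp0 eqxx.
    by rewrite (gt_eqF h).
  by apply: measurable_fun_eqr => //; exact: measurable_dotp.
have mF1 n : measurable_fun [set: 'rV[R]_d] (F1 n) by exact: measurable_fun_ifT.
have mG : measurable_fun [set: 'rV[R]_d] G by apply: measurable_fun_ifT => //; exact: intg_measurable iW.
have F1G xi : F1 n xi @[n --> \oo] --> G xi.
  rewrite /F1 /G; case: eqVneq => [_|x0]; first exact: cvg_cst.
  apply: cvgM; last exact: cvg_cst.
  by rewrite expr2; under eq_fun do rewrite expr2; apply: cvgM; exact: lsym_cvg.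
have F1le n xi : `|F1 n xi| <= lnorm xi ^+ 2 * FF f f xi.
  rewrite /F1; case: eqVneq => [_|x0]; first by rewrite normr0 mulr_ge0 ?sqr_ge0 ?FF_ge0.
  rewrite ger0_norm; last by rewrite mulr_ge0 ?sqr_ge0 ?FF_ge0.
  by apply: ler_wpM2r; [exact: FF_ge0|exact: lsym_le].
have [_ cv] := Rint_dct mF1 F1G iW F1le.
have -> : Wr (D [::]) = \int[mu]_xi G xi.
  apply: Rint_off0 => //; first exact: intg_measurable iW.
  by move=> xi x0; rewrite /G (negbTE x0).
have E n : \int[mu]_x Lop (harmonic n) (harmonic n)^-1 f x ^+ 2 = \int[mu]_xi F1 n xi.
  have SL := sch_Lop (harmonic n)^-1 (h0 n) SD; have [L L0 lL] := sch_lip [::] SL.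
  have [XL _] := SL; have [_ <-] := plancherel (XL [::]) L0 lL.
  rewrite (eq_Rint _ (g := F n)); last by move=> xi; rewrite FF_Lop.
  by apply: Rint_off0 => // xi x0; rewrite /F1 (negbTE x0).
by under eq_fun do rewrite E.
Qed.

End log_symbol.

(** * The logarithmic energy and its polar form *)

Section log_energy.
Context (R : realType) (d : nat).
Hypothesis hd : (1 <= d)%N.
Local Notation mu := (lebesgue_rV R d).
Local Notation leb := (@lebesgue_measure R).
Implicit Types (x y z xi : 'rV[R]_d) (i j : 'I_d) (f g r : 'rV[R]_d -> R).

Definition low xi : R := if dotp xi xi < 1 then lnorm xi ^+ 2 else 0.

Lemma low_ge0 xi : 0 <= low xi.
Proof. by rewrite /low; case: ifP => // _; exact: sqr_ge0. Qed.

Lemma measurable_low : measurable_fun [set: 'rV[R]_d] low.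
Proof.
apply: measurable_fun_ifT => //.
- by apply: measurable_fun_ltr => //; exact: measurable_dotp.
- by apply: measurable_funX; exact: measurable_lnorm.
Qed.

Let rad m : R := 2^-1 ^+ m.

Let rad0 m : 0 <= rad m. Proof. by rewrite exprn_ge0// invr_ge0. Qed.

Let box m : set 'rV[R]_d := [set x | forall i, x ord0 i \in `[- rad m, rad m]].

Let mbox m : measurable (box m).
Proof.
rewrite (_ : box m = \bigcap_(i in [set: 'I_d]) [set x : 'rV[R]_d | x ord0 i \in `[- rad m, rad m]]).
  apply: fin_bigcap_measurable => // i _.
  by have := measurable_coord_rV i measurableT (measurable_itv `[- rad m, rad m]); rewrite setTI.
by apply/seteqP; split=> x /= h i; [move=> _|]; exact: h.
Qed.

Let mu_box m : (mu (box m) <= (2 ^+ d * rad m)%:E)%E.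
Proof.
have h : - rad m <= rad m by rewrite ge0_cp.
have -> : mu (box m) = (\prod_(i < d) (rad m - - rad m))%:E.
  exact: (@lebesgue_rV_box R d (fun=> - rad m) (fun=> rad m) (fun=> h)).
rewrite lee_fin prodr_const card_ord opprK -mulr2n.
have -> : rad m *+ 2 = 2 * rad m by rewrite mulr_natl.
rewrite exprMn.
apply: ler_wpM2l; first by rewrite exprn_ge0.
rewrite -[leRHS]expr1; apply: ler_wiXn2l => //.
by rewrite exprn_ile1// ?invr_ge0// invf_le1// ler1n.
Qed.

Let series_le n : \sum_(0 <= m < n) (2 * m%:R + 1) * rad m <= 6.
Proof.
have -> : \sum_(0 <= m < n) (2 * m%:R + 1) * rad m = 6 - (4 * n%:R + 6) * rad n.
  elim: n => [|n ih]; first by rewrite big_geq// /rad expr0; ring.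
  have e : n.+1%:R = n%:R + 1 :> R by rewrite natr1.
  rewrite big_nat_recr//= ih /rad exprS e.
  by move: (2^-1 ^+ n) (n%:R) => u v; field.
rewrite gerBl mulr_ge0// addr_ge0// mulr_ge0//.
Qed.

Let odd_sum n : \sum_(0 <= m < n) (2 * m%:R + 1) = n%:R ^+ 2 :> R.
Proof.
elim: n => [|n ih]; first by rewrite big_geq// expr0n.
by rewrite big_nat_recr//= ih -natr1; ring.
Qed.

Let term m xi : R := (2 * m%:R + 1) * \1_(box m) xi.

Let term0 m xi : 0 <= term m xi.
Proof. by rewrite mulr_ge0// addr_ge0// mulr_ge0. Qed.

(** A layer-cake bound: if [m <= - ln |xi|] then |xi| is at most e^-m, hence at most 2^-m, and [xi]
    lies in [box m]. The odd weights [2 m + 1] add up to the square of the number of boxes, which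
    exceeds the square of the logarithm. *)
Let low_series xi : ((low xi)%:E <= \sum_(0 <= m <oo) (term m xi)%:E)%E.
Proof.
have s0 : (0 <= \sum_(0 <= m <oo) (term m xi)%:E)%E by apply: nneseries_ge0 => m _ _; rewrite lee_fin.
rewrite /low; case: ifPn => // h; have [x0|x0] := eqVneq xi 0.
  by rewrite {1}x0 /lnorm dotp0 ln0// mulr0 expr0n/=.
have r0 := dotp_gt0 x0; pose L := - lnorm xi.
have L0 : 0 < L by rewrite /L /lnorm oppr_gt0 pmulr_rlt0 ?invr_gt0// ln_lt0// r0.
have /andP[L1 L2] := truncn_itv (ltW L0).
apply: (@le_trans _ _ (\sum_(0 <= m < (Num.truncn L).+1) (term m xi)%:E)%E); last first.
  by apply: nneseries_lim_ge => m _ _; rewrite lee_fin.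
rewrite sumEFin lee_fin -sqrrN -/L.
apply: (@le_trans _ _ ((Num.truncn L).+1%:R ^+ 2)).
  by rewrite lerXn2r ?nnegrE ?(ltW L0) ?(ltW L2)//.
rewrite -odd_sum big_nat_cond [leRHS]big_nat_cond; apply: ler_sum => m /andP[/andP[_ mM] _].
rewrite /term -[leLHS]mulr1; apply: ler_wpM2l; first by rewrite addr_ge0// mulr_ge0.
suff hb : box m xi by rewrite indicE mem_set.
move=> i; rewrite in_itv/= -ler_norml.
have mL : m%:R <= L by apply: le_trans L1; rewrite ler_nat.
have e2 : dotp xi xi = expR (- L) ^+ 2.
  by rewrite -expRM_natl /L opprK /lnorm mulrA divff// mul1r lnK// posrE.
have h1 : `|xi ord0 i| <= expR (- L).
  rewrite -[leRHS]ger0_norm ?expR_ge0// -ler_sqr ?nnegrE// !real_normK ?num_real// -e2.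
  exact: coord_sqr_le.
apply: (le_trans h1); apply: (@le_trans _ _ (expR (m%:R * (- 1)))).
  by rewrite ler_expR mulrN1 lerN2.
rewrite expRM_natl /rad lerXn2r ?nnegrE ?expR_ge0 ?invr_ge0//.
by rewrite expRN lef_pV2 ?posrE ?expR_gt0//; apply: le_trans (expR_ge1Dx 1).
Qed.

(** The measure of [box m] is at most 2^d 2^-m, as the dimension is at least one, and the series of
    [(2 m + 1) 2^-m] has sum 6. *)
Lemma intg_low : intg mu low.
Proof.
apply: intg_lty; [exact: measurable_low|exact: low_ge0|].
have mt m : measurable_fun [set: 'rV[R]_d] (fun xi => (term m xi)%:E).
  by apply/measurable_EFinP; apply: measurable_funM => //; exact: measurable_indic.
apply: (@le_lt_trans _ _ (\int[mu]_xi \sum_(0 <= m <oo) (term m xi)%:E)%E).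
  apply: ge0_le_integral => //.
  - by move=> xi _; rewrite lee_fin low_ge0.
  - by apply/measurable_EFinP; exact: measurable_low.
  - by apply: ge0_emeasurable_sum => // m xi _ _; rewrite lee_fin.
rewrite integral_nneseries//; last by move=> m xi _; rewrite lee_fin.
apply: (@le_lt_trans _ _ (2 ^+ d * 6)%:E); last exact: ltry.
apply: lime_le; first by apply: is_cvg_nneseries => m _ _; apply: integral_ge0 => xi _; rewrite lee_fin.
apply: nearW => n.
apply: (@le_trans _ _ (\sum_(0 <= m < n) ((2 ^+ d * ((2 * m%:R + 1) * rad m))%:E))%E).
  apply: lee_sum => m _.
  under eq_integral do rewrite /term EFinM.
  rewrite ge0_integralZl_EFin//; [|by apply/measurable_EFinP; exact: measurable_indic].
  rewrite integral_indic// setIT mulrCA EFinM; apply: lee_pmul => //.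
  exact: mu_box.
rewrite sumEFin lee_fin -mulr_sumr; apply: ler_wpM2l; first by rewrite exprn_ge0.
exact: series_le.
Qed.

(** For |xi| at least 1, the logarithm is at most 2 |xi|^(1/2), so its square is at most 4 |xi|,
    which the arithmetic-geometric inequality splits with a free parameter. In [Wr_taylor] this
    parameter depends on the time increment. *)
Lemma lnorm_le (lam : R) xi : 0 < lam ->
  lnorm xi ^+ 2 <= low xi + 2 * (lam + lam^-1 * dotp xi xi).
Proof.
move=> l0; have i0 : 0 < lam^-1 by rewrite invr_gt0.
have p0 : 0 <= dotp xi xi by exact: dotp_ge0.
rewrite /low; case: ifPn => [_|]; first by rewrite lerDl mulr_ge0// addr_ge0 ?(ltW l0)// mulr_ge0// ltW.
rewrite -leNgt add0r => r1; have r0 : 0 < dotp xi xi by exact: lt_le_trans r1.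
pose v := Num.sqrt (Num.sqrt (dotp xi xi)).
have v0 : 0 < v by rewrite !sqrtr_gt0.
have e : dotp xi xi = v ^+ 4 by rewrite (exprM v 2 2) !sqr_sqrtr ?sqrtr_ge0.
have v1 : 1 <= v.
  by rewrite leNgt; apply/negP => h; move: r1; rewrite e leNgt exprn_ilt1// ltW.
rewrite /lnorm e lnXn//; have h1 := ln_sublinear v0; have h2 := ln_ge0 v1.
apply: (@le_trans _ _ (4 * v ^+ 2)).
  have -> : 2^-1 * (ln v *+ 4) = 2 * ln v by rewrite -(mulr_natl (ln v) 4); field.
  by rewrite exprMn -natrX ler_wpM2l// lerXn2r ?nnegrE// ltW.
rewrite -subr_ge0.
have -> : 2 * (lam + lam^-1 * v ^+ 4) - 4 * v ^+ 2 = 2 * lam^-1 * (lam - v ^+ 2) ^+ 2.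
  by field; rewrite lt0r_neq0.
by rewrite mulr_ge0 ?sqr_ge0// mulr_ge0// ltW.
Qed.

Definition lenergyC : R := 2 * \int[mu]_xi low xi + 2.

(** At low frequencies the transform is bounded by the L^1 norm and the squared logarithm is
    integrable; at high frequencies [lnorm_le] and Plancherel give the L^2 norms of the function and
    of its gradient. *)
Lemma lenergy_bound (D : seq 'I_d -> 'rV[R]_d -> R) (lam : R) : sch D -> 0 < lam ->
  intg mu (fun xi => lnorm xi ^+ 2 * FF (D [::]) (D [::]) xi) /\
  Wr (D [::]) <= lenergyC * ((\int[mu]_x `|D [::] x|) ^+ 2 + lam * \int[mu]_x D [::] x ^+ 2 +
    lam^-1 * \sum_(i < d) \int[mu]_x D [:: i] x ^+ 2).
Proof.
move=> SD l0; have [XD dD] := SD; pose f := D [::]; have fi := bint_intg (XD [::]).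
pose N1 := \int[mu]_x `|f x|.
have lip_ s : exists2 L : R, 0 <= L & lip L (D s) by exact: sch_lip.
have i0 : 0 <= lam^-1 by rewrite invr_ge0 ltW.
have pl s : intg mu (FF (D s) (D s)) /\ \int[mu]_xi FF (D s) (D s) xi = \int[mu]_x D s x ^+ 2.
  by have [L L0 lL] := lip_ s; exact: plancherel lL.
have [iFF eFF] := pl [::].
have Fi i xi : FF (D [:: i]) (D [:: i]) xi = (4 * pi ^+ 2) * (xi ord0 i ^+ 2 * FF f f xi).
  by apply: FF_der; [exact: XD|exact: XD|exact: sch_lc].
have p0 : 0 < 4 * pi ^+ 2 :> R by rewrite mulr_gt0// exprn_gt0// pi_gt0.
have iFi i : intg mu (fun xi => xi ord0 i ^+ 2 * FF f f xi).
  apply: (@eq_intg _ _ _ _ (fun xi => (4 * pi ^+ 2)^-1 * FF (D [:: i]) (D [:: i]) xi)).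
    by move=> xi; rewrite Fi mulKf// lt0r_neq0.
  by apply: intgZ; case: (pl [:: i]).
have eFi i : \int[mu]_xi (xi ord0 i ^+ 2 * FF f f xi) <= \int[mu]_x D [:: i] x ^+ 2.
  have [h1 <-] := pl [:: i].
  apply: Rint_le => // xi; rewrite Fi; apply: ler_peMl.
    by apply: mulr_ge0; [exact: sqr_ge0|exact: FF_ge0].
  by have := pi_ge2 R => hp; nra.
pose H xi := 2 * N1 ^+ 2 * low xi + (2 * lam * FF f f xi + 2 * lam^-1 * \sum_(i < d) xi ord0 i ^+ 2 * FF f f xi).
have iS : intg mu (fun xi => \sum_(i < d) xi ord0 i ^+ 2 * FF f f xi) by apply: intg_sum => i _; exact: iFi.
have iH2 : intg mu (fun xi => 2 * lam * FF f f xi + 2 * lam^-1 * \sum_(i < d) xi ord0 i ^+ 2 * FF f f xi).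
  by apply: intgD; exact: intgZ.
have iH1 : intg mu (fun xi => 2 * N1 ^+ 2 * low xi) by apply: intgZ; exact: intg_low.
have iH : intg mu H by exact: intgD.
have le xi : lnorm xi ^+ 2 * FF f f xi <= H xi.
  have F0 := FF_ge0 f xi.
  apply: (le_trans (ler_wpM2r F0 (lnorm_le xi l0))).
  rewrite mulrDl; apply: lerD.
    rewrite mulrC; apply: ler_wpM2r; first exact: low_ge0.
    have := FF_le xi fi fi; rewrite ger0_norm ?FF_ge0// => h; exact: (le_trans h).
  have -> : \sum_(i < d) xi ord0 i ^+ 2 * FF f f xi = dotp xi xi * FF f f xi.
    by rewrite -mulr_suml /dotp; congr (_ * _); apply: eq_bigr => i _; rewrite expr2.
  by apply: eq_ler; ring.
have iW : intg mu (fun xi => lnorm xi ^+ 2 * FF f f xi).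
  apply: (intg_le _ _ iH).
    apply: measurable_funM; first by apply: measurable_funX; exact: measurable_lnorm.
    by apply: measurable_FF; exact: bint_measurable (XD [::]).
  by move=> xi; rewrite ger0_norm// mulr_ge0 ?sqr_ge0 ?FF_ge0.
split=> //; apply: (le_trans (Rint_le iW iH le)).
have -> : \int[mu]_xi H xi = 2 * N1 ^+ 2 * \int[mu]_xi low xi + (2 * lam * \int[mu]_x f x ^+ 2 +
    2 * lam^-1 * \sum_(i < d) \int[mu]_xi (xi ord0 i ^+ 2 * FF f f xi)).
  rewrite RintD// (RintZ _ intg_low) RintD; [|exact: intgZ|exact: intgZ].
  by rewrite (RintZ _ iFF) (RintZ _ iS) eFF Rint_sum.
have S1 : \sum_(i < d) \int[mu]_xi (xi ord0 i ^+ 2 * FF f f xi) <= \sum_(i < d) \int[mu]_x D [:: i] x ^+ 2.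
  by apply: ler_sum.
have S0 : 0 <= \sum_(i < d) \int[mu]_x D [:: i] x ^+ 2.
  by apply: sumr_ge0 => i _; apply: Rint_ge0 => x; exact: sqr_ge0.
have Z0 : 0 <= \int[mu]_xi low xi by apply: Rint_ge0 => xi; exact: low_ge0.
have E0 : 0 <= \int[mu]_x f x ^+ 2 by apply: Rint_ge0 => x; exact: sqr_ge0.
have arith (z n e s s' l k : R) : 0 <= z -> 0 <= n -> 0 <= e -> 0 <= s' -> s <= s' -> 0 <= l -> 0 <= k ->
    2 * n * z + (2 * l * e + 2 * k * s) <= (2 * z + 2) * (n + l * e + k * s').
  move=> z0 n0 e0 s0 ss ll k0; have := ler_wpM2l k0 ss; have := mulr_ge0 ll e0; have := mulr_ge0 k0 s0.
  by move=> a1 a2 a3; have := mulr_ge0 z0 a1; have := mulr_ge0 z0 a2; nra.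
by apply: arith => //; [exact: sqr_ge0|exact: ltW].
Qed.

(** The polar form of [Wr]. With [g] the time derivative of [f], it is half the derivative of the
    energy. *)
Definition Qr f g : R := \int[mu]_xi (lnorm xi ^+ 2 * FF f g xi).

Definition lfin f := intg mu f /\ intg mu (fun xi => lnorm xi ^+ 2 * FF f f xi).

Lemma Qr_intg f g : lfin f -> lfin g -> intg mu (fun xi => lnorm xi ^+ 2 * FF f g xi).
Proof.
move=> [fi Wf] [gi Wg]; apply: (intg_le _ _ (intgD Wf Wg)).
  apply: measurable_funM; first by apply: measurable_funX; exact: measurable_lnorm.
  by apply: measurable_FF; [exact: intg_measurable fi|exact: intg_measurable gi].
move=> xi; rewrite -mulrDr normrM ger0_norm ?sqr_ge0//; apply: ler_wpM2l; first exact: sqr_ge0.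
rewrite /FF ler_norml; move: (FC f xi) (FS f xi) (FC g xi) (FS g xi) => a b c e.
have := sqr_ge0 (a - c); have := sqr_ge0 (a + c); have := sqr_ge0 (b - e); have := sqr_ge0 (b + e).
by move=> h1 h2 h3 h4; have := sqr_ge0 a; have := sqr_ge0 b; have := sqr_ge0 c; have := sqr_ge0 e; nra.
Qed.

Lemma lfinD f g : lfin f -> lfin g -> lfin (fun x => f x + g x).
Proof.
move=> hf hg; have [fi Wf] := hf; have [gi Wg] := hg; split; first exact: intgD.
have := intgD (intgD Wf (intgZ 2 (Qr_intg hf hg))) Wg; apply: eq_intg => xi.
by rewrite /FF FCD// FSD//; ring.
Qed.

Lemma lfinZ (k : R) f : lfin f -> lfin (fun x => k * f x).
Proof.
move=> [fi Wf]; split; first exact: intgZ.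
by have := intgZ (k ^+ 2) Wf; apply: eq_intg => xi; rewrite /FF FCZ// FSZ//; ring.
Qed.

Lemma WrD f g : lfin f -> lfin g -> Wr (fun x => f x + g x) = Wr f + 2 * Qr f g + Wr g.
Proof.
move=> hf hg; have [fi Wf] := hf; have [gi Wg] := hg; have Wfg := Qr_intg hf hg.
rewrite /Wr /Qr -(RintZ _ Wfg) -(RintD Wf (intgZ 2 Wfg)) -(RintD (intgD Wf (intgZ 2 Wfg)) Wg).
by apply: eq_Rint => xi; rewrite /FF FCD// FSD//; ring.
Qed.

Lemma WrZ (k : R) f : lfin f -> Wr (fun x => k * f x) = k ^+ 2 * Wr f.
Proof.
move=> [fi Wf]; rewrite /Wr -(RintZ _ Wf); apply: eq_Rint => xi.
by rewrite /FF FCZ// FSZ//; ring.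
Qed.

Lemma QrZ (k : R) f g : lfin f -> lfin g -> Qr f (fun x => k * g x) = k * Qr f g.
Proof.
move=> hf hg; have [gi _] := hg; rewrite /Qr -(RintZ _ (Qr_intg hf hg)); apply: eq_Rint => xi.
by rewrite /FF FCZ// FSZ//; ring.
Qed.

Lemma Wr_ge0 f : 0 <= Wr f.
Proof. by apply: Rint_ge0 => xi; rewrite mulr_ge0 ?sqr_ge0 ?FF_ge0. Qed.

Lemma QrD f g r : lfin f -> lfin g -> lfin r -> Qr f (fun x => g x + r x) = Qr f g + Qr f r.
Proof.
move=> hf hg hr; have [gi _] := hg; have [ri _] := hr.
rewrite /Qr -(RintD (Qr_intg hf hg) (Qr_intg hf hr)); apply: eq_Rint => xi.
by rewrite /FF FCD// FSD//; ring.
Qed.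

Lemma QrC f g : Qr f g = Qr g f.
Proof. by apply: eq_Rint => xi; rewrite /FF; ring. Qed.

Opaque Wr Qr.

Lemma Qr_CS f g : lfin f -> lfin g -> `|Qr f g| <= Num.sqrt (Wr f) * Num.sqrt (Wr g).
Proof.
move=> hf hg; rewrite -sqrtrM ?Wr_ge0// -(ger0_norm (normr_ge0 (Qr f g))) -sqrtr_sqr.
apply: ler_wsqrtr; apply: sqr_le_mul; rewrite ?Wr_ge0// => t t0.
have h1 : 0 <= Wr (fun x => t * f x + g x) by exact: Wr_ge0.
have h2 : 0 <= Wr (fun x => t * f x + (-1) * g x) by exact: Wr_ge0.
have tf := lfinZ t hf; have ng := lfinZ (-1) hg.
rewrite (WrD tf hg) (WrZ t hf) QrC (QrZ t hg hf) QrC in h1.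
rewrite (WrD tf ng) (WrZ t hf) (WrZ (-1) hg) (QrZ (-1) tf hg) QrC (QrZ t hg hf) QrC in h2.
rewrite -{1}(ger0_norm (ltW t0)) -[2 * _ * _]mulrA -normrM.
move: (Wr f) (Qr f g) (Wr g) h1 h2 => u v w h1 h2.
have [e|e] := ger0P (t * v).
  by move: h2; rewrite sqrrN expr1n !mul1r mulN1r; lra.
by move: h1; lra.
Qed.

Lemma Wr_expand f g r (h : R) : lfin f -> lfin g -> lfin r ->
  `|Wr (fun x => f x + (h * g x + r x)) - Wr f - 2 * h * Qr f g| <=
  h ^+ 2 * Wr g + Wr r + 2 * (Num.sqrt (Wr f) + `|h| * Num.sqrt (Wr g)) * Num.sqrt (Wr r).
Proof.
move=> hf hg hr; have hg' := lfinZ h hg; have hgr := lfinD hg' hr.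
rewrite (WrD hf hgr) (QrD hf hg' hr) (WrD hg' hr) (WrZ h hg) (QrZ h hf hg) (QrC (fun x => h * g x) r) (QrZ h hr hg).
have c1 := Qr_CS hf hr; have c2 := Qr_CS hr hg.
have w1 := Wr_ge0 g; have w2 := Wr_ge0 r.
have v1 := sqrtr_ge0 (Wr f); have v2 := sqrtr_ge0 (Wr g); have v3 := sqrtr_ge0 (Wr r).
move: (Num.sqrt (Wr f)) (Num.sqrt (Wr g)) (Num.sqrt (Wr r)) v1 v2 v3 c1 c2 => sf sg sr v1 v2 v3.
move: (Wr f) (Wr g) (Wr r) (Qr f g) (Qr f r) (Qr r g) w1 w2 => A B C D E F w1 w2 c1 c2.
have -> : A + 2 * (h * D + E) + (h ^+ 2 * B + 2 * (h * F) + C) - A - 2 * h * D =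
  (h ^+ 2 * B + C) + (2 * E + 2 * (h * F)) by ring.
apply: (le_trans (ler_normD _ _)); apply: lerD.
  by rewrite ger0_norm// addr_ge0// mulr_ge0 ?sqr_ge0.
apply: (le_trans (ler_normD _ _)); rewrite !normrM ger0_norm//.
rewrite -[leRHS]mulrA -mulrDr; apply: ler_wpM2l => //.
rewrite mulrDl; apply: lerD; first exact: c1.
by rewrite -[leRHS]mulrA; apply: ler_wpM2l => //; rewrite mulrC.
Qed.

Lemma heat_itv_intg (a b : R) f x : 0 < a -> bint f ->
  leb.-integrable `[a, b] (EFin \o (fun s => s^-1 * (heat s f x - esym s * f x))).
Proof.
move=> a0 Xf; apply: continuous_compact_integrable; first exact: segment_compact.
apply: continuous_in_subspaceT => c; rewrite inE/= in_itv/= => /andP[ac cb].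
have c0 : 0 < c by exact: lt_le_trans ac.
apply: continuousM; first exact: der_continuous (der_inv (lt0r_neq0 c0)).
apply: continuousB; first exact: heat_time_continuous.
by apply: continuousM; [exact: exp_lin_continuous|exact: cst_continuous].
Qed.

Lemma LopD (a b : R) f g x : 0 < a -> bint f -> bint g ->
  Lop a b (fun y => f y + g y) x = Lop a b f x + Lop a b g x.
Proof.
move=> a0 Xf Xg; rewrite /Lop -mulrDr; congr (_ * _).
rewrite -(Rint_itvD (heat_itv_intg _ _ a0 Xf) (heat_itv_intg _ _ a0 Xg)).
apply: eq_Rintegral => s; rewrite inE/= in_itv/= => /andP[as_ _].
have s0 : 0 < s by exact: lt_le_trans as_.
by rewrite heatD//; ring.
Qed.

Lemma sch_lfin (D : seq 'I_d -> 'rV[R]_d -> R) : sch D -> lfin (D [::]).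
Proof.
move=> SD; have [XD _] := SD; split; first exact: bint_intg.
by case: (lenergy_bound SD (@ltr01 R)).
Qed.

Lemma schD (D E : seq 'I_d -> 'rV[R]_d -> R) : sch D -> sch E -> sch (fun s x => D s x + E s x).
Proof. by move=> [XD dD] [XE dE]; split=> [s|s i x]; [exact: bintD|exact: derD]. Qed.

Lemma schZ (k : R) (D : seq 'I_d -> 'rV[R]_d -> R) : sch D -> sch (fun s x => k * D s x).
Proof. by move=> [XD dD]; split=> [s|s i x]; [exact: bintZ|exact: derZ]. Qed.

Opaque Lop.

Lemma cvg_polar (u v w : R^nat) (a b c : R) : u n @[n --> \oo] --> a -> v n @[n --> \oo] --> b ->
  w n @[n --> \oo] --> c -> 2^-1 * (u n - v n - w n) @[n --> \oo] --> 2^-1 * (a - b - c).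
Proof.
by move=> ca cb cc; apply: cvgM; [exact: cvg_cst|apply: cvgB => //; exact: cvgB].
Qed.

Lemma cvg_mulsqrt (u : R^nat) (K a : R) : u n @[n --> \oo] --> a ->
  K * Num.sqrt (u n) @[n --> \oo] --> K * Num.sqrt a.
Proof.
move=> ca; apply: cvgM; first exact: cvg_cst.
have h : {for a, continuous (@Num.sqrt R)} by exact: sqrt_continuous.
exact: (continuous_cvg _ h ca).
Qed.

(** Polarisation writes the pairing of [Lop (D [::])] with [Lop (E [::])] by means of three squared
    norms, each of which converges by [Lop_L2_cvg]; the inequality then passes to the limit. *)
Lemma Qr_le_lim (D E : seq 'I_d -> 'rV[R]_d -> R) (K : R) : sch D -> sch E ->
  (forall a b : R, 0 < a -> a <= b -> `|\int[mu]_x (Lop a b (D [::]) x * Lop a b (E [::]) x)| <=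
    K * Num.sqrt (\int[mu]_x Lop a b (D [::]) x ^+ 2)) ->
  `|Qr (D [::]) (E [::])| <= K * Num.sqrt (Wr (D [::])).
Proof.
move=> SD SE h; have [XD _] := SD; have [XE _] := SE; have SDE := schD SD SE.
have fD := sch_lfin SD; have fE := sch_lfin SE; have fDE := sch_lfin SDE.
have cD := Lop_L2_cvg hd SD fD.2; have cE := Lop_L2_cvg hd SE fE.2.
have cDE : \int[mu]_x Lop (harmonic n) (harmonic n)^-1 (fun x => D [::] x + E [::] x) x ^+ 2 @[n --> \oo] -->
  Wr (fun x => D [::] x + E [::] x) := Lop_L2_cvg hd SDE fDE.2.
have h0 n : 0 < harmonic n :> R by rewrite /harmonic/= invr_gt0.
have h1 n : harmonic n <= (harmonic n)^-1 :> R.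
  apply: (@le_trans _ _ 1); first by rewrite /harmonic/= invf_le1 ?ler1n.
  by rewrite /harmonic/= invrK ler1n.
pose P n := \int[mu]_x (Lop (harmonic n) (harmonic n)^-1 (D [::]) x * Lop (harmonic n) (harmonic n)^-1 (E [::]) x).
have cP : P n @[n --> \oo] --> Qr (D [::]) (E [::]).
  have eQ : Qr (D [::]) (E [::]) = 2^-1 * (Wr (fun x => D [::] x + E [::] x) - Wr (D [::]) - Wr (E [::])).
    rewrite (WrD fD fE); move: (Wr _) (Qr _ _) (Wr _) => u v w.
    by field.
  have e n : P n = 2^-1 * (\int[mu]_x Lop (harmonic n) (harmonic n)^-1 (fun x => D [::] x + E [::] x) x ^+ 2 -
      \int[mu]_x Lop (harmonic n) (harmonic n)^-1 (D [::]) x ^+ 2 -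
      \int[mu]_x Lop (harmonic n) (harmonic n)^-1 (E [::]) x ^+ 2).
    have XL := bint_Lop (harmonic n)^-1 (h0 n) (XD [::]).
    have XM := bint_Lop (harmonic n)^-1 (h0 n) (XE [::]).
    have i1 := bint_sqr XL; have i2 := bint_sqr XM; have i3 := bint_mul_intg XL XM.
    rewrite (eq_Rint _ (g := fun x => Lop (harmonic n) (harmonic n)^-1 (D [::]) x ^+ 2 +
      (2 * (Lop (harmonic n) (harmonic n)^-1 (D [::]) x * Lop (harmonic n) (harmonic n)^-1 (E [::]) x) +
       Lop (harmonic n) (harmonic n)^-1 (E [::]) x ^+ 2))); last first.
      by move=> x; rewrite LopD//; ring.
    rewrite (RintD i1 (intgD (intgZ 2 i3) i2)) (RintD (intgZ 2 i3) i2) (RintZ 2 i3) -/(P n).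
    move: (\int[mu]_x _) (\int[mu]_x _) (P n) => u v w.
    by field.
  by rewrite eQ (funext e); exact: (cvg_polar cDE cD cE).
have cS : K * Num.sqrt (\int[mu]_x Lop (harmonic n) (harmonic n)^-1 (D [::]) x ^+ 2) @[n --> \oo] -->
    K * Num.sqrt (Wr (D [::])).
  exact: (@cvg_mulsqrt _ K _ cD).
apply: (ler_cvg_to (cvg_norm cP) cS).
by apply: nearW => n; exact: h.
Qed.

End log_energy.

(** * Null sets and the unit sphere *)

Section null.
Context d (T : measurableType d) (R : realType).
Variable mu : {measure set T -> \bar R}.
Implicit Types f g : T -> R.

(** The functions [min (n f) g] have integral at most 0 and tend to [g] pointwise, since [g]
    vanishes wherever [f] does; Fatou concludes. *)
Lemma Rint_null f g : measurable_fun [set: T] g -> (forall x, 0 <= f x) -> (forall x, 0 <= g x) ->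
  intg mu f -> \int[mu]_x f x <= 0 -> (forall x, f x = 0 -> g x = 0) ->
  intg mu g /\ \int[mu]_x g x = 0.
Proof.
move=> mg f0 g0 fi e fg; pose F (n : nat) x := Num.min (n%:R * f x) (g x).
have mf := intg_measurable fi.
have F0 n x : 0 <= F n x by rewrite /F le_min g0 mulr_ge0.
have Fle n x : F n x <= n%:R * f x by rewrite /F ge_min lexx.
have mF n : measurable_fun [set: T] (F n).
  have m1 : measurable_fun [set: T] (fun x => n%:R * f x) by exact: measurable_funM.
  exact: (measurable_minr m1 mg).
have iF n : intg mu (F n).
  by apply: (intg_le _ _ (intgZ n%:R fi)) => // x; rewrite ger0_norm.
have FG x : F n x @[n --> \oo] --> g x.
  apply: cvg_near_cst; have [fx0|fx] := eqVneq (f x) 0.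
    by apply: nearW => n; rewrite /F fx0 mulr0 (fg _ fx0) minxx.
  have fx1 : 0 < f x by rewrite lt_neqAle eq_sym fx f0.
  have := nbhs_infty_ger (g x / f x); apply: filterS => n hn.
  by rewrite /F; apply/min_idPr; rewrite -ler_pdivrMr.
have up n : \int[mu]_x F n x <= 0.
  apply: (le_trans (Rint_le (iF n) (intgZ n%:R fi) (Fle n))).
  by rewrite RintZ// mulr_ge0_le0.
have [ig hg] := Rint_fatou mF FG F0 iF up.
by split=> //; apply/eqP; rewrite eq_le hg Rint_ge0.
Qed.

End null.

Section sphere.
Context (R : realType) (d : nat).
Hypothesis hd : (1 <= d)%N.
Local Notation mu := (lebesgue_rV R d).
Implicit Types (x y z xi : 'rV[R]_d) (i j : 'I_d) (f g r : 'rV[R]_d -> R).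

Definition sph xi : R := (dotp xi xi == 1)%:R.

Lemma measurable_sph : measurable_fun [set: 'rV[R]_d] sph.
Proof.
rewrite (_ : sph = fun xi => if dotp xi xi == 1 then 1 else 0); last first.
  by apply/funext => xi; rewrite /sph; case: eqP.
by apply: measurable_fun_ifT => //; apply: measurable_fun_eqr => //; exact: measurable_dotp.
Qed.

Let cube : set 'rV[R]_d := [set x | forall i, x ord0 i \in `[-2, 2]].

Let mcube : measurable cube.
Proof.
rewrite (_ : cube = \bigcap_(i in [set: 'I_d]) [set x : 'rV[R]_d | x ord0 i \in `[-2, 2]]).
  apply: fin_bigcap_measurable => // i _.
  by have := measurable_coord_rV i measurableT (measurable_itv `[-2 : R, 2]); rewrite setTI.
by apply/seteqP; split=> x /= h i; [move=> _|]; exact: h.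
Qed.

Let icube : intg mu (\1_cube).
Proof.
apply: intg_lty => //.
rewrite integral_indic// setIT.
have h : (-2 : R) <= 2 by rewrite ge0_cp.
by rewrite [X in (X < _)%E](_ : _ = (\prod_(i < d) (2 - -2))%:E) ?ltry//; exact: (@lebesgue_rV_box R d (fun=> -2) (fun=> 2) (fun=> h)).
Qed.

Let sph_cube (t : R) x : 1 <= t -> t <= 2 -> sph (t^-1 *: x) <= \1_cube x.
Proof.
move=> t1 t2; rewrite /sph; case: eqP => // h.
have t0 : 0 < t by exact: lt_le_trans t1.
suff hc : cube x by rewrite indicE mem_set.
move=> i; rewrite in_itv/= -ler_norml -ler_sqr ?nnegrE// real_normK ?num_real//.
apply: (le_trans (coord_sqr_le x i)); move: h; rewrite dotpZl dotpZr => h.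
have -> : dotp x x = t ^+ 2 * (t^-1 * (t^-1 * dotp x x)) by field; rewrite lt0r_neq0.
by rewrite h mulr1 lerXn2r ?nnegrE// ltW.
Qed.

Lemma intg_sph : intg mu sph.
Proof.
apply: (intg_le measurable_sph _ icube) => x; rewrite ger0_norm ?ler0n//.
have := @sph_cube 1 x (lexx 1); rewrite invr1 scale1r; apply.
by rewrite ler1n.
Qed.

(* The dilates of the sphere by distinct factors in [1, 2] are disjoint and have larger measure,
   while they all lie in a cube. *)
Lemma Rint_sph : \int[mu]_xi sph xi = 0.
Proof.
apply/eqP; rewrite eq_le Rint_ge0 ?andbT; last by move=> x; rewrite ler0n.
set I := \int[mu]_xi sph xi.
have I0 : 0 <= I by apply: Rint_ge0 => x; rewrite ler0n.
pose V := \int[mu]_x (\1_cube x : R).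
have main n : n.+1%:R * I <= V.
  pose t (k : 'I_n.+1) : R := 1 + k%:R / n.+1%:R.
  have n0 : 0 < n.+1%:R :> R by rewrite ltr0n.
  have t1 k : 1 <= t k by rewrite lerDl divr_ge0.
  have t0 k : 0 < t k by exact: lt_le_trans (t1 k).
  have t2 k : t k <= 2.
    have h : k%:R / n.+1%:R <= 1 :> R by rewrite ler_pdivrMr// mul1r ler_nat ltnW.
    by apply: le_trans (lerD (lexx 1) h) _; lra.
  have it k : intg mu (fun x => sph ((t k)^-1 *: x + 0)).
    by apply: intg_rV_affine; [rewrite invr_eq0 lt0r_neq0|exact: intg_sph].
  have eI k : I <= \int[mu]_x sph ((t k)^-1 *: x + 0).
    rewrite Rint_rV_affine; [|by rewrite invr_eq0 lt0r_neq0|exact: intg_sph].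
    rewrite -/I ler_peMl// gtr0_norm ?invr_gt0// exprVn invrK.
    by apply: exprn_ege1.
  have -> : n.+1%:R * I = \sum_(k < n.+1) I by rewrite sumr_const card_ord mulr_natl.
  apply: (@le_trans _ _ (\sum_(k < n.+1) \int[mu]_x sph ((t k)^-1 *: x + 0))); first exact: ler_sum.
  rewrite -Rint_sum//; apply: Rint_le => //; first exact: intg_sum.
  move=> x; have [/existsP[k hk]|/existsPn hn] := boolP [exists k : 'I_n.+1, sph ((t k)^-1 *: x + 0) != 0].
    rewrite (bigD1 k)//= big1 ?addr0; first by rewrite sph_cube.
    move=> l lk; apply/eqP; rewrite /sph pnatr_eq0 eqb0; apply: contra lk => hl.
    move: hk; rewrite /sph pnatr_eq0 eqb0 negbK => hk.
    have sq m : dotp ((t m)^-1 *: x + 0) ((t m)^-1 *: x + 0) == 1 -> dotp x x = t m ^+ 2.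
      rewrite addr0 dotpZl dotpZr => /eqP h.
      have -> : dotp x x = t m ^+ 2 * ((t m)^-1 * ((t m)^-1 * dotp x x)) by field; rewrite lt0r_neq0.
      by rewrite h mulr1.
    have : t l ^+ 2 == t k ^+ 2 by rewrite -(sq _ hl) -(sq _ hk).
    rewrite eqrXn2 ?(ltW (t0 _))// /t (inj_eq (addrI _)) => /eqP/(mulIf _).
    by move=> h; apply/eqP/val_inj/eqP; rewrite -(eqr_nat R); apply/eqP/h; rewrite invr_eq0 lt0r_neq0.
  by rewrite big1 => // k _; apply/eqP; have := hn k; rewrite negbK.
rewrite leNgt; apply/negP => Ip.
have := main (Num.truncn (V / I)); rewrite leNgt => /negP; apply.
rewrite -ltr_pdivrMr//; exact: truncnS_gt.
Qed.

Transparent Wr.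

Lemma Wr_eq0 (D : seq 'I_d -> 'rV[R]_d -> R) : sch D ->
  Wr (D [::]) = 0 <-> \int[mu]_x D [::] x ^+ 2 = 0.
Proof.
move=> SD; have [XD _] := SD; have [L L0 lL] := sch_lip [::] SD.
have [iF <-] := plancherel (XD [::]) L0 lL; have [fi iW] := sch_lfin hd SD.
have mFF := intg_measurable iF; have mW := intg_measurable iW.
have W0 xi : 0 <= lnorm xi ^+ 2 * FF (D [::]) (D [::]) xi by rewrite mulr_ge0 ?sqr_ge0 ?FF_ge0.
split=> h; last first.
  have [] // := Rint_null mW (FF_ge0 (D [::])) W0 iF (eq_ler h).
  by move=> xi e; rewrite e mulr0.
pose g1 xi := (lnorm xi != 0)%:R * FF (D [::]) (D [::]) xi.
pose g2 xi := sph xi * FF (D [::]) (D [::]) xi.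
have m1 : measurable_fun [set: 'rV[R]_d] g1.
  rewrite (_ : g1 = fun xi => if lnorm xi == 0 then 0 else FF (D [::]) (D [::]) xi); last first.
    by apply/funext => xi; rewrite /g1; case: eqP; rewrite ?mul0r ?mul1r.
  by apply: measurable_fun_ifT => //; apply: measurable_fun_eqr => //; exact: measurable_lnorm.
have m2 : measurable_fun [set: 'rV[R]_d] g2 by apply: measurable_funM => //; exact: measurable_sph.
have g10 xi : 0 <= g1 xi by rewrite mulr_ge0 ?ler0n ?FF_ge0.
have g20 xi : 0 <= g2 xi by rewrite mulr_ge0 ?ler0n ?FF_ge0.
have [i1 e1] : intg mu g1 /\ \int[mu]_xi g1 xi = 0.
  apply: (Rint_null m1 W0 g10 iW (eq_ler h)) => xi /eqP.
  rewrite mulf_eq0 sqrf_eq0 /g1 => /orP[->|/eqP ->]; first by rewrite mul0r.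
  by rewrite mulr0.
have [i2 e2] : intg mu g2 /\ \int[mu]_xi g2 xi = 0.
  apply: (Rint_null m2 _ g20 intg_sph (eq_ler Rint_sph)) => [xi|xi e]; first by rewrite ler0n.
  by rewrite /g2 e mul0r.
(* Outside the origin, [lnorm] vanishes exactly on the unit sphere. The origin is excluded because
   the default value of [ln] makes [lnorm] vanish there too. *)
rewrite (Rint_off0 hd (g := fun xi => g1 xi + g2 xi)) //; last 2 first.
- exact: measurable_funD.
- move=> xi /dotp_gt0 x0; rewrite /g1 /g2 /sph -mulrDl -natrD.
  rewrite /lnorm mulf_eq0 invr_eq0 pnatr_eq0/= ln_eq0//.
  by case: eqP => _; rewrite mul1r.
by rewrite RintD// e1 e2 addr0.
Qed.

Opaque Wr.

End sphere.

(** * An integrable majorant for fast decay *)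

Section decay.
Context (R : realType) (d : nat).
Local Notation mu := (lebesgue_rV R d).
Local Notation leb := (@lebesgue_measure R).
Implicit Types (x y z : 'rV[R]_d) (i j : 'I_d) (f g r : 'rV[R]_d -> R).

Let q1 (t : R) : R := (1 + t ^+ 2)^-1.

Let q1_gt0 t : 0 < q1 t. Proof. by rewrite invr_gt0 ltr_pwDl// sqr_ge0. Qed.

Let q1_cont : continuous q1.
Proof.
exact: continuous_oneDsqrV.
Qed.

Let iq1 : intg leb q1.
Proof.
pose F (n : nat) (t : R) := \1_(`[(- n%:R : R), n%:R]%classic) t * q1 t.
have mq : measurable_fun [set: R] q1 by exact: continuous_measurable_fun.
have iF n : intg leb (F n).
  apply: (intg_le _ _ (integrable_indic_itv (- n%:R : R) n%:R true false)).
    by apply: measurable_funM => //; exact: measurable_indic.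
  move=> t; rewrite /F normrM ger0_norm ?ler0n// ger0_norm ?(ltW (q1_gt0 _))//.
  by rewrite ler_piMr// invf_le1 ?lerDl ?sqr_ge0// ltr_pwDl// sqr_ge0.
have FG t : F n t @[n --> \oo] --> q1 t.
  apply: cvg_near_cst; have := nbhs_infty_ger `|t|; apply: filterS => n hn.
  by rewrite /F indicE mem_set ?mul1r//= in_itv/= -ler_norml.
have F0 n t : 0 <= F n t by rewrite mulr_ge0 ?ler0n// ltW.
have up n : \int[leb]_t F n t <= pi.
  rewrite -(Rint_itv_indic (- n%:R) n%:R q1) (@FTC_Rint R (@atan R)).
  - have h1 := atan_ltpi2 (n%:R : R).
    by rewrite atanN opprK; move: h1; lra.
  - by rewrite ge0_cp.
  - by move=> t _; exact: q1_cont.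
by case: (Rint_fatou (fun n => intg_measurable (iF n)) FG F0 iF up).
Qed.

(** The product form reduces integrability to dimension one, where the arctangent is a primitive,
    and [jap_ge] compares the product with a power of [1 + |x|^2]. *)
Definition jap x : R := \prod_(i < d) (1 + x ord0 i ^+ 2)^-1.

Lemma jap_gt0 x : 0 < jap x.
Proof. by apply: prodr_gt0 => i _; exact: q1_gt0. Qed.

Lemma bint_jap : bint jap.
Proof.
have mj : measurable_fun [set: 'rV[R]_d] jap.
  apply: measurable_prod => i _; have mq : measurable_fun [set: R] q1 by exact: continuous_measurable_fun.
  exact: (measurableT_comp mq (measurable_coord_rV i)).
split=> //.
  exists 1 => x; rewrite ger0_norm; last exact: ltW (jap_gt0 x).
  apply: prodr_ile1 => i _; rewrite (ltW (q1_gt0 _))/= invf_le1 ?lerDl ?sqr_ge0//.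
  by rewrite ltr_pwDl// sqr_ge0.
apply: intg_lty => // [x|]; first exact: ltW (jap_gt0 x).
have mq : measurable_fun [set: R] (EFin \o q1) by apply/measurable_EFinP; exact: continuous_measurable_fun.
have E := @integral_rV_prod R d (fun=> EFin \o q1) (fun=> mq) (fun _ t => ltW (q1_gt0 t)).
have {}E : (\int[mu]_x (jap x)%:E = \prod_(i < d) \int[leb]_t (q1 t)%:E)%E.
  by rewrite -[RHS]E; apply: eq_integral => x _; rewrite /jap -prodEFin.
rewrite E -(EFin_Rint iq1) prodEFin; exact: ltry.
Qed.

Lemma jap_ge x : (1 + dotp x x) ^- d <= jap x.
Proof.
rewrite /jap prodfV lef_pV2 ?posrE; last 2 first.
- by rewrite exprn_gt0// ltr_pwDl// dotp_ge0.
- by apply: prodr_gt0 => i _; rewrite ltr_pwDl// sqr_ge0.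
have -> : (1 + dotp x x) ^+ d = \prod_(i < d) (1 + dotp x x) by rewrite prodr_const card_ord.
apply: ler_prod => i _.
by rewrite addr_ge0 ?sqr_ge0//= lerD2l coord_sqr_le.
Qed.

(** Two weights suffice, of order 0 and [2 * d], because [(1 + |x|^2)^d] is at most
    [2^d (1 + |x|^(2 d))]. *)
Lemma decay_jap (a M0 M1 : R) x : 0 <= a -> enorm x ^+ 0 * a <= M0 -> enorm x ^+ (2 * d) * a <= M1 ->
  a <= 2 ^+ d * (M0 + M1) * jap x.
Proof.
move=> a0 h0 h1; have p0 : 0 <= dotp x x by exact: dotp_ge0.
have q0 : 0 < 1 + dotp x x by rewrite ltr_pwDl.
apply: (@le_trans _ _ (2 ^+ d * (M0 + M1) * (1 + dotp x x) ^- d)); last first.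
  apply: ler_wpM2l (jap_ge x); rewrite mulr_ge0 ?exprn_ge0//.
  have : 0 <= M0 by apply: le_trans h0; rewrite expr0 mul1r.
  by move=> m0; apply: addr_ge0 => //; apply: le_trans h1; rewrite mulr_ge0// exprn_ge0// sqrtr_ge0.
rewrite ler_pdivlMr ?exprn_gt0//.
apply: (@le_trans _ _ (a * (2 ^+ d * (1 + dotp x x ^+ d)))).
  apply: ler_wpM2l => //.
  have [r1|/ltW r1] := lerP (dotp x x) 1.
    apply: (@le_trans _ _ (2 ^+ d)).
      by rewrite lerXn2r ?nnegrE ?(ltW q0)//; have := r1; lra.
    by rewrite ler_peMr ?exprn_ge0// lerDl exprn_ge0.
  apply: (@le_trans _ _ ((2 * dotp x x) ^+ d)).
    by rewrite lerXn2r ?nnegrE ?(ltW q0) ?mulr_ge0//; move: r1; lra.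
  by rewrite exprMn ler_wpM2l ?exprn_ge0// lerDr.
rewrite mulrCA; apply: ler_wpM2l; first by rewrite exprn_ge0.
rewrite mulrDr mulr1; apply: lerD; first by move: h0; rewrite expr0 mul1r.
by move: h1; rewrite exprM sqr_sqrtr// mulrC.
Qed.

End decay.

(** * One-sided time derivatives *)

Section within.
Context (R : realType).

Lemma within_comp (T U V : topologicalType) (A : set U) (B : set T) (F : U -> V) (h : T -> U) :
  {within A, continuous F} -> (forall t, B t -> {for t, continuous h}) -> (forall t, B t -> A (h t)) ->
  {within B, continuous (fun t => F (h t))}.
Proof.
move=> /subspace_continuousP cF ch hA; apply/subspace_continuousP => t Bt P hP.
have := cF (h t) (hA t Bt) P hP => h1.
have := ch t Bt _ h1; rewrite /nbhs/= => h2.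
by apply: filterS h2 => s h2 Bs; exact: h2 (hA s Bs).
Qed.

Lemma mvt_le (g g' : R -> R) (a b K : R) : a <= b -> {within `[a, b], continuous g} ->
  (forall t, a < t < b -> is_derive t 1 g (g' t)) -> (forall t, a < t < b -> `|g' t| <= K) ->
  `|g b - g a| <= K * (b - a).
Proof.
move=> ab cg dg gK; have [e|ne] := eqVneq a b.
  by rewrite e !subrr normr0 mulr0.
have {}ab : a < b by rewrite lt_neqAle ne.
have dg' x : x \in `]a, b[ -> is_derive x 1 g (g' x) by rewrite in_itv/=; exact: dg.
have [c hc ->] := MVT ab dg' cg.
rewrite normrM [`|b - a|]ger0_norm ?subr_ge0 ?(ltW ab)//; apply: ler_wpM2r; first by rewrite subr_ge0 ltW.
by apply: gK; move: hc; rewrite in_itv.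
Qed.

(** At a positive time the constraint [0 <= t + h] holds for all small [h], so the derivative is the
    ordinary one. *)
Lemma time_increments_pos (t : R) : 0 < t -> time_increments t = 0^'.
Proof.
move=> t0; rewrite /time_increments; apply/seteqP; split=> P.
  rewrite /within/= => h; have h1 := @dnbhs0_lt R R t t0.
  have := @filterS2 _ _ _ _ _ P _ h h1; apply => u hu.
  by rewrite ltr_norml => /andP[hu1 _]; apply: hu; lra.
by move=> h; rewrite /within/=; apply: filterS h => u hu _.
Qed.

Lemma time_is_derive (g : R -> R) (t : R) : 0 < t -> time_derivable g t ->
  is_derive t 1 g (time_derive g t).
Proof.
move=> t0 h1.
have E : (fun h : R => h^-1 *: ((g \o shift t) (h *: (1 : R)) - g t)) = time_quotient g t.
  by apply/funext => u; rewrite /time_quotient/= -[u *: 1]/(u * 1) mulr1 [t + u]addrC.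
apply: DeriveDef.
  by rewrite /derivable E -(time_increments_pos t0).
by rewrite /derive E -(time_increments_pos t0).
Qed.

End within.

(** * Evolution in time *)

Section smooth_decaying.
Context (R : realType) (d : nat).
Local Notation mu := (lebesgue_rV R d).
Implicit Types (x y z : 'rV[R]_d) (i j : 'I_d) (w s : seq (option 'I_d)).
Variable f : R -> 'rV[R]_d -> R.
Hypothesis hf : smooth_decaying f.
Local Notation pd s := (iter_partial s f).

Lemma pd_dom s (T : R) : exists2 C : R, 0 <= C & forall t x, 0 <= t <= T -> `|pd s t x| <= C * jap x.
Proof.
have [_ fd] := hf; have [M0 h0] := fd s 0%N T; have [M1 h1] := fd s (2 * d)%N T.
exists (`|2 ^+ d * (M0 + M1)|) => // t x tT.
apply: le_trans (decay_jap (normr_ge0 _) (h0 t x tT) (h1 t x tT)) _.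
by apply: ler_wpM2r; [exact: ltW (jap_gt0 x)|exact: ler_norm].
Qed.

Lemma pd_continuous s (t : R) : 0 <= t -> continuous (pd s t).
Proof.
move=> t0; have [sm _] := hf; have [cF _] := sm s.
move/subspace_continuousP : cF => cF x P hP; have h1 := cF (t, x) t0 P hP.
have h0 : {for x, continuous (fun x : 'rV[R]_d => (t, x))}.
  exact: (cvg_pair (cvg_cst t) (@cvg_id _ (nbhs x))).
have h2 := h0 _ h1.
by apply: (@filterS _ (nbhs x) _ _ _ _ h2) => y hy; exact: hy t0.
Qed.

Lemma bint_pd s (t : R) : 0 <= t -> bint (pd s t).
Proof.
move=> t0; have [C C0 hC] := pd_dom s t.
have mf : measurable_fun [set: 'rV[R]_d] (pd s t) by apply: continuous_rV_measurable; exact: pd_continuous.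
have dom x : `|pd s t x| <= C * jap x by apply: hC; rewrite t0 lexx.
have Xj := bintZ C (bint_jap R d); split=> //.
  have [M _ hM] := bint_bound Xj; exists M => x; apply: (le_trans (dom x)).
  exact: le_trans (ler_norm _) (hM x).
exact: (intg_le mf dom (bint_intg Xj)).
Qed.

(** The head of a list is the outermost derivative, hence the space derivatives come in front of
    [w]; [w = [:: None]] gives the family of the time derivative. *)
Lemma sch_pd w (t : R) : 0 <= t -> sch (fun s : seq 'I_d => pd (map Some s ++ w) t).
Proof.
move=> t0; split=> [s|s i x]; first exact: bint_pd.
have [sm _] := hf; have [_ h] := sm (map Some s ++ w).
by have [_ /(_ i) hi] := h t x t0; exact: derivableP.
Qed.

Lemma pd_within s x (a b : R) : 0 <= a -> {within `[a, b], continuous (fun t => pd s t x)}.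
Proof.
move=> a0; have [sm _] := hf; have [cF _] := sm s.
apply: (@within_comp _ _ _ _ `[a, b]%classic _ (fun t : R => (t, x)) cF) => /= t.
  by move=> _; exact: (cvg_pair (@cvg_id _ (nbhs t)) (cvg_cst x)).
by rewrite in_itv/= => /andP[h _]; exact: le_trans h.
Qed.

Lemma pd_time s x (t : R) : 0 < t -> is_derive t 1 (fun u : R => pd s u x) (pd (None :: s) t x).
Proof.
move=> t0; have [sm _] := hf; have [_ h] := sm s; have [h1 _] := h t x (ltW t0).
exact: time_is_derive.
Qed.

Lemma pd_diff_le s x (a b K : R) : 0 <= a -> a <= b ->
  (forall t, a <= t <= b -> `|pd (None :: s) t x| <= K) -> `|pd s b x - pd s a x| <= K * (b - a).
Proof.
move=> a0 ab hK; apply: (mvt_le (g := fun t => pd s t x) (g' := fun t => pd (None :: s) t x)) => //.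
- exact: pd_within.
- by move=> t /andP[at_ _]; apply: pd_time; exact: le_lt_trans at_.
- by move=> t /andP[at_ tb]; apply: hK; rewrite !ltW.
Qed.

Lemma pd_lip s (T : R) : exists2 C : R, 0 <= C & forall t t' x, 0 <= t <= T -> 0 <= t' <= T ->
  `|pd s t' x - pd s t x| <= C * jap x * `|t' - t|.
Proof.
have [C C0 hC] := pd_dom (None :: s) T; exists C => //.
have main (t t' : R) x : 0 <= t -> t <= t' -> t' <= T -> `|pd s t' x - pd s t x| <= C * jap x * (t' - t).
  move=> t0 tt tT; apply: pd_diff_le => // u /andP[u1 u2]; apply: hC.
  by rewrite (le_trans t0 u1) (le_trans u2 tT).
move=> t t' x /andP[t0 tT] /andP[t0' tT']; have [tt|/ltW tt] := lerP t t'.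
  exact: main.
by rewrite distrC; exact: main.
Qed.

(** The function minus its linear part at [t] has the derivative
    [pd (None :: s) u x - pd (None :: s) t x], which is of the order of the increment by [pd_lip];
    the mean value inequality supplies the second power. *)
Lemma pd_taylor s (T : R) : exists2 C : R, 0 <= C & forall t t' x, 0 <= t <= T -> 0 <= t' <= T ->
  `|pd s t' x - pd s t x - (t' - t) * pd (None :: s) t x| <= C * jap x * (t' - t) ^+ 2.
Proof.
have [C C0 hC] := pd_lip (None :: s) T; exists C => //.
move=> t t' x tT tT'; pose g (u : R) := pd s u x - u * pd (None :: s) t x.
have j0 := ltW (jap_gt0 x).
pose K := C * jap x * `|t' - t|.
have main a b : 0 <= a -> a <= b -> b <= T -> (forall u, a <= u <= b -> `|u - t| <= `|t' - t|) ->
    `|g b - g a| <= K * (b - a).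
  move=> a0 ab bT hu.
  apply: (mvt_le (g := g) (g' := fun u => pd (None :: s) u x - pd (None :: s) t x)) => //.
  - have c1 := @pd_within s x a b a0.
    apply/subspace_continuousP => u hu'; apply: cvgB.
      by move/subspace_continuousP : c1; exact.
    apply: cvgM; last exact: cvg_cst.
    by apply: cvg_within_filter; exact: cvg_id.
  - move=> u /andP[au _]; apply: (is_deriveE (derB (@pd_time s x u (le_lt_trans a0 au))
      (derM (der_id u) (derC _ _ (pd (None :: s) t x))))) => //.
    by rewrite mulr0 addr0 mul1r.
  - move=> u /andP[au ub]; apply: le_trans (hC t u x tT _) _.
      by rewrite (le_trans a0 (ltW au)) (le_trans (ltW ub) bT).
    by apply: ler_wpM2l; [exact: mulr_ge0|apply: hu; rewrite !ltW].
have /andP[t0 tT_] := tT; have /andP[t0' tT'_] := tT'.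
have -> : pd s t' x - pd s t x - (t' - t) * pd (None :: s) t x = g t' - g t by rewrite /g; ring.
have -> : C * jap x * (t' - t) ^+ 2 = K * `|t' - t| by rewrite /K -(real_normK (num_real (t' - t))); ring.
have [tt|/ltW tt] := lerP t t'.
  apply: main => //.
  by move=> u /andP[u1 u2]; rewrite !ger0_norm ?subr_ge0// lerB.
rewrite distrC; apply: main => //.
by move=> u /andP[u1 u2]; rewrite distrC [leRHS]distrC !ger0_norm ?subr_ge0// lerB.
Qed.

End smooth_decaying.

(** * Expansion of the energy in time *)

Section energy_taylor.
Context (R : realType) (d : nat).
Hypothesis hd : (1 <= d)%N.
Local Notation mu := (lebesgue_rV R d).
Implicit Types (x y z : 'rV[R]_d) (i j : 'I_d) (w s : seq (option 'I_d)).
Variable f : R -> 'rV[R]_d -> R.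
Hypothesis hf : smooth_decaying f.
Local Notation pd s := (iter_partial s f).

(** It gives an L^2 bound on the gradient from a small function whose second derivatives are merely
    bounded. Applied to a Taylor remainder it is used because an expansion of the gradient itself
    would contain d/dt d/dx_i, whereas the remainder contains d/dx_i d/dt. *)
Lemma sch_ibp (D : seq 'I_d -> 'rV[R]_d -> R) : sch D -> forall i,
  \int[mu]_x D [:: i] x ^+ 2 = - \int[mu]_x (D [::] x * D [:: i; i] x).
Proof.
move=> SD i; have [XD dD] := SD.
rewrite (Rint_ibp (dD [::] i) (dD [:: i] i) (@sch_lc _ _ _ _ _ SD) (@sch_lc _ _ _ _ _ SD) (XD _) (XD _) (XD _) (XD _)) opprK.
by apply: eq_Rint => x; rewrite expr2.
Qed.

Let arith1 (c K1 c0 c1 c2 n1 n2 S h : R) : 0 < h -> h <= 1 -> 0 <= c -> 0 <= n1 -> 0 <= c0 -> 0 <= c1 ->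
  n1 <= c0 * h ^+ 2 -> n2 <= c1 * h ^+ 4 -> S <= c2 * h ^+ 2 -> K1 = c * (c0 ^+ 2 + c1 + c2) ->
  c * (n1 ^+ 2 + h^-1 * n2 + h^-1^-1 * S) <= K1 * h ^+ 3.
Proof.
move=> h0 h1 c0_ n10 c00 c10 e1 e2 e3 ->; rewrite -mulrA; apply: ler_wpM2l => //; rewrite invrK !mulrDl.
have hp n : 0 <= h ^+ n by rewrite exprn_ge0// ltW.
apply: lerD; first apply: lerD.
- apply: (@le_trans _ _ ((c0 * h ^+ 2) ^+ 2)); first by rewrite lerXn2r ?nnegrE// mulr_ge0.
  rewrite exprMn -exprM; apply: ler_wpM2l; first exact: sqr_ge0.
  by apply: ler_wiXn2l => //; exact: ltW.
- apply: (@le_trans _ _ (h^-1 * (c1 * h ^+ 4))); first by apply: ler_wpM2l => //; rewrite invr_ge0 ltW.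
  by rewrite mulrCA (exprS h 3) mulKf// lt0r_neq0.
- apply: (@le_trans _ _ (h * (c2 * h ^+ 2))); first by apply: ler_wpM2l => //; exact: ltW.
  by rewrite mulrCA -exprS.
Qed.

Let arith2 (h Wg Wr_ K1 a b sr : R) : 0 <= h -> h <= 1 -> 0 <= Wg -> 0 <= K1 -> 0 <= a -> 0 <= b -> 0 <= sr ->
  Wr_ <= K1 * h ^+ 3 -> sr <= Num.sqrt K1 * (h * Num.sqrt h) ->
  h ^+ 2 * Wg + Wr_ + 2 * (a + h * b) * sr <= (Wg + K1 + 2 * (a + b) * Num.sqrt K1) * (h * Num.sqrt h).
Proof.
move=> h0 h1 g0 k0 a0 b0 s0 e1 e2; have q0 := sqrtr_ge0 h; have k1 := sqrtr_ge0 K1.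
have hq : h <= Num.sqrt h.
  by rewrite -{1}(sqr_sqrtr h0) expr2 ler_piMl// -sqrtr1 ler_wsqrtr.
have e3 : h ^+ 2 <= h * Num.sqrt h by rewrite expr2; apply: ler_wpM2l.
have hq0 : 0 <= h * Num.sqrt h by exact: mulr_ge0.
rewrite [leRHS]mulrDl [X in _ <= X + _]mulrDl; apply: lerD; first apply: lerD.
- by rewrite mulrC; apply: ler_wpM2l.
- apply: (le_trans e1); apply: ler_wpM2l => //; apply: le_trans e3.
  by apply: ler_wiXn2l.
- rewrite -!mulrA; apply: ler_wpM2l => //.
  by apply: ler_pM => //; [rewrite addr_ge0// mulr_ge0|rewrite lerD2l ler_piMl].
Qed.

Let sqrt_cube (h : R) : Num.sqrt (`|h| ^+ 3) = `|h| * Num.sqrt `|h|.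
Proof. by rewrite (exprSr `|h| 2) sqrtrM ?sqr_ge0// sqrtr_sqr normr_id. Qed.

(** The remainder [Rm] of the expansion of [f] in time is of order h^2, and its pure second space
    derivatives are bounded, so the squared L^2 norm of its gradient is of order h^2 by [sch_ibp].
    Its energy is then of order |h|^3, and the Cauchy-Schwarz bound for the mixed terms in
    [Wr_expand] gives the power 3/2. *)
Lemma Wr_taylor (t : R) : 0 <= t -> exists2 K : R, 0 <= K & forall h : R, 0 <= t + h -> `|h| <= 1 ->
  `|Wr (f (t + h)) - Wr (f t) - 2 * h * Qr (f t) (pd [:: None] t)| <= K * (`|h| * Num.sqrt `|h|).
Proof.
move=> t0; pose T := t + 1.
have [C C0 hC] := pd_taylor hf [::] T.
have bd i : exists2 B : R, 0 <= B & forall u v x, 0 <= u <= T -> 0 <= v <= T ->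
    `|pd [:: Some i; Some i] u x| + `|pd [:: Some i; Some i] v x| + `|pd [:: Some i; Some i; None] v x| <= B * jap x.
  have [B1 b1 h1] := pd_dom hf [:: Some i; Some i] T.
  have [B2 b2 h2] := pd_dom hf [:: Some i; Some i; None] T.
  exists (B1 + B1 + B2); first by rewrite !addr_ge0.
  move=> u v x hu hv; rewrite !mulrDl.
  by apply: lerD; [apply: lerD; exact: h1|exact: h2].
pose B i := s2val (cid2 (bd i)).
have B0 i : 0 <= B i by rewrite /B; case: (cid2 _).
have hB i : forall u v x, 0 <= u <= T -> 0 <= v <= T ->
    `|pd [:: Some i; Some i] u x| + `|pd [:: Some i; Some i] v x| + `|pd [:: Some i; Some i; None] v x| <= B i * jap x.
  by rewrite /B; case: (cid2 _).
have Xj := bint_jap R d; have j0 x : 0 <= jap x by exact: ltW (jap_gt0 x).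
pose J1 := \int[mu]_x jap x; pose J2 := \int[mu]_x jap x ^+ 2.
have J10 : 0 <= J1 by exact: Rint_ge0.
have J20 : 0 <= J2 by apply: Rint_ge0 => x; exact: sqr_ge0.
pose c2 := \sum_(i < d) C * B i * J2.
have c20 : 0 <= c2 by apply: sumr_ge0 => i _; rewrite !mulr_ge0.
pose K1 := lenergyC R d * ((C * J1) ^+ 2 + C ^+ 2 * J2 + c2).
have L0 : 0 <= lenergyC R d.
  by rewrite addr_ge0// mulr_ge0//; apply: Rint_ge0 => xi; exact: low_ge0.
have K10 : 0 <= K1 by rewrite mulr_ge0// !addr_ge0 ?sqr_ge0// mulr_ge0 ?sqr_ge0.
pose D u (s : seq 'I_d) := pd (map Some s ++ [::]) u; pose E (s : seq 'I_d) := pd (map Some s ++ [:: None]) t.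
have SD u : 0 <= u -> sch (D u) by exact: sch_pd.
have SE : sch E by exact: sch_pd.
pose a := Num.sqrt (Wr (f t)); pose b := Num.sqrt (Wr (pd [:: None] t)).
exists (Wr (pd [:: None] t) + K1 + 2 * (a + b) * Num.sqrt K1).
  by rewrite !addr_ge0 ?Wr_ge0// !mulr_ge0 ?addr_ge0 ?sqrtr_ge0.
move=> h th h1; have [->|hn0] := eqVneq h 0.
  by rewrite addr0 subrr mulr0 mul0r subr0 normr0 mul0r mulr0.
have hp : 0 < `|h| by rewrite normr_gt0.
have tT : 0 <= t <= T by rewrite t0 /T lerDl ler01.
have thT : 0 <= t + h <= T by rewrite th /T lerD2l (le_trans (ler_norm _) h1).
pose Rm (s : seq 'I_d) x := D (t + h) s x + (-1) * (D t s x + h * E s x).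
have SR : sch Rm by apply: schD; [exact: SD|apply: schZ; apply: schD; [exact: SD|exact: schZ]].
have [XR dR] := SR.
have Rm0 x : `|Rm [::] x| <= C * jap x * h ^+ 2.
  have := hC t (t + h) x tT thT; have -> : t + h - t = h by ring.
  by congr (`|_| <= _); rewrite /Rm /D /E/=; ring.
have Rmi i x : `|Rm [:: i; i] x| <= B i * jap x.
  apply: le_trans (hB i (t + h) t x thT tT); rewrite /Rm /D /E/= mulN1r opprD addrA.
  apply: (le_trans (ler_normB _ _)); apply: lerD; first exact: ler_normB.
  by rewrite normrM ler_piMl.
have e1 : \int[mu]_x `|Rm [::] x| <= C * J1 * `|h| ^+ 2.
  apply: (@le_trans _ _ (\int[mu]_x (C * h ^+ 2 * jap x))).
    apply: Rint_le; [exact/intg_norm/bint_intg|exact/intgZ/bint_intg|].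
    by move=> x; rewrite mulrAC; exact: Rm0.
  rewrite RintZ; last exact: bint_intg.
  by rewrite real_normK ?num_real// -/J1; apply: eq_ler; ring.
have e2 : \int[mu]_x Rm [::] x ^+ 2 <= C ^+ 2 * J2 * `|h| ^+ 4.
  apply: (@le_trans _ _ (\int[mu]_x (C ^+ 2 * h ^+ 4 * jap x ^+ 2))).
    apply: Rint_le; [exact: bint_sqr|by apply: intgZ; exact: bint_sqr|].
    move=> x; rewrite -(real_normK (num_real (Rm [::] x))).
    apply: (@le_trans _ _ ((C * jap x * h ^+ 2) ^+ 2)).
      have hh : 0 <= C * jap x * h ^+ 2 by apply: mulr_ge0; [exact: mulr_ge0|exact: sqr_ge0].
      by rewrite lerXn2r ?nnegrE ?Rm0.
    by apply: eq_ler; ring.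
  rewrite RintZ; last exact: bint_sqr.
  rewrite (exprM `|h| 2 2) real_normK ?num_real// -exprM -/J2; apply: eq_ler; ring.
have e3 : \sum_(i < d) \int[mu]_x Rm [:: i] x ^+ 2 <= c2 * `|h| ^+ 2.
  rewrite /c2 mulr_suml; apply: ler_sum => i _.
  have -> : \int[mu]_x Rm [:: i] x ^+ 2 = - \int[mu]_x (Rm [::] x * Rm [:: i; i] x).
    exact: sch_ibp SR i.
  apply: (le_trans (ler_norm _)); rewrite normrN.
  apply: (@le_trans _ _ (\int[mu]_x (C * B i * h ^+ 2 * jap x ^+ 2))).
    apply: Rint_norm_le; [exact: bint_mul_intg|by apply: intgZ; exact: bint_sqr|].
    move=> x; rewrite normrM.
    apply: (le_trans (ler_pM (normr_ge0 _) (normr_ge0 _) (Rm0 x) (Rmi i x))).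
    by apply: eq_ler; ring.
  rewrite RintZ; last exact: bint_sqr.
  by rewrite real_normK ?num_real// -/J2; apply: eq_ler; ring.
(* The value 1/|h| of the parameter of [lenergy_bound] balances the L^2 term, of order h^4 / |h|,
   against the gradient term, of order h^2 |h|. *)
have i0 : 0 < `|h|^-1 by rewrite invr_gt0.
have [_ wR] := lenergy_bound hd SR i0.
have wR' : Wr (Rm [::]) <= K1 * `|h| ^+ 3.
  apply: (le_trans wR); apply: (arith1 hp h1 L0 _ _ _ e1 e2 e3) => //.
  - exact: Rint_ge0.
  - exact: mulr_ge0.
  - by rewrite mulr_ge0 ?sqr_ge0.
have sR : Num.sqrt (Wr (Rm [::])) <= Num.sqrt K1 * (`|h| * Num.sqrt `|h|).
  apply: (le_trans (ler_wsqrtr wR')); rewrite sqrtrM//.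
  by rewrite sqrt_cube.
have fD u : 0 <= u -> lfin (f u) by move=> u0; exact: (sch_lfin hd (SD u u0)).
have fE : lfin (pd [:: None] t) by exact: (sch_lfin hd SE).
have fR : lfin (Rm [::]) by exact: sch_lfin.
have -> : Wr (f (t + h)) = Wr (fun x => f t x + (h * pd [:: None] t x + Rm [::] x)).
  by congr Wr; apply/funext => x; rewrite /Rm /D /E/=; ring.
apply: (le_trans (Wr_expand h (fD t t0) fE fR)).
rewrite -(real_normK (num_real h)).
by apply: arith2 => //; rewrite ?Wr_ge0 ?sqrtr_ge0.
Qed.

End energy_taylor.

(** * Renormalising functions *)

Section renormalization.
Context (R : realType).

Lemma is_derive_quad (F : R -> R) (x l K e : R) : 0 < e ->
  (forall h, `|h| <= e -> `|F (x + h) - F x - h * l| <= K * h ^+ 2) -> is_derive x 1 F l.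
Proof.
move=> e0 hF.
have K0 : 0 <= K.
  have := hF e; rewrite ger0_norm ?(ltW e0)// => /(_ (lexx _)) h.
  by have := le_trans (normr_ge0 _) h; rewrite pmulr_lge0// exprn_gt0.
have cv : (fun h : R => h^-1 *: ((F \o shift x) (h *: (1 : R)) - F x)) h @[h --> 0^'] --> l.
  apply/cvgrPdist_le => eps eps0.
  have d0 : 0 < Num.min e (eps / (K + 1)).
    by rewrite lt_min e0 divr_gt0// ltr_wpDl.
  have h1 := @dnbhs0_lt R R _ d0; have h2 := @nbhs_dnbhs_neq R 0.
  apply: (@filterS2 _ _ _ _ _ _ _ h1 h2) => h; rewrite lt_min => /andP[he hk] hn0.
  rewrite /= -[h *: 1]/(h * 1) mulr1 [h + x]addrC.
  have hp : 0 < `|h| by rewrite normr_gt0.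
  have -> : l - h^-1 *: (F (x + h) - F x) = - (h^-1 * (F (x + h) - F x - h * l)).
    by rewrite -[h^-1 *: _]/(h^-1 * _); field.
  rewrite normrN normrM normfV ler_pdivrMl//.
  apply: (le_trans (hF h (ltW he))); rewrite -(real_normK (num_real h)) expr2 mulrCA.
  apply: ler_wpM2l => //; apply: (@le_trans _ _ ((K + 1) * `|h|)).
    by apply: ler_wpM2r => //; rewrite lerDl.
  by rewrite mulrC -ler_pdivlMr ?ltr_wpDl// ltW.
apply: DeriveDef; first by apply/cvg_ex; exists l.
exact: (@cvg_lim _ (@norm_hausdorff _ _) _ _ _ _ _ cv).
Qed.

(** The linear bound on [b'] over bounded sets, with [b 0 = 0], keeps [b] and [b'] of a bounded
    integrable function bounded and integrable. *)
Definition renorm (b b' : R -> R) := [/\ forall x : R, is_derive x 1 b (b' x), continuous b', b 0 = 0 &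
  forall M : R, 0 <= M -> exists2 K : R, 0 <= K & forall x, `|x| <= M -> `|b' x| <= K * `|x|].

Lemma renorm_lip (b b' : R -> R) (M : R) : renorm b b' -> 0 <= M -> exists2 K : R, 0 <= K & forall x y,
  `|x| <= M -> `|y| <= M -> `|b x - b y| <= K * `|x - y|.
Proof.
move=> [db _ _ hK] M0; have [K K0 h] := hK M M0; exists (K * M); first exact: mulr_ge0.
have main (x y : R) : `|x| <= M -> `|y| <= M -> y <= x -> `|b x - b y| <= K * M * (x - y).
  move=> xM yM yx; apply: (mvt_le (g' := b')) => //.
    by apply: continuous_subspaceT => t; exact: der_continuous (db t).
  move=> t /andP[yt tx]; have tM : `|t| <= M.
    move: xM yM; rewrite !ler_norml => /andP[_ x1] /andP[y1 _].
    by rewrite (le_trans y1 (ltW yt)) (le_trans (ltW tx) x1).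
  by apply: (le_trans (h t tM)); apply: ler_wpM2l.
move=> x y xM yM; have [xy|/ltW xy] := lerP y x; first exact: main.
by rewrite distrC; exact: main.
Qed.

(** This is |x|^p written as a power of [x ^+ 2], so that no absolute value has to be
    differentiated; at the origin the derivative comes from the quadratic bound, as [2 <= p]. *)
Definition powb (p x : R) : R := (x ^+ 2) `^ (p / 2).
Definition powb' (p x : R) : R := p * x * (x ^+ 2) `^ (p / 2 - 1).

Lemma powbE (p x : R) : 0 <= p -> `|x| `^ p = powb p x.
Proof.
move=> p0; rewrite /powb -(real_normK (num_real x)) -powR_mulrn// -powRrM.
by congr (_ `^ _); field.
Qed.

Lemma powb'_le (p M x : R) : 2 <= p -> `|x| <= M -> `|powb' p x| <= p * (M ^+ 2) `^ (p / 2 - 1) * `|x|.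
Proof.
move=> p2 xM; have p0 : 0 <= p by lra.
have M0 : 0 <= M by exact: le_trans xM.
rewrite /powb' !normrM (ger0_norm p0) [`|_ `^ _|]ger0_norm ?powR_ge0// mulrAC.
apply: ler_wpM2r => //; apply: ler_wpM2l => //; apply: ge0_ler_powR.
- by lra.
- by rewrite nnegrE sqr_ge0.
- by rewrite nnegrE sqr_ge0.
- by rewrite -(real_normK (num_real x)) lerXn2r ?nnegrE.
Qed.

Lemma renorm_powb (p : R) : 2 <= p -> renorm (powb p) (powb' p).
Proof.
move=> p2; have p0 : 0 <= p by lra.
have z0 : powb p 0 = 0 by rewrite /powb expr0n/= powR0// mulf_neq0 ?invr_neq0 ?pnatr_eq0// gt_eqF//; lra.
have der0 (x : R) : x != 0 -> is_derive x 1 (powb p) (powb' p x).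
  move=> x0; have x2 : 0 < x ^+ 2 by rewrite lt_neqAle eq_sym sqrf_eq0 x0 sqr_ge0.
  have h := @der_comp R (fun y => y `^ (p / 2)) (fun y => y ^+ 2) x _ _ (is_derive1_powR (p / 2) x2) (der_sqr (der_id x)).
  apply: (is_deriveE h) => //; rewrite /powb'; move: (_ `^ _) => u.
  by field.
split=> //.
- move=> x; have [->|x0] := eqVneq x 0; last exact: der0.
  have -> : powb' p 0 = 0 by rewrite /powb' mulr0 mul0r.
  apply: (@is_derive_quad _ _ _ 1 1) => // h h1; rewrite add0r z0 subr0 mulr0 subr0 mul1r.
  rewrite ger0_norm ?powR_ge0// /powb.
  have [->|h0] := eqVneq h 0; first by rewrite expr0n/= powR0// mulf_neq0 ?invr_neq0 ?pnatr_eq0// gt_eqF//; lra.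
  have h2 : 0 < h ^+ 2 by rewrite lt_neqAle eq_sym sqrf_eq0 h0 sqr_ge0.
  have hh : 0 < h ^+ 2 <= 1 by rewrite h2 -(real_normK (num_real h)) expr_le1.
  have hp : 1 <= p / 2 by lra.
  by have := ger_powR hh hp; rewrite powRr1// ltW.
- move=> x; have [->|x0] := eqVneq x 0.
    have zz : powb' p 0 = 0 by rewrite /powb' mulr0 mul0r.
    rewrite /continuous_at zz; apply/cvgrPdist_le => eps eps0; pose C := p * (1 ^+ 2) `^ (p / 2 - 1).
    have C0 : 0 <= C by rewrite mulr_ge0// powR_ge0.
    have d0 : 0 < Num.min 1 (eps / (C + 1)) by rewrite lt_min ltr01 divr_gt0// ltr_wpDl.
    have := @nbhs0_lt R R _ d0; apply: filterS => h; rewrite lt_min => /andP[h1 h2].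
    rewrite sub0r normrN; apply: (le_trans (powb'_le p2 (ltW h1))).
    apply: (@le_trans _ _ ((C + 1) * `|h|)); first by apply: ler_wpM2r => //; rewrite lerDl.
    by rewrite mulrC -ler_pdivlMr ?ltr_wpDl// ltW.
  have x2 : 0 < x ^+ 2 by rewrite lt_neqAle eq_sym sqrf_eq0 x0 sqr_ge0.
  have h := @der_comp R (fun y => y `^ (p / 2 - 1)) (fun y => y ^+ 2) x _ _ (is_derive1_powR (p / 2 - 1) x2) (der_sqr (der_id x)).
  exact: der_continuous (derM (derZ p (der_id x)) h).
- move=> M M0; exists (p * (M ^+ 2) `^ (p / 2 - 1)); first by rewrite mulr_ge0// powR_ge0.
  by move=> x; exact: powb'_le.
Qed.

(** The square of the positive part of [x^2 - A^2]. It is continuously differentiable and vanishes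
    exactly for |x| at most [A], so the conservation of its integral shows that an almost everywhere
    bound by [A] is preserved by the flow. *)
Definition cutb (A x : R) : R := ((x ^+ 2 - A ^+ 2 + `|x ^+ 2 - A ^+ 2|) / 2) ^+ 2.
Definition cutb' (A x : R) : R := 4 * x * ((x ^+ 2 - A ^+ 2 + `|x ^+ 2 - A ^+ 2|) / 2).

Lemma renorm_cutb (A : R) : renorm (cutb A) (cutb' A).
Proof.
have pos (y : R) : is_derive y 1 (fun y => ((y + `|y|) / 2) ^+ 2) (y + `|y|).
  apply: (@is_derive_quad _ _ _ 1 1) => // h _; rewrite mul1r.
  case: (ger0P (y + h)) => h1; case: (ger0P y) => h2; rewrite ler_norml; apply/andP; split; nra.
have absE (y : R) : 0 <= (y + `|y|) / 2 <= `|y| by case: (ger0P y) => h; apply/andP; split; lra.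
split.
- move=> x; have h := @der_comp R (fun y => ((y + `|y|) / 2) ^+ 2) (fun x => x ^+ 2 - A ^+ 2) x _ _ (pos _)
    (derB (der_sqr (der_id x)) (derC _ _ (A ^+ 2))).
  by apply: (is_deriveE h) => //; rewrite /cutb'; field.
- move=> x; have c1 : {for x, continuous (fun x : R => x ^+ 2 - A ^+ 2)}.
    exact: der_continuous (derB (der_sqr (der_id x)) (derC _ _ (A ^+ 2))).
  apply: continuousM; first exact: der_continuous (derZ 4 (der_id x)).
  apply: continuousM; last exact: cst_continuous.
  by apply: continuousD => //; exact: (continuous_comp c1 (@norm_continuous _ _ _)).
- rewrite /cutb expr0n/= sub0r normrN ger0_norm ?sqr_ge0//.
  by rewrite addNr mul0r expr0n.
- move=> M M0; exists (4 * (M ^+ 2 + A ^+ 2)); first by rewrite mulr_ge0// addr_ge0 ?sqr_ge0.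
  move=> x xM; have /andP[h1 h2] := absE (x ^+ 2 - A ^+ 2).
  rewrite /cutb' 2!normrM [`|4|]ger0_norm// (ger0_norm h1) mulrAC; apply: ler_wpM2r => //.
  apply: ler_wpM2l => //; apply: (le_trans h2); apply: (le_trans (ler_normB _ _)).
  rewrite !ger0_norm ?sqr_ge0// lerD2r -(real_normK (num_real x)).
  by rewrite lerXn2r ?nnegrE.
Qed.

Lemma cutb_eq0 (A x : R) : 0 <= A -> (cutb A x == 0) = (`|x| <= A).
Proof.
move=> A0; rewrite /cutb sqrf_eq0 mulf_eq0 invr_eq0 pnatr_eq0/= orbF.
have -> : (`|x| <= A) = (x ^+ 2 - A ^+ 2 <= 0).
  by rewrite subr_le0 -(real_normK (num_real x)) ler_sqr ?nnegrE.
case: (ger0P (x ^+ 2 - A ^+ 2)) => h.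
  by rewrite -mulr2n mulrn_eq0/= eq_le h andbT.
by rewrite subrr eqxx (ltW h).
Qed.

End renormalization.

(** * Conservation of the Lebesgue norms *)

Section conservation.
Context (R : realType) (d : nat).
Local Notation mu := (lebesgue_rV R d).
Implicit Types (x y z : 'rV[R]_d) (i j : 'I_d).
Variables (u : R -> 'rV[R]_d -> 'rV[R]_d) (th : R -> 'rV[R]_d -> R) (th0 : 'rV[R]_d -> R).
Hypotheses (hu : smooth_decaying_field u) (hdiv : divergence_free u)
  (hth : smooth_decaying th) (hsol : transport_solution u th th0).
Local Notation pd s := (iter_partial s th).
Local Notation pu j s := (iter_partial s (fun t x => u t x ord0 j)).

Lemma pd_space (f : R -> 'rV[R]_d -> R) (t : R) i x : smooth_decaying f -> 0 <= t ->
  is_derive x (evec i) (f t) (iter_partial [:: Some i] f t x).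
Proof. by move=> hf t0; have [_ h] := sch_pd hf [::] t0; exact: (h [::] i x). Qed.

Lemma divu0 (t : R) x : 0 <= t -> \sum_(j < d) pu j [:: Some j] t x = 0.
Proof. by move=> t0; exact: hdiv. Qed.

Lemma transport_eq (t : R) x : 0 <= t ->
  pd [:: None] t x = - \sum_(j < d) u t x ord0 j * pd [:: Some j] t x.
Proof.
move=> t0; have [h _] := hsol; have := h t x t0; rewrite -/(pd [:: None] t x).
have -> : divergence (fun y => th t y *: u t y) x = \sum_(j < d) u t x ord0 j * pd [:: Some j] t x.
  rewrite /divergence; transitivity (\sum_(j < d) (u t x ord0 j * pd [:: Some j] t x + th t x * pu j [:: Some j] t x)).
    apply: eq_bigr => j _; have D := derM (pd_space j x hth t0) (pd_space j x (hu j) t0).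
    have D' : is_derive x (evec j) (fun y => (th t y *: u t y) ord0 j)
        (u t x ord0 j * pd [:: Some j] t x + th t x * pu j [:: Some j] t x).
      by apply: (is_deriveE D) => [y|]; [rewrite mxE|rewrite mulrC].
    exact: (@derive_val _ _ _ _ _ _ _ D').
  by rewrite big_split/= -mulr_sumr divu0// mulr0 addr0.
by move=> /eqP; rewrite addr_eq0 => /eqP.
Qed.

Section with_renorm.
Variables (b b' : R -> R).
Hypothesis hb : renorm b b'.

Lemma bint_renorm (t : R) : 0 <= t -> bint (fun x => b (th t x)).
Proof.
move=> t0; have Xt := bint_pd hth [::] t0; have [M M0 hM] := bint_bound Xt.
have [db _ b0 _] := hb; have [K K0 hK] := renorm_lip hb M0.
have mb : measurable_fun [set: R] b.
  by apply: continuous_measurable_fun => y; exact: der_continuous (db y).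
have le x : `|b (th t x)| <= K * `|th t x|.
  have := hK (th t x) 0 (hM x); rewrite b0 !subr0 normr0; exact.
have Xa := bintZ K (bint_norm Xt); split.
- exact: (measurableT_comp mb (bint_measurable Xt)).
- by exists (K * M) => x; apply: (le_trans (le x)); exact: ler_wpM2l.
- by apply: (intg_le _ le (bint_intg Xa)); exact: (measurableT_comp mb (bint_measurable Xt)).
Qed.

Lemma bint_renorm' (t : R) : 0 <= t -> bint (fun x => b' (th t x)).
Proof.
move=> t0; have Xt := bint_pd hth [::] t0; have [M M0 hM] := bint_bound Xt.
have [_ cb _ hK'] := hb; have [K K0 hK] := hK' M M0.
have mb : measurable_fun [set: R] b' by exact: continuous_measurable_fun.
have le x : `|b' (th t x)| <= K * `|th t x| by exact: hK.
have Xa := bintZ K (bint_norm Xt); split.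
- exact: (measurableT_comp mb (bint_measurable Xt)).
- by exists (K * M) => x; apply: (le_trans (le x)); exact: ler_wpM2l.
- by apply: (intg_le _ le (bint_intg Xa)); exact: (measurableT_comp mb (bint_measurable Xt)).
Qed.

(** By the transport equation the integrand is minus the transport of [b (th t)], which is a
    divergence because [u] is divergence free. *)
Lemma renorm_flux (t : R) : 0 <= t -> \int[mu]_x (b' (th t x) * pd [:: None] t x) = 0.
Proof.
move=> t0; have [db cb b0 _] := hb.
have Xb := bint_renorm t0; have Xb' := bint_renorm' t0.
have XU j s : bint (pu j s t) by exact: bint_pd.
have Xs s : bint (pd s t) by exact: bint_pd.
have dth j x : is_derive x (evec j) (th t) (pd [:: Some j] t x) by exact: pd_space.
have dbth j x : is_derive x (evec j) (fun y => b (th t y)) (b' (th t x) * pd [:: Some j] t x).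
  apply: is_derive_line0.
  have h : is_derive (0 : R) 1 (fun s => th t (x + s *: evec j)) (pd [:: Some j] t (x + 0 *: evec j)).
    exact: is_derive_line.
  apply: (is_deriveE (@der_comp R b (fun s => th t (x + s *: evec j)) 0 _ _ (db _) h)) => //.
  by rewrite scale0r addr0.
have E j : \int[mu]_x (pu j [:: Some j] t x * b (th t x)) +
    \int[mu]_x (b' (th t x) * (u t x ord0 j * pd [:: Some j] t x)) = 0.
  have i1 : intg mu (fun x => pu j [:: Some j] t x * b (th t x)) by exact: bint_mul_intg.
  have i2 : intg mu (fun x => b' (th t x) * (u t x ord0 j * pd [:: Some j] t x)).
    by apply: bint_mul_intg => //; apply: bintM => //; exact: (XU j [::]).
  rewrite -RintD//.
  apply: (@Rint_derive0 R d j (fun x => u t x ord0 j * b (th t x))).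
  - move=> x; apply: (is_deriveE (derM (pd_space j x (hu j) t0) (dbth j x))) => //.
    by ring.
  - have lu s : line_continuous j (pu j s t) by apply: continuous_line_continuous; exact: pd_continuous.
    have ls s : line_continuous j (pd s t) by apply: continuous_line_continuous; exact: pd_continuous.
    apply: line_continuousD; first apply: line_continuousM.
    + exact: lu.
    + exact: is_derive_line_continuous (dbth j).
    + apply: line_continuousM.
        by move=> x s; apply: (continuous_comp (ls [::] x s)); exact: cb.
      by apply: line_continuousM; [exact: (lu [::])|exact: ls].
  - by apply: bint_mul_intg => //; exact: (XU j [::]).
  - exact: intgD.
rewrite (eq_Rint _ (g := fun x => - \sum_(j < d) b' (th t x) * (u t x ord0 j * pd [:: Some j] t x))); last first.
  by move=> x; rewrite transport_eq// mulrN mulr_sumr.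
have i2 j : intg mu (fun x => b' (th t x) * (u t x ord0 j * pd [:: Some j] t x)).
  by apply: bint_mul_intg => //; apply: bintM => //; exact: (XU j [::]).
rewrite RintN; last by apply: intg_sum => j _; exact: i2.
rewrite Rint_sum//.
have S : \sum_(j < d) \int[mu]_x (pu j [:: Some j] t x * b (th t x)) = 0.
  rewrite -Rint_sum; last by move=> j _; exact: bint_mul_intg.
  rewrite -[RHS](Rint0 mu); apply: eq_Rint => x.
  by rewrite -mulr_suml divu0// mul0r.
have : \sum_(j < d) (\int[mu]_x (pu j [:: Some j] t x * b (th t x)) +
    \int[mu]_x (b' (th t x) * (u t x ord0 j * pd [:: Some j] t x))) = 0 by rewrite big1.
by rewrite big_split/= S add0r => ->; rewrite oppr0.
Qed.

Lemma conservation (t : R) : 0 <= t -> \int[mu]_x b (th t x) = \int[mu]_x b (th 0 x).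
Proof.
rewrite le_eqVlt => /predU1P[<-//|t0]; pose T := t + 1.
have [C C0 hC] := pd_dom hth [::] T; have [C1 C10 hC1] := pd_dom hth [:: None] T.
have [Cl Cl0 hCl] := pd_lip hth [::] T.
have Xj := bint_jap R d; have [Mj Mj0 hMj] := bint_bound Xj.
have [db cb b0 hK'] := hb; pose M := C * Mj; have M0 : 0 <= M by exact: mulr_ge0.
have thM s x : 0 <= s <= T -> `|th s x| <= M.
  move=> sT; apply: (le_trans (hC s x sT)); apply: ler_wpM2l => //.
  exact: le_trans (ler_norm _) (hMj x).
have [K K0 hK] := renorm_lip hb M0; have [K1 K10 hK1] := hK' M M0.
pose m s := \int[mu]_x b (th s x).
have dm s : 0 < s < T -> is_derive s 1 m 0.
  move=> /[dup] sT /andP[s0 _]; rewrite -(renorm_flux (ltW s0)).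
  have ih : intg mu (fun x => K1 * M * C1 * jap x) by apply: intgZ; exact: bint_intg.
  apply: (@under_is_derive _ _ R mu 0 T (fun s x => b (th s x)) (fun s x => b' (th s x) * pd [:: None] s x)
    (fun x => K1 * M * C1 * jap x)) => //.
  - by move=> r /andP[r0 _]; apply: bint_intg; apply: bint_renorm; exact: ltW.
  - move=> r x /andP[r0 _].
    exact: (@der_comp R b (fun s => th s x) r _ _ (db _) (pd_time hth [::] x r0)).
  - move=> r x /andP[r0 rT]; have hr : 0 <= r <= T by rewrite !ltW.
    rewrite normrM -[leRHS]mulrA; apply: ler_pM => //; last exact: hC1.
    by apply: (le_trans (hK1 _ (thM r x hr))); apply: ler_wpM2l => //; exact: thM.
pose J := \int[mu]_x jap x.
(* The derivative of [m] is used only at positive times; a Lipschitz estimate between 0 and [s]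
   connects them with the initial time as [s] tends to 0. *)
have lipm s : 0 < s -> s <= t -> `|m s - m 0| <= K * Cl * J * s.
  move=> s0 st; have sT : 0 <= s <= T by rewrite (ltW s0)/= (le_trans st)// lerDl.
  have zT : 0 <= (0 : R) <= T by rewrite lexx/= /T addr_ge0// ltW.
  have X1 := bint_renorm (ltW s0); have X0 := bint_renorm (lexx 0).
  rewrite /m -RintB; [|exact: bint_intg|exact: bint_intg].
  apply: (@le_trans _ _ (\int[mu]_x (K * Cl * s * jap x))).
    apply: Rint_norm_le.
    - by apply: intgB; exact: bint_intg.
    - by apply: intgZ; exact: bint_intg.
    move=> x; apply: (le_trans (hK _ _ (thM s x sT) (thM 0 x zT))).
    rewrite -!mulrA; apply: ler_wpM2l => //; apply: (le_trans (hCl 0 s x zT sT)).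
    by rewrite subr0 ger0_norm ?(ltW s0)// -mulrA [jap x * s]mulrC.
  rewrite RintZ; last exact: bint_intg.
  by rewrite -/J mulrAC.
have mconst s : 0 < s -> s <= t -> m t = m s.
  move=> s0 st; apply/eqP; rewrite -subr_eq0 -normr_le0.
  have := @norm_diff_le R m (fun=> 0) (fun=> 0) (fun=> 0) s t st; rewrite subrr; apply.
  - move=> r /andP[sr rt]; apply: dm; rewrite (lt_le_trans s0 sr)/= /T.
    by apply: (le_lt_trans rt); rewrite ltrDl.
  - by move=> r _; rewrite normr0.
apply/eqP; rewrite -subr_eq0 -normr_le0; apply/ler_addgt0Pr => e e0; rewrite add0r.
pose L := K * Cl * J + 1.
have J0 : 0 <= J by apply: Rint_ge0 => x; exact: ltW (jap_gt0 x).
have L0 : 0 < L by rewrite ltr_wpDl// !mulr_ge0.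
pose s := Num.min t (e / L).
have s0 : 0 < s by rewrite lt_min t0 divr_gt0.
have st : s <= t by rewrite ge_min lexx.
rewrite -[X in `|X - _|]/(m t) (mconst s s0 st).
apply: (le_trans (lipm s s0 st)); apply: (@le_trans _ _ (L * s)).
  by apply: ler_wpM2r; [exact: ltW|rewrite lerDl].
by rewrite mulrC -ler_pdivlMr// ge_min lexx orbT.
Qed.

End with_renorm.

Lemma Rint_sqr_conserved (t : R) : 0 <= t -> \int[mu]_x th t x ^+ 2 = \int[mu]_x th 0 x ^+ 2.
Proof.
move=> t0; have h2 : (2 : R) <= 2 by [].
have E s : \int[mu]_x th s x ^+ 2 = \int[mu]_x powb 2 (th s x).
  by apply: eq_Rint => x; rewrite /powb divff ?pnatr_eq0// powRr1// sqr_ge0.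
by rewrite !E; exact: (conservation (renorm_powb h2)).
Qed.

(** Finite exponents follow from the conservation of the integral of [powb]. For [+oo], [cutb A]
    with [A] the initial norm has integral zero at time 0, hence at time [t], which bounds the
    solution by [A] almost everywhere. *)
Lemma Lqnorm_conserved (q : \bar R) (t : R) : (2%:E <= q)%E -> 0 <= t ->
  (Lqnorm q (th t) <= Lqnorm q (th 0))%E.
Proof.
move=> q2 t0; have Xt := bint_pd hth [::] t0; have X0 := bint_pd hth [::] (lexx 0).
case: q q2 => [p|_|//].
  rewrite lee_fin => p2; have p0 : 0 <= p by lra.
  have E s : 0 <= s -> (\int[mu]_x (`|(th s x)%:E| `^ p) = (\int[mu]_x powb p (th s x))%:E)%E.
    move=> s0; rewrite (integral_powR_fin p2 (bint_pd hth [::] s0)); congr (_%:E).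
    by apply: eq_Rint => x; exact: powbE.
  have pn0 : p != 0 by rewrite gt_eqF//; lra.
  rewrite /Lqnorm unlock (E t t0) (E 0 (lexx 0)).
  by rewrite (conservation (renorm_powb p2) t0).
have [B _ hB] := bint_bound X0.
have fin : (Lqnorm +oo%E (th 0) <= B%:E)%E.
  by rewrite /Lqnorm unlock lebesgue_rV_gt0; apply: ess_sup_ler => x; rewrite lee_fin.
have N0 : (0 <= Lqnorm +oo%E (th 0))%E by exact: Lnorm_ge0.
have fn : Lqnorm +oo%E (th 0) \is a fin_num by rewrite ge0_fin_numE// (le_lt_trans fin)// ltry.
rewrite -(fineK fn); set A := fine _.
have [A0 aeA] : 0 <= A /\ \forall x \ae mu, `|th 0 x| <= A by apply: Lqnorm_inf => //; rewrite fineK.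
have cA := renorm_cutb A.
have c0 (y : R) : 0 <= cutb A y by exact: sqr_ge0.
have I0 : \int[mu]_x cutb A (th 0 x) = 0.
  rewrite /Rintegral (ae_eq_integral (cst 0%E))//.
  - by rewrite integral0.
  - by apply/measurable_EFinP; exact: bint_measurable (bint_renorm cA (lexx 0)).
  - apply: filterS aeA => x hx _ /=; congr EFin; apply/eqP.
    by rewrite cutb_eq0.
have It : \int[mu]_x cutb A (th t x) = 0 by rewrite (conservation cA t0).
have Xc := bint_renorm cA t0.
have : ae_eq mu setT (EFin \o (fun x => cutb A (th t x))) (cst 0%E).
  apply/ae_eq_integral_abs => //; first by apply/measurable_EFinP; exact: bint_measurable Xc.
  rewrite (eq_integral (fun x => (cutb A (th t x))%:E)).
    by rewrite -EFin_Rint ?It//; exact: bint_intg.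
  by move=> x _; rewrite /= ger0_norm.
move=> ae0; rewrite /Lqnorm unlock lebesgue_rV_gt0; apply/ess_supP.
apply: filterS ae0 => x /(_ I)/= [] /eqP; rewrite cutb_eq0// => h.
Qed.

End conservation.

(** * Differentiation of the square root *)

Section time_rate.
Context (R : realType).
Implicit Types g : R -> R.

(* The square-root rate is what the expansion of the energy provides. *)
Definition rate g (t l : R) := exists2 C : R, 0 <= C & forall h : R, h != 0 -> 0 <= t + h -> `|h| <= 1 ->
  `|time_quotient g t h - l| <= C * Num.sqrt `|h|.

Lemma time_increments_proper (t : R) : 0 <= t -> ProperFilter (time_increments t).
Proof.
move=> t0; apply: Build_ProperFilter; rewrite /time_increments /within/= => -[e/= e0 he].
apply: (he (e / 2)) => /=.
- by rewrite sub0r normrN ger0_norm ?divr_ge0 ?ltW// ltr_pdivrMr// ltr_pMr// ltr1n.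
- by rewrite lt0r_neq0// divr_gt0.
- by rewrite addr_ge0// divr_ge0// ltW.
Qed.

Lemma rate_cvg g (t l : R) : rate g t l -> time_quotient g t h @[h --> time_increments t] --> l.
Proof.
move=> [C C0 hC]; apply/cvgrPdist_le => e e0; rewrite /time_increments.
pose r := e / (C + 1); have r0 : 0 < r by rewrite divr_gt0// ltr_wpDl.
have d0 : 0 < Num.min 1 (r ^+ 2) by rewrite lt_min ltr01 exprn_gt0.
have h1 := @dnbhs0_lt R R _ d0; have h2 := @nbhs_dnbhs_neq R 0.
rewrite /within/=; apply: (@filterS2 _ _ _ _ _ _ _ h1 h2) => h; rewrite lt_min => /andP[h1' h2'] hn0 th.
rewrite distrC; apply: (le_trans (hC h hn0 th (ltW h1'))).
have sr : Num.sqrt `|h| <= r by rewrite -[leRHS](ger0_norm (ltW r0)) -(sqrtr_sqr r) ler_wsqrtr// ltW.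
apply: (@le_trans _ _ ((C + 1) * r)); last by rewrite /r mulrC divfK// lt0r_neq0// ltr_wpDl.
by apply: ler_pM => //; rewrite ?sqrtr_ge0// lerDl.
Qed.

Lemma rate_time_derive g (t l : R) : 0 <= t -> rate g t l -> time_derivable g t /\ time_derive g t = l.
Proof.
move=> t0 /rate_cvg cv; have P := time_increments_proper t0; split; first by apply/cvg_ex; exists l.
exact: (@cvg_lim _ (@norm_hausdorff _ _) _ _ P _ _ cv).
Qed.

Lemma rate_within g (T : R) : (forall t, 0 <= t -> exists l, rate g t l) -> {within `[0, T], continuous g}.
Proof.
move=> hg; apply/subspace_continuousP => t; rewrite /= in_itv/= => /andP[t0 tT].
have [l [C C0 hC]] := hg t t0.
apply/cvgrPdist_le => e e0; pose L := `|l| + C + 1.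
have L0 : 0 < L by rewrite ltr_wpDl// addr_ge0.
have d0 : 0 < Num.min 1 (e / L) by rewrite lt_min ltr01 divr_gt0.
have h1 : \forall s \near t, `|t - s| < Num.min 1 (e / L) by exact: nbhsx_ballx.
rewrite /within/=; apply: filterS h1 => s; rewrite lt_min => /andP[s1 s2]; rewrite in_itv/= => /andP[s0 sT].
have [->|ne] := eqVneq s t; first by rewrite subrr normr0 ltW.
have hn0 : s - t != 0 by rewrite subr_eq0.
have ts : t + (s - t) = s by ring.
have s1' : `|s - t| <= 1 by rewrite distrC ltW.
have h2 := hC (s - t) hn0; rewrite ts in h2; have {}h2 := h2 s0 s1'.
change (`|g t - g s| <= e).
have -> : g t - g s = - ((s - t) * time_quotient g t (s - t)) by rewrite /time_quotient ts; field.
rewrite normrN normrM distrC; apply: (@le_trans _ _ (`|t - s| * L)).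
  apply: ler_wpM2l => //; rewrite -[X in `|X| <= _](subrK l); apply: (le_trans (ler_normD _ _)).
  rewrite addrC /L -addrA; apply: lerD => //; apply: (@le_trans _ _ (C * 1)); last by rewrite mulr1 lerDl.
  apply: (le_trans h2); apply: ler_wpM2l => //.
  by rewrite -sqrtr1 ler_wsqrtr.
by rewrite -ler_pdivlMr// ltW.
Qed.

Lemma rate_growth g (T M : R) : 0 <= T -> (forall t, 0 <= t -> exists l, rate g t l) ->
  (forall t, 0 <= t -> `|time_derive g t| <= M) -> `|g T - g 0| <= M * T.
Proof.
move=> T0 hg hM; rewrite -[X in M * X]subr0.
apply: (mvt_le (g' := time_derive g)) => //; first exact: rate_within.
- move=> t /andP[t0 _]; apply: time_is_derive => //.
  by have [l hl] := hg t (ltW t0); case: (rate_time_derive (ltW t0) hl).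
- by move=> t /andP[t0 _]; apply: hM; exact: ltW.
Qed.

(** The increment of the root is the increment of [w] divided by the sum of the two roots, and this
    sum is at least the positive number [s]. *)
Lemma rate_sqrt (w : R -> R) (t q K : R) : (forall r, 0 <= w r) -> 0 < w t -> 0 <= K ->
  (forall h : R, 0 <= t + h -> `|h| <= 1 -> `|w (t + h) - w t - 2 * h * q| <= K * (`|h| * Num.sqrt `|h|)) ->
  rate (fun r => Num.sqrt (w r)) t (q / Num.sqrt (w t)).
Proof.
move=> w0 wt K0 hw; pose s := Num.sqrt (w t); have s0 : 0 < s by rewrite sqrtr_gt0.
(* The first term comes from replacing the sum of the two roots by [2 * s], the second from the
   error in the expansion of [w]. *)
pose C := `|q| * (2 * `|q| + K) / s ^+ 3 + K / s.
have i3 : 0 <= s ^- 3 by rewrite invr_ge0 exprn_ge0// ltW.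
have i1 : 0 <= s^-1 by rewrite invr_ge0 ltW.
exists C; first by rewrite addr_ge0 ?mulr_ge0// addr_ge0// mulr_ge0.
move=> h hn0 th h1; have hp : 0 < `|h| by rewrite normr_gt0.
have := hw h th h1; pose e := w (t + h) - w t - 2 * h * q; rewrite -/e => he.
rewrite /time_quotient -/s; set a := Num.sqrt (w (t + h)).
have a0 : 0 <= a by exact: sqrtr_ge0.
have sh1 : Num.sqrt `|h| <= 1 by rewrite -sqrtr1 ler_wsqrtr.
have sh0 := sqrtr_ge0 `|h|.
have hsh : `|h| <= Num.sqrt `|h| by rewrite -{1}(sqr_sqrtr (ltW hp)) expr2 ler_piMl.
have as0 : 0 < a + s by rewrite ltr_wpDl.
have E : (a - s) * (a + s) = 2 * h * q + e.
  have -> : (a - s) * (a + s) = a ^+ 2 - s ^+ 2 by ring.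
  by rewrite !sqr_sqrtr// /e; ring.
have as_le : s <= a + s by rewrite lerDr.
have d1 : `|a - s| <= (2 * `|q| + K) / s * `|h|.
  rewrite mulrAC ler_pdivlMr//; apply: (@le_trans _ _ (`|a - s| * (a + s))); first by apply: ler_wpM2l.
  rewrite -[X in _ * X <= _](ger0_norm (ltW as0)) -normrM E; apply: (le_trans (ler_normD _ _)).
  rewrite !normrM [`|2|]ger0_norm// (mulrDl (2 * `|q|) K); apply: lerD; first by rewrite mulrAC.
  by apply: (le_trans he); apply: ler_wpM2l => //; rewrite ler_piMr.
have -> : h^-1 * (a - s) - q / s = q * (s - a) / (s * (a + s)) + h^-1 * e / (a + s).
  have -> : a - s = (2 * h * q + e) / (a + s) by rewrite -E mulfK// lt0r_neq0.
  have -> : s - a = - ((2 * h * q + e) / (a + s)) by rewrite -E mulfK ?lt0r_neq0// opprB.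
  have : 2 * s * h * q + s * e - q * h * (a + s) = q * - ((2 * h * q + e) / (a + s)) * h + e * s.
    have -> : - ((2 * h * q + e) / (a + s)) = s - a by rewrite -E mulfK ?lt0r_neq0// opprB.
    by ring.
  have n1 : s != 0 by rewrite lt0r_neq0. have n2 : a + s != 0 by rewrite lt0r_neq0.
  move: (- ((2 * h * q + e) / (a + s))) => z hz.
  have -> : q * z / (s * (a + s)) + h^-1 * e / (a + s) = (q * z * h + e * s) / (h * s * (a + s)).
    by field; rewrite n2 n1 hn0.
  by rewrite -hz; field; rewrite n2 n1 hn0.
apply: (le_trans (ler_normD _ _)); rewrite mulrDl; apply: lerD.
  rewrite !normrM normfV normrM (gtr0_norm s0) (gtr0_norm as0) distrC.
  apply: (@le_trans _ _ (`|q| * ((2 * `|q| + K) / s * `|h|) / (s * s))).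
    apply: ler_pM => //.
    - by rewrite invr_ge0 mulr_ge0// ltW.
    - by apply: ler_wpM2l.
    - by rewrite lef_pV2 ?posrE ?mulr_gt0//; apply: ler_wpM2l => //; exact: ltW.
  have -> : `|q| * ((2 * `|q| + K) / s * `|h|) / (s * s) = `|q| * (2 * `|q| + K) / s ^+ 3 * `|h|.
    by field; rewrite lt0r_neq0.
  by apply: ler_wpM2l => //; rewrite !mulr_ge0// addr_ge0// mulr_ge0.
rewrite !normrM !normfV (gtr0_norm as0) [leRHS]mulrAC.
apply: ler_pM.
- by apply: mulr_ge0 => //; rewrite invr_ge0.
- by rewrite invr_ge0 ltW.
- by rewrite ler_pdivrMl// mulrCA.
- by rewrite lef_pV2 ?posrE.
Qed.

End time_rate.

Section lebesgue_norms.
Context (R : realType) (d : nat).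
Local Notation mu := (lebesgue_rV R d).
Implicit Types (x : 'rV[R]_d) (i j : 'I_d) (f g : 'rV[R]_d -> R).

Lemma Lqnorm_lty (q : \bar R) f : (2%:E <= q)%E -> bint f -> (Lqnorm q f < +oo)%E.
Proof.
case: q => [p p2|_|//] Xf; rewrite /Lqnorm unlock.
  by rewrite (integral_powR_fin p2 Xf) poweR_EFin ltry.
rewrite lebesgue_rV_gt0; have [M _ hM] := bint_bound Xf.
by apply: (@le_lt_trans _ _ M%:E); [apply: ess_sup_ler => x; rewrite lee_fin|exact: ltry].
Qed.

Lemma le_Lqnorm (q : \bar R) f g : (2%:E <= q)%E -> bint f -> bint g -> (forall x, `|f x| <= `|g x|) ->
  (Lqnorm q f <= Lqnorm q g)%E.
Proof.
case: q => [p p2|_|//] Xf Xg fg; rewrite /Lqnorm unlock.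
  have p2' : 2 <= p by [].
  rewrite (integral_powR_fin p2' Xf) (integral_powR_fin p2' Xg); apply: gt0_ler_poweR.
  - by rewrite invr_ge0; lra.
  - by rewrite in_itv/= leey lee_fin Rint_ge0// => x; exact: powR_ge0.
  - by rewrite in_itv/= leey lee_fin Rint_ge0// => x; exact: powR_ge0.
  rewrite lee_fin; apply: Rint_le; [exact: intg_powR|exact: intg_powR|move=> x].
  by apply: ge0_ler_powR; rewrite ?nnegrE//; lra.
by rewrite lebesgue_rV_gt0; apply: le_ess_sup; apply: aeW => x; rewrite lee_fin.
Qed.

End lebesgue_norms.

Section complex_fourier.
Context (R : realType) (d : nat).
Local Notation mu := (lebesgue_rV R d).
Local Open Scope complex_scope.
Implicit Types (xi : 'rV[R]_d) (f : 'rV[R]_d -> R).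

Lemma normc_fourier f xi : intg mu f ->
  ComplexField.Normc.normc (fourier (fun x => (f x)%:C) xi) ^+ 2 = FF f f xi.
Proof.
move=> fi; rewrite /fourier /cintegral /=.
rewrite (eq_Rint _ (g := fun x => cos (phase xi x) * f x)); last first.
  by move=> x; rewrite /= mulr0 subr0 cosN.
rewrite (eq_Rint _ (g := fun x => (-1) * (sin (phase xi x) * f x)) 
  (f := fun x => cos (- (2 * pi * dotp xi x)) * 0 + sin (- (2 * pi * dotp xi x)) * f x)); last first.
  by move=> x; rewrite mulr0 add0r sinN /phase; ring.
rewrite RintZ; last exact: FS_intg.
rewrite sqr_sqrtr ?addr_ge0 ?sqr_ge0// -/(FC f xi) -/(FS f xi) /FF.
by ring.
Qed.

Lemma Wfunc_Wr f : lfin f -> Wfunc (fun x => (f x)%:C) = (Wr f)%:E.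
Proof.
move=> [fi iW]; rewrite /Wfunc -[Wr f]/(\int[mu]_xi (lnorm xi ^+ 2 * FF f f xi)) EFin_Rint//.
by apply: eq_integral => xi _; rewrite normc_fourier// ln_enorm.
Qed.

End complex_fourier.

(** * The derivative of the root of the energy *)

Section evolution.
Context (R : realType) (d : nat).
Hypothesis hd : (1 <= d)%N.
Local Notation mu := (lebesgue_rV R d).
Implicit Types (x : 'rV[R]_d) (i j : 'I_d).
Variables (u : R -> 'rV[R]_d -> 'rV[R]_d) (th : R -> 'rV[R]_d -> R) (th0 : 'rV[R]_d -> R).
Hypotheses (hu : smooth_decaying_field u) (hdiv : divergence_free u)
  (hth : smooth_decaying th) (hsol : transport_solution u th th0).
Local Notation pd s := (iter_partial s th).
Local Notation pu j s := (iter_partial s (fun t x => u t x ord0 j)).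

Lemma bint_grad_norm (t : R) : 0 <= t -> bint (grad_norm (u t)).
Proof.
move=> t0; pose D i j x := pu j [:: Some i] t x.
have XD i j : bint (D i j) by exact: bint_pd.
have E x : grad_norm (u t) x = Num.sqrt (\sum_(i < d) \sum_(j < d) D i j x ^+ 2) by [].
have m1 : measurable_fun [set: 'rV[R]_d] (grad_norm (u t)).
  have ms : measurable_fun [set: R] (@Num.sqrt R) by apply: continuous_measurable_fun; exact: sqrt_continuous.
  apply: (measurableT_comp ms); apply: measurable_sum => i; apply: measurable_sum => j.
  by apply: measurable_funX; exact: bint_measurable (XD i j).
have XS : bint (fun x => \sum_(i < d) \sum_(j < d) `|D i j x|).
  by apply: bint_sum => i; apply: bint_sum => j; exact: bint_norm.
have le x : `|grad_norm (u t) x| <= \sum_(i < d) \sum_(j < d) `|D i j x|.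
  have S0 : 0 <= \sum_(i < d) \sum_(j < d) `|D i j x| by apply: sumr_ge0 => i _; apply: sumr_ge0.
  rewrite ger0_norm ?sqrtr_ge0// -[leRHS](ger0_norm S0) -sqrtr_sqr E; apply: ler_wsqrtr.
  have sq n (F : 'I_n -> R) : (forall k, 0 <= F k) -> \sum_(k < n) F k ^+ 2 <= (\sum_(k < n) F k) ^+ 2.
    elim: n F => [|n ih] F F0; first by rewrite !big_ord0 expr0n.
    rewrite !big_ord_recl; have h := ih (fun k => F (lift ord0 k)) (fun k => F0 _).
    have p0 : 0 <= \sum_(i < n) F (lift ord0 i) by exact: sumr_ge0.
    have := mulr_ge0 (F0 ord0) p0; rewrite sqrrD; move: h; lra.
  apply: (@le_trans _ _ (\sum_(i < d) (\sum_(j < d) `|D i j x|) ^+ 2)).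
    apply: ler_sum => i _; apply: le_trans (sq _ _ (fun j => normr_ge0 (D i j x))).
    by apply: ler_sum => j _; rewrite real_normK ?num_real.
  by apply: sq => i; exact: sumr_ge0.
split=> //; last exact: (intg_le m1 le (bint_intg XS)).
have [M _ hM] := bint_bound XS; exists M => x; apply: (le_trans (le x)).
exact: le_trans (ler_norm _) (hM x).
Qed.

Lemma grad_norm_ge (t : R) i j x : 0 <= t -> `|pu j [:: Some i] t x| <= `|grad_norm (u t) x|.
Proof.
move=> t0; rewrite [leRHS]ger0_norm ?sqrtr_ge0// -sqrtr_sqr; apply: ler_wsqrtr.
rewrite (bigD1 i)//= (bigD1 j)//= -addrA lerDl addr_ge0//.
  by apply: sumr_ge0 => k _; exact: sqr_ge0.
by apply: sumr_ge0 => k _; apply: sumr_ge0 => l _; exact: sqr_ge0.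
Qed.

Let w (t : R) : R := Wr (th t).

Let lfin_th (t : R) : 0 <= t -> lfin (th t).
Proof. by move=> t0; exact: (sch_lfin hd (sch_pd hth [::] t0)). Qed.

Lemma Wt_fin (t : R) : 0 <= t -> Wt th t = (Wr (th t))%:E.
Proof. by move=> t0; apply: Wfunc_Wr; exact: lfin_th. Qed.

Lemma Wr_zero (t s : R) : 0 <= t -> 0 <= s -> Wr (th t) = 0 -> Wr (th s) = 0.
Proof.
move=> t0 s0 /(Wr_eq0 hd (sch_pd hth [::] t0)) /= h.
apply/(Wr_eq0 hd (sch_pd hth [::] s0)) => /=; move: h.
by rewrite (Rint_sqr_conserved hu hdiv hth hsol t0) (Rint_sqr_conserved hu hdiv hth hsol s0).
Qed.

Variables q qt : \bar R.
Hypotheses (q2 : (2%:E <= q)%E) (qt2 : (2%:E <= qt)%E) (hq : (q^-1 + qt^-1 = (2^-1)%:E)%E).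

Lemma Qr_transport (t A B : R) : 0 <= t -> (Lqnorm q (grad_norm (u t)) <= A%:E)%E ->
  (Lqnorm qt th0 <= B%:E)%E ->
  `|Qr (th t) (pd [:: None] t)| <= 6 * (commC R d * (A * B)) * Num.sqrt (Wr (th t)).
Proof.
move=> t0 hA hB; pose D (s : seq 'I_d) := pd (map Some s ++ [::]) t.
pose E (s : seq 'I_d) := pd (map Some s ++ [:: None]) t.
pose U j (s : seq 'I_d) := pu j (map Some s ++ [::]) t.
have SD : sch D by exact: sch_pd. have SE : sch E by exact: sch_pd.
have SU j : sch (U j) by exact: (sch_pd (hu j) [::] t0).
have divU x : \sum_(j < d) U j [:: j] x = 0 by exact: hdiv.
have UA i j : (Lqnorm q (U j [:: i]) <= A%:E)%E.
  apply: le_trans hA; apply: le_Lqnorm => //.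
  - by have [X _] := SU j; exact: X.
  - exact: bint_grad_norm.
  - by move=> x; exact: grad_norm_ge.
have DB : (Lqnorm qt (D [::]) <= B%:E)%E.
  apply: le_trans hB; have [_ h0] := hsol.
  have -> : th0 = th 0 by apply/funext => x; rewrite h0.
  exact: (Lqnorm_conserved hu hdiv hth hsol).
have [XE _] := SE.
have [XU XD] : (forall j s, bint (U j s)) /\ (forall s, bint (D s)).
  by split=> [j|]; [have [X _] := SU j|have [X _] := SD]; exact: X.
pose V0 x := \sum_(j < d) U j [::] x * D [:: j] x.
have XV : bint V0 by apply: bint_sum => j; exact: bintM.
apply: (Qr_le_lim hd SD SE) => a b a0 ab.
(* [E [::]] is the time derivative of the solution, and its sum with the transport term [V0] is
   zero; additivity of [Lop] carries this over. *)
have LE x : Lop a b (E [::]) x = - Lop a b V0 x.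
  have := LopD b x a0 (XE [::]) XV.
  have -> : (fun y => E [::] y + V0 y) = (fun=> 0).
    apply/funext => y; have h := transport_eq hu hdiv hth hsol y t0.
    by rewrite -[E [::] y]/(pd [:: None] t y) h; exact: addNr.
  have -> : Lop a b (fun=> 0) x = 0.
    have := LopD b x a0 (bint0 R d) (bint0 R d).
    have -> : (fun y : 'rV[R]_d => 0 + 0 :> R) = (fun=> 0) by apply/funext => y; rewrite addr0.
    by lra.
  by move/eqP; rewrite eq_sym addr_eq0 => /eqP.
rewrite (eq_Rint _ (g := fun x => - (Lop a b (D [::]) x * Lop a b V0 x))); last by move=> x; rewrite LE mulrN.
rewrite RintN; last by apply: bint_mul_intg; exact: bint_Lop.
rewrite normrN; apply: le_trans (Lop_commutator a0 ab SD SU divU q2 qt2 hq UA DB) _.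
by apply: eq_ler; move: (Num.sqrt _) (commC R d) => S K'; ring.
Qed.

Lemma sqrt_Wt_rate (t A B : R) : 0 <= t -> 0 <= A -> 0 <= B -> (Lqnorm q (grad_norm (u t)) <= A%:E)%E ->
  (Lqnorm qt th0 <= B%:E)%E ->
  exists2 l : R, rate (fun r => Num.sqrt (fine (Wt th r))) t l & `|l| <= 6 * (commC R d * (A * B)).
Proof.
move=> t0 A0 B0 hA hB; have cA : 0 <= 6 * (commC R d * (A * B)).
  by rewrite !mulr_ge0// (le_trans _ (trilC_ge2 R d)).
have same (l : R) : rate (fun r => Num.sqrt (Wr (th r))) t l -> rate (fun r => Num.sqrt (fine (Wt th r))) t l.
  move=> [C C0 hC]; exists C => // h hn0 th_ h1.
  by rewrite /time_quotient !Wt_fin//; exact: hC.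
have [w0|w0] := eqVneq (Wr (th t)) 0.
  exists 0; last by rewrite normr0.
  apply: same; exists 0 => // h hn0 th_ h1.
  by rewrite /time_quotient w0 (Wr_zero t0 th_ w0) subrr mulr0 subrr normr0 mul0r.
have wp : 0 < Wr (th t) by rewrite lt_neqAle eq_sym w0 Wr_ge0.
have [K K0 hK] := Wr_taylor hd hth t0.
exists (Qr (th t) (pd [:: None] t) / Num.sqrt (Wr (th t))).
  by apply: same; apply: (rate_sqrt (fun r => Wr_ge0 _) wp K0).
have sp : 0 < Num.sqrt (Wr (th t)) by rewrite sqrtr_gt0.
rewrite normrM normfV (gtr0_norm sp) ler_pdivrMr//.
exact: Qr_transport.
Qed.

End evolution.

Theorem theorem2 (R : realType) (d : nat) (hd : (1 <= d)%N) :
  exists C : R, 0 < C /\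
  forall (q qt : \bar R),
    (2%:E <= q)%E -> (2%:E <= qt)%E -> (q^-1 + qt^-1 = (2^-1)%:E)%E ->
  forall (u : R -> 'rV[R]_d -> 'rV[R]_d) (theta : R -> 'rV[R]_d -> R)
    (theta0 : 'rV[R]_d -> R),
    smooth_decaying_field u -> divergence_free u ->
    smooth_decaying theta -> transport_solution u theta theta0 ->
  (forall t : R, 0 <= t ->
    [/\ (Wt theta t < +oo)%E,
        time_derivable (fun r => Num.sqrt (fine (Wt theta r))) t
      & (`|time_derive (fun r => Num.sqrt (fine (Wt theta r))) t|%:E
         <= C%:E * Lqnorm qt theta0 * Lqnorm q (grad_norm (u t)))%E])
  /\
  (theta0 \in Lfun (lebesgue_rV R d) 2%:E ->
   theta0 \in Lfun (lebesgue_rV R d) +oo%E ->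
   (ereal_sup [set Lqnorm q (grad_norm (u t)) | t in [set t | (0 <= t)%R]]
     < +oo)%E ->
   exists C' : R, forall t : R, 0 <= t ->
     (Wt theta t <= (C' * (1 + t) ^+ 2)%:E)%E).
Proof.
have c0 : 0 <= commC R d by rewrite mulr_ge0// mulr_ge0// (le_trans _ (trilC_ge2 R d)).
pose C := 6 * commC R d + 1; have C0 : 0 < C by rewrite ltr_wpDl// mulr_ge0.
exists C; split=> // q qt q2 qt2 hq u th th0 hu hdiv hth hsol.
have th0E : th0 = th 0 by case: hsol => _ h; apply/funext => x; rewrite h.
(* The norms of smooth decaying data are finite, so that the product in the extended reals is a
   product of real numbers. *)
have fB : Lqnorm qt th0 \is a fin_num.
  by rewrite ge0_fin_numE ?Lnorm_ge0// th0E; apply: Lqnorm_lty => //; exact: (bint_pd hth [::]).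
have fA t : 0 <= t -> Lqnorm q (grad_norm (u t)) \is a fin_num.
  by move=> t0; rewrite ge0_fin_numE ?Lnorm_ge0//; apply: Lqnorm_lty => //; exact: bint_grad_norm.
pose A t := fine (Lqnorm q (grad_norm (u t))); pose B := fine (Lqnorm qt th0).
have A0 t : 0 <= A t by rewrite fine_ge0// Lnorm_ge0.
have B0 : 0 <= B by rewrite fine_ge0// Lnorm_ge0.
pose g r := Num.sqrt (fine (Wt th r)).
have hrate t : 0 <= t -> exists2 l : R, rate g t l & `|l| <= C * B * A t.
  move=> t0; have hA : (Lqnorm q (grad_norm (u t)) <= (A t)%:E)%E by rewrite fineK// fA.
  have hB : (Lqnorm qt th0 <= B%:E)%E by rewrite fineK.
  have [l hl le] := sqrt_Wt_rate hd hu hdiv hth hsol q2 qt2 hq t0 (A0 t) B0 hA hB.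
  exists l => //; apply: (le_trans le); rewrite mulrA [A t * B]mulrC mulrA.
  by apply: ler_wpM2r => //; apply: ler_wpM2r => //; rewrite lerDl.
have hder t : 0 <= t -> time_derivable g t /\ `|time_derive g t| <= C * B * A t.
  by move=> t0; have [l hl le] := hrate t t0; have [h1 ->] := rate_time_derive t0 hl.
split=> [t t0|_ _ sup].
  have [h1 h2] := hder t t0; split=> //; first by rewrite (Wt_fin hd hth t0) ltry.
  by rewrite -(fineK fB) -(fineK (fA t t0)) -!EFinM lee_fin.
pose S := ereal_sup [set Lqnorm q (grad_norm (u t)) | t in [set t | 0 <= t]].
have leS t : 0 <= t -> (Lqnorm q (grad_norm (u t)) <= S)%E.
  by move=> t0; apply: ereal_sup_ubound; exists t.
have S0 : (0 <= S)%E by apply: le_trans (leS 0 (lexx 0)); exact: Lnorm_ge0.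
have fS : S \is a fin_num by rewrite ge0_fin_numE.
pose G := fine S; have G0 : 0 <= G by rewrite fine_ge0.
have AG t : 0 <= t -> A t <= G by move=> t0; rewrite -lee_fin !fineK ?fA// leS.
pose M := C * B * G; have M0 : 0 <= M by rewrite !mulr_ge0// ltW.
(* Integrating the derivative bound gives [g t <= g 0 + M * t], which is at most
   [(g 0 + M) * (1 + t)]; the energy is the square of [g]. *)
exists ((g 0 + M) ^+ 2) => t t0.
have grow : `|g t - g 0| <= M * t.
  apply: rate_growth => // r r0; first by have [l hl _] := hrate r r0; exists l.
  have [_ h] := hder r r0; apply: (le_trans h); apply: ler_wpM2l; last exact: AG.
  by rewrite mulr_ge0// ltW.
have gt0 r : 0 <= g r by exact: sqrtr_ge0.
have gt : g t <= (g 0 + M) * (1 + t).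
  have h := le_trans (ler_norm _) grow; rewrite lerBlDl in h; apply: (le_trans h).
  have -> : (g 0 + M) * (1 + t) = g 0 + M * t + (g 0 * t + M) by ring.
  by rewrite lerDl addr_ge0// mulr_ge0.
rewrite (Wt_fin hd hth t0) lee_fin -exprMn.
have -> : Wr (th t) = g t ^+ 2 by rewrite /g (Wt_fin hd hth t0)/= sqr_sqrtr// Wr_ge0.
by rewrite lerXn2r ?nnegrE// mulr_ge0// addr_ge0.
Qed.
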